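(* Let $r>\frac52$, $\tau_0>0$, and let $\Omega\in\mathbb{R}$ be arbitrary and fixed. Let $\overline{v}_0,\widetilde{v}_0\in\mathcal{S}\cap\mathcal{D}(e^{\tau_0A}:H^r(\mathbb{T}^3))$ be of the form $\overline v_0=P_0v_0$, $\widetilde v_0=(I-P_0)v_0$ with $v_0$ even in $z$ (so $\overline v_0$ depends only on $\boldsymbol{x}'$, $\nabla\cdot\overline v_0=0$, and $P_0\widetilde v_0=0$). Then there are a constant $C_r>0$ depending only on $r$, a time $$\mathcal{T}=\frac{\tau_0}{1+2C_r\big(1+\|e^{\tau_0A}\overline v_0\|_{H^r}^2+\|e^{\tau_0A}\widetilde v_0\|_{H^r}^2\big)}>0,$$ and a function $$\tau(t)=\tau_0-2tC_r\big(1+\|e^{\tau_0A}\overline v_0\|_{H^r}^2+\|e^{\tau_0A}\widetilde v_0\|_{H^r}^2\big),$$ both independent of $\Omega$, such that there exists a unique solution $$(\overline v,\widetilde v)\in L^\infty\big(0,\mathcal{T};\mathcal{S}\cap\mathcal{D}(e^{\tau(t)A}:H^r(\mathbb{T}^3))\big)\cap L^2\big(0,\mathcal{T};\mathcal{D}(e^{\tau(t)A}:H^{r+\frac12}(\mathbb{T}^3))\big)$$ on $[0,\mathcal{T}]$ of the system $$\partial_t\overline v+\mathbb{P}_h(\overline v\cdot\nabla\overline v)+\mathbb{P}_hP_0\big((\nabla\cdot\widetilde v)\widetilde v+\widetilde v\cdot\nabla\widetilde v\big)=0,$$ $$\partial_t\widetilde v+\widetilde v\cdot\nabla\widetilde v+\widetilde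 v\cdot\nabla\overline v+\overline v\cdot\nabla\widetilde v-P_0\big(\widetilde v\cdot\nabla\widetilde v+(\nabla\cdot\widetilde v)\widetilde v\big)-\Big(\int_0^z\nabla\cdot\widetilde v(\boldsymbol{x}',s)\,ds\Big)\partial_z\widetilde v+\Omega\widetilde v^\perp=0,$$ with $\overline v,\widetilde v$ periodic in $\mathbb{T}^3$ and even in $z$, and $(\overline v,\widetilde v)|_{t=0}=(\overline v_0,\widetilde v_0)$. Moreover, the unique solution depends continuously on the initial data in the following sense. For $i=1,2$, let $\tau_{i0}>0$ and let $(\overline v_0)_i,(\widetilde v_0)_i\in\mathcal{S}\cap\mathcal{D}(e^{\tau_{i0}A}:H^r(\mathbb{T}^3))$ be initial data (with radius of analyticity $\tau_{i0}$) of the form $(\overline v_0)_i=P_0(v_0)_i$, $(\widetilde v_0)_i=(I-P_0)(v_0)_i$ with $(v_0)_i$ even in $z$. Put $\mathcal{T}_i=\frac{\tau_{i0}}{1+2C_r(1+\|e^{\tau_{i0}A}(\overline v_0)_i\|_{H^r}^2+\|e^{\tau_{i0}A}(\widetilde v_0)_i\|_{H^r}^2)}$ and $\tau_i(t)=\tau_{i0}-2tC_r\big(1+\|e^{\tau_{i0}A}(\overline v_0)_i\|_{H^r}^2+\|e^{\tau_{i0}A}(\widetilde v_0)_i\|_{H^r}^2\big)$, and let $$(\overline v_i,\widetilde v_i)\in L^\infty\big(0,\mathcal{T}_i;\mathcal{S}\cap\mathcal{D}(e^{\tau_i(t)A}:H^r(\mathbb{T}^3))\big)\cap L^2\big(0,\mathcal{T}_i;\mathcal{D}(e^{\tau_i(t)A}:H^{r+\frac12}(\mathbb{T}^3))\big)$$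 be the unique solution on $[0,\mathcal{T}_i]$, periodic in $\mathbb{T}^3$ and even in $z$, with $(\overline v_i,\widetilde v_i)|_{t=0}=((\overline v_0)_i,(\widetilde v_0)_i)$, of the system (with the same $\Omega$ for $i=1,2$) $$\partial_t\overline v_i+\mathbb{P}_h(\overline v_i\cdot\nabla\overline v_i)+\mathbb{P}_hP_0\big((\nabla\cdot\widetilde v_i)\widetilde v_i+\widetilde v_i\cdot\nabla\widetilde v_i\big)=0,$$ $$\partial_t\widetilde v_i+\widetilde v_i\cdot\nabla\widetilde v_i+\widetilde v_i\cdot\nabla\overline v_i+\overline v_i\cdot\nabla\widetilde v_i-P_0\big(\widetilde v_i\cdot\nabla\widetilde v_i+(\nabla\cdot\widetilde v_i)\widetilde v_i\big)-\Big(\int_0^z\nabla\cdot\widetilde v_i(\boldsymbol{x}',s)\,ds\Big)\partial_z\widetilde v_i+\Omega\widetilde v_i^\perp=0.$$ Put $\tau_0=\min\{\tau_{10},\tau_{20}\}$, $M=\max_{i=1,2}\big\{\|e^{\tau_{i0}A}(\overline v_0)_i\|_{H^r}^2+\|e^{\tau_{i0}A}(\widetilde v_0)_i\|_{H^r}^2\big\}$, $\widetilde\tau(t)=\tau_0-2tC_r(1+M)$ and $\widetilde{\mathcal{T}}=\frac{\tau_0}{1+2C_r(1+M)}$. Then for all $t\in[0,\widetilde{\mathcal{T}}]$, $$\|e^{\widetilde\tau(t)A}(\overline v_1-\overline v_2)(t)\|_{H^{r-\frac12}}^2+\|e^{\widetilde\tau(t)A}(\widetilde v_1-\widetilde v_2)(t)\|_{H^{r-\frac12}}^2\le\|e^{\tau_0A}((\overline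 v_0)_1-(\overline v_0)_2)\|_{H^{r-\frac12}}^2+\|e^{\tau_0A}((\widetilde v_0)_1-(\widetilde v_0)_2)\|_{H^{r-\frac12}}^2.$$
   Context: $\mathbb{T}^3$ is the three-dimensional torus with unit length; $\boldsymbol{x}=(\boldsymbol{x}',z)=(x_1,x_2,z)$. $\nabla=(\partial_{x_1},\partial_{x_2})$ and $\Delta=\partial_{x_1x_1}+\partial_{x_2x_2}$ are the horizontal gradient and Laplacian; $(\varphi_1,\varphi_2)^\perp=(-\varphi_2,\varphi_1)$. Fourier coefficients: $f(\boldsymbol{x})=\sum_{\boldsymbol{k}\in\mathbb{Z}^3}\hat f_{\boldsymbol{k}}e^{2\pi i\boldsymbol{k}\cdot\boldsymbol{x}}$. With $A=\sqrt{-(\Delta+\partial_{zz})}$, for $r\ge0$, $\tau\ge0$, $$\|e^{\tau A}f\|_{H^r}:=\Big(\sum_{\boldsymbol{k}\in\mathbb{Z}^3}(1+|\boldsymbol{k}|^{2r}e^{2\tau|\boldsymbol{k}|})|\hat f_{\boldsymbol{k}}|^2\Big)^{1/2},\qquad \mathcal{D}(e^{\tau A}:H^r(\mathbb{T}^3)):=\{f\in H^r(\mathbb{T}^3):\|e^{\tau A}f\|_{H^r}<\infty\}.$$ $f\in L^p(0,T;\mathcal{D}(e^{\tau(t)A}:H^r))$ means $t\mapsto\|e^{\tau(t)A}f(t)\|_{H^r}$ is in $L^p(0,T)$. The vertical average (barotropic projection) is $P_0\varphi(\boldsymbol{x}')=\overline\varphi(\boldsymbol{x}'):=\int_0^1\varphi(\boldsymbol{x}',z)\,dz$,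 and $\widetilde\varphi:=\varphi-\overline\varphi$. For functions of $\boldsymbol{x}'$, $\mathbb{P}_h\overline\varphi:=\overline\varphi-\nabla\Delta^{-1}\nabla\cdot\overline\varphi$ is the 2D Leray projection ($\Delta^{-1}$ the inverse Laplacian on $\mathbb{T}^2$ with zero mean value). Finally $\dot L^2:=\{\varphi\in L^2(\mathbb{T}^3,\mathbb{R}^2):\int_{\mathbb{T}^3}\varphi\,d\boldsymbol{x}=0\}$ and $\mathcal{S}:=\{\varphi\in\dot L^2:\nabla\cdot\overline\varphi=0\}$. *)

(* Defs.v *)
From HB Require Import structures.
From mathcomp Require Import all_boot all_order all_algebra.
From mathcomp Require Import complex.
From mathcomp Require Import all_classical all_reals all_analysis.
From mathcomp Require Import measurable_realfun ess_sup_inf.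

Set Implicit Arguments.
Unset Strict Implicit.
Unset Printing Implicit Defensive.
Import Order.TTheory GRing.Theory Num.Theory.
Import numFieldNormedType.Exports.
Local Open Scope classical_set_scope.
Local Open Scope ring_scope.

(* Functions on the tori T^2 and T^3 are 1-periodic functions on R^2 = R * R   *)
(* and R^3 = (R * R) * R; a point of R^3 is x = (x', z) with x' = x.1 and      *)
(* z = x.2.  Integrals over a torus are taken over its fundamental domain.     *)

Section Torus.
Context {R : realType}.
Implicit Types (x : R * R * R) (y : R * R) (z s : R).

Definition square : set (R * R) := `[0, 1]%classic `*` `[0, 1]%classic.
Definition cube : set (R * R * R) := square `*` `[0, 1]%classic.

Definition leb2 := ((@lebesgue_measure R) \x (@lebesgue_measure R))%E.
Definition leb3 := (leb2 \x (@lebesgue_measure R))%E.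

Definition periodic2 {V : Type} (g : R * R -> V) : Prop :=
  forall y, g (y.1 + 1, y.2) = g y /\ g (y.1, y.2 + 1) = g y.

Definition periodic3 {V : Type} (f : R * R * R -> V) : Prop :=
  forall x, [/\ f (x.1.1 + 1, x.1.2, x.2) = f x,
                f (x.1.1, x.1.2 + 1, x.2) = f x &
                f (x.1, x.2 + 1) = f x].

Definition even_z {V : Type} (f : R * R * R -> V) : Prop :=
  forall x, f (x.1, - x.2) = f x.

Definition lift3 {V : Type} (g : R * R -> V) : R * R * R -> V := fun x => g x.1.

Definition slice {V : Type} (f : R * R * R -> V) z : R * R -> V :=
  fun y => f (y, z).

End Torus.

Section HorizontalCalculus.
Context {R : realType}.
Implicit Types (g p : R * R -> R) (u w : R * R -> R * R).

Definition dx1 g : R * R -> R := fun y => derive1 (fun s : R => g (s, y.2)) y.1.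
Definition dx2 g : R * R -> R := fun y => derive1 (fun s : R => g (y.1, s)) y.2.

Definition grad p : R * R -> R * R := fun y => (dx1 p y, dx2 p y).
Definition div u : R * R -> R := fun y => dx1 (fst \o u) y + dx2 (snd \o u) y.
Definition lap p : R * R -> R := fun y => dx1 (dx1 p) y + dx2 (dx2 p) y.

(* u . grad w *)
Definition adv u w : R * R -> R * R := fun y =>
  ((u y).1 * dx1 (fst \o w) y + (u y).2 * dx2 (fst \o w) y,
   (u y).1 * dx1 (snd \o w) y + (u y).2 * dx2 (snd \o w) y).

Fixpoint classC (k : nat) g : Prop :=
  if k is k'.+1 then
    [/\ forall y, derivable (fun s : R => g (s, y.2)) y.1 1
                  /\ derivable (fun s : R => g (y.1, s)) y.2 1,
        classC k' (dx1 g) & classC k' (dx2 g)]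
  else continuous g.

(* The zero-mean solution p on T^2 of lap p = g.  It is used below only on     *)
(* divergences of real-analytic periodic fields, for which a (unique)          *)
(* classical solution exists.                                                  *)
Definition is_inv_lap g p : Prop :=
  [/\ periodic2 p, classC 2 p, (\int[leb2]_(y in square) p y) = 0 &
      forall y, lap p y = g y].

Definition inv_lap g : R * R -> R := xget (fun=> 0) [set p : R * R -> R | is_inv_lap g p].

Definition leray u : R * R -> R * R := fun y => u y - grad (inv_lap (div u)) y.

(* div u = 0 in the sense of distributions on T^2 *)
Definition weak_div_free u : Prop :=
  forall psi : R * R -> R, periodic2 psi -> (forall k, classC k psi) ->
    \int[leb2]_(y in square)
      ((u y).1 * dx1 psi y + (u y).2 * dx2 psi y) = 0.

Definition perp (a : R * R) : R * R := (- a.2, a.1).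

End HorizontalCalculus.

Section VerticalCalculus.
Context {R : realType}.
Implicit Types (phi : R * R * R -> R * R).

(* barotropic projection and its complement *)
Definition P0 phi : R * R -> R * R := fun y =>
  (\int[lebesgue_measure]_(z in `[0, 1]) (phi (y, z)).1,
   \int[lebesgue_measure]_(z in `[0, 1]) (phi (y, z)).2).

Definition fluct phi : R * R * R -> R * R := fun x => phi x - P0 phi x.1.

Definition dz phi : R * R * R -> R * R := fun x =>
  (derive1 (fun s : R => (phi (x.1, s)).1) x.2,
   derive1 (fun s : R => (phi (x.1, s)).2) x.2).

(* the oriented integral of h from 0 to z *)
Definition int0 (h : R -> R) (z : R) : R :=
  if 0 <= z then \int[lebesgue_measure]_(s in `[0, z]) h s
  else - \int[lebesgue_measure]_(s in `[z, 0]) h s.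

Definition div3 phi : R * R * R -> R := fun x => div (slice phi x.2) x.1.

Definition adv3 (phi chi : R * R * R -> R * R) : R * R * R -> R * R :=
  fun x => adv (slice phi x.2) (slice chi x.2) x.1.

End VerticalCalculus.

Section AnalyticSpaces.
Context {R : realType}.
Implicit Types (f : R * R * R -> R) (phi : R * R * R -> R * R)
  (k : int * int * int) (tau r : R).

Definition phase k (x : R * R * R) : R :=
  2 * pi * (k.1.1%:~R * x.1.1 + k.1.2%:~R * x.1.2 + k.2%:~R * x.2).

(* \int f(x) exp(- 2 i pi k.x) dx *)
Definition fourier f k : R[i] :=
  Complex (\int[leb3]_(x in cube) (f x * cos (phase k x)))
          (- \int[leb3]_(x in cube) (f x * sin (phase k x))).

Definition freq k : R :=
  Num.sqrt (k.1.1%:~R ^+ 2 + k.1.2%:~R ^+ 2 + k.2%:~R ^+ 2).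

(* | hat phi_k |^2 for a vector field *)
Definition fourier_sq phi k : R :=
  ComplexField.Normc.normc (fourier (fst \o phi) k) ^+ 2
  + ComplexField.Normc.normc (fourier (snd \o phi) k) ^+ 2.

(* || e^{tau A} phi ||_{H^r} *)
Definition anorm tau r phi : \bar R :=
  ((\esum_(k in [set: int * int * int])
      ((1 + freq k `^ (2 * r) * expR (2 * tau * freq k))
       * fourier_sq phi k)%:E) `^ 2^-1)%E.

Definition L2scalar f : Prop :=
  [/\ periodic3 f, measurable_fun cube f &
      leb3.-integrable cube (fun x => (f x ^+ 2)%:E)].

Definition L2 : set (R * R * R -> R * R) :=
  [set phi : R * R * R -> R * R | L2scalar (fst \o phi) /\ L2scalar (snd \o phi)].

Definition Hsob r : set (R * R * R -> R * R) :=
  [set phi : R * R * R -> R * R | L2 phi /\ (anorm 0 r phi < +oo)%E].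

Definition Dana tau r : set (R * R * R -> R * R) :=
  [set phi : R * R * R -> R * R | Hsob r phi /\ (anorm tau r phi < +oo)%E].

Definition L2dot : set (R * R * R -> R * R) :=
  [set phi : R * R * R -> R * R | [/\ L2 phi, (\int[leb3]_(x in cube) (phi x).1) = 0 &
                 (\int[leb3]_(x in cube) (phi x).2) = 0]].

Definition spaceS : set (R * R * R -> R * R) :=
  [set phi : R * R * R -> R * R | L2dot phi /\ weak_div_free (P0 phi)].

(* phi in L^p(0, T; X(t)), where N t is the norm of X(t) *)
Definition Lp_in (p : \bar R) (T : R) (X : R -> set (R * R * R -> R * R))
    (N : R -> (R * R * R -> R * R) -> \bar R)
    (phi : R -> R * R * R -> R * R) : Prop :=
  [/\ {ae lebesgue_measure, forall t : R, t \in `]0, T[ -> X t (phi t)},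
      measurable_fun `]0, T[ (fun t => N t (phi t)) &
      ('N[lebesgue_measure]_p
         [(fun t => N t (phi t)) \_ `]0%R, T[%classic] < +oo)%E].

End AnalyticSpaces.

Section System.
Context {R : realType}.

(* u is absolutely continuous on [0, T] with derivative g *)
Definition has_dt (T : R) (u g : R -> R) : Prop :=
  lebesgue_measure.-integrable `[0, T] (EFin \o g) /\
  forall t : R, t \in `[0, T] ->
    u t = u 0 + \int[lebesgue_measure]_(s in `[0, t]) g s.

Definition has_dt2 (T : R) (u g : R -> R * R) : Prop :=
  has_dt T (fst \o u) (fst \o g) /\ has_dt T (snd \o u) (snd \o g).

Definition barotropic_eq (dvb : R * R -> R * R) (vb : R * R -> R * R)
    (vt : R * R * R -> R * R) : Prop :=
  forall y,
    dvb y + leray (adv vb vb) y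
    + leray (P0 (fun x => div3 vt x *: vt x + adv3 vt vt x)) y = 0.

Definition baroclinic_eq (Omega : R) (dvt : R * R * R -> R * R)
    (vb : R * R -> R * R) (vt : R * R * R -> R * R) : Prop :=
  forall x,
    dvt x + adv3 vt vt x + adv3 vt (lift3 vb) x + adv3 (lift3 vb) vt x
    - P0 (fun x' => adv3 vt vt x' + div3 vt x' *: vt x') x.1
    - int0 (fun s => div3 vt (x.1, s)) x.2 *: dz vt x
    + Omega *: perp (vt x) = 0.

(* Solutions on [0, T] in the analytic class with a given radius of            *)
(* analyticity tau(t) > 0.  Since r > 5/2, the elements of the spaces          *)
(* Dana (tau t) r have a continuous representative (which is then              *)
(* real-analytic), and vb t and vt t are taken to be this representative.      *)
(* The initial data, being elements of L^2, are attained almost everywhere.    *)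
(* vb is a function of x' only; its lift to T^3 is trivially even in z.        *)
Record solution (r Omega T : R) (tau : R -> R)
    (vb0 : R * R -> R * R) (vt0 : R * R * R -> R * R)
    (vb : R -> R * R -> R * R) (vt : R -> R * R * R -> R * R) : Prop :=
  Solution {
    sol_bar : forall t : R, t \in `[0, T] -> periodic2 (vb t) /\ continuous (vb t);
    sol_fluct : forall t : R, t \in `[0, T] ->
      [/\ periodic3 (vt t), continuous (vt t) & even_z (vt t)];
    sol_Linfty :
      Lp_in +oo%E T (fun t => spaceS `&` Dana (tau t) r)
        (fun t => anorm (tau t) r) (fun t => lift3 (vb t)) /\
      Lp_in +oo%E T (fun t => spaceS `&` Dana (tau t) r)
        (fun t => anorm (tau t) r) vt;
    sol_L2 :
      Lp_in 2%:E T (fun t => Dana (tau t) (r + 2^-1))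
        (fun t => anorm (tau t) (r + 2^-1)) (fun t => lift3 (vb t)) /\
      Lp_in 2%:E T (fun t => Dana (tau t) (r + 2^-1))
        (fun t => anorm (tau t) (r + 2^-1)) vt;
    sol_eq : exists (dvb : R -> R * R -> R * R) (dvt : R -> R * R * R -> R * R),
      [/\ forall y, has_dt2 T (vb ^~ y) (dvb ^~ y),
          forall x, has_dt2 T (vt ^~ x) (dvt ^~ x) &
          {ae lebesgue_measure, forall t : R, t \in `]0, T[ ->
             barotropic_eq (dvb t) (vb t) (vt t) /\
             baroclinic_eq Omega (dvt t) (vb t) (vt t)}];
    sol_init :
      {ae leb2, forall y, square y -> vb 0 y = vb0 y} /\
      {ae leb3, forall x, cube x -> vt 0 x = vt0 x}
  }.

(* initial data  v0bar = P0 v0,  v0tilde = (I - P0) v0 *)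
Definition admissible (r tau0 : R) (v0 : R * R * R -> R * R) : Prop :=
  [/\ even_z v0,
      (spaceS `&` Dana tau0 r) (lift3 (P0 v0)) &
      (spaceS `&` Dana tau0 r) (fluct v0)].

(* || e^{tau0 A} v0bar ||_{H^r}^2 + || e^{tau0 A} v0tilde ||_{H^r}^2 *)
Definition data_size (r tau0 : R) (v0 : R * R * R -> R * R) : R :=
  fine (anorm tau0 r (lift3 (P0 v0))) ^+ 2 + fine (anorm tau0 r (fluct v0)) ^+ 2.

Definition lifespan (C tau0 M : R) : R := tau0 / (1 + 2 * C * (1 + M)).

Definition analytic_radius (C tau0 M t : R) : R := tau0 - 2 * t * C * (1 + M).

End System.

(* Main.v *)
(* Let the real unknowns be the Fourier coefficients of the two fields, rotated
   by the angle Omega t in the plane of the horizontal components of the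
   baroclinic one.  The Coriolis term disappears and the system becomes
   u(t) = u(0) + \int_0^t N_s(u(s)) ds with N_s quadratic, bounded uniformly in s
   and Omega: |N_s(u)_k| <= c \sum_l |l| |k - l| U_l U_(k-l) whenever |u_k| <= U_k.
   The factor |l| |k - l| accounts for the horizontal gradients, for d_z and for
   the vertical integral of the divergence.

   If |u_k(s)| <= e^(-(tau0 - lam s)|k|) U_k then the time integral of the
   nonlinearity is bounded by e^(-(tau0 - lam t)|k|) times the convolution divided
   by lam |k|.  For r > 5/2 this operation maps the weighted space of those U with
   (|k|^r U_k) in l^2 into itself, with a constant of size kap(r)/lam, so that for
   lam of size 1 + M the Picard iterates converge with a t-independent majorant S.
   Hence e^(tau(t)|k|) u_k(t) is dominated by |k|^(-r) times an l^2 sequence as soon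
   as tau decreases at least as fast as tau0 - lam t, and the L^2 in time bound in
   H^(r + 1/2) comes from the strictly faster decrease in the theorem.

   For an arbitrary solution, boundedness of the time derivatives (almost
   everywhere in t) makes the Fourier coefficients Lipschitz in time, so the
   a priori decay holds at every time and the coefficients solve the same integral
   equation, whose bounded solutions are unique.  Continuous dependence is the
   weighted energy inequality for the difference of two coefficient families: the
   decrease of the radius produces a dissipation |k| which absorbs the
   nonlinearity, and the rotation is an isometry. *)
Require Import Defs.
From HB Require Import structures.
From mathcomp Require Import all_boot all_order all_algebra.
From mathcomp Require Import finmap complex ring lra zify.
From mathcomp Require Import all_classical all_reals all_analysis.
From mathcomp Require Import measurable_realfun ess_sup_inf.
Set Implicit Arguments.
Unset Strict Implicit.
Unset Printing Implicit Defensive.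
Import Order.TTheory GRing.Theory Num.Theory.
Import numFieldNormedType.Exports.
Local Open Scope classical_set_scope.
Local Open Scope ring_scope.

(** * Absolutely convergent sums *)

(** The estimates live on coefficients, whereas the statement speaks of fields satisfying the
    equations at every point [x] for almost every time. Two bridges are therefore needed: an
    integrable function on the cube is determined by its Fourier coefficients, and [inv_lap], a mere
    choice, is identified with a multiplier through uniqueness of the periodic Poisson problem.

    The weight |k|^r does not see k = 0. The nonlinearity is therefore set to zero there, which is
    faithful to the equations because of the constraints (divergence, vertical mean). Reality,
    evenness in [z], solenoidality and vanishing of prescribed modes are linear relations between at
    most two coefficients, so a single argument carries all of them through the Picard iteration.

    The summand 1 in the denominator of the lifespan keeps the radius strictly positive up to and
    including the final time. On the whole closed interval the coefficients decay exponentially at a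
    fixed rate: every series can be differentiated termwise, and uniqueness never meets a vanishing
    radius. The constant C_r is fixed last, large enough for existence, for the gap between the two
    rates, and for the energy estimate. *)

Section Summation.
Context {R : realType} {K : choiceType}.
Implicit Types (f g p q : K -> R) (A : {fset K}).

Definition summ f : Prop := (\esum_(k in [set: K]) `|f k|%:E < +oo)%E.

Definition tot f : R := fine (\esum_(k in [set: K]) (f k)%:E).

(** A signed sum obtained as positive part minus negative part; the value is meaningful only under
    [summ], which the lemmas below carry as a side condition. *)
Definition sm f : R :=
  tot (fun k => Num.max (f k) 0) - tot (fun k => Num.max (- f k) 0).

Lemma fsum_le_esum A f : (forall k, 0 <= f k) ->
  ((\sum_(k <- A) f k)%:E <= \esum_(k in [set: K]) (f k)%:E)%E.
Proof.
move=> f0; apply: esum_ge; exists [set` A]; first by split.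
by rewrite fsbig_finite//= set_fsetK sumEFin.
Qed.

Lemma esum_le_fsum f (M : R) : 
  (forall A, \sum_(k <- A) f k <= M) -> (\esum_(k in [set: K]) (f k)%:E <= M%:E)%E.
Proof.
move=> h; apply: ub_ereal_sup => _ [A [fA _] <-].
by rewrite fsbig_finite//= sumEFin lee_fin.
Qed.

Lemma summ_le f g : (forall k, `|f k| <= g k) -> summ g -> summ f.
Proof.
move=> h; apply: le_lt_trans; apply: le_esum => k _.
by rewrite lee_fin (le_trans (h k))// ler_norm.
Qed.

Lemma summ_fin f (M : R) : (forall A, \sum_(k <- A) `|f k| <= M) -> summ f.
Proof. by move=> h; rewrite /summ (le_lt_trans (esum_le_fsum h))// ltry. Qed.

Lemma totE f : (forall k, 0 <= f k) -> summ f -> 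
  (\esum_(k in [set: K]) (f k)%:E = (tot f)%:E)%E.
Proof.
move=> f0 sf; rewrite /tot fineK// ge0_fin_numE; last first.
  by apply: esum_ge0 => k _; rewrite lee_fin.
by move: sf; rewrite /summ; under eq_esum do rewrite ger0_norm//.
Qed.

Lemma summ_abs f : summ f -> summ (fun k => `|f k|).
Proof. by apply: le_lt_trans; apply: le_esum => k _; rewrite normr_id. Qed.

Lemma summD f g : summ f -> summ g -> summ (fun k => f k + g k).
Proof.
move=> sf sg; apply: (@le_lt_trans _ _ (\esum_(k in [set: K]) (`|f k|%:E + `|g k|%:E))%E).
  by apply: le_esum => k _; rewrite -EFinD lee_fin ler_normD.
rewrite esumD; [|by move=> *; rewrite lee_fin..].
by apply: lte_add_pinfty.
Qed.

Lemma summN f : summ f -> summ (fun k => - f k).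
Proof. by move/summ_abs; apply: summ_le => k; rewrite normrN. Qed.

Lemma summB f g : summ f -> summ g -> summ (fun k => f k - g k).
Proof. by move=> sf sg; apply: summD => //; apply: summN. Qed.

Lemma tot_ge0 f : (forall k, 0 <= f k) -> 0 <= tot f.
Proof. by move=> f0; apply: fine_ge0; apply: esum_ge0 => k _; rewrite lee_fin. Qed.

Lemma totD f g : (forall k, 0 <= f k) -> (forall k, 0 <= g k) -> summ f -> summ g ->
  tot (fun k => f k + g k) = tot f + tot g.
Proof.
move=> f0 g0 sf sg; apply: EFin_inj; rewrite EFinD -!totE//; last 2 first.
- by move=> k; rewrite addr_ge0.
- exact: summD.
by rewrite -esumD; [|by move=> *; rewrite lee_fin..].
Qed.

Lemma tot_eq f g : f =1 g -> tot f = tot g.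
Proof. by move=> /funext ->. Qed.

(** Both decompositions satisfy p + f^- = q + f^+, and additivity of nonnegative sums does the rest.
    Linearity of [sm] is read off from convenient choices of [p] and [q]. *)
Lemma smE f p q : (forall k, 0 <= p k) -> (forall k, 0 <= q k) -> summ p -> summ q ->
  (forall k, f k = p k - q k) -> sm f = tot p - tot q.
Proof.
move=> p0 q0 sp sq fpq.
have sf : summ f by rewrite (funext fpq); apply: summB.
have m0 (x : R) : 0 <= Num.max x 0 by rewrite le_max lexx orbT.
have s1 : summ (fun k => Num.max (f k) 0).
  apply: summ_le (summ_abs sf) => k; rewrite ger0_norm// ge_max normr_ge0 andbT.
  exact: ler_norm.
have s2 : summ (fun k => Num.max (- f k) 0).
  apply: summ_le (summ_abs sf) => k; rewrite ger0_norm// ge_max normr_ge0 andbT.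
  by rewrite -normrN ler_norm.
apply/eqP; rewrite /sm subr_eq addrAC eq_sym subr_eq -!totD//; apply/eqP/tot_eq => k.
have -> : Num.max (f k) 0 = f k + Num.max (- f k) 0.
  by case: (leP 0 (f k)) => h; case: (leP 0 (- f k)); lra.
by rewrite fpq; lra.
Qed.

Lemma sm_tot f : (forall k, 0 <= f k) -> summ f -> sm f = tot f.
Proof.
move=> f0 sf; rewrite (@smE f f (fun=> 0))//; last 2 first.
- by apply: summ_le sf => k; rewrite normr0.
- by move=> k; rewrite subr0.
by rewrite [X in _ - X]/tot esum1// subr0.
Qed.

Lemma sm_esum f : (forall k, 0 <= f k) -> summ f ->
  (\esum_(k in [set: K]) (f k)%:E = (sm f)%:E)%E.
Proof. by move=> f0 sf; rewrite sm_tot// totE. Qed.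

Lemma posneg f : summ f -> exists p q, [/\ (forall k, 0 <= p k), (forall k, 0 <= q k), summ p, summ q &
  forall k, f k = p k - q k].
Proof.
move=> sf; exists (fun k => `|f k|), (fun k => `|f k| - f k); split => //.
- by move=> k; rewrite subr_ge0 ler_norm.
- exact: summ_abs.
- by apply: summB => //; apply: summ_abs.
- by move=> k; lra.
Qed.

Lemma eq_sm f g : f =1 g -> sm f = sm g.
Proof. by move=> /funext ->. Qed.

Lemma smD f g : summ f -> summ g -> sm (fun k => f k + g k) = sm f + sm g.
Proof.
move=> /posneg[p [q [p0 q0 sp sq fE]]] /posneg[p' [q' [p'0 q'0 sp' sq' gE]]].
rewrite (@smE _ (fun k => p k + p' k) (fun k => q k + q' k)).
- by rewrite !totD// (smE p0 q0)// (smE p'0 q'0)//; lra.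
- by move=> k; rewrite addr_ge0.
- by move=> k; rewrite addr_ge0.
- exact: summD.
- exact: summD.
- by move=> k; rewrite fE gE; lra.
Qed.

Lemma smN f : sm (fun k => - f k) = - sm f.
Proof. by rewrite /sm opprB; under [in X in _ - X]tot_eq do rewrite opprK. Qed.

Lemma smB f g : summ f -> summ g -> sm (fun k => f k - g k) = sm f - sm g.
Proof. by move=> sf sg; rewrite smD// ?smN//; apply: summN. Qed.

Lemma summZ c f : summ f -> summ (fun k => c * f k).
Proof.
move=> sf; have h A : \sum_(k <- A) `|c * f k| <= `|c| * tot (fun k => `|f k|).
  under eq_bigr do rewrite normrM; rewrite -big_distrr/= ler_wpM2l//.
  rewrite -lee_fin -totE//; last exact: summ_abs.
  exact: fsum_le_esum.
exact: summ_fin h.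
Qed.

Lemma summZr c f : summ f -> summ (fun k => f k * c).
Proof. by move/(summZ c); under eq_fun do rewrite mulrC. Qed.

Lemma summ0 : summ (fun=> 0).
Proof. by rewrite /summ esum1 ?ltry// => k _; rewrite normr0. Qed.

Lemma sm_ge0 f : (forall k, 0 <= f k) -> 0 <= sm f.
Proof.
move=> f0; rewrite /sm [X in _ - X](_ : _ = 0) ?subr0; last first.
  by rewrite /tot esum1// => k _; congr EFin; apply/max_idPr; rewrite oppr_le0.
by apply: tot_ge0 => k; rewrite le_max lexx orbT.
Qed.

Lemma sm0 : sm (fun=> 0) = 0.
Proof. by rewrite /sm oppr0 subrr. Qed.

Lemma le_sm f g : summ f -> summ g -> (forall k, f k <= g k) -> sm f <= sm g.
Proof. by move=> sf sg fg; rewrite -subr_ge0 -smB//; apply: sm_ge0 => k; rewrite subr_ge0. Qed.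

Lemma le_norm_sm f g : summ g -> (forall k, `|f k| <= g k) -> `|sm f| <= sm g.
Proof.
move=> sg fg; have sf := summ_le fg sg.
by rewrite ler_norml -smN !le_sm//; [move=> k; have := ler_norm (f k); have := fg k; lra
  |exact: summN|move=> k; have := ler_norm (- f k); rewrite normrN; have := fg k; lra].
Qed.

Lemma fsum_le_sm A f : (forall k, 0 <= f k) -> summ f -> \sum_(k <- A) f k <= sm f.
Proof. by move=> f0 sf; rewrite -lee_fin -sm_esum//; apply: fsum_le_esum. Qed.

Lemma le_sm1 k f : (forall k, 0 <= f k) -> summ f -> f k <= sm f.
Proof. by move=> f0 sf; have := fsum_le_sm [fset k]%fset f0 sf; rewrite big_seq_fset1. Qed.

Lemma sm_le_fsum f (M : R) : (forall k, 0 <= f k) -> (forall A, \sum_(k <- A) f k <= M) -> sm f <= M.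
Proof.
move=> f0 h; rewrite -lee_fin -sm_esum//; first exact: esum_le_fsum.
by apply: summ_fin => A; under eq_bigr do rewrite ger0_norm//; exact: h.
Qed.

Lemma sm_fin A f : (forall k, k \notin A -> f k = 0) -> summ f /\ sm f = \sum_(k <- A) f k.
Proof.
have nn g : (forall k, 0 <= g k) -> (forall k, k \notin A -> g k = 0) -> 
    summ g /\ tot g = \sum_(k <- A) g k.
  move=> g0 gA.
  have h (B : {fset K}) : \sum_(k <- B) g k <= \sum_(k <- A) g k.
    rewrite (big_fsetID _ (mem A))/= [X in _ + X]big1_fset ?addr0; last first.
      by move=> k; rewrite !inE => /andP[_ /gA].
    rewrite [leRHS](big_fsetID _ (mem B))/=.
    rewrite [X in X + _](_ : _ = \sum_(k <- [fset x in B | x \in A]%fset) g k).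
      by rewrite lerDl sumr_ge0.
    by apply: eq_fbigl => k; rewrite !inE/= andbC.
  have sg : summ g by apply: summ_fin (\sum_(k <- A) g k) _ => B; under eq_bigr do rewrite ger0_norm//; exact: h.
  split=> //; rewrite -sm_tot//; apply/eqP; rewrite eq_le fsum_le_sm// andbT.
  exact: sm_le_fsum.
move=> fA.
have [k|k kA|sp tp] := nn (fun k => Num.max (f k) 0).
- by rewrite le_max lexx orbT.
- by rewrite fA// maxxx.
have [k|k kA|sq tq] := nn (fun k => Num.max (- f k) 0).
- by rewrite le_max lexx orbT.
- by rewrite fA// oppr0 maxxx.
split.
  apply: summ_le (summD sp sq) => k.
  by case: (leP 0 (f k)) => h; rewrite ?(ger0_norm h) ?(ltr0_norm h); case: (leP 0 (- f k)); lra.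
rewrite /sm tp tq -sumrB; apply: eq_bigr => k _.
by case: (leP 0 (f k)) => h; case: (leP 0 (- f k)); lra.
Qed.

(** One finite set serves all [g] dominated by [f] at once; this uniformity is what the limit
    arguments below rely on. *)
Lemma summ_tail f e : summ f -> 0 < e -> exists A, 
  forall g, (forall k, `|g k| <= `|f k|) -> (forall k, k \in A -> g k = 0) -> `|sm g| <= e.
Proof.
move=> sf e0; have sF := summ_abs sf.
have : (sm (fun k => `|f k|) - e)%:E%E \isn't a fin_num \/ True by right.
move=> _; have : ((sm (fun k => `|f k|) - e)%:E < \esum_(k in [set: K]) (`|f k|)%:E)%E.
  by rewrite sm_esum// lte_fin ltrBlDr ltrDl.
move=> /ereal_sup_gt[_ [X [fX _] <-]]; rewrite fsbig_finite//= sumEFin lte_fin => hA.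
exists (fset_set X) => g gf gA; set A := fset_set X in hA gA.
pose h k := if k \in A then `|f k| else 0.
have [sh smh] : summ h /\ sm h = \sum_(k <- A) `|f k|.
  have [|? ->] := @sm_fin A h; first by move=> k; rewrite /h => /negPf ->.
  by split=> //; apply: eq_big_seq => k; rewrite /h => ->.
apply: (@le_trans _ _ (sm (fun k => `|f k| - h k))); last by rewrite smB// smh; lra.
apply: le_norm_sm; first exact: summB.
by move=> k; rewrite /h; case: ifPn => [/gA ->|_]; rewrite ?normr0 ?subrr ?subr0.
Qed.

(** True for finite sums; both sides are compared with the same finite truncation of [f]. *)
Lemma smZ c f : summ f -> sm (fun k => c * f k) = c * sm f.
Proof.
move=> sf; apply/eqP; rewrite -subr_eq0 -normr_le0; apply/ler_addgt0Pl => e e0; rewrite addr0.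
(* The two truncation errors add up to e' + |c| e' = e / 2. *)
pose e' := e / (2 * (1 + `|c|)).
have c1 : 0 < 1 + `|c| by rewrite ltr_wpDr.
have e'0 : 0 < e' by rewrite divr_gt0// mulr_gt0.
have [A tA] := summ_tail sf e'0; have [B tB] := summ_tail (summZ c sf) e'0.
pose g k := if k \in (A `|` B)%fset then f k else 0.
have [sg Sg] : summ g /\ sm g = \sum_(k <- (A `|` B)%fset) f k.
  have [|? ->] := @sm_fin (A `|` B)%fset g; first by move=> k; rewrite /g => /negPf ->.
  by split=> //; apply: eq_big_seq => k; rewrite /g => ->.
have [sg' Sg'] : summ (fun k => c * g k) /\ sm (fun k => c * g k) = c * sm g.
  have [|? ->] := @sm_fin (A `|` B)%fset (fun k => c * g k).
    by move=> k; rewrite /g => /negPf ->; rewrite mulr0.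
  by split=> //; rewrite Sg big_distrr/=; apply: eq_big_seq => k; rewrite /g => ->.
have h1 : `|sm (fun k => f k - g k)| <= e'.
  apply: tA => k; first by rewrite /g; case: ifP; rewrite ?subrr ?normr0 ?subr0.
  by rewrite /g inE => ->; rewrite subrr.
have h2 : `|sm (fun k => c * f k - c * g k)| <= e'.
  apply: tB => k; first by rewrite /g; case: ifP; rewrite ?subrr ?normr0 ?mulr0 ?subr0.
  by rewrite /g inE => ->; rewrite orbT subrr.
rewrite smB// in h1; rewrite smB// ?Sg' in h2; last exact: summZ.
have -> : sm (fun k => c * f k) - c * sm f = (sm (fun k => c * f k) - c * sm g) - c * (sm f - sm g) by lra.
apply: (le_trans (ler_normB _ _)); rewrite normrM.
apply: (@le_trans _ _ (e' + `|c| * e')); first by rewrite lerD// ler_wpM2l.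
have -> : e' + `|c| * e' = e / 2 by rewrite /e'; field; rewrite gt_eqF.
by lra.
Qed.

Lemma smZr c f : summ f -> sm (fun k => f k * c) = sm f * c.
Proof. by move=> sf; rewrite mulrC -smZ//; apply: eq_sm => k; rewrite mulrC. Qed.

(** Tannery's theorem along an arbitrary filter: outside a finite set the dominating family is
    small, inside it the convergence is a finite matter. It yields continuity in [x] and in [t] of
    every series below. *)
Lemma sm_cvg (T : Type) (F : set_system T) (FF : Filter F) (f : T -> K -> R) g (M : K -> R) :
  summ M -> (\forall t \near F, forall k, `|f t k| <= M k) -> (forall k, `|g k| <= M k) ->
  (forall k, f t k @[t --> F] --> g k) -> sm (f t) @[t --> F] --> sm g.
Proof.
move=> sM fM gM fg; apply/cvgrPdist_le => e e0.
have e30 : 0 < e / 3 by rewrite divr_gt0.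
have [A tA] := summ_tail sM e30.
have M0 k : 0 <= M k by apply: le_trans (gM k).
have sg := summ_le gM sM.
pose cut (h : K -> R) k := if k \in A then h k else 0.
have cutP h : (forall k, `|h k| <= M k) -> `|sm h - \sum_(k <- A) h k| <= e / 3.
  move=> hM; have sh := summ_le hM sM.
  have [sc Sc] : summ (cut h) /\ sm (cut h) = \sum_(k <- A) h k.
    have [|? ->] := @sm_fin A (cut h); first by move=> k; rewrite /cut => /negPf ->.
    by split=> //; apply: eq_big_seq => k; rewrite /cut => ->.
  rewrite -Sc -smB//; apply: tA => k; last by rewrite /cut => ->; rewrite subrr.
  rewrite /cut; case: ifP => // _; first by rewrite subrr normr0.
  by rewrite subr0 (le_trans (hM k))// ler_norm.
have : \sum_(k <- A) f t k @[t --> F] --> \sum_(k <- A) g k.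
  elim: {tA cutP} (A : seq K) => [|k s IH].
    by rewrite big_nil; under eq_fun do rewrite big_nil; exact: cvg_cst.
  rewrite big_cons; under eq_fun do rewrite big_cons; exact: cvgD.
move/cvgrPdist_le => /(_ _ e30); apply: filterS2 fM => t fMt ht.
have -> : sm g - sm (f t) = (sm g - \sum_(k <- A) g k) + (\sum_(k <- A) g k - \sum_(k <- A) f t k)
   - (sm (f t) - \sum_(k <- A) f t k) by lra.
have h1 := cutP _ gM; have h2 := cutP _ fMt.
apply: (le_trans (ler_normB _ _)); apply: (@le_trans _ _ (e/3 + e/3 + e/3)); last lra.
apply: lerD => //; apply: (le_trans (ler_normD _ _)); exact: lerD.
Qed.

End Summation.

(** * Reindexing and double sums *)

Section Reindex.
Context {R : realType}.

Lemma sm_reindex (K L : choiceType) (e : L -> K) (f : K -> R) : bijective e ->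
  sm (f \o e) = sm f /\ (summ (f \o e) <-> summ f).
Proof.
move=> be.
have se : set_bij [set: L] [set: K] e by rewrite setTT_bijective.
have re g : (forall k, 0 <= g k)%E -> \esum_(k in [set: K]) g k = (\esum_(l in [set: L]) g (e l))%E :> \bar R.
  by move=> g0; rewrite (reindex_esum [set: L] [set: K] e).
split; last by rewrite /summ re//; split.
rewrite /sm /tot !(re (fun k => (Num.max _ 0)%:E))//= => k; by rewrite lee_fin le_max lexx orbT.
Qed.

(** The nonnegative case is Tonelli; the signed case follows by writing f = |f| - (|f| - f), a
    difference of two nonnegative summable families. *)
Lemma sm_pair (K L : choiceType) (f : K -> L -> R) : summ (fun kl : K * L => f kl.1 kl.2) ->
  [/\ forall k, summ (f k), summ (fun k => sm (f k)) & sm (fun k => sm (f k)) = sm (fun kl : K * L => f kl.1 kl.2)].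
Proof.
have nn (g : K -> L -> R) : (forall k l, 0 <= g k l) -> summ (fun kl : K * L => g kl.1 kl.2) ->
  [/\ forall k, summ (g k), summ (fun k => sm (g k)) & sm (fun k => sm (g k)) = sm (fun kl : K * L => g kl.1 kl.2)].
  move=> g0 sg.
  have E : (\esum_(k in [set: K]) \esum_(l in [set: L]) (g k l)%:E = (sm (fun kl : K * L => g kl.1 kl.2))%:E)%E.
    rewrite -sm_esum// esum_esum; last by move=> *; rewrite lee_fin.
    by congr esum; apply/seteqP; split=> // -[].
  have sgk k : summ (g k).
    rewrite /summ; under eq_esum do rewrite ger0_norm//.
    rewrite ltNge leye_eq; apply/negP => /eqP gk.
    move: E; rewrite (esumID [set k])/=; last by move=> *; apply: esum_ge0 => *; rewrite lee_fin.
    rewrite setTI esum_set1 ?gk; last by [].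
    rewrite addye; first by [].
    by rewrite gt_eqF// (lt_le_trans ltNy0)//; apply: esum_ge0 => *; apply: esum_ge0 => *; rewrite lee_fin.
  have gs0 k : 0 <= sm (g k) by exact: sm_ge0.
  have sgg : summ (fun k => sm (g k)).
    rewrite /summ; under eq_esum => k _ do rewrite ger0_norm// -sm_esum//.
    by rewrite E ltry.
  split=> //; apply: EFin_inj; rewrite -sm_esum// -E; apply: eq_esum => k _.
  by rewrite sm_esum.
move=> sf.
have [||s1 s2 s3] := nn (fun k l => `|f k l|).
- by [].
- exact: summ_abs.
have [||s4 s5 s6] := nn (fun k l => `|f k l| - f k l).
- by move=> k l; rewrite subr_ge0 ler_norm.
- by apply: summB => //; apply: summ_abs.
have sfk k : summ (f k).
  by apply: summ_le (s1 k) => l.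
have E k : sm (f k) = sm (fun l => `|f k l|) - sm (fun l => `|f k l| - f k l).
  by rewrite -smB//; apply: eq_sm => l; lra.
split => //.
- by rewrite (funext E); apply: summB.
- rewrite (funext E) smB// s3 s6 -smB//; last 2 first.
  + exact: summ_abs.
  + by apply: summB => //; apply: summ_abs.
  by apply: eq_sm => l; lra.
Qed.

Lemma summ_pair (K L : choiceType) (f : K -> L -> R) (g : K -> R) : 
  (forall k, summ (f k)) -> (forall k, sm (fun l => `|f k l|) <= g k) -> summ g -> 
  summ (fun kl : K * L => f kl.1 kl.2).
Proof.
move=> sf fg sg; rewrite /summ.
have -> : (\esum_(k in [set: K * L]) (`|f k.1 k.2|)%:E = \esum_(k in [set: K]) \esum_(l in [set: L]) `|f k l|%:E)%E.
  rewrite esum_esum; last by move=> *; rewrite lee_fin.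
  by congr esum; apply/seteqP; split=> // -[].
apply: le_lt_trans sg; apply: le_esum => k _; rewrite sm_esum//; last exact: summ_abs.
by rewrite lee_fin (le_trans (fg k))// ler_norm.
Qed.

Lemma sm_swap (K L : choiceType) (f : K -> L -> R) : summ (fun kl : K * L => f kl.1 kl.2) ->
  sm (fun k => sm (f k)) = sm (fun l => sm (f^~ l)).
Proof.
move=> sf.
have bs : bijective (fun lk : L * K => (lk.2, lk.1)).
  by exists (fun kl => (kl.2, kl.1)) => -[].
have [E1 E2] := sm_reindex (fun kl : K * L => f kl.1 kl.2) bs.
have [_ _ ->] := sm_pair sf.
by have [_ _ ->] := sm_pair (f := fun l k => f k l) (E2.2 sf).
Qed.
End Reindex.

(** * Dominated convergence and exchange of sums with integrals *)

Section Integration.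
Context {d : measure_display} {T : measurableType d} {R : realType}.
Variable mu : {measure set T -> \bar R}.
Implicit Types (D : set T).

Lemma Rdct_ae D (f_ : nat -> T -> R) (f g : T -> R) : measurable D ->
  (forall n, measurable_fun D (f_ n)) -> measurable_fun D f ->
  {ae mu, forall x, D x -> f_ n x @[n --> \oo] --> f x} ->
  mu.-integrable D (EFin \o g) ->
  {ae mu, forall x n, D x -> `|f_ n x| <= g x} ->
  mu.-integrable D (EFin \o f) /\
  \int[mu]_(x in D) f_ n x @[n --> \oo] --> \int[mu]_(x in D) f x.
Proof.
move=> mD mf_ mf cv ig bd.
have [|||||i1 _ i3] := @dominated_convergence _ _ _ mu D mD (fun n => EFin \o f_ n) (EFin \o f) (EFin \o g).
- by move=> n; apply/measurable_EFinP.
- exact/measurable_EFinP.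
- apply: filterS cv => x h Dx; apply/fine_cvgP; split; first by apply: nearW => n.
  exact: h.
- exact: ig.
- by apply: filterS bd => x h n Dx; rewrite /= lee_fin; exact: h.
split=> //; rewrite /Rintegral.
apply: (@fine_cvg _ _ _ _ (fun n => \int[mu]_(x in D) (f_ n x)%:E)%E).
by rewrite fineK//; exact: integrable_fin_num.
Qed.

Lemma Rdct D (f_ : nat -> T -> R) (f g : T -> R) : measurable D ->
  (forall n, measurable_fun D (f_ n)) ->
  (forall x, D x -> f_ n x @[n --> \oo] --> f x) ->
  mu.-integrable D (EFin \o g) ->
  (forall x n, D x -> `|f_ n x| <= g x) ->
  mu.-integrable D (EFin \o f) /\
  \int[mu]_(x in D) f_ n x @[n --> \oo] --> \int[mu]_(x in D) f x.
Proof.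
move=> mD mf_ cv ig bd; apply: (@Rdct_ae D f_ f g) => //.
- exact: (measurable_fun_cvg mf_ cv).
- by apply: aeW.
- by apply: aeW.
Qed.

Lemma bounded_integrable D (f : T -> R) (M : R) : measurable D -> (mu D < +oo)%E ->
  measurable_fun D f -> (forall x, D x -> `|f x| <= M) -> mu.-integrable D (EFin \o f).
Proof.
move=> mD fD mf fM; apply: measurable_bounded_integrable => //.
exists M; split; first by rewrite num_real.
by move=> x Mx y Dy /=; rewrite (le_trans (fM _ Dy))// ltW.
Qed.

Lemma Rintegral_sum D (I : Type) (s : seq I) (f : I -> T -> R) : measurable D ->
  (forall i, mu.-integrable D (EFin \o f i)) ->
  mu.-integrable D (fun x => (\sum_(i <- s) f i x)%:E) /\
  \int[mu]_(x in D) (\sum_(i <- s) f i x) = \sum_(i <- s) \int[mu]_(x in D) f i x.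
Proof.
move=> mD fi; elim: s => [|i s [IH1 IH2]].
  split; first by under eq_fun do rewrite big_nil; exact: integrable0.
  by rewrite big_nil; under eq_Rintegral do rewrite big_nil; rewrite Rintegral_cst// mul0r.
split.
  have -> : (fun x => (\sum_(j <- i :: s) f j x)%:E) = 
     ((EFin \o f i) \+ (fun x => (\sum_(j <- s) f j x)%:E))%E.
    by apply/funext => x; rewrite big_cons EFinD.
  exact: integrableD.
by rewrite big_cons -IH2 -RintegralD//; under eq_Rintegral do rewrite big_cons.
Qed.

Variable K : countType.

(** An increasing exhaustion of a countable index type by finite sets, which turns unordered sums
    into limits of sequences so that the convergence theorems for integrals apply. *)
Definition trunc (n : nat) : {fset K} := [fset k in pmap (@choice.unpickle K) (iota 0 n)]%fset.

Lemma trunc_in (k : K) n : (choice.pickle k < n)%N -> k \in trunc n.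
Proof.
move=> kn; rewrite /trunc !inE/= mem_pmap; apply/mapP; exists (choice.pickle k).
  by rewrite mem_iota.
by rewrite choice.pickleK.
Qed.

Lemma sm_trunc (f : K -> R) : summ f -> \sum_(k <- trunc n) f k @[n --> \oo] --> sm f.
Proof.
move=> sf.
pose g n k := if k \in trunc n then f k else 0.
have -> : (fun n => \sum_(k <- trunc n) f k) = (fun n => sm (g n)).
  apply/funext => n; have [|_ ->] := @sm_fin _ _ (trunc n) (g n).
    by move=> k; rewrite /g => /negPf ->.
  by apply: eq_big_seq => k; rewrite /g => ->.
apply: (@sm_cvg _ _ _ _ _ _ _ (fun k => `|f k|)) => //.
- exact: summ_abs.
- by apply: nearW => n k; rewrite /g; case: ifP; rewrite ?normr0.
- move=> k; apply: cvg_near_cst; near=> n; rewrite /g ifT//; apply: trunc_in.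
  by near: n; exists (choice.pickle k).+1.
Unshelve. all: by end_near. Qed.

(** The partial sums are dominated by the constant [sm M], integrable because the measure of [D] is
    finite. *)
Lemma sm_integral D (f : K -> T -> R) (M : K -> R) : measurable D -> (mu D < +oo)%E ->
  (forall k, measurable_fun D (f k)) -> (forall k x, D x -> `|f k x| <= M k) -> summ M ->
  [/\ measurable_fun D (fun x => sm (f^~ x)), mu.-integrable D (EFin \o (fun x => sm (f^~ x))),
    summ (fun k => \int[mu]_(x in D) f k x) &
  \int[mu]_(x in D) sm (f^~ x) = sm (fun k => \int[mu]_(x in D) f k x)].
Proof.
move=> mD fD mf fM sM.
have intf k : mu.-integrable D (EFin \o f k) by exact: bounded_integrable (mf k) (fM k).
have mm : mu.-integrable D (EFin \o cst (sm M)).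
  by apply: (@bounded_integrable _ _ `|sm M|) => //.
have si : summ (fun k => \int[mu]_(x in D) f k x).
  apply: summ_le (summZr (fine (mu D)) sM) => k.
  apply: (le_trans (le_normr_Rintegral mD (intf k))).
  rewrite -Rintegral_cst//; apply: le_Rintegral => //; last by move=> x; exact: fM.
    by have := integrable_norm (intf k).
  by apply: (@bounded_integrable _ _ `|M k|).
have [n|x Dx|x n Dx|i1 i2] := @Rdct D (fun n x => \sum_(k <- trunc n) f k x) (fun x => sm (f^~ x)) (cst (sm M)) mD _ _ mm.
- by apply: measurable_sum => k; exact: mf.
- by apply: sm_trunc; apply: summ_le sM => k; exact: fM.
- apply: (le_trans (ler_norm_sum _ _ _)).
  apply: (@le_trans _ _ (\sum_(k <- trunc n) M k)); first by apply: ler_sum => k _; exact: fM.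
  by apply: fsum_le_sm => // k; apply: le_trans (fM k x Dx).
split=> //; first by apply/measurable_EFinP; exact: measurable_int i1.
apply: (cvg_unique _ i2) => //.
have -> : (fun n => \int[mu]_(x in D) (\sum_(k <- trunc n) f k x)) = (fun n => \sum_(k <- trunc n) \int[mu]_(x in D) f k x).
  by apply/funext => n; have [_ ->] := Rintegral_sum (trunc n) mD intf.
exact: sm_trunc.
Qed.
End Integration.

(** * Cauchy-Schwarz and Minkowski inequalities for families *)

Section cs.
Context {R : realType} {K : choiceType}.

(** Discriminant argument: a t^2 + 2 c t + b is a sum of squares for every t. Its value at t = -c/a
    gives the inequality; if a = 0, then t = -(b+1)/(2c) would produce -1 unless c = 0. *)
Lemma summ_mul (f g : K -> R) : summ (fun k => f k ^+ 2) -> summ (fun k => g k ^+ 2) ->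
  summ (fun k => f k * g k) /\ sm (fun k => f k * g k) ^+ 2 <= sm (fun k => f k ^+ 2) * sm (fun k => g k ^+ 2).
Proof.
move=> sf sg.
have sfg : summ (fun k => f k * g k).
  apply: summ_le (summD sf sg) => k; rewrite ler_norml; have := sqr_ge0 (f k + g k).
  by have := sqr_ge0 (f k - g k); nra.
split=> //.
set a := sm (fun k => f k ^+ 2); set b := sm (fun k => g k ^+ 2); set c := sm _.
have H t : 0 <= a * t ^+ 2 + c * (2 * t) + b.
  have s1 := summZr (t ^+ 2) sf; have s2 := summZr (2 * t) sfg.
  have <- : sm (fun k => f k ^+ 2 * t ^+ 2 + f k * g k * (2 * t) + g k ^+ 2) = a * t ^+ 2 + c * (2 * t) + b.
    by rewrite (smD (summD s1 s2) sg) (smD s1 s2) smZr// smZr.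
  apply: sm_ge0 => k; have -> : f k ^+ 2 * t ^+ 2 + f k * g k * (2 * t) + g k ^+ 2 = (f k * t + g k) ^+ 2 by ring.
  exact: sqr_ge0.
have a0 : 0 <= a by apply: sm_ge0 => k; exact: sqr_ge0.
have b0 : 0 <= b by apply: sm_ge0 => k; exact: sqr_ge0.
have [a00|an0] := eqVneq a 0.
  rewrite a00 mul0r; have [->|c0] := eqVneq c 0; first by rewrite expr0n.
  have := H (- (b + 1) / (2 * c)); rewrite a00 mul0r add0r.
  have -> : c * (2 * (- (b + 1) / (2 * c))) = - (b + 1) by field.
  lra.
have ap : 0 < a by rewrite lt0r an0.
have := H (- c / a).
have -> : a * (- c / a) ^+ 2 + c * (2 * (- c / a)) + b = (a * b - c ^+ 2) / a by field.
by rewrite pmulr_lge0 ?invr_gt0// subr_ge0.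
Qed.

Lemma cauchy_sm (f g : K -> R) (A B : R) : 0 <= A -> 0 <= B ->
  summ (fun k => f k ^+ 2) -> summ (fun k => g k ^+ 2) ->
  sm (fun k => f k ^+ 2) <= A ^+ 2 -> sm (fun k => g k ^+ 2) <= B ^+ 2 ->
  sm (fun k => f k * g k) <= A * B.
Proof.
move=> A0 B0 sf sg fA gB; have [sfg h] := summ_mul sf sg.
have AB := mulr_ge0 A0 B0.
rewrite (le_trans (ler_norm _))// -(ler_pXn2r (n := 2))// ?nnegrE// real_normK ?num_real//.
rewrite (le_trans h)// exprMn ler_pM//; by apply: sm_ge0 => k; exact: sqr_ge0.
Qed.

Lemma minkowski2 (f g : K -> R) (A B : R) : 0 <= A -> 0 <= B ->
  summ (fun k => f k ^+ 2) -> summ (fun k => g k ^+ 2) ->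
  sm (fun k => f k ^+ 2) <= A ^+ 2 -> sm (fun k => g k ^+ 2) <= B ^+ 2 ->
  summ (fun k => (f k + g k) ^+ 2) /\ sm (fun k => (f k + g k) ^+ 2) <= (A + B) ^+ 2.
Proof.
move=> A0 B0 sf sg fA gB; have [sfg _] := summ_mul sf sg.
have := cauchy_sm A0 B0 sf sg fA gB => h.
have E : (fun k => (f k + g k) ^+ 2) = (fun k => f k ^+ 2 + (2 * (f k * g k) + g k ^+ 2)).
  by apply/funext => k; ring.
have s2 := summZ 2 sfg.
split; first by rewrite E; apply: summD => //; apply: summD.
rewrite E (smD sf (summD s2 sg)) (smD s2 sg) (smZ _ sfg).
have -> : (A + B) ^+ 2 = A ^+ 2 + 2 * (A * B) + B ^+ 2 by ring.
lra.
Qed.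
End cs.

(** * Lattice sums and the product estimate *)

Section Lattice.
Context {R : realType}.
Local Notation K := (int * int * int)%type.
Local Notation freq := (@freq R).
Implicit Types k l m : K.

Lemma freq_ge0 k : 0 <= freq k. Proof. exact: sqrtr_ge0. Qed.

Lemma freq_sq k : freq k ^+ 2 = k.1.1%:~R ^+ 2 + k.1.2%:~R ^+ 2 + k.2%:~R ^+ 2.
Proof. by rewrite sqr_sqrtr// !addr_ge0 ?sqr_ge0. Qed.

Lemma freq0 : freq 0 = 0.
Proof. by apply/eqP; rewrite -sqrf_eq0 freq_sq /= !expr0n/= !addr0. Qed.

Lemma le_freq k : [/\ `|k.1.1%:~R| <= freq k, `|k.1.2%:~R| <= freq k & `|k.2%:~R| <= freq k].
Proof.
have h (x : R) : x ^+ 2 <= freq k ^+ 2 -> `|x| <= freq k.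
  by move=> h; rewrite -(ler_pXn2r (n := 2))// ?nnegrE ?freq_ge0// real_normK ?num_real.
have := (sqr_ge0 (k.1.1%:~R : R)); have := (sqr_ge0 (k.1.2%:~R : R)); have := (sqr_ge0 (k.2%:~R : R)).
move=> *; split; apply: h; rewrite freq_sq; lra.
Qed.

Lemma freq_ge1 k : k != 0 -> 1 <= freq k.
Proof.
move=> k0.
have [] := le_freq k; rewrite -!intr_norm => h1 h2 h3.
have : [|| k.1.1 != 0, k.1.2 != 0 | k.2 != 0].
  by apply: contraNT k0; rewrite !negb_or !negbK => /and3P[/eqP a /eqP b /eqP c]; case: k a b c {h1 h2 h3} => -[? ?] ? /= -> -> ->.
by case/or3P => h; [apply: le_trans h1|apply: le_trans h2|apply: le_trans h3]; rewrite ler1z -gtz0_ge1 normr_gt0.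
Qed.

Lemma freq_gt0 k : k != 0 -> 0 < freq k.
Proof. by move=> /freq_ge1; apply: lt_le_trans. Qed.

Lemma freqD k l : freq (k + l) <= freq k + freq l.
Proof.
rewrite -(ler_pXn2r (n := 2))// ?nnegrE ?addr_ge0 ?freq_ge0//.
rewrite sqrrD !freq_sq /= !intrD.
set a := k.1.1%:~R; set b := k.1.2%:~R; set c := k.2%:~R.
set x := l.1.1%:~R; set y := l.1.2%:~R; set z := l.2%:~R.
have h : (a * x + b * y + c * z) <= freq k * freq l.
  rewrite (le_trans (ler_norm _))// -(ler_pXn2r (n := 2))// ?nnegrE ?mulr_ge0 ?freq_ge0//.
  rewrite real_normK ?num_real// exprMn !freq_sq -/a -/b -/c -/x -/y -/z.
  have := sqr_ge0 (a * y - b * x); have := sqr_ge0 (a * z - c * x); have := sqr_ge0 (b * z - c * y).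
  nra.
rewrite mulr2n; nra.
Qed.

Lemma freq_sub k l : freq k <= freq l + freq (k - l).
Proof. by have := freqD l (k - l); rewrite addrC subrK. Qed.

(** A discrete form of the integral test, with a telescoping right-hand side. It comes from ln(n+2)
    - ln(n+1) >= 1/(n+2) and e^x >= 1 + x. *)
Lemma riemann_step (q : R) n : 0 < q ->
  (n.+2%:R `^ (- (1 + q))) <= q^-1 * (n.+1%:R `^ (- q) - n.+2%:R `^ (- q)) :> R.
Proof.
move=> q0.
have n1 : 0 < n.+1%:R :> R by rewrite ltr0n.
have n2 : 0 < n.+2%:R :> R by rewrite ltr0n.
have hl : ln (n.+1%:R : R) + n.+2%:R^-1 <= ln (n.+2%:R : R).
  rewrite -ler_expR expRD !lnK ?posrE//.
  have : expR (n.+2%:R^-1 : R) * (1 - n.+2%:R^-1) <= 1.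
    rewrite -[leRHS](expR0) -[X in _ <= expR X](subrr (n.+2%:R^-1)) expRD ler_wpM2l// ?expR_ge0//.
    exact: expR_ge1Dx.
  have -> : 1 - n.+2%:R^-1 = n.+1%:R / n.+2%:R :> R.
    rewrite -[X in X - _](@divff _ n.+2%:R) ?gt_eqF// -{2}(mul1r (n.+2%:R^-1)) -mulrBl; congr (_ / _).
    by rewrite -natr1 addrK.
  by rewrite mulrA ler_pdivrMr// mul1r mulrC.
have E : n.+1%:R `^ (- q) >= n.+2%:R `^ (- q) * (1 + q / n.+2%:R) :> R.
  rewrite /powR !gt_eqF//.
  rewrite (le_trans (ler_wpM2l (expR_ge0 _) (expR_ge1Dx _)))// -expRD ler_expR.
  move: hl; set i := n.+2%:R^-1; set x := ln _; set y := ln _ => hl.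
  have := ler_wpM2l (ltW q0) hl; rewrite mulrDr => h; lra.
rewrite powRN; rewrite ler_pdivlMl//.
have -> : n.+2%:R `^ (1 + q) = n.+2%:R * n.+2%:R `^ q :> R.
  by rewrite powRD ?powRr1 ?ltW// (gt_eqF n2) implybT.
rewrite invfM [X in q * (_ * X)](_ : _ = n.+2%:R `^ (- q)); last by rewrite powRN.
move: E; set i := n.+2%:R^-1; set x := _ `^ _; set y := _ `^ _; lra.
Qed.

Lemma le_fsum (T : choiceType) (A B : {fset T}) (f : T -> R) : (forall x, 0 <= f x) ->
  {subset A <= B} -> \sum_(k <- A) f k <= \sum_(k <- B) f k.
Proof.
move=> f0 AB; rewrite [leRHS](big_fsetID _ (mem A))/=.
rewrite (_ : \sum_(k <- [fset x in B | x \in A]%fset) f k = \sum_(k <- A) f k).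
  by rewrite lerDl sumr_ge0.
by apply: eq_fbigl => k; rewrite !inE/= andb_idl//; exact: AB.
Qed.

(** Telescoping bounds the sum over natural numbers by 2 + 1/q with q = p - 1; the negative integers
    contribute at most as much again. *)
Lemma summ_int (p : R) : 1 < p -> summ (fun n : int => (Num.max 1 `|n|%:~R) `^ (- p) : R).
Proof.
move=> p1; set f := fun n : int => _.
have f0 n : 0 <= f n by exact: powR_ge0.
pose q := p - 1; have q0 : 0 < q by rewrite subr_gt0.
pose g (n : nat) : R := f n.
have gS n : \sum_(0 <= i < n.+2) g i <= 2 + q^-1 * (1 - n.+1%:R `^ (- q)).
  elim: n => [|n IH].
    rewrite !big_nat_recr//= big_nil /g /f/= powR1 subrr mulr0 addr0.
    by rewrite normr0 normr1 maxxx (max_idPl _)// !powR1 add0r.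
  rewrite big_nat_recr//=.
  have -> : g n.+2 = n.+2%:R `^ (- (1 + q)).
    rewrite /g /f; have -> : - (1 + q) = - p by rewrite /q; lra.
    by congr (_ `^ _); apply/max_idPr; rewrite ger0_norm// ler1n.
  have := riemann_step n q0; rewrite !mulrBr mulr1 in IH *; lra.
have gS' n : \sum_(i <- iota 0 n) g i <= 2 + q^-1.
  apply: (@le_trans _ _ (\sum_(0 <= i < n.+2) g i)).
    rewrite /index_iota subn0 -addn2 iotaD big_cat/= lerDl; apply: sumr_ge0 => *; exact: f0.
  apply: (le_trans (gS n)); rewrite lerD2l ler_piMr ?invr_ge0 ?ltW//.
apply: (@summ_fin _ _ _ ((2 + q^-1) + (2 + q^-1))) => A; under eq_bigr do rewrite ger0_norm//.
pose N := (\max_(k <- A) `|k|%N).+1.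
pose s := [seq Posz i | i <- iota 0 N] ++ [seq - Posz i | i <- iota 1 N].
have us : uniq s.
  rewrite cat_uniq !map_inj_uniq ?iota_uniq; [|by move=> a b; lia|by move=> a b; lia].
  rewrite andTb andbT; apply/hasPn => x xs; apply/negP => xs'.
  have [n] := seq.mapP xs; have [j _ ->] := seq.mapP xs'; rewrite mem_iota; lia.
have As : {subset A <= [fset x in s]%fset}.
  move=> k kA; suff : k \in s by move=> ks; rewrite in_fset.
  rewrite /s mem_cat.
  have kN : (`|k| < N)%N by rewrite ltnS; apply: leq_bigmax_seq.
  case: (leP 0 k) => k0; apply/orP; [left|right]; apply/seq.mapP; exists `|k|%N; rewrite ?mem_iota; lia.
apply: (le_trans (le_fsum f0 As)).
rewrite (perm_big s)/=; last first.
  by apply: uniq_perm; [exact: fset_uniq|exact: us|move=> x; rewrite in_fset].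
rewrite big_cat; apply: lerD.
  by rewrite big_map; exact: gS'.
rewrite big_map.
apply: (@le_trans _ _ (\sum_(i <- iota 1 N) g i)).
  by apply: ler_sum => i _; rewrite /g /f normrN.
apply: le_trans (gS' N.+1).
have -> : iota 0 N.+1 = 0%N :: iota 1 N by [].
by rewrite [leRHS]big_cons lerDr; exact: f0.
Qed.

Lemma summ_mulpair (T U : choiceType) (f : T -> R) (g : U -> R) : summ f -> summ g ->
  summ (fun tu : T * U => f tu.1 * g tu.2).
Proof.
move=> sf sg; apply: (@summ_pair _ _ _ (fun t u => f t * g u) (fun t => `|f t| * sm (fun u => `|g u|))).
- by move=> k; exact: summZ.
- move=> k; under eq_sm do rewrite normrM; rewrite smZ//; exact: summ_abs.
- by apply: summZr; exact: summ_abs.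
Qed.

(** For k != 0 the length |k| dominates max(1, |k_i|) for each coordinate, so |k|^(-s) is at most a
    product of three one-dimensional terms of exponent s/3 > 1. *)
Lemma summ_freq (s : R) : 3 < s -> summ (fun k => if k == 0 then 0 else freq k `^ (- s)).
Proof.
move=> s3; pose p := s / 3; have p1 : 1 < p by rewrite ltr_pdivlMr//; lra.
have S := summ_int p1; set f := (fun n : int => _) in S.
apply: summ_le (summ_mulpair (summ_mulpair S S) S) => k /=.
have f0 n : 0 <= f n by exact: powR_ge0.
have [_|k0] := eqVneq k 0; first by rewrite normr0 !mulr_ge0.
rewrite ger0_norm ?powR_ge0//.
have [h1 h2 h3] := le_freq k; have h0 := freq_ge1 k0.
have H (n : int) : `|n%:~R| <= freq k -> freq k `^ (- p) <= f n.
  move=> h; rewrite /f !powRN lef_pV2 ?posrE ?powR_gt0// ?lt_max ?ltr01 ?(lt_le_trans ltr01 h0)//.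
  apply: ge0_ler_powR; rewrite ?nnegrE ?le_max ?ler01 ?freq_ge0//.
    by apply: ltW; apply: lt_trans p1.
  by rewrite ge_max h0 intr_norm.
have -> : freq k `^ (- s) = freq k `^ (- p) * freq k `^ (- p) * freq k `^ (- p).
  have fk : freq k != 0 by rewrite gt_eqF// (lt_le_trans ltr01).
  by rewrite -!powRD ?fk ?implybT//; congr (_ `^ _); rewrite /p; field.
by rewrite !ler_pM ?mulr_ge0 ?powR_ge0//; exact: H.
Qed.

(** A homogeneous weight: for r > 0 it puts no bound on [U 0], and the zero frequency has to be
    treated separately everywhere. *)
Definition maj (r : R) (U : K -> R) (A : R) :=
  [/\ forall k, 0 <= U k, summ (fun k => (freq k `^ r * U k) ^+ 2) &
      sm (fun k => (freq k `^ r * U k) ^+ 2) <= A ^+ 2].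

Definition Q (U V : K -> R) k := sm (fun l => freq l * U l * (freq (k - l) * V (k - l))).

(** The constant of the embedding of [maj r] into the families with |k| U_k summable. The sum
    converges when 2r - 2 > 3; this is the origin of the threshold 5/2. *)
Definition emb (r : R) : R := Num.sqrt (sm (fun k => (if k == 0 then 0 else freq k `^ (1 - r)) ^+ 2)).

Lemma maj_l1 r U A : 5 / 2 < r -> 0 <= A -> maj r U A ->
  summ (fun k => freq k * U k) /\ sm (fun k => freq k * U k) <= emb r * A.
Proof.
move=> hr A0 [U0 sU UA]; set g := fun k => (if k == 0 then 0 else freq k `^ (1 - r)) : R.
have sg : summ (fun k => g k ^+ 2).
  have := @summ_freq (2 * r - 2) _; rewrite (_ : (fun k => _) = (fun k => g k ^+ 2)).
    by apply; lra.
  apply/funext => k; rewrite /g; case: eqVneq => [_|k0]; first by rewrite expr0n.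
  have fk : freq k != 0 by rewrite gt_eqF// freq_gt0.
  by rewrite expr2 -powRD ?fk ?implybT//; congr (_ `^ _); lra.
have E : (fun k => freq k * U k) = (fun k => g k * (freq k `^ r * U k)).
  apply/funext => k; rewrite /g; case: eqVneq => [->|k0]; first by rewrite freq0 !mul0r.
  have fk : freq k != 0 by rewrite gt_eqF// freq_gt0.
  by rewrite mulrA -powRD ?fk ?implybT// subrK powRr1// freq_ge0.
rewrite E; have [s1 s2] := summ_mul sg sU; split=> //.
apply: cauchy_sm => //; first exact: sqrtr_ge0.
by rewrite /emb sqr_sqrtr//; apply: sm_ge0 => k; exact: sqr_ge0.
Qed.

Lemma bij_sub k : bijective (fun l : K => k - l).
Proof. by exists (fun l => k - l) => l; rewrite subKr. Qed.

Lemma bij_subr l : bijective (fun k : K => k - l).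
Proof. by exists (fun k => k + l) => k; rewrite ?subrK ?addrK. Qed.

(** Young's inequality for the convolution of l^2 with l^1. Cauchy-Schwarz with the weight g(k - l)
    split into two square roots gives the pointwise bound [C], and exchanging the two sums
    finishes. *)
Lemma young (F g : K -> R) (A B : R) : 0 <= A -> (forall k, 0 <= F k) -> (forall k, 0 <= g k) ->
  summ (fun k => F k ^+ 2) -> sm (fun k => F k ^+ 2) <= A ^+ 2 -> summ g -> sm g <= B ->
  [/\ forall k, summ (fun l => F l * g (k - l)), summ (fun k => sm (fun l => F l * g (k - l)) ^+ 2) &
  sm (fun k => sm (fun l => F l * g (k - l)) ^+ 2) <= (A * B) ^+ 2].
Proof.
move=> A0 F0 g0 sF FA sg gB.
have B0 : 0 <= B by apply: le_trans gB; exact: sm_ge0.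
have FlA l : F l <= A.
  rewrite -(ler_pXn2r (n := 2))// ?nnegrE//; apply: le_trans FA.
  by apply: (le_sm1 l _ sF) => k; exact: sqr_ge0.
have sgk k : summ (fun l => g (k - l)) by have [_ [_ h]] := sm_reindex g (bij_sub k); exact: h.
have smgk k : sm (fun l => g (k - l)) = sm g by have [h _] := sm_reindex g (bij_sub k).
have sgl l : summ (fun k => g (k - l)) by have [_ [_ h]] := sm_reindex g (bij_subr l); exact: h.
have smgl l : sm (fun k => g (k - l)) = sm g by have [h _] := sm_reindex g (bij_subr l).
have s1 k : summ (fun l => F l * g (k - l)).
  apply: summ_le (summZ A (sgk k)) => l; rewrite ger0_norm ?mulr_ge0//.
  exact: ler_wpM2r.
have s2 k : summ (fun l => F l ^+ 2 * g (k - l)).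
  apply: summ_le (summZ (A ^+ 2) (sgk k)) => l; rewrite ger0_norm ?mulr_ge0 ?sqr_ge0//.
  by apply: ler_wpM2r => //; rewrite ler_pXn2r ?nnegrE.
have C k : sm (fun l => F l * g (k - l)) ^+ 2 <= sm (fun l => F l ^+ 2 * g (k - l)) * sm g.
  have [||_] := @summ_mul _ _ (fun l => F l * Num.sqrt (g (k - l))) (fun l => Num.sqrt (g (k - l))).
  - by under eq_fun do rewrite exprMn sqr_sqrtr//.
  - by under eq_fun do rewrite sqr_sqrtr//.
  under eq_sm do rewrite -mulrA -expr2 sqr_sqrtr//.
  under [in X in _ <= X * _ -> _]eq_sm do rewrite exprMn sqr_sqrtr//.
  under [in X in _ <= _ * X -> _]eq_sm do rewrite sqr_sqrtr//.
  by rewrite smgk.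
have P : summ (fun lk : K * K => F lk.1 ^+ 2 * g (lk.2 - lk.1)).
  apply: (@summ_pair _ _ _ (fun l k => F l ^+ 2 * g (k - l)) (fun l => F l ^+ 2 * sm g)).
  - by move=> l; exact: summZ.
  - move=> l; under eq_sm do rewrite ger0_norm ?mulr_ge0 ?sqr_ge0//.
    by rewrite smZ// smgl.
  - exact: summZr.
have [p1 p2 p3] := sm_pair (f := fun l k => F l ^+ 2 * g (k - l)) P.
have SW := sm_swap (f := fun l k => F l ^+ 2 * g (k - l)) P.
have p2' : summ (fun k => sm (fun l => F l ^+ 2 * g (k - l))).
  have bs : bijective (fun kl : K * K => (kl.2, kl.1)) by exists (fun kl => (kl.2, kl.1)) => -[].
  have [_ [_ h]] := sm_reindex (fun lk : K * K => F lk.1 ^+ 2 * g (lk.2 - lk.1)) bs.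
  by have [_ hh _] := sm_pair (f := fun k l => F l ^+ 2 * g (k - l)) (h P).
have s3 : summ (fun k => sm (fun l => F l * g (k - l)) ^+ 2).
  apply: summ_le (summZr (sm g) p2') => k; rewrite ger0_norm ?sqr_ge0//; exact: C.
split=> //; apply: (le_trans (le_sm s3 (summZr (sm g) p2') C)).
rewrite smZr// -SW; under eq_sm do rewrite smZ// smgl.
rewrite smZr// exprMn -mulrA ler_pM ?sm_ge0//; first by move=> k; exact: sqr_ge0.
  by rewrite mulr_ge0 ?sm_ge0.
by rewrite expr2 ler_pM ?sm_ge0.
Qed.

(** 2^(r-1) comes from distributing |k|^(r-1) over l and k - l; the remaining factor 2 counts the
    two resulting convolutions. *)
Definition kap r : R := 2 `^ r * emb r.

Lemma powR_sum_le (p a b c : R) : 0 <= p -> 0 <= a -> 0 <= b -> 0 <= c -> c <= a + b ->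
  c `^ p <= 2 `^ p * (a `^ p + b `^ p).
Proof.
move=> p0 a0 b0 c0 cab.
wlog ab : a b a0 b0 cab / a <= b.
  move=> h; case: (leP a b) => [ab|/ltW ba]; first exact: h.
  by rewrite addrC h// addrC.
have : c `^ p <= (2 * b) `^ p by apply: ge0_ler_powR; rewrite ?nnegrE//; lra.
rewrite powRM// => h; apply: (le_trans h); rewrite ler_wpM2l ?powR_ge0// lerDr; exact: powR_ge0.
Qed.

Lemma Q_summ1 U V : (forall k, 0 <= U k) -> (forall k, 0 <= V k) ->
  summ (fun k => freq k * U k) -> summ (fun k => freq k * V k) -> forall k,
  summ (fun l => freq l * U l * (freq (k - l) * V (k - l))).
Proof.
move=> U0 V0 sU sV k.
have [_ [_ sV']] := sm_reindex (fun k => freq k * V k) (bij_sub k).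
apply: summ_le (summZ (sm (fun k => freq k * U k)) (sV' sV)) => l.
have h0 (W : K -> R) j : (forall j, 0 <= W j) -> 0 <= freq j * W j by move=> ?; rewrite mulr_ge0// freq_ge0.
rewrite ger0_norm ?mulr_ge0 ?freq_ge0//= ler_wpM2r ?h0//.
by apply: (le_sm1 l _ sU) => j; exact: h0.
Qed.

Lemma Q_summ r U V A B : 5 / 2 < r -> 0 <= A -> 0 <= B -> maj r U A -> maj r V B -> forall k,
  summ (fun l => freq l * U l * (freq (k - l) * V (k - l))).
Proof.
move=> hr A0 B0 mU mV.
have [sU _] := maj_l1 hr A0 mU; have [sV _] := maj_l1 hr B0 mV.
by case: mU mV => U0 _ _ [V0 _ _]; exact: Q_summ1.
Qed.

Lemma Q_ge0 U V k : (forall k, 0 <= U k) -> (forall k, 0 <= V k) -> 0 <= Q U V k.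
Proof. by move=> U0 V0; apply: sm_ge0 => l; rewrite !mulr_ge0 ?freq_ge0. Qed.

(** After division by |k| only |k|^(r-1) is left, at most 2^(r-1) (|l|^(r-1) + |k-l|^(r-1)). Each
    factor of [Q] already carries one power of its frequency, so the favoured factor has weight
    |.|^r and lies in l^2, while the other has weight |.| and lies in l^1: Young's inequality
    applies to both halves. *)
Lemma Q_est r U V A B : 5 / 2 < r -> 0 <= A -> 0 <= B -> maj r U A -> maj r V B ->
  maj r (fun k => if k == 0 then 0 else Q U V k / freq k) (kap r * A * B).
Proof.
move=> hr A0 B0 mU mV.
have [sU lU] := maj_l1 hr A0 mU; have [sV lV] := maj_l1 hr B0 mV.
have sQ := Q_summ hr A0 B0 mU mV.
case: (mU) (mV) => U0 sU2 UA [V0 sV2 VB].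
pose F k := freq k `^ r * U k; pose f k := freq k * U k.
pose G k := freq k `^ r * V k; pose g k := freq k * V k.
have F0 k : 0 <= F k by rewrite mulr_ge0 ?powR_ge0.
have f0 k : 0 <= f k by rewrite mulr_ge0 ?freq_ge0.
have G0 k : 0 <= G k by rewrite mulr_ge0 ?powR_ge0.
have g0 k : 0 <= g k by rewrite mulr_ge0 ?freq_ge0.
have [y1 y2 y3] := young A0 F0 g0 sU2 UA sV lV.
have [z1 z2 z3] := young B0 G0 f0 sV2 VB sU lU.
have n1 k : 0 <= sm (fun l => F l * g (k - l)) by apply: sm_ge0 => l; rewrite mulr_ge0.
have n2 k : 0 <= sm (fun l => G l * f (k - l)) by apply: sm_ge0 => l; rewrite mulr_ge0.
have e0 : 0 <= emb r by exact: sqrtr_ge0.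
pose c : R := 2 `^ (r - 1).
have c0 : 0 <= c by exact: powR_ge0.
have pw (k : K) : k != 0 -> freq k `^ r = freq k `^ (r - 1) * freq k.
  move=> k0; have fk : freq k != 0 by rewrite gt_eqF// freq_gt0.
  by rewrite -{3}(powRr1 (freq_ge0 k)) -powRD ?fk ?implybT// subrK.
have pw0 (k : K) : freq k `^ r = freq k `^ (r - 1) * freq k.
  have [->|/pw//] := eqVneq k 0; rewrite freq0 mulr0 powR0//; by apply/negP => /eqP; lra.
have W k : freq k `^ r * (if k == 0 then 0 else Q U V k / freq k) <=
    c * (sm (fun l => F l * g (k - l)) + sm (fun l => G l * f (k - l))).
  case: eqVneq => [_|k0]; first by rewrite mulr0; apply: mulr_ge0 => //; exact: addr_ge0.
  have fk : freq k != 0 by rewrite gt_eqF// freq_gt0.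
  have -> : freq k `^ r * (Q U V k / freq k) = freq k `^ (r - 1) * Q U V k by rewrite pw//; field.
  have [rE [_ rS]] := sm_reindex (fun l => G l * f (k - l)) (bij_sub k).
  have sD := summD (y1 k) (rS (z1 k)).
  rewrite -rE -(smD (y1 k) (rS (z1 k))) /Q -(smZ (freq k `^ (r - 1)) (sQ k)) -(smZ c sD).
  apply: le_sm; [exact: summZ|exact: summZ|].
  move=> l /=; rewrite subKr /F /G /f /g !pw0.
  have := @powR_sum_le (r - 1) (freq l) (freq (k - l)) (freq k) _ (freq_ge0 _) (freq_ge0 _) (freq_ge0 _) (freq_sub k l).
  have r1 : 0 <= r - 1 by lra.
  move=> /(_ r1) h.
  have := ler_wpM2r (mulr_ge0 (f0 l) (g0 (k - l))) h; rewrite /f /g -/c.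
  by apply: le_trans_eq || (move=> hh; apply: (le_trans hh); rewrite le_eqVlt; apply/orP; left; apply/eqP; ring).
have AB0 : 0 <= A * (emb r * B) by rewrite !mulr_ge0.
have BA0 : 0 <= B * (emb r * A) by rewrite !mulr_ge0.
have [m1 m2] := minkowski2 AB0 BA0 y2 z2 y3 z3.
split.
- by move=> k; case: eqVneq => // k0; rewrite divr_ge0 ?freq_ge0 ?Q_ge0.
- apply: summ_le (summZ (c ^+ 2) m1) => k; rewrite ger0_norm ?sqr_ge0// -exprMn.
  rewrite ler_pXn2r ?nnegrE//; first by rewrite mulr_ge0 ?powR_ge0//; case: eqVneq => // k0; rewrite divr_ge0 ?freq_ge0 ?Q_ge0.
  by apply: mulr_ge0 => //; exact: addr_ge0.
- apply: (@le_trans _ _ (sm (fun k => c ^+ 2 * (sm (fun l => F l * g (k - l)) + sm (fun l => G l * f (k - l))) ^+ 2))).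
    apply: (le_trans (ler_norm _)); apply: le_norm_sm; first exact: summZ.
    move=> k; rewrite ger0_norm ?sqr_ge0// -exprMn.
    rewrite ler_pXn2r ?nnegrE//; first by rewrite mulr_ge0 ?powR_ge0//; case: eqVneq => // k0; rewrite divr_ge0 ?freq_ge0 ?Q_ge0.
    by apply: mulr_ge0 => //; exact: addr_ge0.
  rewrite smZ// (le_trans (ler_wpM2l (sqr_ge0 c) m2))// -exprMn.
  have -> : c * (A * (emb r * B) + B * (emb r * A)) = kap r * A * B.
    have -> : kap r = 2 * c * emb r.
      rewrite /kap /c; congr (_ * _); rewrite -{2}(@powRr1 _ 2)// -powRD ?pnatr_eq0 ?implybT//.
      by congr (_ `^ _); lra.
    ring.
  by [].
Qed.

Lemma kap_ge0 r : 0 <= kap r.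
Proof. by rewrite mulr_ge0 ?powR_ge0 ?sqrtr_ge0. Qed.

Lemma majW r U A B : 0 <= A -> A <= B -> maj r U A -> maj r U B.
Proof.
move=> A0 AB [U0 sU UA]; split=> //; apply: (le_trans UA).
by rewrite ler_pXn2r ?nnegrE// (le_trans A0).
Qed.

Lemma majD r U V A B : 0 <= A -> 0 <= B -> maj r U A -> maj r V B -> maj r (fun k => U k + V k) (A + B).
Proof.
move=> A0 B0 [U0 sU UA] [V0 sV VB].
have [h1 h2] := minkowski2 A0 B0 sU sV UA VB.
split; first by move=> k; rewrite addr_ge0.
  by under eq_fun do rewrite mulrDr.
by under eq_sm do rewrite mulrDr.
Qed.

Lemma majZ r U A c : 0 <= c -> maj r U A -> maj r (fun k => c * U k) (c * A).
Proof.
move=> c0 [U0 sU UA].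
have E : (fun k => (freq k `^ r * (c * U k)) ^+ 2) = (fun k => c ^+ 2 * (freq k `^ r * U k) ^+ 2).
  by apply/funext => k; ring.
split; first by move=> k; rewrite mulr_ge0.
  by rewrite E; exact: summZ.
by rewrite E smZ// exprMn ler_wpM2l// sqr_ge0.
Qed.

Lemma maj_le r U V A : (forall k, 0 <= U k <= V k) -> maj r V A -> maj r U A.
Proof.
move=> UV [V0 sV VA].
have h k : `|(freq k `^ r * U k) ^+ 2| <= (freq k `^ r * V k) ^+ 2.
  have /andP[u0 uv] := UV k.
  rewrite ger0_norm ?sqr_ge0// ler_pXn2r ?nnegrE ?mulr_ge0 ?powR_ge0//.
  by rewrite ler_wpM2l// powR_ge0.
split; first by move=> k; case/andP: (UV k).
  exact: summ_le h sV.
apply: le_trans VA; apply: (le_trans (ler_norm _)); exact: le_norm_sm.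
Qed.

Lemma maj_pt r U A k : 0 <= r -> 0 <= A -> maj r U A -> k != 0 -> U k <= A.
Proof.
move=> r0 A0 [U0 sU UA] k0; rewrite -(ler_pXn2r (n := 2))// ?nnegrE//; apply: le_trans UA.
apply: le_trans (le_sm1 k _ sU); last by move=> j; exact: sqr_ge0.
rewrite ler_pXn2r ?nnegrE ?mulr_ge0 ?powR_ge0// ler_peMl//.
by rewrite -(powRr0 (freq k)) ler_powR// freq_ge1.
Qed.

Lemma cvg_fsum (T : choiceType) (A : seq T) (F : set_system nat) (FF : Filter F) (f : nat -> T -> R) (g : T -> R) :
  (forall x, f n x @[n --> F] --> g x) -> \sum_(k <- A) f n k @[n --> F] --> \sum_(k <- A) g k.
Proof.
move=> fg; elim: A => [|k s IH].
  by rewrite big_nil; under eq_fun do rewrite big_nil; exact: cvg_cst.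
by rewrite big_cons; under eq_fun do rewrite big_cons; exact: cvgD.
Qed.

(** Fatou's lemma for sums: each finite partial sum passes to the limit. *)
Lemma maj_lim r (X : nat -> K -> R) U A : (\forall n \near \oo, maj r (X n) A) ->
  (forall k, X n k @[n --> \oo] --> U k) -> maj r U A.
Proof.
move=> mX XU.
have U0 k : 0 <= U k.
  apply: (@closed_cvg _ _ \oo _ (X^~ k) (fun x => 0 <= x)); [exact: closed_ge| |exact: XU].
  by apply: filterS mX => n [].
have H (F : {fset K}) : \sum_(k <- F) (freq k `^ r * U k) ^+ 2 <= A ^+ 2.
  apply: (@closed_cvg _ _ \oo _ (fun n => \sum_(k <- F) (freq k `^ r * X n k) ^+ 2) (fun x => x <= A ^+ 2)).
  - exact: closed_le.
  - apply: filterS mX => n [X0 sX]; apply: le_trans; apply: fsum_le_sm => // k; exact: sqr_ge0.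
  - apply: cvg_fsum => k; rewrite !expr2; apply: cvgM; apply: cvgMr; exact: XU.
split=> //; last by apply: sm_le_fsum => // k; exact: sqr_ge0.
by apply: (@summ_fin _ _ _ (A ^+ 2)) => F; under eq_bigr do rewrite ger0_norm ?sqr_ge0//.
Qed.

(** By the triangle inequality |k| <= |l| + |k - l| the product of the two exponential weights is at
    most the weight at k, so analytic decay passes through convolutions at no cost. *)
Lemma Q_exp s U V : 0 <= s -> (forall k, 0 <= U k) -> (forall k, 0 <= V k) ->
  summ (fun k => freq k * U k) -> summ (fun k => freq k * V k) -> forall k,
  Q (fun l => expR (- (s * freq l)) * U l) (fun l => expR (- (s * freq l)) * V l) k <= expR (- (s * freq k)) * Q U V k.
Proof.
move=> s0 U0 V0 sU sV k; have sQ := Q_summ1 U0 V0 sU sV k.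
have e1 l : expR (- (s * freq l)) <= 1 by rewrite expR_le1 oppr_le0 mulr_ge0// freq_ge0.
rewrite /Q -(smZ _ sQ).
have P l : freq l * (expR (- (s * freq l)) * U l) * (freq (k - l) * (expR (- (s * freq (k - l))) * V (k - l))) <=
   expR (- (s * freq k)) * (freq l * U l * (freq (k - l) * V (k - l))).
  rewrite [leLHS](_ : _ = (expR (- (s * freq l)) * expR (- (s * freq (k - l)))) * (freq l * U l * (freq (k - l) * V (k - l)))); last by ring.
  apply: ler_wpM2r; first by rewrite !mulr_ge0 ?freq_ge0.
  rewrite -expRD ler_expR; have := ler_wpM2l s0 (freq_sub k l); lra.
have P0 l : 0 <= freq l * (expR (- (s * freq l)) * U l) * (freq (k - l) * (expR (- (s * freq (k - l))) * V (k - l))).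
  by rewrite !mulr_ge0 ?freq_ge0 ?expR_ge0.
apply: le_sm => //; last exact: summZ.
by apply: summ_le (summZ _ sQ) => l; rewrite ger0_norm; [exact: P|exact: P0].
Qed.

End Lattice.

(** * Quadratic coefficient systems with shrinking analyticity radius *)

Section TimeIntegral.
Context {R : realType}.
Local Notation leb := (@lebesgue_measure R).
Implicit Types (f g h : R -> R) (t s : R).

Definition ig g t : R := \int[leb]_(s in `[0, t]) g s.

Lemma cts_within (D : set R) g : continuous g -> {within D, continuous g}.
Proof. by move=> cg; apply: continuous_subspaceT => x; exact: cg. Qed.

Lemma cts_integrable g a b : continuous g -> leb.-integrable `[a, b] (EFin \o g).
Proof.
move=> cg; apply: continuous_compact_integrable; first exact: segment_compact.
exact: cts_within.
Qed.

Lemma cts_measurable g (D : set R) : measurable D -> continuous g -> measurable_fun D g.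
Proof. by move=> mD cg; apply: measurable_funS (continuous_measurable_fun cg). Qed.

Lemma is_derive_cts g (x d : R) : is_derive x 1 g d -> {for x, continuous g}.
Proof. by move=> h; apply: differentiable_continuous; apply/derivable1_diffP. Qed.

(** Integrating from -1 rather than from 0 gives an antiderivative that is two-sidedly
    differentiable at 0 as well. *)
Lemma ig_anti g : continuous g -> exists G : R -> R,
  (forall t, -1 < t -> is_derive t 1 G (g t)) /\ (forall t, 0 <= t -> ig g t = G t - G 0).
Proof.
move=> cg; exists (fun t => \int[leb]_(s in `[-1, t]) g s); split=> [t t1|t t0].
  have tt : t < t + 1 by rewrite ltrDl.
  have [d1 d2] := continuous_FTC1_closed tt (cts_integrable _ _ cg) t1 (cg t).
  by split; [exact: d1|rewrite -derive1E].
rewrite (@Rintegral_itvB _ g (BLeft (-1)) (BRight t) 0); first last.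
- by rewrite bnd_simp.
- by rewrite bnd_simp lerN10.
- exact: cts_integrable.
rewrite Rintegral_itv_obnd_cbnd//.
by apply: integrableS (cts_integrable 0 t cg) => //; apply: subset_itvr; rewrite bnd_simp.
Qed.

Lemma ig0 g : ig g 0 = 0.
Proof. by rewrite /ig set_itv1 Rintegral_set1. Qed.

Lemma ig_derive g t : continuous g -> 0 < t -> is_derive t 1 (ig g) (g t).
Proof.
move=> cg t0; have tt : t < t + 1 by rewrite ltrDl.
have [d1 d2] := continuous_FTC1_closed tt (cts_integrable _ _ cg) t0 (cg t).
by split; [exact: d1|rewrite -derive1E].
Qed.

Lemma derive_cst_anti (F G : R -> R) a t : a < t -> (forall x, a < x < t -> is_derive x 1 F 0) ->
  {within `[a, t], continuous F} -> F t = F a.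
Proof.
move=> lat dF cF.
have dF' x : x \in `]a, t[ -> is_derive x 1 F ((fun=> 0 : R) x) by rewrite in_itv/=; exact: dF.
have [c ct /eqP] := MVT lat dF' cF.
by rewrite mul0r subr_eq0 => /eqP.
Qed.

Lemma ig_FTC2 g F t : continuous g -> (forall x, 0 < x < t -> is_derive x 1 F (g x)) -> 
  {within `[0, t], continuous F} -> 0 <= t -> ig g t = F t - F 0.
Proof.
move=> cg dF cF; rewrite le_eqVlt => /predU1P[<-|t0]; first by rewrite ig0 subrr.
have [G [dG ->]] := ig_anti cg; last exact: ltW.
have : (F \- G) t = (F \- G) 0; last by rewrite /=; lra.
apply: derive_cst_anti => // [x xt|].
  have h1 := dF x xt; have h2 : is_derive x 1 G (g x) by apply: dG; lra.
  by apply: is_derive_eq; rewrite subrr.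
have cG : {within `[0, t], continuous G}.
  apply/continuous_in_subspaceT => x; rewrite inE/= in_itv/= => /andP[x0 _].
  by apply: is_derive_cts (dG x _); lra.
move=> x; apply: continuousB; [exact: cF|exact: cG].
Qed.

Lemma le_ig g h t : continuous g -> continuous h -> 
  (forall s, 0 <= s <= t -> `|g s| <= h s) -> `|ig g t| <= ig h t.
Proof.
move=> cg ch gh; have ing := cts_integrable 0 t cg.
apply: (le_trans (le_normr_Rintegral _ ing)) => //.
apply: le_Rintegral; [by []|exact: (integrable_norm ing)|exact: cts_integrable|].
by move=> s /=; rewrite in_itv/=; exact: gh.
Qed.

Lemma igB g h t : continuous g -> continuous h -> ig (fun s => g s - h s) t = ig g t - ig h t.
Proof. by move=> cg ch; rewrite /ig RintegralB//; exact: cts_integrable. Qed.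

Lemma igD g h t : continuous g -> continuous h -> ig (fun s => g s + h s) t = ig g t + ig h t.
Proof. by move=> cg ch; rewrite /ig RintegralD//; exact: cts_integrable. Qed.

Lemma igZ c g t : continuous g -> ig (fun s => c * g s) t = c * ig g t.
Proof. by move=> cg; rewrite /ig RintegralZl//; exact: cts_integrable. Qed.

Lemma eq_ig g h t : (forall s, 0 <= s <= t -> g s = h s) -> ig g t = ig h t.
Proof. by move=> gh; apply: eq_Rintegral => s; rewrite inE/= in_itv/=; exact: gh. Qed.

(** Time clamped to [0, T]. Trajectories become continuous functions on the whole line satisfying
    bounds at every real time, so no domain condition has to be carried. *)
Definition cl (T t : R) : R := Num.max 0 (Num.min t T).

Lemma cl_itv T t : 0 <= T -> 0 <= cl T t <= T.
Proof. by move=> T0; rewrite /cl le_max lexx/= ge_max T0 ge_min lexx orbT. Qed.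

Lemma cl_id T t : 0 <= t <= T -> cl T t = t.
Proof. by move=> /andP[t0 tT]; rewrite /cl (min_idPl tT) (max_idPr t0). Qed.

Lemma cl_cts T : continuous (cl T).
Proof.
move=> t; apply: (@continuous_max _ _ (fun=> 0) (fun t => Num.min t T) t); first exact: cvg_cst.
by apply: (@continuous_min _ _ id (fun=> T) t); [exact: cvg_id|exact: cvg_cst].
Qed.

Lemma clK T t : 0 <= T -> cl T (cl T t) = cl T t.
Proof. by move=> T0; rewrite (cl_id (cl_itv t T0)). Qed.

Lemma ig_cl_cts T g : 0 <= T -> continuous g -> continuous (fun t => ig g (cl T t)).
Proof.
move=> T0 cg; have [G [dG GE]] := ig_anti cg.
have -> : (fun t => ig g (cl T t)) = (fun t => G (cl T t) - G 0).
  by apply/funext => t; rewrite GE//; case/andP: (cl_itv t T0).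
move=> t; apply: cvgB; last exact: cvg_cst.
apply: (@continuous_comp _ _ _ (cl T) G); first exact: cl_cts.
by apply: is_derive_cts (dG _ _); case/andP: (cl_itv t T0) => h _; lra.
Qed.

Lemma is_derive_affine (f : R -> R) (p m x d : R) : is_derive x 1 f d ->
  is_derive x 1 (fun t => p + m * f t) (m * d).
Proof.
move=> h; have h1 := @is_deriveZ _ _ _ f m x 1 d h.
have h2 := is_deriveD (is_derive_cst p x 1) h1.
by rewrite add0r in h2.
Qed.

Lemma exp_aff_derive (a b x : R) : is_derive x 1 (fun s => expR (a + b * s)) (b * expR (a + b * x)).
Proof.
have h : is_derive x 1 (fun s : R => a + b * s) b.
  by apply: is_derive_eq; rewrite /GRing.scale/=; lra.
have := @is_derive1_comp _ expR (fun s => a + b * s) x _ _ (is_derive_expR (a + b * x)) h.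
by rewrite mulrC.
Qed.

Lemma exp_aff_cts (a b : R) : continuous (fun s => expR (a + b * s)).
Proof. by move=> x; apply: is_derive_cts (exp_aff_derive a b x). Qed.

Lemma ig_exp (a b t : R) : b != 0 -> 0 <= t -> 
  ig (fun s => expR (a + b * s)) t = (expR (a + b * t) - expR a) / b.
Proof.
move=> b0 t0.
have := @ig_FTC2 (fun s => expR (a + b * s)) (fun s => b^-1 * expR (a + b * s)) t (@exp_aff_cts a b).
rewrite mulr0 addr0 -mulrBr mulrC; apply => //.
- move=> x _; have h := exp_aff_derive a b x.
  by apply: is_derive_eq; rewrite /GRing.scale/= mulKf.
- apply: cts_within => x; apply: cvgM; [exact: cvg_cst|exact: exp_aff_cts].
Qed.

(* Integrating the shrinking exponential weight gains the factor [1 / (lam * w)], which pays for the derivative lost by the nonlinearity. *)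
Lemma duhamel_int (g : R -> R) (tau0 lam w B t : R) : continuous g -> 0 < lam -> 0 < w -> 0 <= B -> 0 <= t ->
  (forall s, 0 <= s <= t -> `|g s| <= expR (- ((tau0 - lam * s) * w)) * B) ->
  `|ig g t| <= expR (- ((tau0 - lam * t) * w)) * (B / (lam * w)).
Proof.
move=> cg lam0 w0 B0 t0 gB.
have E s : - ((tau0 - lam * s) * w) = - (tau0 * w) + (lam * w) * s by ring.
have lw : 0 < lam * w by rewrite mulr_gt0.
have ce := @exp_aff_cts (- (tau0 * w)) (lam * w).
apply: (le_trans (@le_ig g (fun s => B * expR (- (tau0 * w) + (lam * w) * s)) t cg _ _)).
- by move=> x; apply: cvgM; [exact: cvg_cst|exact: ce].
- by move=> s st; rewrite mulrC -E; exact: gB.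
rewrite igZ// ig_exp ?gt_eqF// E.
have : 0 <= B * expR (- (tau0 * w)) / (lam * w) by apply: divr_ge0; [exact: mulr_ge0 B0 (expR_ge0 _)|exact: ltW].
set X := expR _; set Y := expR _; set Z := _^-1; lra.
Qed.

End TimeIntegral.

(** * Limits of sequences with geometric increments *)

Section GeomCvg.
Context {R : realType}.

Lemma geom_dist (x : nat -> R) (al : R) : 0 <= al -> (forall n, `|x n.+1 - x n| <= al / 2 ^+ n.+1) -> 
  forall n m, (n <= m)%N -> `|x m - x n| <= al / 2 ^+ n - al / 2 ^+ m.
Proof.
move=> al0 h n m /subnK <-; elim: (m - n)%N => [|j IH]; first by rewrite add0n !subrr normr0.
rewrite addSn; have := h (j + n)%N.
have -> : al / 2 ^+ (j + n).+1 = al / 2 ^+ (j + n) / 2 by rewrite exprSr invfM mulrA.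
have -> : x (j + n).+1 - x n = (x (j + n).+1 - x (j + n)%N) + (x (j + n)%N - x n) by lra.
move=> h'; apply: (le_trans (ler_normD _ _)); lra.
Qed.

Lemma geom0 (al : R) : al / 2 ^+ n @[n --> \oo] --> (0 : R).
Proof.
rewrite -(mulr0 al); apply: cvgMr; under eq_fun do rewrite -exprVn; apply: cvg_expr.
by rewrite ger0_norm ?invr_ge0// invf_lt1// ltr1n.
Qed.

Lemma geom_cvg (x : nat -> R) (al : R) : 0 <= al -> (forall n, `|x n.+1 - x n| <= al / 2 ^+ n.+1) ->
  x n @[n --> \oo] --> limn x /\ forall n, `|limn x - x n| <= al / 2 ^+ n.
Proof.
move=> al0 h; have d := geom_dist al0 h.
have d' n m : (n <= m)%N -> `|x m - x n| <= al / 2 ^+ n.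
  move=> nm; apply: (le_trans (d _ _ nm)); rewrite lerBlDr lerDl divr_ge0// exprn_ge0//.
have cx : cvgn x.
  apply/cauchy_cvgP/cauchyP => e e0.
  have /cvgrPdist_lt/(_ e e0)[n _ hn] := geom0 al.
  exists (x n); exists n => // m /= nm; rewrite /ball/= distrC.
  apply: (le_lt_trans (d' _ _ nm)).
  by have := hn n (leqnn n); rewrite sub0r normrN ger0_norm// divr_ge0// exprn_ge0.
split=> // n; have h1 : x m - x n @[m --> \oo] --> limn x - x n by apply: cvgB => //; exact: cvg_cst.
apply: (@closed_cvg _ _ \oo _ (fun m => `|x m - x n|) (fun y => y <= al / 2 ^+ n)).
- exact: closed_le.
- by exists n => // m /= nm; exact: d'.
- exact: cvg_norm.
Qed.
End GeomCvg.

(** * Picard iteration for an abstract quadratic system *)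

Section Evolution.
Context {R : realType} {I : finType}.
Local Notation K := (int * int * int)%type.
Local Notation freq := (@freq R).
Local Notation st := (I -> K -> R).
Implicit Types (u v : st) (U V D S : K -> R) (k : K).

Definition bdd u U := forall i k, `|u i k| <= U k.
Definition sdiff u v : st := fun i k => u i k - v i k.
(** Enough for all the sums [Q U V k] to converge absolutely; implied by [maj r] when r > 5/2. *)
Definition smallw U := (forall k, 0 <= U k) /\ summ (fun k => freq k * U k).

(** All that the existence, uniqueness and energy arguments use about the nonlinearity. The bound is
    stated for differences, with the difference entering linearly; together with [quad_0] the case v
    = 0 bounds N itself. *)
Record quad (N : R -> st -> st) (c : R) : Prop := Quad {
  quad_lip : forall t u v U V D, smallw U -> smallw V -> smallw D ->
     bdd u U -> bdd v V -> bdd (sdiff u v) D ->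
     forall i k, `|N t u i k - N t v i k| <= c * (Q U D k + Q D V k);
  quad_0 : forall t i k, N t (fun _ _ => 0) i k = 0;
  quad_k0 : forall t u i, N t u i 0 = 0;
  quad_cts : forall (u : R -> st) U, smallw U -> (forall t, bdd (u t) U) ->
     (forall i k, continuous (fun t => u t i k)) ->
     forall i k, continuous (fun t => N t (u t) i k) }.

Definition ub (tau0 lam T t : R) U k : R := expR (- ((tau0 - lam * cl T t) * freq k)) * U k.

Variables (r : R) (N : R -> st -> st) (c tau0 lam T : R).
Hypotheses (hr : 5 / 2 < r) (c0 : 0 <= c) (qN : quad N c) (T0 : 0 <= T) (lam0 : 0 < lam).
Hypothesis tauT : lam * T <= tau0.

Local Notation ubt := (ub tau0 lam T).
Local Notation cT := (cl T).

Lemma tau_ge0 t : 0 <= tau0 - lam * cT t.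
Proof.
have /andP[_ h] := cl_itv t T0.
by rewrite subr_ge0 (le_trans _ tauT)// ler_wpM2l// ltW.
Qed.

Lemma e_le1 t k : expR (- ((tau0 - lam * cT t) * freq k)) <= 1.
Proof. by rewrite expR_le1 oppr_le0 mulr_ge0 ?tau_ge0 ?freq_ge0. Qed.

Lemma ub_le t U k : 0 <= U k -> ubt t U k <= U k.
Proof. by move=> U0; rewrite /ub ler_piMl// e_le1. Qed.

Lemma ub_ge0 t U k : 0 <= U k -> 0 <= ubt t U k.
Proof. by move=> U0; rewrite mulr_ge0// expR_ge0. Qed.

Lemma maj_small U a : 0 <= a -> maj r U a -> smallw U.
Proof. by move=> a0 mU; split; [case: mU|have [] := maj_l1 hr a0 mU]. Qed.

Lemma small_ub t U : smallw U -> smallw (ubt t U).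
Proof.
move=> [U0 sU]; split; first by move=> k; exact: ub_ge0.
apply: summ_le sU => k; rewrite ger0_norm ?mulr_ge0 ?freq_ge0 ?expR_ge0//.
by rewrite ler_wpM2l ?freq_ge0// ub_le.
Qed.

Lemma bdd_ub t u U : smallw U -> bdd u (ubt t U) -> bdd u U.
Proof. by move=> [U0 _] h i k; apply: (le_trans (h i k)); exact: ub_le. Qed.

(** The majorant produced by one time integration: the factor 1/(lam |k|) is the gain of
    [duhamel_int]. *)
Definition Mj (U V D : K -> R) k : R := if k == 0 then 0 else c / lam * ((Q U D k + Q D V k) / freq k).

Lemma ckl_ge0 : 0 <= c / lam * kap r.
Proof. by apply: mulr_ge0; [apply: divr_ge0 => //; exact: ltW|exact: kap_ge0]. Qed.

Lemma maj_Mj U V D a b d : 0 <= a -> 0 <= b -> 0 <= d -> maj r U a -> maj r V b -> maj r D d ->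
  maj r (Mj U V D) (c / lam * kap r * (a + b) * d).
Proof.
move=> a0 b0 d0 mU mV mD.
have k0 : 0 <= kap r :> R := kap_ge0 r.
have cl0 : 0 <= c / lam by rewrite divr_ge0// ltW.
have h1 := Q_est hr a0 d0 mU mD; have h2 := Q_est hr d0 b0 mD mV.
have n1 : 0 <= kap r * a * d by apply: mulr_ge0 => //; exact: mulr_ge0.
have n2 : 0 <= kap r * d * b by apply: mulr_ge0 => //; exact: mulr_ge0.
have := majZ cl0 (majD n1 n2 h1 h2).
have -> : c / lam * kap r * (a + b) * d = c / lam * (kap r * a * d + kap r * d * b) by ring.
apply: maj_le => k; rewrite /Mj; case: eqVneq => [_|kn0]; first by rewrite addr0 mulr0 lexx.
rewrite -mulrDl lexx andbT mulr_ge0// divr_ge0 ?freq_ge0// addr_ge0// Q_ge0//; by [case: mU|case: mV|case: mD].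
Qed.

Lemma lip_ub t u v U V D : smallw U -> smallw V -> smallw D ->
  bdd u (ubt t U) -> bdd v (ubt t V) -> bdd (sdiff u v) (ubt t D) ->
  forall s i k, `|N s u i k - N s v i k| <= expR (- ((tau0 - lam * cT t) * freq k)) * (c * (Q U D k + Q D V k)).
Proof.
move=> sU sV sD bu bv bd s i k.
apply: (le_trans (quad_lip qN s (small_ub t sU) (small_ub t sV) (small_ub t sD) bu bv bd i k)).
rewrite mulrCA ler_wpM2l// mulrDr lerD//; apply: Q_exp; rewrite ?tau_ge0//; by [case: sU|case: sV|case: sD].
Qed.

(** The Lipschitz bound keeps the exponential weight by [Q_exp], and integrating that weight in time
    turns c (Q U D + Q D V) into [Mj]. The weight is absorbed in [ub], hence the majorants stay
    independent of time. *)
Lemma duh_step (u v : R -> st) U V D : smallw U -> smallw V -> smallw D ->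
  (forall i k, continuous (fun t => u t i k)) -> (forall i k, continuous (fun t => v t i k)) ->
  (forall t, bdd (u t) (ubt t U)) -> (forall t, bdd (v t) (ubt t V)) -> 
  (forall t, bdd (sdiff (u t) (v t)) (ubt t D)) ->
  forall t i k, `|ig (fun s => N s (u s) i k) (cT t) - ig (fun s => N s (v s) i k) (cT t)| <= ubt t (Mj U V D) k.
Proof.
move=> sU sV sD cu cv bu bv bd t i k.
have cNu : continuous (fun s => N s (u s) i k).
  by apply: (quad_cts qN sU) => // s; apply: bdd_ub (bu s).
have cNv : continuous (fun s => N s (v s) i k).
  by apply: (quad_cts qN sV) => // s; apply: bdd_ub (bv s).
rewrite -igB// /ub /Mj; case: eqVneq => [->|k0].
  rewrite (@eq_ig _ _ (fun=> 0)); last by move=> s _; rewrite !(quad_k0 qN) subrr.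
  by rewrite /ig Rintegral_cst// mul0r normr0 mulr0.
have /andP[t0 tT] := cl_itv t T0.
have Q0 : 0 <= Q U D k + Q D V k.
  by rewrite addr_ge0// Q_ge0//; by [case: sU|case: sV|case: sD].
have := @duhamel_int _ (fun s => N s (u s) i k - N s (v s) i k) tau0 lam (freq k) (c * (Q U D k + Q D V k)) (cT t).
have -> : c * (Q U D k + Q D V k) / (lam * freq k) = c / lam * ((Q U D k + Q D V k) / freq k).
  by field; rewrite !gt_eqF// freq_gt0.
apply => //; [by move=> x; apply: cvgB; [exact: cNu|exact: cNv]|exact: freq_gt0|exact: mulr_ge0|].
move=> s /andP[s0 st]; have cs : cT s = s by apply: cl_id; rewrite s0 (le_trans st).
have := lip_ub sU sV sD (bu s) (bv s) (bd s) s i k; rewrite cs; exact.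
Qed.

Section Picard.
Variables (a : st) (A : K -> R) (alpha : R).
Hypotheses (al0 : 0 <= alpha) (mA : maj r A alpha) (bA : forall i k, `|a i k| <= expR (- (tau0 * freq k)) * A k).
Hypothesis small : 8 * c * kap r * alpha <= lam.

Fixpoint un (n : nat) : R -> st := if n is m.+1 then 
   (fun t i k => a i k + ig (fun s => N s (un m s) i k) (cT t)) else (fun=> a).

(** The predecessor of [un n], with zero before the first iterate, so that the increment at n = 0 is
    the datum itself. *)
Definition pn n : R -> st := if n is m.+1 then un m else (fun _ _ _ => 0).

(** Time-independent majorants of the n-th iterate (first component) and of its increment over the
    previous one (second component). *)
Fixpoint SD (n : nat) : (K -> R) * (K -> R) := if n is m.+1 then
  ((fun k => (SD m).1 k + Mj (SD m).1 (SD m).1 (SD m).2 k), Mj (SD m).1 (SD m).1 (SD m).2) else (A, A).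

(** As long as the iterates stay below 2 alpha, the increments are multiplied by at most (c / lam)
    kap (4 alpha) <= 1/2, which is exactly the hypothesis [small]; summing the geometric series
    keeps the iterates below 2 alpha. *)
Lemma SD_maj n : maj r (SD n).1 (2 * alpha - alpha / 2 ^+ n) /\ maj r (SD n).2 (alpha / 2 ^+ n).
Proof.
have h2 m : 0 <= alpha / 2 ^+ m by rewrite divr_ge0// exprn_ge0.
have h3 m : alpha / 2 ^+ m <= alpha.
  by rewrite ler_pdivrMr ?exprn_gt0// ler_peMr// exprn_ege1// ler1n.
elim: n => [|n [IH1 IH2]]; first by rewrite expr0 divr1; split=> //; rewrite (_ : _ - _ = alpha)//; lra.
have s0 : 0 <= 2 * alpha - alpha / 2 ^+ n by have := h3 n; have := al0; move: (_ / _) => x; lra.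
have E : alpha / 2 ^+ n.+1 = alpha / 2 ^+ n / 2 by rewrite exprSr invfM mulrA.
have M2 : maj r (Mj (SD n).1 (SD n).1 (SD n).2) (alpha / 2 ^+ n.+1).
  apply: majW (maj_Mj s0 s0 (h2 n) IH1 IH1 IH2).
    apply: mulr_ge0 => //; apply: mulr_ge0; last exact: addr_ge0.
    exact: ckl_ge0.
  rewrite E [leRHS]mulrC ler_wpM2r//.
  apply: (@le_trans _ _ (c / lam * kap r * (4 * alpha))).
    by rewrite ler_wpM2l ?ckl_ge0//; have := h2 n; have := al0; move: (_ / _) => x; lra.
  rewrite (_ : _ * _ = (8 * c * kap r * alpha) / (2 * lam)); last by field; rewrite gt_eqF.
  by rewrite ler_pdivrMr ?mulr_gt0//; have := small; lra.
split=> //=.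
have -> : 2 * alpha - alpha / 2 ^+ n.+1 = (2 * alpha - alpha / 2 ^+ n) + alpha / 2 ^+ n.+1 by rewrite E; move: (_ / _ ^+ _) => x; lra.
by apply: majD.
Qed.

Lemma S_maj n : maj r (SD n).1 (2 * alpha).
Proof.
have [h _] := SD_maj n; apply: majW h; last by rewrite lerBlDr lerDl divr_ge0// exprn_ge0.
have : alpha / 2 ^+ n <= alpha by rewrite ler_pdivrMr ?exprn_gt0// ler_peMr// exprn_ege1// ler1n.
by have := al0; move: (_ / _) => x; lra.
Qed.

Lemma al2 : 0 <= 2 * alpha. Proof. by rewrite mulr_ge0. Qed.

Lemma S_small n : smallw (SD n).1. Proof. exact: maj_small al2 (S_maj n). Qed.
Lemma D_small n : smallw (SD n).2.
Proof. by apply: (@maj_small _ (alpha / 2 ^+ n)); [rewrite divr_ge0// exprn_ge0|case: (SD_maj n)]. Qed.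

Lemma un_inv n : [/\ forall i k, continuous (fun t => un n t i k),
   forall i k, continuous (fun t => pn n t i k),
   forall t, bdd (un n t) (ubt t (SD n).1), forall t, bdd (pn n t) (ubt t (SD n).1) &
   forall t, bdd (sdiff (un n t) (pn n t)) (ubt t (SD n).2)].
Proof.
have A0 k : 0 <= A k by case: mA.
have eA t k : expR (- (tau0 * freq k)) * A k <= ubt t A k.
  rewrite ler_wpM2r// ler_expR lerN2 ler_wpM2r ?freq_ge0// lerBlDr lerDl.
  by apply: mulr_ge0; [exact: ltW|case/andP: (cl_itv t T0)].
have ci n' : (forall i k, continuous (fun t => un n' t i k)) -> (forall t, bdd (un n' t) (ubt t (SD n').1)) ->
    forall i k, continuous (fun s => N s (un n' s) i k).
  move=> h1 h2 i k; apply: (quad_cts qN (S_small n')) => // t; exact: bdd_ub (S_small n') (h2 t).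
elim: n => [|n [c1 c2 b1 b2 b3]] /=.
  split; [move=> *; exact: cst_continuous|move=> *; exact: cst_continuous| | |].
  - by move=> t i k; apply: (le_trans (bA i k)).
  - by move=> t i k; rewrite normr0 ub_ge0.
  - by move=> t i k; rewrite /sdiff subr0; apply: (le_trans (bA i k)).
have cN := ci _ c1 b1.
have Sn := S_small n; have Dn := D_small n.
have D' : forall t, bdd (sdiff (un n.+1 t) (un n t)) (ubt t (Mj (SD n).1 (SD n).1 (SD n).2)).
  move=> t i k; have := duh_step Sn Sn Dn c1 c2 b1 b2 b3 t i k.
  rewrite /sdiff; case: (n) => [|m] /=; last by rewrite opprD addrACA subrr add0r.
  rewrite [X in _ - X](@eq_ig _ _ (fun=> 0)); last by move=> s _; rewrite (quad_0 qN).
  by rewrite /ig [X in _ - X]Rintegral_cst// mul0r subr0 [a i k + _]addrC addrK.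
have S' k : ubt^~ (fun k => (SD n).1 k + Mj (SD n).1 (SD n).1 (SD n).2 k) ^~ k =1 (fun t => ubt t (SD n).1 k + ubt t (Mj (SD n).1 (SD n).1 (SD n).2) k).
  by move=> t; rewrite /ub mulrDr.
have M0 k : 0 <= Mj (SD n).1 (SD n).1 (SD n).2 k by case: (D_small n.+1) => h _; exact: h.
split=> //.
- by move=> i k t; apply: cvgD; [exact: cvg_cst|apply: ig_cl_cts].
- move=> t i k; rewrite S'.
  have -> : a i k + ig (fun s => N s (un n s) i k) (cT t) = un n t i k + sdiff (un n.+1 t) (un n t) i k by rewrite /sdiff /= addrCA subrr addr0.
  by apply: (le_trans (ler_normD _ _)); apply: lerD; [exact: b1|exact: D'].
- move=> t i k; rewrite S'; apply: (le_trans (b1 t i k)); rewrite lerDl; exact: ub_ge0.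
Qed.

Lemma D_pt n k : Mj (SD n).1 (SD n).1 (SD n).2 k <= alpha / 2 ^+ n.+1.
Proof.
have [-> |k0] := eqVneq k 0; first by rewrite /Mj eqxx divr_ge0// exprn_ge0.
have [_ h] := SD_maj n.+1; apply: (maj_pt _ _ h) => //; [by have := hr; lra|by rewrite divr_ge0// exprn_ge0].
Qed.

Definition u_lim t : st := fun i k => limn (fun n => un n t i k).
Definition S_lim k : R := limn (fun n => (SD n).1 k).

Lemma S_cvg k : (SD n).1 k @[n --> \oo] --> S_lim k /\ forall n, `|S_lim k - (SD n).1 k| <= alpha / 2 ^+ n.
Proof.
apply: geom_cvg => // n /=; rewrite addrAC subrr add0r.
rewrite ger0_norm; first exact: D_pt.
by case: (D_small n.+1) => h _; exact: h.
Qed.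

Lemma un_step n t i k : `|un n.+1 t i k - un n t i k| <= ubt t (SD n.+1).2 k.
Proof. by have [_ _ _ _ h] := un_inv n.+1; exact: h. Qed.

Lemma un_dist n m t i k : (n <= m)%N -> `|un m t i k - un n t i k| <= ubt t (fun k => (SD m).1 k - (SD n).1 k) k.
Proof.
move=> /subnK <-; elim: (m - n)%N => [|j IH]; first by rewrite add0n !subrr normr0 ub_ge0// subrr.
rewrite addSn.
have -> : un (j + n).+1 t i k - un n t i k = (un (j + n).+1 t i k - un (j + n)%N t i k) + (un (j + n)%N t i k - un n t i k) by rewrite addrA subrK.
apply: (le_trans (ler_normD _ _)); apply: (le_trans (lerD (un_step _ _ _ _) IH)).
by rewrite /ub -mulrDr /= addrA [Mj _ _ _ k + _]addrC.
Qed.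

Lemma u_cvg t i k : un n t i k @[n --> \oo] --> u_lim t i k /\ forall n, `|u_lim t i k - un n t i k| <= alpha / 2 ^+ n.
Proof.
apply: geom_cvg => // n; apply: (le_trans (un_step n t i k)).
apply: le_trans (D_pt n k); apply: ub_le; by case: (D_small n.+1) => h _; exact: h.
Qed.

Lemma S_le n m k : (n <= m)%N -> (SD n).1 k <= (SD m).1 k.
Proof.
move=> /subnK <-; elim: (m - n)%N => [|j IH] //; rewrite addSn; apply: (le_trans IH) => /=.
by rewrite lerDl; case: (D_small (j + n).+1) => h _; exact: h.
Qed.

Lemma S_le_lim n k : (SD n).1 k <= S_lim k.
Proof.
apply: (@closed_cvg _ _ \oo _ (fun m => (SD m).1 k) (fun y => (SD n).1 k <= y)).
- exact: closed_ge.
- by exists n => // m /= nm; exact: S_le.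
- by case: (S_cvg k).
Qed.

Lemma S_lim_maj : maj r S_lim (2 * alpha).
Proof.
apply: (@maj_lim _ _ (fun n => (SD n).1)); first by apply: nearW => n; exact: S_maj.
by move=> k; case: (S_cvg k).
Qed.

Lemma SmS_maj n m : (n <= m)%N -> maj r (fun k => (SD m).1 k - (SD n).1 k) (alpha / 2 ^+ n - alpha / 2 ^+ m).
Proof.
have h2 j : 0 <= alpha / 2 ^+ j by rewrite divr_ge0// exprn_ge0.
have E j : alpha / 2 ^+ j.+1 = alpha / 2 ^+ j / 2 by rewrite exprSr invfM mulrA.
have mono i j : (i <= j)%N -> alpha / 2 ^+ j <= alpha / 2 ^+ i.
  move=> /subnK <-; elim: (j - i)%N => [//|p IH]; rewrite addSn E.
  by apply: le_trans IH; have := h2 (p + i)%N; move: (_ / _) => x; lra.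
move=> nm; move: (nm) => /subnK <-; elim: (m - n)%N => [|j IH].
  rewrite add0n; under eq_fun do rewrite subrr; rewrite subrr.
  by split=> //; [under eq_fun do rewrite mulr0 expr0n; exact: summ0|under eq_sm do rewrite mulr0 expr0n; rewrite sm0 expr0n].
rewrite addSn; have [_ h] := SD_maj (j + n).+1.
have n0 : 0 <= alpha / 2 ^+ n - alpha / 2 ^+ (j + n) by rewrite subr_ge0 mono// leq_addl.
have := majD n0 (h2 _) IH h; rewrite E => hh.
have -> : alpha / 2 ^+ n - alpha / 2 ^+ (j + n) / 2 = alpha / 2 ^+ n - alpha / 2 ^+ (j + n) + alpha / 2 ^+ (j + n) / 2.
  by move: (_ / _ ^+ (j + n)) => x; move: (_ / _ ^+ n) => y; lra.
apply: maj_le hh => k /=; rewrite addrAC lexx andbT addr_ge0//.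
  by rewrite subr_ge0 S_le// leq_addl.
by case: (D_small (j + n).+1) => hh _; exact: hh.
Qed.

(** The remainder of the majorant series is small in the weighted norm and not only at each
    frequency; this is what allows the Picard map to be applied to the difference between the limit
    and an iterate. *)
Lemma SlimS_maj n : maj r (fun k => S_lim k - (SD n).1 k) (alpha / 2 ^+ n).
Proof.
have h2 j : 0 <= alpha / 2 ^+ j by rewrite divr_ge0// exprn_ge0.
apply: (@maj_lim _ _ (fun m k => (SD m).1 k - (SD n).1 k)).
  exists n => // m /= nm; apply: majW (SmS_maj nm); last by rewrite lerBlDr lerDl.
  rewrite subr_ge0 ler_wpM2l// lef_pV2 ?posrE ?exprn_gt0// ler_weXn2l// ler1n//.
by move=> k; apply: cvgB; [case: (S_cvg k)|exact: cvg_cst].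
Qed.

Lemma u_lim_cts i k : continuous (fun t => u_lim t i k).
Proof.
move=> t; apply/cvgrPdist_le => e e0.
have e3 : 0 < e / 3 by rewrite divr_gt0.
have /cvgrPdist_lt/(_ _ e3)[n _ /(_ n (leqnn n))] := geom0 alpha.
rewrite sub0r normrN ger0_norm ?divr_ge0 ?exprn_ge0// => hn.
have [c1 _ _ _ _] := un_inv n.
have /cvgrPdist_le/(_ _ e3) := c1 i k t; apply: filterS => s hs.
have [_ /(_ n) h1] := u_cvg t i k; have [_ /(_ n) h2] := u_cvg s i k.
have -> : u_lim t i k - u_lim s i k = (u_lim t i k - un n t i k) + (un n t i k - un n s i k) - (u_lim s i k - un n s i k) by lra.
apply: (le_trans (ler_normB _ _)); apply: (@le_trans _ _ (e / 3 + e / 3 + e / 3)); last lra.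
apply: lerD; last exact: le_trans h2 (ltW hn).
by apply: (le_trans (ler_normD _ _)); apply: lerD => //; exact: le_trans h1 (ltW hn).
Qed.

Lemma u_lim_bdd t : bdd (u_lim t) (ubt t S_lim).
Proof.
move=> i k; apply: (@closed_cvg _ _ \oo _ (fun n => `|un n t i k|) (fun y => y <= ubt t S_lim k)).
- exact: closed_le.
- apply: nearW => n; have [_ _ h _ _] := un_inv n; apply: (le_trans (h t i k)).
  by rewrite ler_wpM2l ?expR_ge0// S_le_lim.
- by apply: cvg_norm; case: (u_cvg t i k).
Qed.

Lemma u_lim_dist n t : bdd (sdiff (u_lim t) (un n t)) (ubt t (fun k => S_lim k - (SD n).1 k)).
Proof.
move=> i k; apply: (@closed_cvg _ _ \oo _ (fun m => `|un m t i k - un n t i k|) (fun y => y <= ubt t (fun k => S_lim k - (SD n).1 k) k)).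
- exact: closed_le.
- exists n => // m /= nm; apply: (le_trans (un_dist t i k nm)).
  by rewrite ler_wpM2l ?expR_ge0// lerB// S_le_lim.
- by apply: cvg_norm; apply: cvgB; [case: (u_cvg t i k)|exact: cvg_cst].
Qed.

(** The right-hand side and [un n.+1] are the images under the Picard map of the limit and of
    [un n], hence at distance at most alpha / 2^n by [duh_step]; and [un n.+1] tends to the
    left-hand side. *)
Lemma u_lim_eq t i k : u_lim t i k = a i k + ig (fun s => N s (u_lim s) i k) (cT t).
Proof.
have S1 := maj_small al2 S_lim_maj.
have h2 j : 0 <= alpha / 2 ^+ j by rewrite divr_ge0// exprn_ge0.
set g := ig _ _.
have H n : `|un n.+1 t i k - (a i k + g)| <= (alpha / 2 ^+ n).
  have [c1 _ b1 _ _] := un_inv n; have hD := SlimS_maj n.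
  have sD := maj_small (h2 n) hD.
  have b1' s : bdd (un n s) (ubt s S_lim).
    by move=> i' k'; apply: (le_trans (b1 s i' k')); rewrite ler_wpM2l ?expR_ge0// S_le_lim.
  have := duh_step S1 S1 sD u_lim_cts c1 u_lim_bdd b1' (u_lim_dist n) t i k.
  rewrite distrC => h.
  have -> : un n.+1 t i k - (a i k + g) = ig (fun s => N s (un n s) i k) (cT t) - g.
    by rewrite /= opprD addrACA subrr add0r.
  apply: (le_trans h).
  have hM := maj_Mj al2 al2 (h2 n) S_lim_maj S_lim_maj hD.
  have M0 : 0 <= Mj S_lim S_lim (fun k => S_lim k - (SD n).1 k) k by case: hM => hM _ _; exact: hM.
  apply: (le_trans (ub_le t M0)).
  have [->|k0] := eqVneq k 0; first by rewrite /Mj eqxx.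
  have C0 : 0 <= c / lam * kap r * (2 * alpha + 2 * alpha) * (alpha / 2 ^+ n).
    by apply: mulr_ge0 => //; apply: mulr_ge0; [exact: ckl_ge0|apply: addr_ge0; exact: al2].
  have r0 : 0 <= r by have := hr; lra.
  apply: (le_trans (maj_pt r0 C0 hM k0)); rewrite ler_piMl//.
  rewrite (_ : _ * _ = (8 * c * kap r * alpha) / (2 * lam)); last by field; rewrite gt_eqF.
  by rewrite ler_pdivrMr ?mulr_gt0//; have := small; have := lam0; lra.
apply/eqP; rewrite -subr_eq0 -normr_le0; apply/ler_addgt0Pl => e e0; rewrite addr0.
have e2 : 0 < e / 3 by rewrite divr_gt0.
have /cvgrPdist_lt/(_ _ e2)[n _ /(_ n (leqnn n))] := geom0 alpha.
rewrite sub0r normrN ger0_norm// => hn.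
have [_ /(_ n.+1) h1] := u_cvg t i k.
have h1' : alpha / 2 ^+ n.+1 <= alpha / 2 ^+ n.
  by rewrite ler_wpM2l// lef_pV2 ?posrE ?exprn_gt0// ler_weXn2l// ler1n.
have -> : u_lim t i k - (a i k + g) = (u_lim t i k - un n.+1 t i k) + (un n.+1 t i k - (a i k + g)) by rewrite addrA subrK.
apply: (le_trans (ler_normD _ _)); apply: (le_trans (lerD h1 (H n))).
by move: hn h1'; move: (_ / _ ^+ n) => x; move: (_ / _ ^+ _) => y; lra.
Qed.

(** A linear functional involving at most two coefficients; this shape is general enough to express
    reality, evenness, zero divergence and the vanishing of a coefficient. *)
Definition ev2 (l : R * (I * K) * (R * (I * K))) (u : st) : R :=
  l.1.1 * u l.1.2.1 l.1.2.2 + l.2.1 * u l.2.2.1 l.2.2.2.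

(** Finite linear relations commute with the time integral and with the pointwise limit, so it is
    enough that the datum satisfies them and that N preserves them. *)
Lemma u_lim_inv (L : set (R * (I * K) * (R * (I * K)))) :
  (forall t u U, smallw U -> bdd u U -> (forall l, L l -> ev2 l u = 0) -> forall l, L l -> ev2 l (N t u) = 0) ->
  (forall l, L l -> ev2 l a = 0) -> forall t l, L l -> ev2 l (u_lim t) = 0.
Proof.
move=> LN La t l Ll.
have H n s l' : L l' -> ev2 l' (un n s) = 0.
  elim: n s l' => [|n IH] s l' Ll' /=; first exact: La.
  have [c1 _ b1 _ _] := un_inv n.
  have cN i k : continuous (fun s => N s (un n s) i k).
    by apply: (quad_cts qN (S_small n)) => // s'; apply: bdd_ub (b1 s'); exact: S_small.
  rewrite /ev2 !mulrDr addrACA [X in X + _]La// add0r -!igZ// -igD; last 2 first.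
  - by move=> x; apply: cvgM; [exact: cvg_cst|exact: cN].
  - by move=> x; apply: cvgM; [exact: cvg_cst|exact: cN].
  rewrite (@eq_ig _ _ (fun=> 0)); first by rewrite /ig Rintegral_cst// mul0r.
  move=> s' _; apply: (LN s' (un n s') _ (S_small n)) => //; last by move=> *; exact: IH.
  by apply: bdd_ub (b1 s'); exact: S_small.
apply: (@closed_cvg _ _ \oo _ (fun n => ev2 l (un n t)) (fun y => y = 0)).
- exact: closed_eq.
- by apply: nearW => n; exact: H.
- by apply: cvgD; apply: cvgMr; [case: (u_cvg t l.1.2.1 l.1.2.2)|case: (u_cvg t l.2.2.1 l.2.2.2)].
Qed.

End Picard.
End Evolution.


(** * Uniqueness of exponentially decaying solutions of the quadratic system *)

Section Uniqueness.
Context {R : realType} {I : finType}.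
Local Notation K := (int * int * int)%type.
Local Notation freq := (@freq R).
Local Notation st := (I -> K -> R).
Variables (r : R) (N : R -> st -> st) (c T : R).
Hypotheses (hr : 5 / 2 < r) (c0 : 0 <= c) (qN : quad N c) (T0 : 0 <= T).
Local Notation cT := (cl T).

Variables (a : st) (u v : R -> st) (W : K -> R) (s0 w : R).
Hypotheses (s00 : 0 < s0) (w0 : 0 <= w) (mW : maj r W w).
Hypothesis cu : forall i k, continuous (fun t => u t i k).
Hypothesis cv : forall i k, continuous (fun t => v t i k).
Hypothesis bu : forall t, bdd (u t) (fun k => expR (- (s0 * freq k)) * W k).
Hypothesis bv : forall t, bdd (v t) (fun k => expR (- (s0 * freq k)) * W k).
Hypothesis eu : forall t i k, u t i k = a i k + ig (fun s => N s (u s) i k) (cT t).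
Hypothesis ev : forall t i k, v t i k = a i k + ig (fun s => N s (v s) i k) (cT t).

Let sW : smallw W := maj_small hr w0 mW.
(** The first term makes the map [Mu] shrink norms by a factor 4; the summand 1 keeps the rate
    positive when w = 0. *)
Let Lam : R := 8 * c * kap r * w + 1.

Let Lam0 : 0 < Lam.
Proof.
by rewrite /Lam ltr_wpDl//; apply: mulr_ge0 => //; apply: mulr_ge0; [exact: mulr_ge0|exact: kap_ge0].
Qed.

Let eW k : expR (- (s0 * freq k)) * W k <= W k.
Proof. by case: sW => W0 _; rewrite ler_piMl// expR_le1 oppr_le0 mulr_ge0 ?freq_ge0// ltW. Qed.

Let cN (x : R -> st) : (forall i k, continuous (fun t => x t i k)) -> 
  (forall t, bdd (x t) (fun k => expR (- (s0 * freq k)) * W k)) -> forall i k, continuous (fun s => N s (x s) i k).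
Proof.
move=> cx bx; apply: (quad_cts qN sW) => // t i k; exact: le_trans (bx t i k) (eW k).
Qed.

Let k0_eq t i : u t i 0 = v t i 0.
Proof. by rewrite eu ev; congr (_ + _); apply: eq_ig => s _; rewrite !(quad_k0 qN). Qed.

Definition Mu (D : K -> R) k : R := if k == 0 then 0 else c * (Q W D k + Q D W k) / (Lam * freq k).

Let maj_Mu D d : 0 <= d -> maj r D d -> maj r (Mu D) (d / 4).
Proof.
move=> d0 mD.
have cl0 : 0 <= c / Lam by rewrite divr_ge0// ltW.
have h1 := Q_est hr w0 d0 mW mD; have h2 := Q_est hr d0 w0 mD mW.
have n1 : 0 <= kap r * w * d by apply: mulr_ge0 => //; apply: mulr_ge0 => //; exact: kap_ge0.
have n2 : 0 <= kap r * d * w by apply: mulr_ge0 => //; apply: mulr_ge0 => //; exact: kap_ge0.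
have := majZ cl0 (majD n1 n2 h1 h2) => h.
have {h} : maj r (Mu D) (c / Lam * (kap r * w * d + kap r * d * w)).
  apply: maj_le h => k; rewrite /Mu; case: eqVneq => [_|kn0]; first by rewrite addr0 mulr0 lexx.
  have fk : freq k != 0 by rewrite gt_eqF// freq_gt0.
  have -> : c * (Q W D k + Q D W k) / (Lam * freq k) = c / Lam * (Q W D k / freq k + Q D W k / freq k).
    by field; rewrite fk gt_eqF.
  rewrite lexx andbT mulr_ge0// addr_ge0// divr_ge0 ?freq_ge0// Q_ge0//; by [case: mW|case: mD].
apply: majW; first by apply: mulr_ge0 => //; exact: addr_ge0.
rewrite mulrAC ler_pdivrMr// /Lam.
have -> : c * (kap r * w * d + kap r * d * w) = (8 * c * kap r * w) * (d / 4) by field.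
by rewrite mulrC ler_wpM2l ?divr_ge0// lerDl.
Qed.

(** Both solutions decay at the fixed rate s0. On a further interval of length s0 / (2 Lam) this
    reserve is spent on an artificially shrinking radius, in whose weight the Picard map contracts;
    iterating the contraction on the difference forces it to vanish. *)
Let step s1 : 0 <= s1 -> (forall t, t <= s1 -> u t = v t) -> 
  forall t, t <= s1 + s0 / (2 * Lam) -> u t = v t.
Proof.
move=> s10 uv t0 tt0; have W0 k : 0 <= W k by case: sW.
(* The artificial radius: s0 / 2 at time s1, decreasing at rate Lam down to 0 at T1. *)
pose sig t : R := s0 / 2 + Lam * s1 - Lam * t.
pose T1 := s1 + s0 / (2 * Lam).
have sig_itv t : s1 <= t <= T1 -> 0 <= sig t <= s0.
  move=> /andP[h1 h2]; have := ler_wpM2l (ltW Lam0) h1; have := ler_wpM2l (ltW Lam0) h2.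
  rewrite /T1 mulrDr (_ : Lam * (s0 / (2 * Lam)) = s0 / 2); last by field; rewrite gt_eqF.
  by have := s00; rewrite /sig => h3 h4 h5; apply/andP; split; lra.
have bW t (x : st) : s1 <= t <= T1 -> bdd x (fun k => expR (- (s0 * freq k)) * W k) -> 
    bdd x (fun k => expR (- (sig t * freq k)) * W k).
  move=> /sig_itv /andP[h1 h2] bx i k; apply: (le_trans (bx i k)).
  by rewrite ler_wpM2r// ler_expR lerN2 ler_wpM2r ?freq_ge0.
(* Successive majorants of u - v: the crude bound 2 W at the start, a norm divided by 4 at each
   stage. *)
pose D := fix D (n : nat) := if n is m.+1 then Mu (D m) else (fun k => 2 * W k).
have mD n : maj r (D n) (2 * w / 4 ^+ n).
  elim: n => [|n IH]; first by rewrite expr0 divr1; exact: majZ.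
  have n0 : 0 <= 2 * w / 4 ^+ n by rewrite divr_ge0 ?exprn_ge0// mulr_ge0.
  have := maj_Mu n0 IH; rewrite (_ : 2 * w / 4 ^+ n / 4 = 2 * w / 4 ^+ n.+1)//.
  by rewrite exprSr invfM mulrA.
have d0 n : 0 <= 2 * w / 4 ^+ n by rewrite divr_ge0 ?exprn_ge0// mulr_ge0.
have sD n := maj_small hr (d0 n) (mD n).
have H n t : s1 <= t <= T1 -> forall i k, `|u t i k - v t i k| <= expR (- (sig t * freq k)) * D n k.
  elim: n t => [|n IH] t tT i k /=.
    rewrite mulrCA mulr_natl mulr2n; apply: (le_trans (ler_normB _ _)); apply: lerD; exact: bW.
  have [->|k0] := eqVneq k 0; first by rewrite k0_eq subrr normr0 /Mu eqxx mulr0.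
  have fk : 0 < freq k := freq_gt0 k0.
  rewrite eu ev opprD addrACA subrr add0r -igB; [|exact: cN|exact: cN].
  have /andP[ct0 ctT] := cl_itv t T0.
  have Q0 : 0 <= Q W (D n) k + Q (D n) W k.
    by rewrite addr_ge0// Q_ge0//; case: (sD n).
  (* Before s1 the solutions agree and the integrand is zero, so the bound holds there too, even
     where the formula for the radius exceeds s0. *)
  have P : forall s, 0 <= s -> s <= T1 -> `|N s (u s) i k - N s (v s) i k| <= 
       expR (- ((s0 / 2 + Lam * s1 - Lam * s) * freq k)) * (c * (Q W (D n) k + Q (D n) W k)).
    move=> s s_0 sT1; case: (leP s s1) => ss1.
      by rewrite uv// subrr normr0 !mulr_ge0 ?expR_ge0.
    have ss : s1 <= s <= T1 by rewrite (ltW ss1).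
    have sg0 : 0 <= sig s by case/andP: (sig_itv _ ss).
    have sE X : smallw X -> smallw (fun k => expR (- (sig s * freq k)) * X k).
      move=> [X0 sX]; split; first by move=> l; rewrite mulr_ge0 ?expR_ge0.
      apply: summ_le sX => l; rewrite ger0_norm ?mulr_ge0 ?freq_ge0 ?expR_ge0//.
      rewrite ler_wpM2l ?freq_ge0// ler_piMl// expR_le1 oppr_le0 mulr_ge0 ?freq_ge0//.
    have := quad_lip qN s (sE _ sW) (sE _ sW) (sE _ (sD n)) (bW _ _ ss (@bu s)) (bW _ _ ss (@bv s)) (IH s ss) i k.
    move=> h; apply: (le_trans h); rewrite mulrCA ler_wpM2l// mulrDr lerD//; apply: Q_exp => //; by [case: sW|case: (sD n)].
  have tcl : cT t <= t.
    rewrite /cl ge_max ge_min lexx andbT; case/andP: tT => h _; exact: le_trans h.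
  have ctT1 : cT t <= T1 by apply: (le_trans tcl); case/andP: tT.
  have ch : continuous (fun s => N s (u s) i k - N s (v s) i k).
    by move=> x; apply: cvgB; exact: cN.
  have := @duhamel_int _ (fun s => N s (u s) i k - N s (v s) i k) (s0 / 2 + Lam * s1) Lam (freq k) 
     (c * (Q W (D n) k + Q (D n) W k)) (cT t) ch Lam0 fk (mulr_ge0 c0 Q0) ct0 _.
  have hh : forall s : R, 0 <= s <= cT t -> `|N s (u s) i k - N s (v s) i k| <= 
       expR (- ((s0 / 2 + Lam * s1 - Lam * s) * freq k)) * (c * (Q W (D n) k + Q (D n) W k)).
    by move=> s /andP[h1 h2]; apply: P => //; exact: le_trans h2 ctT1.
  move=> /(_ hh) h; apply: (le_trans h); rewrite /Mu (negbTE k0) ler_wpM2r//.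
    by rewrite divr_ge0 ?mulr_ge0// ltW// mulr_gt0.
  rewrite ler_expR lerN2 ler_wpM2r ?freq_ge0// /sig lerD2l lerN2 ler_wpM2l// ltW//.
have [ts1|s1t] := leP t0 s1; first exact: uv.
have ss : s1 <= t0 <= T1 by rewrite (ltW s1t).
apply/funext => i; apply/funext => k; apply/eqP; rewrite -subr_eq0 -normr_le0.
have [->|k0] := eqVneq k 0; first by rewrite k0_eq subrr normr0.
apply/ler_addgt0Pl => e e0; rewrite addr0.
have h4 : 2 * w / 4 ^+ n @[n --> \oo] --> (0 : R).
  rewrite -(mulr0 (2 * w)); apply: cvgMr; under eq_fun do rewrite -exprVn; apply: cvg_expr.
  by rewrite ger0_norm ?invr_ge0// invf_lt1// ltr1n.
have /cvgrPdist_lt/(_ _ e0)[n _ /(_ n (leqnn n))] := h4.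
rewrite sub0r normrN ger0_norm// => hn.
have r0 : 0 <= r by have := hr; lra.
apply: (le_trans (H n t0 ss i k)); apply: le_trans (ltW hn); apply: le_trans (maj_pt r0 (d0 n) (mD n) k0).
rewrite ler_piMl//; first by case: (mD n).
by rewrite expR_le1 oppr_le0 mulr_ge0 ?freq_ge0//; case/andP: (sig_itv _ ss).
Qed.

(** The length of the step depends only on s0 and w, so finitely many steps reach any time; the
    start is t <= 0, where clamping reduces both sides to the datum [a]. *)
Lemma quad_unique t : u t = v t.
Proof.
have H n : forall s, s <= n%:R * (s0 / (2 * Lam)) -> u s = v s.
  elim: n => [|n IH] s; last first.
    by rewrite -natr1 mulrDl mul1r; apply: step => //; rewrite mulr_ge0// divr_ge0// ltW// mulr_gt0.
  rewrite mul0r => sl0; apply/funext => i; apply/funext => k; rewrite eu ev.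
  have -> : cT s = 0 by rewrite /cl; apply/max_idPl; rewrite ge_min sl0.
  by rewrite !ig0.
have p : 0 < s0 / (2 * Lam) by rewrite divr_gt0// mulr_gt0.
have [tn|t_p] := leP t 0; first by apply: (H 0%N); rewrite mul0r.
have /archi_boundP := ltW (divr_gt0 t_p p); set n := Num.bound _ => hn.
by apply: (H n); rewrite -ler_pdivrMr// ltW.
Qed.
End Uniqueness.

(** * Weighted energy estimate for the difference of two solutions *)

Section Energy.
Context {R : realType} {I : finType}.
Local Notation K := (int * int * int)%type.
Local Notation freq := (@freq R).
Local Notation st := (I -> K -> R).

Lemma is_derive_bigsum (T : Type) (s : seq T) (f : T -> R -> R) (df : T -> R) (x : R) :
  (forall k, is_derive x 1 (f k) (df k)) -> is_derive x 1 (fun t => \sum_(k <- s) f k t) (\sum_(k <- s) df k).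
Proof.
move=> h; elim: s => [|k s IH].
  by under eq_fun do rewrite big_nil; rewrite big_nil; exact: is_derive_cst.
have -> : (fun t => \sum_(k0 <- k :: s) f k0 t) = (f k + (fun t => \sum_(k0 <- s) f k0 t)).
  by apply/funext => t; rewrite big_cons.
by rewrite big_cons; have h1 := h k; exact: is_deriveD.
Qed.

Lemma cts_bigsum (X : topologicalType) (T : Type) (s : seq T) (f : T -> X -> R) :
  (forall k, continuous (f k)) -> continuous (fun t => \sum_(k <- s) f k t).
Proof.
move=> h; elim: s => [|k s IH] x.
  by under eq_fun do rewrite big_nil; exact: cvg_cst.
by under eq_fun do rewrite big_cons; apply: cvgD; [exact: h|exact: IH].
Qed.

Variables (r : R) (N : R -> st -> st) (c tau0 mu T : R).
Hypotheses (hr : 5 / 2 < r) (c0 : 0 <= c) (qN : quad N c) (T0 : 0 <= T) (mu0 : 0 < mu).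
Hypothesis tauT : mu * T <= tau0.
Local Notation cT := (cl T).
Local Notation ubt := (ub tau0 mu T).
Variables (a b : st) (u v : R -> st) (U V : K -> R) (al be : R).
Hypotheses (al0 : 0 <= al) (be0 : 0 <= be) (mU : maj r U al) (mV : maj r V be).
Hypothesis cu : forall i k, continuous (fun t => u t i k).
Hypothesis cv : forall i k, continuous (fun t => v t i k).
Hypothesis bu : forall t, bdd (u t) (ubt t U).
Hypothesis bv : forall t, bdd (v t) (ubt t V).
Hypothesis eu : forall t i k, u t i k = a i k + ig (fun s => N s (u s) i k) (cT t).
Hypothesis ev : forall t i k, v t i k = b i k + ig (fun s => N s (v s) i k) (cT t).
Hypothesis ab0 : forall i, a i 0 = b i 0.
Hypothesis mu_large : 2 * #|I|%:R * c * kap r * (al + be) <= mu.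

Definition dsq (t : R) k : R := \sum_i (u t i k - v t i k) ^+ 2.
Definition wt (t : R) k : R := 1 + freq k `^ (2 * (r - 2^-1)) * expR (2 * (tau0 - mu * t) * freq k).

Let sU := maj_small hr al0 mU.
Let sV := maj_small hr be0 mV.

Let dsq_ge0 t k : 0 <= dsq t k. Proof. by apply: sumr_ge0 => i _; exact: sqr_ge0. Qed.

Let dsq0 t : dsq t 0 = 0.
Proof.
rewrite /dsq big1// => i _; rewrite eu ev ab0 opprD addrACA subrr add0r.
rewrite (@eq_ig _ _ (fun=> 0)); last by move=> s _; rewrite (quad_k0 qN).
rewrite [X in _ - X](@eq_ig _ _ (fun=> 0)); last by move=> s _; rewrite (quad_k0 qN).
by rewrite subrr expr0n.
Qed.

Let e1 t k : 0 <= t <= T -> expR (- ((tau0 - mu * t) * freq k)) * expR ((tau0 - mu * t) * freq k) = 1.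
Proof. by move=> _; rewrite expRN mulVf// gt_eqF// expR_gt0. Qed.

(** The difference is its own majorant: with D = [Dd t] the Lipschitz bound becomes a quadratic
    inequality in the difference itself. *)
Let Dd t k := expR ((tau0 - mu * t) * freq k) * Num.sqrt (dsq t k).

(** Differentiating the weight |k|^(2r-1) e^(2 tau |k|) in time brings down -2 mu |k|, so the
    dissipation is exactly -2 mu Y^2. This half power explains why the energy is taken at order r -
    1/2: its dissipation has the order r at which [Q_est] is available. *)
Let Y t k := freq k `^ r * Dd t k.
(** A bound of [Dd] independent of time, needed to make the tails small uniformly in time. *)
Let G k := #|I|%:R * (U k + V k).

Let mG : maj r G (#|I|%:R * (al + be)).
Proof. by apply: majZ => //; exact: majD. Qed.

Let DdG t k : 0 <= t <= T -> 0 <= Dd t k <= G k.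
Proof.
move=> tT; rewrite mulr_ge0 ?expR_ge0 ?sqrtr_ge0//=.
have ct : cT t = t by exact: cl_id.
have h i : `|u t i k - v t i k| <= expR (- ((tau0 - mu * t) * freq k)) * (U k + V k).
  rewrite mulrDr; apply: (le_trans (ler_normB _ _)).
  by have := bu t i k; have := bv t i k; rewrite /ub ct => h1 h2; exact: lerD.
have UV0 : 0 <= U k + V k by case: sU => h1 _; case: sV => h2 _; rewrite addr_ge0.
have E0 := mulr_ge0 (expR_ge0 (- ((tau0 - mu * t) * freq k))) UV0.
rewrite -(@ler_pM2l _ (expR (- ((tau0 - mu * t) * freq k)))) ?expR_gt0// mulrA e1// mul1r.
rewrite /G mulrCA -(ler_pXn2r (n := 2))// ?nnegrE ?sqrtr_ge0 ?mulr_ge0//.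
rewrite sqr_sqrtr// exprMn; set z := _ * (U k + V k) in h E0 *.
apply: (@le_trans _ _ (\sum_(i : I) z ^+ 2)).
  apply: ler_sum => i _; rewrite -real_normK ?num_real// ler_pXn2r ?nnegrE//; exact: h.
rewrite sumr_const -[leLHS]mulr_natl ler_wpM2r ?sqr_ge0//.
case: #|I| => [|n]; first by rewrite expr0n.
by rewrite expr2 ler_peMr// ler1n.
Qed.

Let mDd t : 0 <= t <= T -> maj r (Dd t) (Num.sqrt (sm (fun k => Y t k ^+ 2))).
Proof.
move=> tT; have [_ h _] : maj r (Dd t) (#|I|%:R * (al + be)).
  by apply: maj_le mG => k; exact: DdG.
split=> //; first by move=> k; case/andP: (DdG k tT).
by rewrite sqr_sqrtr//; apply: sm_ge0 => k; exact: sqr_ge0.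
Qed.

Let g t i k := N t (u t) i k - N t (v t) i k.

Let q t k := Q U (Dd t) k + Q (Dd t) V k.

Let g_le t i k : 0 <= t <= T -> `|g t i k| <= expR (- ((tau0 - mu * t) * freq k)) * (c * q t k).
Proof.
move=> tT; have ct : cT t = t by exact: cl_id.
have bd : bdd (sdiff (u t) (v t)) (ubt t (Dd t)).
  move=> j l; rewrite /ub /Dd ct mulrA e1// mul1r -sqrtr_sqr ler_wsqrtr//.
  by rewrite /dsq (bigD1 j)//= lerDl sumr_ge0// => *; exact: sqr_ge0.
have := lip_ub c0 qN T0 mu0 tauT sU sV (maj_small hr (sqrtr_ge0 _) (mDd tT)) (bu t) (bv t) bd t i k.
by rewrite ct.
Qed.

Let dE (F : {fset K}) t := \sum_(k <- F) (- (2 * mu * freq k) * (freq k `^ (2 * (r - 2^-1)) * expR (2 * (tau0 - mu * t) * freq k)) * dsq t k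
   + wt t k * \sum_i (2 * (u t i k - v t i k) * g t i k)).

(** Frequency by frequency the nonlinear work is at most 4 |I| c Y times the order-r weight of the
    convolution divided by |k|. Cauchy-Schwarz and [Q_est] bound its total by 2 mu times the full
    sum of Y^2, thanks to [mu_large]. The dissipation is summed over [F] only, whence the tail on
    the right. *)
Let dE_le F t : 0 <= t <= T -> dE F t <= 2 * mu * (sm (fun k => Y t k ^+ 2) - \sum_(k <- F) Y t k ^+ 2).
Proof.
move=> tT.
set de := Num.sqrt (sm (fun k => Y t k ^+ 2)).
have de0 : 0 <= de by exact: sqrtr_ge0.
have mD : maj r (Dd t) de := mDd tT.
have sY : summ (fun k => Y t k ^+ 2) by case: mD.
have h1 := Q_est hr al0 de0 mU mD; have h2 := Q_est hr de0 be0 mD mV.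
have n1 : 0 <= kap r * al * de by apply: mulr_ge0 => //; apply: mulr_ge0 => //; exact: kap_ge0.
have n2 : 0 <= kap r * de * be by apply: mulr_ge0 => //; apply: mulr_ge0 => //; exact: kap_ge0.
have mZ := majD n1 n2 h1 h2.
set Zz := (fun k => _ + _) in mZ.
have Z0 k : 0 <= Zz k by case: mZ.
pose YZ k := Y t k * (freq k `^ r * Zz k).
have Y0 k : 0 <= Y t k by rewrite mulr_ge0 ?powR_ge0//; case/andP: (DdG k tT).
have YZ0 k : 0 <= YZ k by rewrite !mulr_ge0 ?powR_ge0.
have cC : 0 <= 4 * #|I|%:R * c by rewrite !mulr_ge0.
have P k : - (2 * mu * freq k) * (freq k `^ (2 * (r - 2^-1)) * expR (2 * (tau0 - mu * t) * freq k)) * dsq t k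
   + wt t k * \sum_i (2 * (u t i k - v t i k) * g t i k) <= - (2 * mu * Y t k ^+ 2) + 4 * #|I|%:R * c * YZ k.
  have [->|k0] := eqVneq k 0.
    have [d0 Y00] : dsq t 0 = 0 /\ Y t 0 = 0 by rewrite /Y /Dd dsq0 sqrtr0 !mulr0.
    rewrite d0 mulr0 add0r Y00 expr0n mulr0 oppr0 add0r /YZ Y00 mul0r mulr0.
    rewrite big1 ?mulr0// => i _; rewrite (_ : u t i 0 - v t i 0 = 0) ?mulr0 ?mul0r//.
    apply/eqP; rewrite -sqrf_eq0 eq_le sqr_ge0 andbT -d0 /dsq (bigD1 i)//= lerDl sumr_ge0// => *; exact: sqr_ge0.
  have fk : 0 < freq k := freq_gt0 k0; have fkn : freq k != 0 by rewrite gt_eqF.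
  set B := freq k `^ _ * expR _.
  set s := tau0 - mu * t; set n := Num.sqrt (dsq t k).
  have n0 : 0 <= n by exact: sqrtr_ge0.
  have nn : dsq t k = n ^+ 2 by rewrite sqr_sqrtr.
  have s0 : 0 <= s by have := tau_ge0 T0 mu0 tauT t; rewrite cl_id.
  (* For k != 0 the inhomogeneous summand 1 of the weight is below its homogeneous part, so the
     weight is at most 2 B. *)
  have B1 : 1 <= B.
    rewrite -[1]mulr1 ler_pM//; last by rewrite -expR0 ler_expR mulr_ge0 ?freq_ge0// mulr_ge0.
    rewrite -{1}(powRr0 (freq k)) ler_powR ?freq_ge1//; have := hr; lra.
  have BY : freq k * B * n ^+ 2 = Y t k ^+ 2.
    rewrite /Y /Dd -/s -/n /B !exprMn -expRM_natl mulrA mulrA.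
    have -> : 2 * (s * freq k) = 2 * s * freq k by rewrite mulrA.
    congr (_ * _ * _); rewrite expr2 -powRD ?fkn ?implybT//.
    rewrite -{1}(powRr1 (ltW fk)) -powRD ?fkn ?implybT//; congr (_ `^ _); lra.
  have S : \sum_i (2 * (u t i k - v t i k) * g t i k) <= 2 * #|I|%:R * (n * (expR (- (s * freq k)) * (c * q t k))).
    apply: (@le_trans _ _ (\sum_(i : I) 2 * (n * (expR (- (s * freq k)) * (c * q t k))))); last first.
      by rewrite sumr_const -[leLHS]mulr_natl mulrCA mulrA.
    apply: ler_sum => i _; rewrite -mulrA ler_wpM2l//; apply: (le_trans (ler_norm _)).
    rewrite normrM ler_pM//; last exact: g_le.
    by rewrite -sqrtr_sqr ler_wsqrtr// /dsq (bigD1 i)//= lerDl sumr_ge0// => *; exact: sqr_ge0.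
  have q0 : 0 <= q t k by rewrite addr_ge0// Q_ge0//; [case: sU|case: mD|case: mD|case: sV].
  have R0 : 0 <= 2 * #|I|%:R * (n * (expR (- (s * freq k)) * (c * q t k))) by rewrite !mulr_ge0 ?expR_ge0.
  apply: lerD; first by rewrite le_eqVlt; apply/orP; left; apply/eqP; rewrite -BY nn; ring.
  apply: (@le_trans _ _ (2 * B * (2 * #|I|%:R * (n * (expR (- (s * freq k)) * (c * q t k)))))).
    apply: (@le_trans _ _ (wt t k * (2 * #|I|%:R * (n * (expR (- (s * freq k)) * (c * q t k)))))).
      by rewrite ler_wpM2l//; rewrite /wt -/B addr_ge0// (le_trans ler01).
    by rewrite ler_wpM2r// /wt -/B mulr_natl mulr2n lerD2r.
  have ZE : Zz k = q t k / freq k by rewrite /Zz (negbTE k0) -mulrDl.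
  rewrite le_eqVlt; apply/orP; left; apply/eqP.
  have BE : B * expR (- (s * freq k)) * n = Y t k * (freq k `^ r / freq k).
    rewrite /Y /Dd -/s -/n /B.
    have -> : expR (2 * s * freq k) = expR (s * freq k) * expR (s * freq k) by rewrite -expRD; congr expR; ring.
    have -> : freq k `^ (2 * (r - 2^-1)) = freq k `^ r * (freq k `^ r / freq k).
      rewrite -(powR_inv1 (ltW fk)) -powRD ?fkn ?implybT// -powRD ?fkn ?implybT//; congr (_ `^ _); lra.
    have := e1 k tT; rewrite -/s => e1'.
    transitivity (freq k `^ r * (freq k `^ r / freq k) * expR (s * freq k) * (expR (- (s * freq k)) * expR (s * freq k)) * n); first by ring.
    by rewrite e1'; ring.
  transitivity (4 * #|I|%:R * c * q t k * (B * expR (- (s * freq k)) * n)); first by ring.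
  by rewrite BE /YZ ZE; field.
have [sYZ _] : summ YZ /\ True.
  by split=> //; have [_ sZ _] := mZ; have [h _] := summ_mul sY sZ.
have CS : sm YZ <= de * (kap r * al * de + kap r * de * be).
  have [_ sZ lZ] := mZ; have [_ _ lY] := mD.
  by apply: cauchy_sm => //; exact: addr_ge0.
apply: (@le_trans _ _ (\sum_(k <- F) (- (2 * mu * Y t k ^+ 2) + 4 * #|I|%:R * c * YZ k))).
  by apply: ler_sum => k _; exact: P.
rewrite big_split/= sumrN -!big_distrr/= addrC mulrBr lerD2r.
apply: (@le_trans _ _ (4 * #|I|%:R * c * sm YZ)).
  by rewrite ler_wpM2l//; exact: fsum_le_sm.
apply: (le_trans (ler_wpM2l cC CS)).
have -> : sm (fun k => Y t k ^+ 2) = de ^+ 2 by rewrite sqr_sqrtr//; apply: sm_ge0 => k; exact: sqr_ge0.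
have -> : 4 * #|I|%:R * c * (de * (kap r * al * de + kap r * de * be)) = 2 * (2 * #|I|%:R * c * kap r * (al + be)) * de ^+ 2 by ring.
rewrite ler_wpM2r ?sqr_ge0// ler_wpM2l//; exact: mu_large.
Qed.

Let Ef (F : {fset K}) t := \sum_(k <- F) wt t k * dsq t k.

Let Ef_cts F : continuous (Ef F).
Proof.
apply: cts_bigsum => k t; apply: cvgM.
  apply: cvgD; first exact: cvg_cst.
  apply: cvgMr.
  have -> : (fun t => expR (2 * (tau0 - mu * t) * freq k)) = (fun t => expR (2 * tau0 * freq k + (- 2 * mu * freq k) * t)).
    by apply/funext => s; congr expR; ring.
  have := @exp_aff_cts _ (2 * tau0 * freq k) (- 2 * mu * freq k) t.
  by rewrite /continuous_at (_ : 2 * tau0 * freq k + - 2 * mu * freq k * t = 2 * (tau0 - mu * t) * freq k); last ring.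
apply: (@cts_bigsum _ _ _ (fun i t => (u t i k - v t i k) ^+ 2)) => i s; under eq_fun do rewrite expr2; apply: cvgM; apply: cvgB; by [exact: cu|exact: cv].
Qed.

Let cN (x : R -> st) X : smallw X -> (forall i k, continuous (fun t => x t i k)) -> 
  (forall t, bdd (x t) (ubt t X)) -> forall i k, continuous (fun s => N s (x s) i k).
Proof.
by move=> sX cx bx; apply: (quad_cts qN sX) => // t; apply: bdd_ub (bx t).
Qed.

Let Ef_der F t : 0 < t < T -> is_derive t 1 (Ef F) (dE F t).
Proof.
move=> /andP[t0 tT]; apply: is_derive_bigsum => k.
have hd (x : R -> st) (a' : st) X i : smallw X -> (forall i k, continuous (fun t => x t i k)) -> 
  (forall t, bdd (x t) (ubt t X)) -> (forall t i k, x t i k = a' i k + ig (fun s => N s (x s) i k) (cT t)) ->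
  is_derive t 1 (fun t => x t i k) (N t (x t) i k).
  move=> sX cx bx ex.
  have cn : continuous (fun s => N s (x s) i k) by exact: (cN sX cx bx).
  have h1 := ig_derive cn t0.
  have h2 : is_derive t 1 (fun s => a' i k + ig (fun s => N s (x s) i k) s) (N t (x t) i k).
    have -> : (fun s => a' i k + ig (fun s => N s (x s) i k) s) = cst (a' i k) + ig (fun s => N s (x s) i k) by [].
    by apply: is_derive_eq; rewrite add0r.
  apply: near_eq_is_derive h2 => //.
  near=> s; rewrite ex cl_id//; apply/andP; split; apply: ltW; near: s.
    exact: lt_nbhsr.
  exact: lt_nbhsl.
have hw : is_derive t 1 (wt^~ k) (- (2 * mu * freq k) * (freq k `^ (2 * (r - 2^-1)) * expR (2 * (tau0 - mu * t) * freq k))).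
  have := exp_aff_derive (2 * tau0 * freq k) (- 2 * mu * freq k) t.
  have -> : (fun s => expR (2 * tau0 * freq k + (- 2 * mu * freq k) * s)) = (fun t => expR (2 * (tau0 - mu * t) * freq k)).
    by apply/funext => s; congr expR; ring.
  have -> : 2 * tau0 * freq k + - 2 * mu * freq k * t = 2 * (tau0 - mu * t) * freq k by ring.
  move=> h.
  apply: (is_derive_eq (is_derive_affine 1 (freq k `^ (2 * (r - 2^-1))) h)).
  by set E := expR _; set P := _ `^ _; ring.
have hs : is_derive t 1 (dsq^~ k) (\sum_i (2 * (u t i k - v t i k) * g t i k)).
  apply: (@is_derive_bigsum _ _ (fun i t => (u t i k - v t i k) ^+ 2)) => i.
  have h1 := hd u a U i sU cu bu eu; have h2 := hd v b V i sV cv bv ev.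
  have -> : (fun t => (u t i k - v t i k) ^+ 2) = ((fun t => u t i k) - (fun t => v t i k)) * ((fun t => u t i k) - (fun t => v t i k)).
    by apply/funext => s; rewrite expr2.
  apply: is_derive_eq; rewrite /GRing.scale/= /g.
  have -> : ((fun t => u t i k) - (fun t => v t i k)) t = u t i k - v t i k by [].
  ring.
have -> : (fun t => wt t k * dsq t k) = (wt^~ k) * (dsq^~ k) by [].
apply: is_derive_eq; rewrite /GRing.scale/=; ring.
Unshelve. all: by end_near. Qed.

(** Infinite sums are never differentiated: the energy is truncated to a finite set [F] whose
    complement carries little of Y^2 uniformly in time. The mean value theorem then bounds the
    growth of the truncated energy by [e], and [e] is arbitrary. *)
Lemma energy t : 0 <= t <= T -> 
  (\esum_(k in [set: K]) (wt t k * dsq t k)%:E <= \esum_(k in [set: K]) (wt 0 k * dsq 0 k)%:E)%E.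
Proof.
move=> tT; apply: ub_ereal_sup => _ [A [fA _] <-].
rewrite fsbig_finite//= sumEFin; set F0 := fset_set A.
have w0 s k : 0 <= wt s k by rewrite addr_ge0// mulr_ge0 ?powR_ge0 ?expR_ge0.
have wd0 s k : 0 <= wt s k * dsq s k by rewrite mulr_ge0.
apply/lee_addgt0Pr => e e0.
have sG : summ (fun k => (freq k `^ r * G k) ^+ 2) by case: mG.
(* Chosen so that the tail contribution 2 mu e', integrated over a time at most T + 1, is [e]; T + 1
   stays positive when T = 0. *)
pose e' := e / (2 * mu * (T + 1)).
have T1 : 0 < T + 1 by rewrite ltr_wpDl.
have e'0 : 0 < e' by rewrite divr_gt0// !mulr_gt0.
have [B hB] := summ_tail sG e'0.
set F := (F0 `|` B)%fset.
have tail s : 0 <= s <= T -> sm (fun k => Y s k ^+ 2) - \sum_(k <- F) Y s k ^+ 2 <= e'.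
  move=> sT; have [_ sY _] := mDd sT.
  pose h k := if k \in F then Y s k ^+ 2 else 0.
  have [sh Sh] : summ h /\ sm h = \sum_(k <- F) Y s k ^+ 2.
    have [|? ->] := @sm_fin _ _ F h; first by move=> k; rewrite /h => /negPf ->.
    by split=> //; apply: eq_big_seq => k; rewrite /h => ->.
  rewrite -Sh -smB//; apply: (le_trans (ler_norm _)); apply: hB => k; last first.
    by move=> kB; rewrite /h inE kB orbT subrr.
  have /andP[d0 dG] := DdG k sT.
  have : `|Y s k ^+ 2| <= `|(freq k `^ r * G k) ^+ 2|.
    have y1 : 0 <= Y s k by rewrite mulr_ge0 ?powR_ge0.
    have y2 : 0 <= freq k `^ r * G k by rewrite mulr_ge0 ?powR_ge0// (le_trans d0).
    by rewrite !ger0_norm ?sqr_ge0// ler_pXn2r ?nnegrE// ler_wpM2l ?powR_ge0.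
  by rewrite /h; case: ifP => // _; rewrite ?subr0// subrr normr0.
have EF : Ef F t <= Ef F 0 + e.
  have /andP[t0 tT'] := tT; move: t0; rewrite le_eqVlt => /predU1P[<-|t0]; first by rewrite lerDl ltW.
  have cE : {within `[0, t], continuous (Ef F)} by apply: cts_within; exact: Ef_cts.
  have dE' x : x \in `]0, t[ -> is_derive x 1 (Ef F) (dE F x).
    by rewrite in_itv/= => /andP[x0 xt]; apply: Ef_der; rewrite x0 (lt_le_trans xt).
  have [s] := MVT t0 dE' cE; rewrite in_itv/= => /andP[s0 st] h.
  have sT : 0 <= s <= T by rewrite (ltW s0) (le_trans (ltW st)).
  rewrite -lerBlDl h subr0.
  apply: (@le_trans _ _ (2 * mu * e' * t)).
    rewrite ler_wpM2r ?(ltW t0)//; apply: (le_trans (dE_le F sT)).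
    by rewrite ler_wpM2l ?mulr_ge0 ?(ltW mu0)//; exact: tail.
  apply: (@le_trans _ _ (2 * mu * e' * (T + 1))).
    apply: ler_wpM2l; last by move: tT'; lra.
    by apply: mulr_ge0 (ltW e'0); rewrite mulr_ge0// ltW.
  by rewrite le_eqVlt; apply/orP; left; apply/eqP; rewrite /e'; field; rewrite !gt_eqF.
have EF0 : \sum_(k <- F0) wt t k * dsq t k <= Ef F t.
  by apply: le_fsum => // k kF; rewrite inE kF.
apply: (@le_trans _ _ (Ef F 0 + e)%:E); first by rewrite lee_fin (le_trans EF0).
by rewrite EFinD leeD2r//; exact: fsum_le_esum.
Qed.
End Energy.

(** * Fourier uniqueness and calculus on the torus *)

Section AlmostEverywhere.
Context d (T : measurableType d) (R : realType) (mu : {measure set T -> \bar R}).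

Lemma ae1 (P Z : T -> Prop) : {ae mu, forall x, P x} -> (forall x, P x -> Z x) -> {ae mu, forall x, Z x}.
Proof. by move=> hP h; apply: filterS hP. Qed.

Lemma ae2 (P Q Z : T -> Prop) : {ae mu, forall x, P x} -> {ae mu, forall x, Q x} ->
  (forall x, P x -> Q x -> Z x) -> {ae mu, forall x, Z x}.
Proof. by move=> hP hQ h; apply: filterS2 hP hQ. Qed.
End AlmostEverywhere.

(** * Fubini on product sets and completeness of product systems *)

Section FubiniSet.
Context d1 d2 (T1 : measurableType d1) (T2 : measurableType d2) (R : realType).
Variables (m1 : {sigma_finite_measure set T1 -> \bar R}) (m2 : {sigma_finite_measure set T2 -> \bar R}).
Variables (A : set T1) (B : set T2).
Hypotheses (mA : measurable A) (mB : measurable B).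

Lemma fubini_set (f : T1 * T2 -> R) : (m1 \x m2)%E.-integrable (A `*` B) (EFin \o f) ->
  [/\ {ae m1, forall x, A x -> m2.-integrable B (fun y => (f (x, y))%:E)},
     m1.-integrable A (fun x => (\int[m2]_(y in B) f (x, y))%:E) &
     \int[(m1 \x m2)%E]_(z in A `*` B) f z = \int[m1]_(x in A) \int[m2]_(y in B) f (x, y)].
Proof.
move=> fi; have mAB : measurable (A `*` B) by exact: measurableX.
pose g := (EFin \o f) \_ (A `*` B).
have gi : (m1 \x m2)%E.-integrable setT g by rewrite /g; apply/(integrable_mkcond _ mAB).
have gE x : A x -> (fun y => g (x, y)) = (fun y => (f (x, y))%:E) \_ B.
  move=> Ax; apply/funext => y; rewrite /g /patch; congr (if _ then _ else _).
  by apply/idP/idP; rewrite !inE => // -[].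
have gE' x : ~ A x -> (fun y => g (x, y)) = cst 0%E.
  by move=> Ax; apply/funext => y; rewrite /g patchE memNset// => -[].
have h1 : {ae m1, forall x, A x -> m2.-integrable B (fun y => (f (x, y))%:E)}.
  apply: filterS (ae_integrable1 gi) => x + Ax; rewrite gE//.
  by move/(integrable_mkcond _ mB).
have iF := integrable_fubini_F gi.
have iFA : m1.-integrable A (fubini_F m2 g) by exact: integrableS iF.
have mF := measurable_int _ iFA.
have mRF : measurable_fun A (fun x => fine (fubini_F m2 g x)).
  by apply: measurableT_comp mF; exact: fine_measurable.
have FE x : A x -> (\int[m2]_(y in B) f (x, y))%:E = (fine (fubini_F m2 g x))%:E.
  by move=> Ax; rewrite /fubini_F gE// -integral_mkcond.
have mR : measurable_fun A (fun x => (\int[m2]_(y in B) f (x, y))%:E).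
  apply: (eq_measurable_fun (fun x => (fine (fubini_F m2 g x))%:E)).
    by move=> x; rewrite inE => /FE ->.
  exact/measurable_EFinP.
have h2 : m1.-integrable A (fun x => (\int[m2]_(y in B) f (x, y))%:E).
  apply: le_integrable iFA => // x Ax; rewrite FE//=.
  by case: (fubini_F m2 g x) => [z||] //=; rewrite normr0 leey.
split=> //.
have E : \int[(m1 \x m2)%E]_(z in A `*` B) f z = fine (\int[m1]_(x in A) fubini_F m2 g x)%E.
  rewrite /Rintegral integral_mkcond -/g -(integral12_prod_meas1 gi); congr fine.
  rewrite [in RHS]integral_mkcond; apply: eq_integral => x _.
  rewrite patchE; case: ifPn => //; rewrite notin_setE => nA.
  by rewrite /fubini_F gE'// integral_cst// mul0e.
rewrite E; congr fine; apply: ae_eq_integral => //.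
apply: filterS h1 => x h Ax; rewrite FE//= fineK//.
rewrite /fubini_F gE// -integral_mkcond; apply: integrable_fin_num => //; exact: h.
Qed.

(** Tested against integrable functions rather than square-integrable ones, so that the slices and
    partial integrals supplied by Fubini are again admissible. *)
Definition complete d (T : measurableType d) (m : {measure set T -> \bar R}) (D : set T) (I : Type) (phi : I -> T -> R) :=
  forall h, m.-integrable D (EFin \o h) -> (forall i, \int[m]_(x in D) (h x * phi i x) = 0) ->
  {ae m, forall x, D x -> h x = 0}.

Lemma integrable_bddM d (T : measurableType d) (m : {measure set T -> \bar R}) (D : set T) (f g : T -> R) (M : R) :
  measurable D -> m.-integrable D (EFin \o f) -> measurable_fun setT g -> (forall x, `|g x| <= M) ->
  m.-integrable D (fun x => (f x * g x)%:E).
Proof.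
move=> mD fi mg gM; have M0 : 0 <= M by apply: le_trans (gM point).
apply: (@le_integrable _ _ _ m D mD _ (fun x => (M * f x)%:E)).
- apply/measurable_EFinP; apply: measurable_funM; first by apply/measurable_EFinP; exact: measurable_int fi.
  exact: measurable_funS mg.
- move=> x Dx; rewrite /= lee_fin normrM mulrC normrM (ger0_norm M0); exact: ler_wpM2r.
- under eq_fun do rewrite EFinM; exact: integrableZl.
Qed.

Lemma integrableZE d (T : measurableType d) (m : {measure set T -> \bar R}) (D : set T) (f : T -> R) (k : R) :
  measurable D -> m.-integrable D (EFin \o f) -> m.-integrable D (EFin \o (fun x => k * f x)).
Proof.
move=> mD fi; rewrite (_ : EFin \o _ = (fun x => k%:E * (f x)%:E)%E); first exact: integrableZl.
by apply/funext => x /=; rewrite EFinM.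
Qed.

(** For fixed j, integrating out the second variable leaves a function of x orthogonal to every
    [phi i], hence zero almost everywhere. Countability of [J] gives one null set for all j, and
    outside it completeness in the second variable kills the slice. *)
Lemma complete_prod (I J : countType) (phi : I -> T1 -> R) (psi : J -> T2 -> R) :
  (forall i, measurable_fun setT (phi i)) -> (forall i x, `|phi i x| <= 1) ->
  (forall j, measurable_fun setT (psi j)) -> (forall j y, `|psi j y| <= 1) ->
  complete m1 A phi -> complete m2 B psi ->
  complete (m1 \x m2)%E (A `*` B) (fun ij x => phi ij.1 x.1 * psi ij.2 x.2).
Proof.
move=> mphi bphi mpsi bpsi c1 c2 h hi h0.
have mAB : measurable (A `*` B) by exact: measurableX.
have mpsi' j : measurable_fun setT (fun x : T1 * T2 => psi j x.2) by apply: measurableT_comp.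
have mphi' i : measurable_fun setT (fun x : T1 * T2 => phi i x.1) by apply: measurableT_comp.
have hj j : (m1 \x m2)%E.-integrable (A `*` B) (fun x => (h x * psi j x.2)%:E).
  by apply: (integrable_bddM mAB hi (mpsi' j) (M := 1)) => x; exact: bpsi.
have [f1 _ _] := fubini_set hi.
have H j : {ae m1, forall x, A x -> \int[m2]_(y in B) (h (x, y) * psi j y) = 0}.
  have [_ i1 _] := fubini_set (hj j).
  apply: c1 => // i.
  have := h0 (i, j); rewrite /=.
  have ii : (m1 \x m2)%E.-integrable (A `*` B) (fun x => (h x * (phi i x.1 * psi j x.2))%:E).
    have := integrable_bddM mAB (hj j) (mphi' i) (M := 1) => /(_ (fun x => bphi i x.1)).
    by under eq_fun do rewrite mulrAC -mulrA.
  have [g1 _ ->] := fubini_set ii.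
  have [k1 _ _] := fubini_set (hj j).
  move=> <-; rewrite /Rintegral; congr fine; apply: ae_eq_integral => //.
  - apply/measurable_EFinP/measurable_funM; last exact: measurable_funS (mphi i).
    by apply/measurable_EFinP; exact: measurable_int i1.
  - have [_ q _] := fubini_set ii; exact: measurable_int q.
  - apply: filterS k1 => x kx Ax; congr EFin; rewrite -RintegralZr//; last exact: kx.
    by apply: eq_Rintegral => y _; rewrite /=; ring.
have {}H : {ae m1, forall x, forall j, A x -> \int[m2]_(y in B) (h (x, y) * psi j y) = 0}.
  have : {ae m1, forall x, forall n : nat, forall j, choice.unpickle n = Some j -> A x -> \int[m2]_(y in B) (h (x, y) * psi j y) = 0}.
    apply/ae_foralln => n; case: (choice.unpickle n) => [j|]; last by apply: aeW.
    by apply: filterS (H j) => x + _ [<-].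
  by apply: filterS => x hx j; apply: (hx (choice.pickle j)); rewrite choice.pickleK.
have Z : {ae m1, forall x, A x -> \int[m2]_(y in B) `|h (x, y)| = 0}.
  apply: filterS2 f1 H => x f1x Hx Ax.
  have hx0 := c2 _ (f1x Ax) (fun j => Hx j Ax).
  rewrite /Rintegral (ae_eq_integral (cst 0%E))//; first by rewrite integral0.
  - apply/measurable_EFinP; apply: measurableT_comp => //; apply/measurable_EFinP; exact: measurable_int (f1x Ax).
  - by apply: filterS hx0 => y + By; move=> /(_ By) /= ->; rewrite normr0.
have ni : (m1 \x m2)%E.-integrable (A `*` B) (EFin \o (fun x => `|h x|)) by exact: (integrable_norm hi).
have [_ ni1 E] := fubini_set ni.
have E0 : \int[(m1 \x m2)%E]_(z in A `*` B) `|h z| = 0.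
  rewrite E /Rintegral (ae_eq_integral (cst 0%E))//; first by rewrite integral0.
  - exact: measurable_int ni1.
  - by apply: filterS Z => x + Ax => /(_ Ax) zx; congr EFin; exact: zx.
have mh := measurable_int _ hi.
have : (\int[(m1 \x m2)%E]_(z in A `*` B) `|(h z)%:E| = 0)%E.
  by have := integrable_fin_num mAB ni; move=> /fineK <-; rewrite -[X in _ = X]/(0%R%:E) -E0.
move/(ae_eq_integral_abs _ mAB mh); apply: filterS => x + Dx => /(_ Dx) [].
exact.
Qed.
End FubiniSet.

(** * Completeness of the trigonometric system on the unit interval *)

Section Complete1D.
Context {R : realType}.
Local Notation leb := (@lebesgue_measure R).

Definition tb (nb : int * bool) (x : R) : R := 
  if nb.2 then cos (2 * pi * nb.1%:~R * x) else sin (2 * pi * nb.1%:~R * x).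

Lemma cts_cosZ (a : R) : continuous (fun x => cos (a * x)).
Proof. by move=> x; apply: (@continuous_comp _ _ _ ( *%R a) cos); [exact: mulrl_continuous|exact: continuous_cos]. Qed.

Lemma cts_sinZ (a : R) : continuous (fun x => sin (a * x)).
Proof. by move=> x; apply: (@continuous_comp _ _ _ ( *%R a) sin); [exact: mulrl_continuous|exact: continuous_sin]. Qed.

Lemma tb_cts nb : continuous (tb nb).
Proof. by case: nb => n []; [exact: cts_cosZ|exact: cts_sinZ]. Qed.

Lemma cos_le1' (x : R) : `|cos x| <= 1.
Proof. by rewrite ler_norml cos_geN1 cos_le1. Qed.

Lemma sin_le1' (x : R) : `|sin x| <= 1.
Proof. by rewrite ler_norml sin_geN1 sin_le1. Qed.

Lemma tb_le1 nb x : `|tb nb x| <= 1.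
Proof. by rewrite /tb; case: ifP => _; [exact: cos_le1'|exact: sin_le1']. Qed.

Lemma tb_meas nb : measurable_fun setT (tb nb).
Proof. by apply: continuous_measurable_fun; exact: tb_cts. Qed.

Section H.
Variable h : R -> R.
Hypothesis hi : leb.-integrable `[0, 1] (EFin \o h).
Hypothesis h0 : forall i, \int[leb]_(x in `[0, 1]) (h x * tb i x) = 0.

Let bc (phi : R -> R) := continuous phi /\ exists M, forall x, `|phi x| <= M.

(** The multipliers [phi] for which h phi is still orthogonal to the system. They form a linear
    space stable under multiplication by sines and cosines, hence under every trigonometric
    polynomial; explicit polynomials approximating an indicator then take the place of a density
    theorem. *)
Let ann phi := bc phi /\ forall i, \int[leb]_(x in `[0, 1]) (h x * (phi x * tb i x)) = 0.

Let bcM phi psi : bc phi -> bc psi -> bc (fun x => phi x * psi x).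
Proof.
move=> [c1 [M1 b1]] [c2 [M2 b2]]; split; first by move=> x; apply: cvgM; [exact: c1|exact: c2].
by exists (M1 * M2) => x; rewrite normrM ler_pM.
Qed.

Let hint phi : bc phi -> leb.-integrable `[0, 1] (EFin \o (fun x => h x * phi x)).
Proof.
move=> [c1 [M b]]; apply: (integrable_bddM _ hi _ (M := M)) => //.
exact: continuous_measurable_fun.
Qed.

Let bct i : bc (tb i).
Proof. by split; [exact: tb_cts|exists 1 => x; exact: tb_le1]. Qed.

Let annL a b phi psi : ann phi -> ann psi -> ann (fun x => a * phi x + b * psi x).
Proof.
move=> [b1 a1] [b2 a2]; split.
  case: b1 b2 => c1 [M1 b1] [c2 [M2 b2]]; split.
    by move=> x; apply: cvgD; apply: cvgMr; [exact: c1|exact: c2].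
  exists (`|a| * M1 + `|b| * M2) => x; apply: (le_trans (ler_normD _ _)); rewrite !normrM.
  by apply: lerD; exact: ler_wpM2l.
move=> i; have i1 := hint (bcM b1 (bct i)); have i2 := hint (bcM b2 (bct i)).
have -> : (fun x => h x * ((a * phi x + b * psi x) * tb i x)) = 
   (fun x => a * (h x * (phi x * tb i x)) + b * (h x * (psi x * tb i x))) by apply/funext => x; ring.
rewrite RintegralD//.
- by rewrite !RintegralZl// a1 a2 !mulr0 addr0.
- exact: integrableZE.
- exact: integrableZE.
Qed.

Let ann1 : ann (fun=> 1).
Proof.
split; first by split; [exact: cst_continuous|exists 1 => x; rewrite normr1].
by move=> i; under eq_Rintegral do rewrite mul1r; exact: h0.
Qed.

Let tbM (b : bool) n b' : exists i j s, forall x, tb (n, b') x * tb (1, b) x = 2^-1 * (tb i x + s * tb j x).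
Proof.
have E1 y : 2 * pi * (n + 1)%:~R * y = 2 * pi * n%:~R * y + 2 * pi * 1%:~R * y :> R by rewrite intrD; ring.
have E2 y : 2 * pi * (n - 1)%:~R * y = 2 * pi * n%:~R * y - 2 * pi * 1%:~R * y :> R by rewrite intrB; ring.
case: b; case: b'.
- exists (n + 1, true), (n - 1, true), 1 => y; rewrite /tb /= E1 E2 cosD cosB; by field.
- exists (n + 1, false), (n - 1, false), 1 => y; rewrite /tb /= E1 E2 sinD sinB; by field.
- exists (n + 1, false), (n - 1, false), (-1) => y; rewrite /tb /= E1 E2 sinD sinB; by field.
- exists (n - 1, true), (n + 1, true), (-1) => y; rewrite /tb /= E1 E2 cosB cosD; by field.
Qed.

Let annM phi b : ann phi -> ann (fun x => phi x * tb (1, b) x).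
Proof.
move=> [b1 a1]; split; first exact: bcM.
move=> [n b']; have [i [j [s E]]] := tbM b n b'.
have i1 := hint (bcM b1 (bct i)); have i2 := hint (bcM b1 (bct j)).
have -> : (fun x => h x * (phi x * tb (1, b) x * tb (n, b') x)) = 
   (fun x => 2^-1 * (h x * (phi x * tb i x)) + (2^-1 * s) * (h x * (phi x * tb j x))).
  by apply/funext => x; rewrite -mulrA [tb (1, b) x * _]mulrC E; ring.
rewrite RintegralD//.
- by rewrite !RintegralZl// !a1 !mulr0 addr0.
- exact: integrableZE.
- exact: integrableZE.
Qed.

Variable c : R.
Hypothesis c01 : 0 < c < 1.

(* cos (2 pi x - pi c) - cos (pi c) = - 2 sin (pi x) sin (pi (x - c)), whose sign on [0, 1[ tells x <= c from x > c *)
Let u x : R := 2^-1 - sin (pi * x) * sin (pi * (x - c)) / 2.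

Let uE x : u x = (2^-1 - cos (pi * c) / 4) + ((cos (pi * c) / 4) * tb (1, true) x + (sin (pi * c) / 4) * tb (1, false) x).
Proof.
rewrite /u /tb /= mulrBr sinB.
have -> : 2 * pi * 1%:~R * x = pi * x + pi * x by ring.
rewrite cosD sinD; have := cos2Dsin2 (pi * x) => h1.
have -> : cos (pi * x) * cos (pi * x) - sin (pi * x) * sin (pi * x) = 1 - 2 * sin (pi * x) ^+ 2 by rewrite -[X in X - 2 * _]h1; ring.
by field.
Qed.

Let annu phi : ann phi -> ann (fun x => phi x * u x).
Proof.
move=> ap; have a1 := annM true ap; have a2 := annM false ap.
have := annL (2^-1 - cos (pi * c) / 4) 1 ap (annL (cos (pi * c) / 4) (sin (pi * c) / 4) a1 a2).
congr ann; apply/funext => x; rewrite uE; ring.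
Qed.

Let annun n phi : ann phi -> ann (fun x => phi x * (1 - u x ^+ n)).
Proof.
move=> ap; have au : ann (fun x => phi x * u x ^+ n).
  elim: n => [|n IH]; first by under eq_fun do rewrite expr0 mulr1.
  by under eq_fun do rewrite exprSr mulrA; exact: annu.
have := annL 1 (-1) ap au.
congr ann; apply/funext => x; ring.
Qed.

(** The approximate indicator from the elementary proof of the Stone-Weierstrass theorem. By
    Bernoulli it tends to 1 where 2 u < 1, and to 0 where 2 u >= 1; the extra factor n in the
    exponent covers the borderline 2 u = 1. *)
Let q n x : R := (1 - u x ^+ n) ^+ (n * 2 ^ n).

Let annq n : ann (q n).
Proof.
rewrite /q; elim: (n * 2 ^ n)%N => [|m IH]; first by under eq_fun do rewrite expr0; exact: ann1.
by under eq_fun do rewrite exprSr; exact: annun.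
Qed.

Let u01 x : 0 <= u x <= 1.
Proof.
have := sin_le1' (pi * x); have := sin_le1' (pi * (x - c)).
rewrite /u; set a := sin _; set b := sin _ => h1 h2.
have : `|b * a| <= 1 by rewrite normrM -[1]mulr1 ler_pM.
by rewrite ler_norml => /andP[h3 h4]; apply/andP; split; lra.
Qed.

Let q01 n x : `|q n x| <= 1.
Proof.
have /andP[u0 u1] := u01 x.
have h2 : 0 <= 1 - u x ^+ n by rewrite subr_ge0 exprn_ile1.
rewrite ger0_norm ?exprn_ge0// exprn_ile1// lerBlDr lerDl exprn_ge0//.
Qed.

Let q_cvg x : x \in `[0, 1[ -> q n x @[n --> \oo] --> (if x <= c then 0 else 1 : R).
Proof.
rewrite in_itv/= => /andP[x0 x1]; have /andP[c0 c1] := c01.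
have /andP[u0 u1] := u01 x; have pi0 := pi_gt0 R.
have sx : 0 <= sin (pi * x).
  apply: sin_ge0_pi; apply/andP; split; first by rewrite mulr_ge0// ltW.
  by rewrite ler_piMr// ltW.
have bern (a : R) m : 0 <= a -> 1 + m%:R * a <= (1 + a) ^+ m.
  move=> a0; elim: m => [|m IH]; first by rewrite mul0r addr0 expr0.
  have ma : 0 <= m%:R * a by rewrite mulr_ge0.
  rewrite exprS -natr1; have := ler_wpM2l (addr_ge0 ler01 a0) IH.
  have := mulr_ge0 a0 ma; move: ((1 + a) ^+ m) (m%:R) => y z h1 h2; apply: le_trans h2; lra.
have bern' (a : R) m : 0 <= a <= 1 -> 1 - m%:R * a <= (1 - a) ^+ m.
  move=> /andP[a0 a1]; elim: m => [|m IH]; first by rewrite mul0r subr0 expr0.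
  have ma : 0 <= m%:R * a by rewrite mulr_ge0.
  have b0 : 0 <= 1 - a by rewrite subr_ge0.
  rewrite exprS -natr1; have := ler_wpM2l b0 IH.
  have := mulr_ge0 a0 ma; move: ((1 - a) ^+ m) (m%:R) => y z h1 h2; apply: le_trans h2; lra.
have un01 n : 0 <= u x ^+ n <= 1 by rewrite exprn_ge0// exprn_ile1.
have q0 n : 0 <= q n x.
  by rewrite /q exprn_ge0// subr_ge0; case/andP: (un01 n).
case: ifPn => [xc|]; last rewrite -ltNge => cx.
  have sc : sin (pi * (x - c)) <= 0.
    rewrite -oppr_ge0 -sinN -mulrN opprB; apply: sin_ge0_pi; apply/andP; split.
      by rewrite mulr_ge0 ?subr_ge0// ltW.
    by rewrite ler_piMr ?(ltW pi0)//; lra.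
  have u2 : 2^-1 <= u x.
    by rewrite /u; have := mulr_ge0_le0 sx sc; move: (sin _ * sin _) => z; lra.
  apply: (@squeeze_cvgr _ _ _ _ (fun=> 0) (fun n => (1 + n%:R)^-1 : R)); last 2 first.
  - exact: cvg_cst.
  - by under eq_fun do rewrite addrC natr1; exact: cvg_harmonic.
  apply: nearW => n; rewrite q0/=.
  have /andP[a0 a1] := un01 n.
  have n0 : 0 < 1 + n%:R :> R by rewrite ltr_pwDl.
  rewrite -[leRHS]mul1r ler_pdivlMr//.
  (* The product equals (1 - u^(2n)) to a power, hence is at most 1, while Bernoulli bounds the
     second factor below by 1 + n. *)
  apply: (@le_trans _ _ (q n x * (1 + u x ^+ n) ^+ (n * 2 ^ n))).
    rewrite ler_wpM2l// (le_trans _ (bern _ _ a0))// lerD2l natrM natrX.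
    have : 1 <= 2 ^+ n * u x ^+ n by rewrite -exprMn exprn_ege1//; lra.
    by rewrite -mulrA => hh; rewrite ler_peMr.
  rewrite /q -exprMn exprn_ile1//; first by rewrite mulr_ge0 ?subr_ge0 ?addr_ge0.
  by have := sqr_ge0 (u x ^+ n); move: (u x ^+ n) => z; lra.
have sc : 0 < sin (pi * (x - c)).
  apply: sin_gt0_pi; apply/andP; split; first by rewrite mulr_gt0// subr_gt0.
  by rewrite gtr_pMr//; lra.
have sx' : 0 < sin (pi * x).
  apply: sin_gt0_pi; apply/andP; split; first by rewrite mulr_gt0// (lt_trans c0).
  by rewrite gtr_pMr.
have u2 : 2 * u x < 1.
  by rewrite /u; have := mulr_gt0 sx' sc; move: (sin _ * sin _) => z; lra.
(* [y] lies strictly between 2 u and 1. With y = z^2 the error n (2u)^n is at most (n z^n) z^n, a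
   bounded factor times one tending to 0. *)
pose y := (2 * u x + 1) / 2; pose z := Num.sqrt y.
have y0 : 0 < y by rewrite /y; lra.
have y1 : y < 1 by rewrite /y; lra.
have z0 : 0 < z by rewrite sqrtr_gt0.
have z1 : z < 1 by rewrite -sqrtr1 ltr_sqrt.
have zz : z ^+ 2 = y by rewrite sqr_sqrtr// ltW.
have d0 : 0 < z^-1 - 1 by rewrite subr_gt0 invf_gt1.
have nz n : n%:R * z ^+ n <= (z^-1 - 1)^-1.
  rewrite -[leRHS]mul1r ler_pdivlMr//.
  have := bern _ n (ltW d0); rewrite addrCA subrr addr0 exprVn => hh.
  rewrite mulrAC -ler_pdivlMr ?exprn_gt0// mul1r; apply: le_trans hh; lra.
apply: (@squeeze_cvgr _ _ _ _ (fun n => 1 - (z^-1 - 1)^-1 * z ^+ n : R) (fun=> 1)); last 2 first.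
- rewrite -[X in _ --> X](subr0 1); apply: cvgB; first exact: cvg_cst.
  rewrite -(mulr0 (z^-1 - 1)^-1); apply: cvgMr; apply: cvg_expr.
  by rewrite ger0_norm// ltW.
- exact: cvg_cst.
apply: nearW => n; have := q01 n x; rewrite ger0_norm// => ->; rewrite andbT.
apply: (@le_trans _ _ (1 - (n * 2 ^ n)%:R * u x ^+ n)); last by apply: bern'; exact: un01.
rewrite lerD2l lerN2 natrM natrX -mulrA -exprMn.
apply: (@le_trans _ _ (n%:R * y ^+ n)).
  by rewrite ler_wpM2l// lerXn2r ?nnegrE ?mulr_ge0 ?(ltW y0)// /y; lra.
by rewrite -zz -exprM mul2n -addnn exprD mulrA ler_wpM2r// exprn_ge0// ltW.
Qed.

(** Dominated convergence along [q n] gives a zero integral over ]c, 1[; the cosine of frequency 0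
    gives a zero integral over [0, 1]. *)
Lemma int_0c : \int[leb]_(x in `[0, c]) h x = 0.
Proof.
have /andP[c0 c1] := c01.
have sub : `[0, 1[ `<=` `[0, 1 : R]%classic by apply: subset_itvl; rewrite bnd_simp.
have hi' : leb.-integrable `[0, 1[ (EFin \o h) by exact: integrableS hi.
have e x : x \in `[0, 1[ -> h x * q n x @[n --> \oo] --> h x * (if x <= c then 0 else 1).
  by move=> xx; apply: cvgMr; exact: q_cvg.
have [|||||_] := @Rdct _ _ _ leb `[0, 1[ (fun n x => h x * q n x) (fun x => h x * (if x <= c then 0 else 1)) (fun x => `|h x|).
- by [].
- move=> n; apply/measurable_EFinP; apply: measurable_int; apply: integrableS (hint (annq n).1) => //.
- by move=> x /= xx; exact: e.
- exact: (integrable_norm hi').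
- by move=> x n _; rewrite normrM ler_piMr.
have q0 n : \int[leb]_(x in `[0, 1[) (h x * q n x) = 0.
  rewrite Rintegral_itv_bndo_bndc; last by apply: integrableS (hint (annq n).1).
  have [_ /(_ (0, true))] := annq n; rewrite /tb /=.
  by under eq_Rintegral do rewrite mulr0 mul0r cos0 mulr1.
under eq_fun do rewrite q0; move=> /cvg_lim; rewrite lim_cst// => /(_ (@Rhausdorff R)) E.
have hz : \int[leb]_(x in `[0, 1]) h x = 0.
  have := h0 (0, true); rewrite /tb /=.
  by under eq_Rintegral do rewrite mulr0 mul0r cos0 mulr1.
have hc : \int[leb]_(x in `]c, 1[) h x = 0.
  rewrite [RHS]E [RHS]Rintegral_mkcond [LHS]Rintegral_mkcond; apply: eq_Rintegral => x _.
  rewrite !patchE; case: ifPn; rewrite ?inE ?notin_setE/= in_itv/= => h1.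
    rewrite ifT; last by rewrite inE/= in_itv/=; lra.
    by rewrite leNgt; case/andP: h1 => -> _; rewrite mulr1.
  case: ifPn; rewrite ?inE//= in_itv/= => /andP[x0 x1].
  move: h1 => /negP; rewrite x1 andbT -leNgt => ->; by rewrite mulr0.
have := @Rintegral_itvB _ h (BLeft 0) (BRight 1) c hi.
rewrite !bnd_simp => /(_ (ltW c0) (ltW c1)); rewrite hz.
rewrite -(@Rintegral_itv_bndo_bndc _ (BRight c) 1 h); last first.
  apply: integrableS hi => // y /=; rewrite !in_itv/= => /andP[yc y1]; apply/andP; split; lra.
by rewrite hc sub0r => /eqP; rewrite oppr_eq0 => /eqP.
Qed.
End H.

(** The indefinite integral of h vanishes identically, and by Lebesgue differentiation its
    derivative is h almost everywhere. *)
Lemma tb_complete : complete leb `[0, 1] tb.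
Proof.
move=> h hi h0; pose f := h \_ `[0, 1].
have fi : leb.-integrable setT (EFin \o f).
  have := (integrable_mkcond (EFin \o h) (measurable_itv `[0, 1])).1 hi.
  congr (integrable _ _ _); apply/funext => x; rewrite /f /= !patchE; by case: ifP.
have fiy y : leb.-integrable [set` Interval (BLeft 0) (BRight y)] (EFin \o f) by apply: integrableS fi.
have := @FTC1 _ f (BLeft 0) fiy (integrable_locally (measurable_itv `[0, 1]) hi).
have F0 x : 0 < x < 1 -> \int[leb]_(t in `[0, x]) f t = 0.
  move=> x01; rewrite -[RHS](int_0c hi h0 x01); apply: eq_Rintegral => y; rewrite inE/= in_itv/= => /andP[y0 yx].
  by rewrite /f patchE ifT// inE/= in_itv/= y0 (le_trans yx)//; case/andP: x01 => _ /ltW.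
have n01 : {ae leb, forall x : R, x != 0 /\ x != 1}.
  have N (a : R) : {ae leb, forall x : R, x != a}.
    exists [set a]; split => //; first exact: lebesgue_measure_set1.
    by move=> x /= /negP; rewrite negbK => /eqP.
  by apply: (ae2 (N 0) (N 1)) => x h1 h2; split.
move=> dF; apply: (ae2 n01 dF) => x [x0 x1] /= + x01; rewrite in_itv/= in x01.
have xx : 0 < x < 1 by rewrite !lt_neqAle eq_sym x0 x1.
rewrite lte_fin; case/andP: (xx) => x0' _ /(_ x0') [_].
have -> : f x = h x by rewrite /f patchE ifT// inE/= in_itv.
move=> <-; rewrite derive1E; apply: derive_val.
have dc : is_derive (x : R) 1 (cst (0 : R)) 0 by exact: is_derive_cst.
apply: near_eq_is_derive dc => //.
  near=> y; rewrite /= F0//; apply/andP; split; near: y; [apply: lt_nbhsr|apply: lt_nbhsl]; by case/andP: xx.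
Unshelve. all: by end_near. Qed.

End Complete1D.

Lemma trig_per (R : realType) (a : R) (n : int) :
  cos (a + n%:~R * (2 * pi)) = cos a /\ sin (a + n%:~R * (2 * pi)) = sin a.
Proof.
case: n => n.
  elim: n => [|n [IH1 IH2]]; first by rewrite mul0r addr0.
  have -> : a + n.+1%:~R * (2 * pi) = a + n%:~R * (2 * pi) + pi *+ 2.
    by rewrite -[n.+1%:~R]/(n.+1%:R) -natr1 -[n%:~R]/(n%:R) -mulr_natl; ring.
  by rewrite cosD2pi sinD2pi.
rewrite NegzE mulrNz mulNr; elim: n.+1 => [|m [IH1 IH2]]; first by rewrite mul0r subr0.
have -> : a - m.+1%:~R * (2 * pi) = a - m%:~R * (2 * pi) - pi *+ 2.
  by rewrite -[m.+1%:~R]/(m.+1%:R) -natr1 -[m%:~R]/(m%:R) -mulr_natl; ring.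
split; first by rewrite -IH1 -(cosD2pi (_ - pi *+ 2)) subrK.
by rewrite -IH2 -(sinD2pi (_ - pi *+ 2)) subrK.
Qed.

(** * Fourier uniqueness on the three-dimensional torus *)

Section Torus.
Context {R : realType}.
Local Notation K := (int * int * int)%type.
Local Notation leb := (@lebesgue_measure R).
Local Notation leb2 := (@leb2 R).
Local Notation leb3 := (@leb3 R).
Local Notation I01 := (`[0%R, 1%R]%classic : set R).
Local Notation phase := (@phase R).
Implicit Types (k m : K) (x : R * R * R).

Lemma mI01 : measurable I01. Proof. exact: measurable_itv. Qed.
Lemma msquare : measurable (@square R). Proof. exact: measurableX mI01 mI01. Qed.
Lemma mcube : measurable (@cube R). Proof. exact: measurableX msquare mI01. Qed.
Hint Resolve mI01 msquare mcube : core.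

Lemma leb01 : leb I01 = 1%E.
Proof. by rewrite lebesgue_measure_itv/= lte01 sube0. Qed.

Lemma leb2_square : leb2 square = 1%E.
Proof.
transitivity (leb I01 * leb I01)%E; first by apply: product_measure1E; exact: mI01.
by rewrite leb01 mule1.
Qed.

Lemma leb3_cube : leb3 cube = 1%E.
Proof.
transitivity (leb2 square * leb I01)%E; last by rewrite leb01 leb2_square mule1.
by apply: product_measure1E; [exact: msquare|exact: mI01].
Qed.

Lemma leb3_cube_fin : (leb3 cube < +oo)%E. Proof. by rewrite leb3_cube ltry. Qed.
Lemma leb2_square_fin : (leb2 square < +oo)%E. Proof. by rewrite leb2_square ltry. Qed.
Lemma leb01_fin : (leb I01 < +oo)%E. Proof. by rewrite leb01 ltry. Qed.

Lemma phaseD k m x : phase (k + m) x = phase k x + phase m x.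
Proof. by rewrite /Defs.phase /= !intrD; ring. Qed.

Lemma phaseN k x : phase (- k) x = - phase k x.
Proof. by rewrite /Defs.phase /= !mulrNz; ring. Qed.

Lemma phase0 x : phase 0 x = 0.
Proof. by rewrite /Defs.phase /= !mul0r !addr0 mulr0. Qed.

Lemma phase_meas k : measurable_fun setT (phase k).
Proof.
apply: measurable_funM; first exact: measurable_cst.
apply: measurable_funD; first apply: measurable_funD.
- by apply: measurable_funM; [exact: measurable_cst|exact: (measurableT_comp measurable_fst)].
- by apply: measurable_funM; [exact: measurable_cst|exact: (measurableT_comp measurable_snd)].
- by apply: measurable_funM; [exact: measurable_cst|exact: measurable_snd].
Qed.

Lemma cosph_meas k : measurable_fun setT (fun x => cos (phase k x)).
Proof. by apply: (measurableT_comp (f := cos)); [apply: continuous_measurable_fun; exact: continuous_cos|exact: phase_meas]. Qed.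

Lemma sinph_meas k : measurable_fun setT (fun x => sin (phase k x)).
Proof. by apply: (measurableT_comp (f := sin)); [apply: continuous_measurable_fun; exact: continuous_sin|exact: phase_meas]. Qed.

Definition wv (b : bool) k x : R := if b then cos (phase k x) else sin (phase k x).

Lemma wv_meas b k : measurable_fun setT (wv b k).
Proof. by case: b; [exact: cosph_meas|exact: sinph_meas]. Qed.

Lemma wv_le1 b k x : `|wv b k x| <= 1.
Proof. by rewrite /wv; case: b; [exact: cos_le1'|exact: sin_le1']. Qed.

Lemma wvM b m b' k : exists s1 s2 : R, forall x, wv b' k x * wv b m x = s1 * wv (b == b') (k + m) x + s2 * wv (b == b') (k - m) x.
Proof.
case: b; case: b'.
- by exists 2^-1, 2^-1 => x; rewrite /wv /= !phaseD phaseN cosB cosD; field.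
- by exists 2^-1, 2^-1 => x; rewrite /wv /= !phaseD phaseN sinB sinD; field.
- by exists 2^-1, (- 2^-1) => x; rewrite /wv /= !phaseD phaseN sinB sinD; field.
- by exists (- 2^-1), 2^-1 => x; rewrite /wv /= !phaseD phaseN cosB cosD; field.
Qed.

(* The library's canonical sigma-finite structure on [m1 \x m2] is shadowed by the one for subprobabilities. *)
Lemma leb2_sigma_finite : sigma_finite setT leb2.
Proof.
pose J n : set R := `[- n%:R, n%:R]%classic.
have mJ n : measurable (J n) by exact: measurable_itv.
exists (fun n => J n `*` J n).
  apply/seteqP; split=> // -[x y] _.
  pose n := (Num.bound `|x| + Num.bound `|y|)%N.
  have hx : `|x| < n%:R.
    by rewrite (lt_le_trans (archi_boundP (normr_ge0 x)))// ler_nat leq_addr.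
  have hy : `|y| < n%:R.
    by rewrite (lt_le_trans (archi_boundP (normr_ge0 y)))// ler_nat leq_addl.
  by exists n => //; split; rewrite /J /= in_itv/= -ler_norml ltW.
move=> n; split; first exact: (measurableX (mJ n) (mJ n)).
have -> : leb2 (J n `*` J n) = (leb (J n) * leb (J n))%E by apply: product_measure1E; exact: mJ.
have f1 : leb (J n) \is a fin_num.
  by rewrite ge0_fin_numE// lebesgue_measure_itv/=; case: ifP => // _; rewrite -EFinB ltry.
by rewrite -ge0_fin_numE ?mule_ge0// fin_numM.
Qed.

HB.instance Definition _ := Measure.copy leb2 (leb \x leb)%E.
HB.instance Definition _ := Measure_isSigmaFinite.Build _ _ _ leb2 leb2_sigma_finite.
Definition leb2s : {sigma_finite_measure set (measurableTypeR R * measurableTypeR R)%type -> \bar R} := leb2.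

Section Unique.
Variable f : R * R * R -> R.
Hypothesis fi : leb3.-integrable cube (EFin \o f).
Hypothesis f0 : forall b k, \int[leb3]_(x in cube) (f x * wv b k x) = 0.

Let bm (phi : R * R * R -> R) := measurable_fun setT phi /\ exists M, forall x, `|phi x| <= M.

Let bmM phi psi : bm phi -> bm psi -> bm (fun x => phi x * psi x).
Proof.
move=> [c1 [M1 b1]] [c2 [M2 b2]]; split; first exact: measurable_funM.
by exists (M1 * M2) => x; rewrite normrM ler_pM.
Qed.

Let hint phi : bm phi -> leb3.-integrable cube (EFin \o (fun x => f x * phi x)).
Proof. by move=> [c1 [M b]]; apply: (integrable_bddM _ fi _ (M := M)). Qed.

Let bmw b k : bm (wv b k). Proof. by split; [exact: wv_meas|exists 1 => x; exact: wv_le1]. Qed.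

Let ann phi := bm phi /\ forall b k, \int[leb3]_(x in cube) (f x * (phi x * wv b k x)) = 0.

Let annM phi b m : ann phi -> ann (fun x => phi x * wv b m x).
Proof.
move=> [b1 a1]; split; first exact: bmM.
move=> b' k; have [s1 [s2 E]] := wvM b m b' k.
have i1 := hint (bmM b1 (bmw (b == b') (k + m))).
have i2 := hint (bmM b1 (bmw (b == b') (k - m))).
have -> : (fun x => f x * (phi x * wv b m x * wv b' k x)) = 
   (fun x => s1 * (f x * (phi x * wv (b == b') (k + m) x)) + s2 * (f x * (phi x * wv (b == b') (k - m) x))).
  by apply/funext => x; rewrite -mulrA [wv b m x * _]mulrC E; ring.
rewrite RintegralD//; [|exact: integrableZE|exact: integrableZE].
by rewrite !RintegralZl// !a1 !mulr0 addr0.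
Qed.

(** Completeness in three variables asks for orthogonality to products of coordinate waves, whereas
    the hypothesis speaks of waves in k.x. The stable class [ann] connects them: three
    multiplications of the constant 1 by a wave produce every such product. *)
Lemma wave_unique : {ae leb3, forall x, cube x -> f x = 0}.
Proof.
have meas1 : forall i, measurable_fun setT (@tb R i : measurableTypeR R -> R) := @tb_meas R.
have b1 i (y : R) := @tb_le1 R i y.
have c2 := @complete_prod _ _ _ _ _ leb leb I01 I01 mI01 mI01 _ _ _ _ meas1 b1 meas1 b1 (@tb_complete R) (@tb_complete R).
have m2 (ij : (int * bool) * (int * bool)) : measurable_fun setT (fun x : R * R => @tb R ij.1 x.1 * tb ij.2 x.2).
  by apply: measurable_funM; [apply: (measurableT_comp (meas1 _) measurable_fst)|apply: (measurableT_comp (meas1 _) measurable_snd)].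
have b2 (ij : (int * bool) * (int * bool)) (x : R * R) : `|tb ij.1 x.1 * tb ij.2 x.2| <= 1.
  by rewrite normrM -[1]mulr1 ler_pM.
have c3 := @complete_prod _ _ _ _ _ leb2s leb square I01 msquare mI01 _ _ _ _ m2 b2 meas1 b1 c2 (@tb_complete R).
apply: c3 => // -[[[n1 d1] [n2 d2]] [n3 d3]].
have E1 x : tb (n1, d1) x.1.1 = wv d1 (n1, 0, 0) x.
  by rewrite /tb /wv /Defs.phase /= !mul0r !addr0 !mulrA.
have E2 x : tb (n2, d2) x.1.2 = wv d2 (0, n2, 0) x.
  by rewrite /tb /wv /Defs.phase /= !mul0r addr0 add0r !mulrA.
have E3 x : tb (n3, d3) x.2 = wv d3 (0, 0, n3) x.
  by rewrite /tb /wv /Defs.phase /= !mul0r !add0r !mulrA.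
have a1 : ann (fun=> 1).
  split; first by split; [exact: measurable_cst|exists 1 => x; rewrite normr1].
  by move=> b k; under eq_Rintegral do rewrite mul1r; exact: f0.
have [_ /(_ true 0)] := annM d3 (0, 0, n3) (annM d2 (0, n2, 0) (annM d1 (n1, 0, 0) a1)).
by under eq_Rintegral do rewrite {4}/wv phase0 cos0 mulr1 mul1r -E1 -E2 -E3.
Qed.
End Unique.

Lemma fourier_unique f : leb3.-integrable cube (EFin \o f) -> (forall k, fourier f k = 0) ->
  {ae leb3, forall x, cube x -> f x = 0}.
Proof.
move=> fi f0; apply: wave_unique fi _ => b k; have := f0 k; rewrite /fourier /wv => -[h1 /eqP].
by rewrite oppr_eq0 => /eqP h2; case: b.
Qed.

Lemma int01_cos (a : R) (n : int) : 
  \int[leb]_(z in I01) cos (a + 2 * pi * n%:~R * z) = (if n == 0 then cos a else 0) /\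
  \int[leb]_(z in I01) sin (a + 2 * pi * n%:~R * z) = (if n == 0 then sin a else 0).
Proof.
have [->|n0] := eqVneq n 0.
  have e01 : fine (leb I01) = 1 by rewrite leb01.
  split.
    by under eq_Rintegral do rewrite mulr0 mul0r addr0; rewrite Rintegral_cst// e01 mulr1.
  by under eq_Rintegral do rewrite mulr0 mul0r addr0; rewrite Rintegral_cst// e01 mulr1.
set w := 2 * pi * n%:~R.
have w0 : w != 0 by rewrite /w mulf_neq0 ?intr_eq0// mulf_neq0 ?pnatr_eq0// gt_eqF// pi_gt0.
have aff (x : R) : is_derive x 1 (fun s : R => a + w * s) w.
  have := is_derive_affine a w (is_derive_id x 1); by rewrite mulr1.
have ca : continuous (fun s : R => a + w * s) by move=> x; exact: is_derive_cts (aff x).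
have cper : cos (a + w) = cos a /\ sin (a + w) = sin a.
  have -> : w = n%:~R * (2 * pi) by rewrite /w; ring.
  exact: trig_per.
split.
  have := @ig_FTC2 _ (fun z => cos (a + w * z)) (fun z => 0 + w^-1 * sin (a + w * z)) 1.
  rewrite /ig !mulr1 !mulr0 !addr0 !add0r cper.2 subrr => h.
  apply: h => //.
  - by move=> x; apply: (@continuous_comp _ _ _ (fun s => a + w * s) cos x); [exact: ca|exact: continuous_cos].
  - move=> x _; have h1 := @is_derive1_comp _ sin (fun s => a + w * s) x _ _ (is_derive_sin _) (aff x).
    by have := is_derive_affine 0 w^-1 h1; rewrite [cos _ * w]mulrC mulKf.
  - apply: cts_within => x; apply: cvgD; first exact: cvg_cst.
    by apply: cvgMr; apply: (@continuous_comp _ _ _ (fun s => a + w * s) sin x); [exact: ca|exact: continuous_sin].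
have := @ig_FTC2 _ (fun z => sin (a + w * z)) (fun z => 0 + (- w^-1) * cos (a + w * z)) 1.
rewrite /ig !mulr1 !mulr0 !addr0 !add0r cper.1 subrr => h.
apply: h => //.
- by move=> x; apply: (@continuous_comp _ _ _ (fun s => a + w * s) sin x); [exact: ca|exact: continuous_sin].
- move=> x _; have h1 := @is_derive1_comp _ cos (fun s => a + w * s) x _ _ (is_derive_cos _) (aff x).
  have := is_derive_affine 0 (- w^-1) h1.
  by have -> : - w^-1 * (- sin (a + w * x) * w) = sin (a + w * x) by field.
- apply: cts_within => x; apply: cvgD; first exact: cvg_cst.
  by apply: cvgMr; apply: (@continuous_comp _ _ _ (fun s => a + w * s) cos x); [exact: ca|exact: continuous_cos].
Qed.

End Torus.

(** Carathéodory functions are jointly measurable: the second variable is rounded down to multiples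
    of 1/(n+1), which gives countable gluings of measurable sections converging pointwise to g.
    Continuous functions of several variables are thereby measurable for the product
    sigma-algebra. *)
Lemma meas_carat d (T : measurableType d) (R : realType) (g : T * R -> R) :
  (forall y : R, measurable_fun setT (fun x => g (x, y))) -> (forall x, continuous (fun y : R => g (x, y))) ->
  measurable_fun setT (g : T * measurableTypeR R -> R).
Proof.
move=> mg cg.
pose fl n (y : R) : int := Num.floor (n.+1%:R * y).
pose gn n (x : T * measurableTypeR R) : R := g (x.1, (fl n x.2)%:~R / n.+1%:R).
have flm n (j : int) : measurable ([set y | fl n y = j] : set (measurableTypeR R)).
  rewrite (_ : [set y | _] = `[j%:~R / n.+1%:R, (j + 1)%:~R / n.+1%:R[%classic); first exact: measurable_itv.
  have n0 : (0 : R) < n.+1%:R by rewrite ltr0n.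
  apply/seteqP; split=> y /=; rewrite in_itv/= ler_pdivrMr// ltr_pdivlMr// [y * _]mulrC.
    by move=> <-; rewrite floor_le_tmp floorD1_gt.
  by move=> /andP[h1 h2]; apply/floor_def; rewrite h1.
apply: (@measurable_fun_cvg _ (T * measurableTypeR R)%type _ _ gn).
- move=> n _ U mU; rewrite setTI.
  have -> : gn n @^-1` U = \bigcup_(j : int) ([set x | U (g (x, j%:~R / n.+1%:R))] `*` [set y | fl n y = j]).
    apply/seteqP; split=> [[x y] Uxy|[x y] [j _ [/= h h2]]]; last by rewrite /gn /= h2.
    by exists (fl n y) => //; split.
  apply: countable_bigcupT_measurable => // j; apply: measurableX => //.
  by have := mg (j%:~R / n.+1%:R) measurableT _ mU; rewrite setTI.
- move=> [x y] _ /=; apply: (cvg_comp (fun n => (fl n y)%:~R / n.+1%:R) (fun s : R => g (x, s))); last exact: cg.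
  apply/cvgrPdist_le => e e0; near=> n.
  have n0 : (0 : R) < n.+1%:R by rewrite ltr0n.
  have -> : y - (fl n y)%:~R / n.+1%:R = (n.+1%:R * y - (fl n y)%:~R) / n.+1%:R by field.
  have /andP[h1 h2] := floor_itv (n.+1%:R * y).
  have a1 : `|n.+1%:R * y - (fl n y)%:~R| <= 1.
    rewrite ger0_norm; last by rewrite subr_ge0.
    by rewrite lerBlDl ltW// -intrD1.
  have hn : e^-1 <= n.+1%:R.
    near: n; exists (Num.bound e^-1) => // n /= hn.
    have e1 : 0 <= e^-1 by rewrite invr_ge0 ltW.
    by apply/ltW/(lt_le_trans (archi_boundP e1)); rewrite ler_nat ltnW.
  rewrite normrM normfV (ger0_norm (ltW n0)) ler_pdivrMr// (le_trans a1)// mulrC.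
  by rewrite -ler_pdivrMr// mul1r.
Unshelve. all: by end_near.
Qed.

(** * Continuous periodic functions and their integrals *)

Section Torus2.
Context {R : realType}.
Local Notation leb := (@lebesgue_measure R).
Local Notation leb2 := (@leb2 R).
Local Notation leb3 := (@leb3 R).
Local Notation I01 := (`[0%R, 1%R]%classic : set R).
Local Notation phase := (@phase R).
Local Notation T2 := (measurableTypeR R * measurableTypeR R)%type.
Hint Resolve mI01 msquare mcube : core.

Lemma pair1_cts (U V : topologicalType) (y : V) : continuous (fun x : U => (x, y)).
Proof. by move=> s; apply: (@cvg_pair _ _ _ (nbhs s) (nbhs s) (nbhs y) _ _ _ id (fun=> y)); [exact: cvg_id|exact: cvg_cst]. Qed.

Lemma pair2_cts (U V : topologicalType) (x : U) : continuous (fun y : V => (x, y)).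
Proof. by move=> s; apply: (@cvg_pair _ _ _ (nbhs s) (nbhs x) (nbhs s) _ _ _ (fun=> x) id); [exact: cvg_cst|exact: cvg_id]. Qed.

Lemma slice1_cts (g : R * R -> R) (y : R) : continuous g -> continuous (fun s : R => g (s, y)).
Proof. by move=> cg s; apply: (continuous_comp (f := fun s : R => (s, y)) (g := g)); [exact: pair1_cts|exact: cg]. Qed.

Lemma slice2_cts (U : topologicalType) (g : U * R -> R) (x : U) : continuous g -> continuous (fun s : R => g (x, s)).
Proof. by move=> cg s; apply: (continuous_comp (f := fun s : R => (x, s)) (g := g)); [exact: pair2_cts|exact: cg]. Qed.

Lemma cts2_meas (g : R * R -> R) : continuous g -> measurable_fun setT (g : T2 -> R).
Proof.
move=> cg; apply: (@meas_carat _ (measurableTypeR R)) => y; last exact: slice2_cts.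
by apply: continuous_measurable_fun; exact: slice1_cts.
Qed.

Lemma cts3_meas (g : R * R * R -> R) : continuous g -> measurable_fun setT (g : T2 * measurableTypeR R -> R).
Proof.
move=> cg; apply: (@meas_carat _ T2) => y; last by move=> *; exact: slice2_cts.
apply: cts2_meas => x; apply: (continuous_comp (f := fun x : R * R => (x, y)) (g := g)); last exact: cg.
exact: pair1_cts.
Qed.

Lemma square_compact : compact (@square R).
Proof. by apply: compact_setX; exact: segment_compact. Qed.

Lemma cube_compact : compact (@cube R).
Proof. by apply: compact_setX; [exact: square_compact|exact: segment_compact]. Qed.

Lemma cts_bdd (U : topologicalType) (D : set U) (g : U -> R) : compact D -> continuous g -> exists M, forall x, D x -> `|g x| <= M.
Proof.
move=> cD cg; have /compact_bounded := continuous_compact (continuous_subspaceT cg) cD.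
move=> [M [_ hM]]; exists (M + 1) => x Dx; apply: hM; last by exists x.
by rewrite ltrDl.
Qed.

Lemma cts2_int (g : R * R -> R) : continuous g -> leb2.-integrable square (EFin \o g).
Proof.
move=> cg; have [M hM] := cts_bdd square_compact cg.
apply: (@bounded_integrable _ _ _ leb2 _ _ M) => //; [exact: msquare|exact: leb2_square_fin|].
by apply: measurable_funTS; exact: cts2_meas.
Qed.

Lemma cts3_int (g : R * R * R -> R) : continuous g -> leb3.-integrable cube (EFin \o g).
Proof.
move=> cg; have [M hM] := cts_bdd cube_compact cg.
apply: (@bounded_integrable _ _ _ leb3 _ _ M) => //; [exact: mcube|exact: leb3_cube_fin|].
by apply: measurable_funTS; exact: cts3_meas.
Qed.

Lemma fubini3 (f : R * R * R -> R) : leb3.-integrable cube (EFin \o f) ->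
  [/\ {ae leb2, forall y, square y -> leb.-integrable I01 (fun z => (f (y, z))%:E)},
     leb2.-integrable square (fun y => (\int[leb]_(z in I01) f (y, z))%:E) &
     \int[leb3]_(x in cube) f x = \int[leb2]_(y in square) \int[leb]_(z in I01) f (y, z)].
Proof. by move=> fi; exact: (@fubini_set _ _ _ _ _ leb2s leb _ _ msquare mI01 f fi). Qed.

Lemma fubini2 (f : R * R -> R) : leb2.-integrable square (EFin \o f) ->
  [/\ {ae leb, forall y, I01 y -> leb.-integrable I01 (fun z => (f (y, z))%:E)},
     leb.-integrable I01 (fun y => (\int[leb]_(z in I01) f (y, z))%:E) &
     \int[leb2]_(y in square) f y = \int[leb]_(s in I01) \int[leb]_(z in I01) f (s, z)].
Proof. by move=> fi; exact: (@fubini_set _ _ _ _ _ leb leb _ _ mI01 mI01 f fi). Qed.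

Lemma int01_cst (c : R) : \int[leb]_(z in I01) c = c.
Proof. rewrite Rintegral_cst//; have -> : fine (leb I01) = 1 :> R by rewrite leb01.
by rewrite mulr1. Qed.

Lemma lift_int (h : R * R -> R) : leb3.-integrable cube (EFin \o lift3 h) ->
  leb2.-integrable square (EFin \o h) /\ \int[leb3]_(x in cube) lift3 h x = \int[leb2]_(y in square) h y.
Proof.
move=> hi; have [_ i2 ->] := fubini3 hi.
have E : (fun y => \int[leb]_(z in I01) lift3 h (y, z)) = h.
  by apply/funext => y; rewrite /lift3 /= int01_cst.
by split; [move: i2; under eq_fun do rewrite /lift3 /= int01_cst|rewrite E].
Qed.

Lemma ae_lift (P : R * R -> Prop) : {ae leb2, forall y, P y} -> {ae leb3, forall x, P x.1}.
Proof.
move=> [N [mN N0 PN]]; exists (N `*` setT); split; first exact: measurableX.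
  have -> : leb3 (N `*` setT) = (leb2 N * leb setT)%E by apply: product_measure1E.
  by rewrite N0 mul0e.
by move=> x Px; split => //; apply: PN.
Qed.

Lemma periodic3Z (f : R * R * R -> R) (n1 n2 n3 : int) x : periodic3 f ->
  f (x.1.1 + n1%:~R, x.1.2 + n2%:~R, x.2 + n3%:~R) = f x.
Proof.
move=> pf.
have H (g : R -> R) : (forall s, g (s + 1) = g s) -> forall (n : int) s, g (s + n%:~R) = g s.
  move=> pg; have Hn (n : nat) s : g (s + n%:R) = g s.
    by elim: n => [|n IH]; rewrite ?addr0// -natr1 addrA pg.
  by case=> n s; [exact: Hn|rewrite NegzE mulrNz -{2}(subrK n.+1%:R s) Hn].
rewrite (H (fun s => f (x.1.1 + n1%:~R, x.1.2 + n2%:~R, s))); last first.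
  by move=> s; have [_ _] := pf (x.1.1 + n1%:~R, x.1.2 + n2%:~R, s).
rewrite (H (fun s => f (x.1.1 + n1%:~R, s, x.2))); last by move=> s; have [_ + _] := pf (x.1.1 + n1%:~R, s, x.2).
rewrite (H (fun s => f (s, x.1.2, x.2))); first by case: x => -[].
by move=> s; have [+ _ _] := pf (s, x.1.2, x.2).
Qed.

(** By periodicity a point of disagreement may be taken in [0, 1[^3. A small box extending from it
    in the increasing directions stays inside the cube and inside the exceptional set, although its
    volume d^3 is positive. *)
Lemma cts_ae_eq (f g : R * R * R -> R) : continuous f -> continuous g -> periodic3 f -> periodic3 g ->
  {ae leb3, forall x, cube x -> f x = g x} -> f = g.
Proof.
move=> cf cg pf pg [N [mN N0 PN]].
suff H x : 0 <= x.1.1 < 1 -> 0 <= x.1.2 < 1 -> 0 <= x.2 < 1 -> f x = g x.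
  apply/funext => x.
  have fr (s : R) : 0 <= s + (- Num.floor s)%:~R < 1.
    by rewrite mulrNz subr_ge0 floor_le_tmp ltrBlDl -intrD1 floorD1_gt.
  rewrite -(periodic3Z (- Num.floor x.1.1) (- Num.floor x.1.2) (- Num.floor x.2) x pf).
  by rewrite -(periodic3Z (- Num.floor x.1.1) (- Num.floor x.1.2) (- Num.floor x.2) x pg); apply: H; exact: fr.
case: x => -[x1 x2] x3 /= /andP[a1 b1] /andP[a2 b2] /andP[a3 b3].
apply: contrapT => fg.
have d0 : 0 < `|f (x1, x2, x3) - g (x1, x2, x3)| by rewrite normr_gt0 subr_eq0; apply/eqP.
have cd : continuous (fun x => f x - g x) by move=> x; apply: cvgB; [exact: cf|exact: cg].
have := cd (x1, x2, x3) => /cvgrPdist_lt /(_ _ d0) [[V W] [/= [[V1 V2] [/= hV1 hV2] VV] hW] VW].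
have [e1 /= e10 B1] := hV1; have [e2 /= e20 B2] := hV2; have [e3 /= e30 B3] := hW.
have [d dp [d1 d2]] : exists2 d, 0 < d & (forall s y e, (y, e) \in [:: (x1, e1); (x2, e2); (x3, e3)] -> y <= s <= y + d -> `|y - s| < e) /\
   [/\ x1 + d <= 1, x2 + d <= 1 & x3 + d <= 1].
  pose m := Num.min (Num.min (Num.min e1 (1 - x1)) (Num.min e2 (1 - x2))) (Num.min e3 (1 - x3)).
  have m0 : 0 < m by rewrite /m !lt_min e10 e20 e30 !subr_gt0 b1 b2 b3.
  have : m <= m by []; rewrite {2}/m !le_min => /andP[/andP[/andP[m1 m2] /andP[m3 m4]] /andP[m5 m6]].
  exists (m / 2); first by rewrite divr_gt0.
  split; first last.
    by clear -m1 m2 m3 m4 m5 m6 m0; split; lra.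
  move=> s y e; rewrite !inE => /or3P[]/eqP[-> ->] /andP[s1 s2]; clear -s1 s2 m1 m2 m3 m4 m5 m6 m0; rewrite ler0_norm; lra.
pose S := (`[x1, x1 + d]%classic `*` `[x2, x2 + d]%classic `*` `[x3, x3 + d]%classic) : set (R * R * R).
have mi (a : R) : measurable (`[a, a + d]%classic : set (measurableTypeR R)) by exact: measurable_itv.
have SN : S `<=` N.
  move=> -[[s1 s2] s3] [[/= ]]; rewrite !in_itv/= => h1 h2 h3; apply: PN => /= H.
  have : (V `*` W) (s1, s2, s3).
    split => /=; last by apply: B3 => /=; apply: (d1 s3) h3; rewrite !inE eqxx !orbT.
    apply: VV; split => /=; first by apply: B1 => /=; apply: (d1 s1) h1; rewrite !inE eqxx.
    by apply: B2 => /=; apply: (d1 s2) h2; rewrite !inE eqxx orbT.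
  move=> /VW /=; rewrite H ?subrr ?subr0 ?ltxx//.
  have itv (a s : R) : 0 <= a -> a + d <= 1 -> a <= s <= a + d -> 0 <= s <= 1.
    by move=> h01 h02 /andP[h03 h04]; rewrite (le_trans h01 h03) (le_trans h04 h02).
  by case: d2 => q1 q2 q3; split; [split|] => /=; rewrite in_itv/=; [apply: itv h1|apply: itv h2|apply: itv h3].
have : leb3 S = (leb `[x1, (x1 + d)%R] * leb `[x2, (x2 + d)%R] * leb `[x3, (x3 + d)%R])%E.
  transitivity (leb2 (`[x1, (x1 + d)%R]%classic `*` `[x2, (x2 + d)%R]%classic) * leb `[x3, (x3 + d)%R])%E.
    by apply: product_measure1E; [exact: measurableX|exact: mi].
  by congr (_ * _)%E; apply: product_measure1E; exact: mi.
have len (a : R) : leb `[a, (a + d)%R] = d%:E.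
  by rewrite lebesgue_measure_itv/= lte_fin ltrDl dp -EFinB addrAC subrr add0r.
rewrite !len -!EFinM => S0.
have : (leb3 S <= leb3 N)%E by apply: le_measure; rewrite ?inE//; apply: measurableX; [apply: measurableX; exact: mi|exact: mi].
by rewrite N0 S0 lee_fin leNgt !mulr_gt0.
Qed.

Lemma refl_leb (A : set (measurableTypeR R)) : measurable A ->
  pushforward leb (fun z : measurableTypeR R => (1 - z : measurableTypeR R)) A = leb A.
Proof.
have mph : measurable_fun setT (fun z : measurableTypeR R => (1 - z : measurableTypeR R)).
  by apply: measurable_funB; [exact: measurable_cst|exact: measurable_id].
move=> mA; apply/esym/lebesgue_measure_unique => //= _ [[a b]] _ <-.
rewrite /pushforward.
have -> : (fun z : measurableTypeR R => (1 - z : measurableTypeR R)) @^-1` [set` `]a, b]] = `[1 - b, 1 - a[%classic.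
  by apply/seteqP; split=> z /=; rewrite !in_itv/= => /andP[h1 h2]; apply/andP; split; lra.
rewrite !lebesgue_measure_itv/= !lte_fin ltrD2l ltrN2 -!EFinB.
by case: ifP => // _; congr EFin; ring.
Qed.

Lemma int01_refl (h : R -> R) : leb.-integrable I01 (EFin \o h) ->
  \int[leb]_(z in I01) h (1 - z) = \int[leb]_(z in I01) h z.
Proof.
move=> hi; pose g : measurableTypeR R -> \bar R := (EFin \o h) \_ I01.
have gi : leb.-integrable setT g by apply/(@integrable_mkcond _ (measurableTypeR R) R leb _ _ mI01).
pose ph := (fun z : measurableTypeR R => (1 - z : measurableTypeR R)).
have mph : measurable_fun setT ph.
  by apply: measurable_funB; [exact: measurable_cst|exact: measurable_id].
have mg : measurable_fun setT g by exact: measurable_int gi.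
have eq_push (f : measurableTypeR R -> \bar R) : (\int[pushforward leb ph]_y f y = \int[leb]_y f y)%E.
  by apply: eq_measure_integral => A mA _; exact: refl_leb.
have gpi : leb.-integrable (ph @^-1` setT) (g \o ph).
  rewrite preimage_setT; apply/integrableP; split; first exact: measurableT_comp.
  have [_] := integrableP _ _ _ gi; apply: le_lt_trans.
  rewrite -(eq_push (fun y => `|g y|%E)) (ge0_integral_pushforward mph)//; last exact: measurableT_comp.

have := @integral_pushforward _ _ _ _ _ _ mph leb setT g mg gpi measurableT.
rewrite eq_push preimage_setT /Rintegral => E; congr fine.
rewrite [RHS]integral_mkcond -/g E [LHS]integral_mkcond; apply: eq_integral => z _.
rewrite /g /patch /=; congr (if _ then _ else _).
have q (s : R) : (0 <= s <= 1) = (0 <= 1 - s <= 1) by apply/idP/idP => /andP[h1 h2]; apply/andP; split; lra.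
by apply/idP/idP; rewrite !inE /= !in_itv/=; rewrite (q z).
Qed.


Lemma phase_z k (y : R * R) (z : R) : phase k (y, z) = phase (k.1, 0) (y, 0) + 2 * pi * k.2%:~R * z.
Proof. by rewrite /Defs.phase /=; ring. Qed.

Lemma wv_int b k : \int[leb3]_(x in cube) wv b k x = (b && (k == 0))%:R.
Proof.
have bi (D : set (R * R * R)) : measurable (D : set (T2 * measurableTypeR R)) -> (leb3 D < +oo)%E -> leb3.-integrable D (EFin \o wv b k).
  move=> mD fD; apply: (bounded_integrable (M := 1)) => //; first by apply: measurable_funTS; exact: wv_meas.
  by move=> *; exact: wv_le1.
have [_ _ ->] := fubini3 (bi _ mcube leb3_cube_fin).
have E (y : R * R) : \int[leb]_(z in I01) wv b k (y, z) = if k.2 == 0 then wv b (k.1, 0) (y, 0) else 0.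
  have [h1 h2] := int01_cos (phase (k.1, 0) (y, 0)) k.2.
  by rewrite /wv; case: (b); under eq_Rintegral do rewrite phase_z; rewrite ?h1 ?h2.
under eq_Rintegral do rewrite E.
case: k E bi => -[k1 k2] k3 _ _ /=; have [->|k30] := eqVneq k3 0; last first.
  rewrite Rintegral_cst//; last exact: msquare.
  by rewrite mul0r !xpair_eqE (negbTE k30) !andbF.
have c2 : continuous (fun y : R * R => wv b (k1, k2, 0) (y, 0)).
  have cp : continuous (fun y : R * R => phase (k1, k2, 0) (y, 0)).
    rewrite (_ : (fun y : R * R => _) = (fun y => 2 * pi * k1%:~R * y.1 + 2 * pi * k2%:~R * y.2)).
      by move=> y; apply: cvgD; apply: cvgMr; [exact: cvg_fst|exact: cvg_snd].
    by apply/funext => y; rewrite /Defs.phase /=; ring.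
  move=> y; rewrite /wv; case: (b).
    by apply: (@continuous_comp _ _ _ (fun y : R * R => phase (k1, k2, 0) (y, 0)) cos y); [exact: cp|exact: continuous_cos].
  by apply: (@continuous_comp _ _ _ (fun y : R * R => phase (k1, k2, 0) (y, 0)) sin y); [exact: cp|exact: continuous_sin].
have [_ _ ->] := fubini2 (cts2_int c2).
have E2 (s : R) : \int[leb]_(z in I01) wv b (k1, k2, 0) ((s, z), 0) = if k2 == 0 then wv b (k1, 0, 0) (s, 0, 0) else 0.
  have [h1 h2] := int01_cos (phase (k1, 0, 0) (s, 0, 0)) k2.
  have pE (z : R) : phase (k1, k2, 0) (s, z, 0) = phase (k1, 0, 0) (s, 0, 0) + 2 * pi * k2%:~R * z by rewrite /Defs.phase /=; ring.
  by rewrite /wv; case: (b); under eq_Rintegral do rewrite pE; rewrite ?h1 ?h2.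
under eq_Rintegral do rewrite E2.
have [->|k20] := eqVneq k2 0; last by rewrite int01_cst !xpair_eqE (negbTE k20) !andbF.
have [h1 h2] := @int01_cos R 0 k1.
have pE (z : R) : phase (k1, 0, 0) (z, 0, 0) = 0 + 2 * pi * k1%:~R * z by rewrite /Defs.phase /=; ring.
rewrite /wv; case: (b); under eq_Rintegral do rewrite pE; rewrite ?h1 ?h2 ?cos0 ?sin0 !xpair_eqE !eqxx !andbT.
  by case: ifP.
by case: ifP.
Qed.

(** The reflection used is z -> 1 - z, which preserves the fundamental domain; by periodicity it
    acts on [f] and on the phases as z -> -z. *)
Lemma fourier_even (f : R * R * R -> R) k : leb3.-integrable cube (EFin \o f) -> periodic3 f -> even_z f ->
  fourier f (k.1, - k.2) = fourier f k.
Proof.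
move=> fi pf ef.
suff H b : \int[leb3]_(x in cube) (f x * wv b (k.1, - k.2) x) = \int[leb3]_(x in cube) (f x * wv b k x).
  by rewrite /fourier; have := H true; have := H false; rewrite /wv => -> ->.
have ii m : leb3.-integrable cube (fun x => (f x * wv b m x)%:E).
  apply: (integrable_bddM _ fi _ (M := 1)) => [||x]; [exact: mcube|exact: wv_meas|exact: wv_le1].
have i1 := ii (k.1, - k.2); have i2 := ii k.
have [a1 j1 ->] := fubini3 i1; have [a2 j2 ->] := fubini3 i2.
congr fine; apply: ae_eq_integral; [exact: msquare|exact: measurable_int j1|exact: measurable_int j2|].
apply: (ae1 a1) => y h Sy; congr EFin.
rewrite -(int01_refl (h Sy)); apply: eq_Rintegral => z _ /=; congr (_ * _).
  by have [_ _ h1] := pf (y, - z); rewrite -(ef (y, z)) -h1 /= addrC.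
have [c1 s1] : cos (phase (k.1, - k.2) (y, 1 - z)) = cos (phase k (y, z)) /\ sin (phase (k.1, - k.2) (y, 1 - z)) = sin (phase k (y, z)).
  have -> : phase (k.1, - k.2) (y, 1 - z) = phase k (y, z) + (- k.2)%:~R * (2 * pi).
    by rewrite /Defs.phase /= mulrNz; ring.
  exact: trig_per.
by rewrite /wv c1 s1.
Qed.

Lemma int01_derive (g : R -> R) : (forall s, derivable g s 1) -> continuous (derive1 g) -> g 1 = g 0 ->
  \int[leb]_(s in I01) derive1 g s = 0.
Proof.
move=> dg cg g10; have := @ig_FTC2 _ (derive1 g) g 1 cg; rewrite /ig g10 subrr; apply => //.
  by move=> x _; split => //; rewrite derive1E.
by apply: cts_within => x; apply/differentiable_continuous; rewrite -derivable1_diffP.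
Qed.

Lemma Rint_fin (f : R -> R) : leb.-integrable I01 (EFin \o f) ->
  (\int[leb]_(s in I01) (f s)%:E = (\int[leb]_(s in I01) f s)%:E)%E.
Proof. by move=> fi; rewrite /Rintegral fineK//; exact: integrable_fin_num. Qed.

Lemma int_dx2 (G : R * R -> R) : periodic2 G -> (forall y, derivable (fun s : R => G (y.1, s)) y.2 1) ->
  continuous (dx2 G) -> \int[leb2]_(y in square) dx2 G y = 0.
Proof.
move=> pG dG cG; have [_ _ ->] := fubini2 (cts2_int cG).
rewrite -[RHS](int01_cst 0); apply: eq_Rintegral => s _.
have := @int01_derive (fun z => G (s, z)); apply.
- by move=> z; exact: (dG (s, z)).
- exact: (@slice2_cts _ (dx2 G) s cG).
- by have [_] := pG (s, 0); rewrite /= add0r.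
Qed.

(** Here the differentiated variable is the outer one of the iterated integral, so the order of
    integration is exchanged before the fundamental theorem can be applied. *)
Lemma int_dx1 (G : R * R -> R) : periodic2 G -> (forall y, derivable (fun s : R => G (s, y.2)) y.1 1) ->
  continuous (dx1 G) -> \int[leb2]_(y in square) dx1 G y = 0.
Proof.
move=> pG dG cG; have gi := cts2_int cG.
have [_ _ E] := fubini2 gi; rewrite E.
have hi : leb2.-integrable setT (fun y : T2 => ((EFin \o dx1 G) \_ square) y).
  by apply/(@integrable_mkcond _ T2 R leb2 _ _ msquare).
have F := @Fubini _ _ (measurableTypeR R) (measurableTypeR R) R leb leb _ hi.
have gE (s z : R) : ((EFin \o dx1 G) \_ square) (s, z) = if (s \in I01) && (z \in I01) then (dx1 G (s, z))%:E else 0%E.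
  rewrite /patch /=; congr (if _ then _ else _).
  by apply/idP/andP; [rewrite inE => -[h1 h2]; split; rewrite inE|rewrite !inE => -[h1 h2]; split].
have ci1 (s : R) : leb.-integrable I01 (fun z => (dx1 G (s, z))%:E) := cts_integrable _ _ (@slice2_cts _ (dx1 G) s cG).
have ci2 (z : R) : leb.-integrable I01 (fun s => (dx1 G (s, z))%:E) := cts_integrable _ _ (@slice1_cts (dx1 G) z cG).
have A1 : (\int[leb]_s \int[leb]_z ((EFin \o dx1 G) \_ square) (s, z) =
    \int[leb]_(s in I01) (\int[leb]_(z in I01) dx1 G (s, z))%:E)%E.
  rewrite [RHS]integral_mkcond; apply: eq_integral => s _.
  rewrite [RHS]/patch; case: ifPn => sI; last first.
    by apply: integral0_eq => z _; rewrite gE (negbTE sI).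
  rewrite /Rintegral fineK; last by apply: integrable_fin_num; [exact: mI01|exact: ci1].
  by rewrite [RHS]integral_mkcond; apply: eq_integral => z _; rewrite gE sI.
have A2 : (\int[leb]_z \int[leb]_s ((EFin \o dx1 G) \_ square) (s, z) = 0)%E.
  apply: integral0_eq => z _; have [zI|zI] := boolP (z \in I01); last first.
    by apply: integral0_eq => s _; rewrite gE (negbTE zI) andbF.
  transitivity (\int[leb]_(s in I01) (dx1 G (s, z))%:E)%E.
    by rewrite [RHS]integral_mkcond; apply: eq_integral => s _; rewrite gE zI andbT.
  transitivity ((\int[leb]_(s in I01) dx1 G (s, z))%:E).
    exact: (Rint_fin (ci2 z)).
  congr EFin; have := @int01_derive (fun s => G (s, z)); apply.
  - by move=> s; exact: (dG (s, z)).
  - exact: (@slice1_cts (dx1 G) z cG).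
  - by have [+ _] := pG (0, z); rewrite /= add0r.
by rewrite /Rintegral -[X in fine X]A1 F A2.
Qed.

End Torus2.

Lemma ge0_int0_ae d (T : measurableType d) (R : realType) (mu : {measure set T -> \bar R}) (D : set T) (f : T -> R) :
  measurable D -> mu.-integrable D (EFin \o f) -> (forall x, D x -> 0 <= f x) -> \int[mu]_(x in D) f x = 0 ->
  {ae mu, forall x, D x -> f x = 0}.
Proof.
move=> mD fi f0 i0; have : (\int[mu]_(x in D) `|(f x)%:E| = 0)%E.
  transitivity (\int[mu]_(x in D) (f x)%:E)%E.
    by apply: eq_integral => x; rewrite inE => Dx /=; rewrite ger0_norm// f0.
  by have /fineK <- := integrable_fin_num mD fi; rewrite -[X in _ = X]/(0%R%:E) -i0.
move/(ae_eq_integral_abs _ mD (measurable_int _ fi)) => ae.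
by apply: (ae1 ae) => x + Dx => /(_ Dx) [].
Qed.

(** * Derivatives in one variable *)

Section Derive.
Context {R : realType}.

Lemma derivable_is (f : R -> R) (s : R) : derivable f s 1 -> is_derive s 1 f (derive1 f s).
Proof. by move=> d; split=> //; rewrite derive1E. Qed.

Lemma is_derive_1 (f : R -> R) (s d : R) : is_derive s 1 f d -> derivable f s 1 /\ derive1 f s = d.
Proof. by move=> h; split; [case: h|rewrite derive1E; exact: derive_val]. Qed.

Lemma derivable_cts (f : R -> R) : (forall s, derivable f s 1) -> continuous f.
Proof. by move=> d s; exact: (is_derive_cts (derivable_is (d s))). Qed.

Lemma lip_derive (f : R -> R) (M a b : R) : (forall s, derivable f s 1) ->
  (forall s, `|s - a| <= `|b - a| -> `|derive1 f s| <= M) -> `|f b - f a| <= M * `|b - a|.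
Proof.
move=> df fM.
have cw D : {within D, continuous f} by apply: cts_within => x; exact: derivable_cts.
have [ab|ba] := leP a b.
  have [c] := MVT_segment ab (fun s _ => derivable_is (df s)) (cw _).
  rewrite in_itv/= => /andP[c1 c2] ->; rewrite normrM ler_wpM2r//; apply: fM.
  by rewrite !ger0_norm ?subr_ge0// lerB.
have [c] := MVT_segment (ltW ba) (fun s _ => derivable_is (df s)) (cw _).
rewrite in_itv/= => /andP[c1 c2] E; rewrite (distrC (f b)) E normrM (distrC b a) ler_wpM2r//; apply: fM.
by rewrite !ler0_norm ?subr_le0// ?(ltW ba)// !opprB lerB.
Qed.

Lemma derive1_per (f : R -> R) : (forall s, derivable f s 1) -> (forall s, f (s + 1) = f s) ->
  forall s, derive1 f (s + 1) = derive1 f s.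
Proof.
move=> df pf s; have a1 : is_derive s 1 (fun s : R => 1 + 1 * s) 1.
  by have := is_derive_affine 1 1 (is_derive_id s 1); rewrite mulr1.
have e : s + 1 = 1 + 1 * s by rewrite mul1r addrC.
have d1 : is_derive (1 + 1 * s) 1 f (derive1 f (s + 1)) by rewrite -e; exact: derivable_is.
have := @is_derive1_comp _ f (fun s : R => 1 + 1 * s) s _ _ d1 a1; rewrite mulr1.
have -> : f \o (fun s : R => 1 + 1 * s) = f by apply/funext => t /=; rewrite mul1r addrC pf.
by case/is_derive_1.
Qed.

End Derive.

(** * Uniqueness for the periodic Poisson problem *)

Section InverseLaplacian.
Context {R : realType}.
Local Notation leb2 := (@leb2 R).
Local Notation leb3 := (@leb3 R).
Implicit Types (g p q : R * R -> R).

(** [classC] requires continuity only at the last order of differentiation, so lower orders must be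
    recovered: the partial derivatives are locally bounded and the mean value theorem is used along
    the two coordinate directions. *)
Lemma C1_cts g : (forall y, derivable (fun s : R => g (s, y.2)) y.1 1 /\ derivable (fun s : R => g (y.1, s)) y.2 1) ->
  continuous (dx1 g) -> continuous (dx2 g) -> continuous g.
Proof.
move=> dg c1 c2 [x0 y0]; apply/cvgrPdist_le => e e0.
have [A1 A2] := (c1 (x0, y0), c2 (x0, y0)).
have loc (h : R * R -> R) : {for (x0, y0), continuous h} -> exists2 d : R, 0 < d & forall x y, `|x - x0| < d -> `|y - y0| < d -> `|h (x, y)| <= `|h (x0, y0)| + 1.
  move=> /cvgrPdist_lt /(_ _ ltr01) [[V W] [/= [e1 /= e10 B1] [e2 /= e20 B2]] VW].
  exists (Num.min e1 e2); first by rewrite lt_min e10.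
  move=> x y; rewrite !lt_min => /andP[h1 _] /andP[_ h2].
  have /= : `|h (x0, y0) - h (x, y)| < 1.
    by apply: (VW (x, y)); split => /=; [apply: B1|apply: B2]; rewrite /= distrC.
  move=> h3; rewrite -{1}(subrK (h (x0, y0)) (h (x, y))) addrC (le_trans (ler_normD _ _))// lerD2l distrC ltW//.
have [d1 d10 D1] := loc _ A1; have [d2 d20 D2] := loc _ A2.
set M := `|dx1 g (x0, y0)| + 1 in D1; set N := `|dx2 g (x0, y0)| + 1 in D2.
have M0 : 0 < M by apply: ltr_wpDl; [exact: normr_ge0|exact: ltr01].
have N0 : 0 < N by apply: ltr_wpDl; [exact: normr_ge0|exact: ltr01].
have MN0 : 0 < M + N by exact: addr_gt0.
clearbody M N.
pose d := Num.min (Num.min d1 d2) (e / (M + N)).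
have d0 : 0 < d by rewrite !lt_min d10 d20 divr_gt0// addr_gt0.
exists (ball x0 d, ball y0 d); first by split; exact: nbhsx_ballx.
move=> [x y] [/= hx hy].
have dd : d <= d1 /\ d <= d2 by rewrite !ge_min !lexx !orbT.
have hx' : `|x - x0| < d by rewrite distrC.
have hy' : `|y - y0| < d by rewrite distrC.
have L1 : `|g (x, y) - g (x0, y)| <= M * `|x - x0|.
  apply: (@lip_derive _ (fun s => g (s, y))) => [s|s hs]; first exact (proj1 (dg (s, y))).
  apply: (D1 s y); last exact: lt_le_trans hy' dd.1.
  by apply: le_lt_trans hs _; exact: lt_le_trans hx' dd.1.
have L2 : `|g (x0, y) - g (x0, y0)| <= N * `|y - y0|.
  apply: (@lip_derive _ (fun s => g (x0, s))) => [s|s hs]; first exact (proj2 (dg (x0, s))).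
  apply: (D2 x0 s); first by rewrite subrr normr0.
  by apply: le_lt_trans hs _; exact: lt_le_trans hy' dd.2.
rewrite distrC (_ : _ - _ = (g (x, y) - g (x0, y)) + (g (x0, y) - g (x0, y0))); last by rewrite addrA subrK.
apply: le_trans (ler_normD _ _) _; apply: le_trans (lerD L1 L2) _.
apply: le_trans (lerD (ler_wpM2l (ltW M0) (ltW hx')) (ler_wpM2l (ltW N0) (ltW hy'))) _.
rewrite -mulrDl mulrC -ler_pdivlMr//.
by rewrite /d ge_min lexx orbT.
Qed.

Lemma classC_cts k g : classC k g -> continuous g.
Proof. by elim: k g => [//|k IH] g [d h1 h2]; apply: C1_cts => //; exact: IH. Qed.

Lemma dxB k p q : classC k.+1 p -> classC k.+1 q -> dx1 (p \- q) = dx1 p \- dx1 q /\ dx2 (p \- q) = dx2 p \- dx2 q.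
Proof.
move=> [dp _ _] [dq _ _]; split; apply/funext => y /=.
  have [d _] := dp y; have [d' _] := dq y.
  by have := is_deriveB (derivable_is d) (derivable_is d'); case/is_derive_1.
have [_ d] := dp y; have [_ d'] := dq y.
by have := is_deriveB (derivable_is d) (derivable_is d'); case/is_derive_1.
Qed.

Lemma classCB k p q : classC k p -> classC k q -> classC k (p \- q).
Proof.
elim: k p q => [|k IH] p q; first by move=> cp cq x; apply: cvgB; [exact: cp|exact: cq].
move=> hp hq; have [e1 e2] := dxB hp hq; case: hp hq => [dp p1 p2] [dq q1 q2].
split; [|by rewrite e1; exact: IH|by rewrite e2; exact: IH].
move=> y; have [a b] := dp y; have [a' b'] := dq y; split.
  by have := is_deriveB (derivable_is a) (derivable_is a'); case/is_derive_1.
by have := is_deriveB (derivable_is b) (derivable_is b'); case/is_derive_1.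
Qed.

Lemma periodic_dx1 k q : classC k.+1 q -> periodic2 q -> periodic2 (dx1 q).
Proof.
move=> [dq _ _] pq y; split; last first.
  by rewrite /dx1 /=; congr (derive1 _ _); apply/funext => s; have [_] := pq (s, y.2).
have h1 (s : R) : derivable (fun s : R => q (s, y.2)) s 1 := proj1 (dq (s, y.2)).
have h2 (s : R) : q (s + 1, y.2) = q (s, y.2) by have [] := pq (s, y.2).
exact: (@derive1_per _ (fun s => q (s, y.2)) h1 h2 y.1).
Qed.

Lemma periodic_dx2 k q : classC k.+1 q -> periodic2 q -> periodic2 (dx2 q).
Proof.
move=> [dq _ _] pq y; split.
  by rewrite /dx2 /=; congr (derive1 _ _); apply/funext => s; have [] := pq (y.1, s).
have h1 (s : R) : derivable (fun s : R => q (y.1, s)) s 1 := proj2 (dq (y.1, s)).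
have h2 (s : R) : q (y.1, s + 1) = q (y.1, s) by have [] := pq (y.1, s).
exact: (@derive1_per _ (fun s => q (y.1, s)) h1 h2 y.2).
Qed.

Lemma dxM p q : (forall y, derivable (fun s : R => p (s, y.2)) y.1 1 /\ derivable (fun s : R => p (y.1, s)) y.2 1) ->
  (forall y, derivable (fun s : R => q (s, y.2)) y.1 1 /\ derivable (fun s : R => q (y.1, s)) y.2 1) ->
  [/\ forall y, derivable (fun s : R => p (s, y.2) * q (s, y.2)) y.1 1, forall y, derivable (fun s : R => p (y.1, s) * q (y.1, s)) y.2 1,
    dx1 (fun y => p y * q y) = (fun y => p y * dx1 q y + q y * dx1 p y) &
    dx2 (fun y => p y * q y) = (fun y => p y * dx2 q y + q y * dx2 p y)].
Proof.
move=> dp dq.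
have h1 (y : R * R) : is_derive y.1 1 (fun s : R => p (s, y.2) * q (s, y.2)) (p y * dx1 q y + q y * dx1 p y).
  have [d _] := dp y; have [d' _] := dq y.
  by have := is_deriveM (derivable_is d) (derivable_is d'); case: (y).
have h2 (y : R * R) : is_derive y.2 1 (fun s : R => p (y.1, s) * q (y.1, s)) (p y * dx2 q y + q y * dx2 p y).
  have [_ d] := dp y; have [_ d'] := dq y.
  by have := is_deriveM (derivable_is d) (derivable_is d'); case: (y).
split=> [y|y||]; [by have [] := is_derive_1 (h1 y)|by have [] := is_derive_1 (h2 y)| |];
  apply/funext => y; [by have [] := is_derive_1 (h1 y)|by have [] := is_derive_1 (h2 y)].
Qed.

Lemma lift3_cts g : continuous g -> continuous (lift3 g).
Proof. by move=> cg x; apply: (continuous_comp (f := fst) (g := g)); [exact: cvg_fst|exact: cg]. Qed.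

Lemma periodic_lift3 g : periodic2 g -> periodic3 (lift3 g).
Proof. by move=> pg x; have [h1 h2] := pg x.1; split; rewrite /lift3 /= ?h1 ?h2. Qed.

(** Lifted to three variables in order to reuse [cts_ae_eq]. *)
Lemma cts2_int0 (h : R * R -> R) : continuous h -> periodic2 h -> (forall y, 0 <= h y) ->
  \int[leb2]_(y in square) h y = 0 -> forall y, h y = 0.
Proof.
move=> ch ph h0 hi; have cl := lift3_cts ch; have li := cts3_int cl.
have [_ E] := lift_int li; rewrite hi in E.
have ae : {ae leb3, forall x, cube x -> lift3 h x = 0}.
  by apply: (ge0_int0_ae _ li _ E) => [|x _]; [exact: mcube|exact: h0].
have : lift3 h = (fun=> 0).
  apply: cts_ae_eq => //; first by move=> x; exact: cvg_cst.
  exact: periodic_lift3.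
by move=> H y; have := congr1 (fun f => f (y, 0)) H.
Qed.

(** Energy argument for the harmonic difference q: the integrals of the derivatives of q dx1 q and q
    dx2 q vanish by periodicity, so the squared gradient integrates to 0, q is constant, and its
    mean is 0. *)
Lemma inv_lap_unique g p p' : is_inv_lap g p -> is_inv_lap g p' -> p = p'.
Proof.
move=> [pp cp ip lp] [pp' cp' ip' lp'].
pose q := p \- p'; suff q0 y : q y = 0.
  by apply/funext => y; apply/eqP; rewrite -subr_eq0; apply/eqP/(q0 y).
have cq : classC 2 q := classCB cp cp'.
have pq : periodic2 q by move=> z; rewrite /q /=; have [-> ->] := pp z; have [-> ->] := pp' z.
have iq : \int[leb2]_(y in square) q y = 0.
  transitivity (\int[leb2]_(y in square) p y - \int[leb2]_(y in square) p' y); last by rewrite ip ip' subrr.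
  apply: RintegralB; [exact: msquare| |]; apply: cts2_int; [exact: classC_cts cp|exact: classC_cts cp'].
have lq y' : lap q y' = 0.
  have [e1 e2] := dxB cp cp'; rewrite /lap /q e1 e2.
  have [_ a1 b1] := cp; have [_ a1' b1'] := cp'.
  have [-> _] := @dxB 0 _ _ a1 a1'; have [_ ->] := @dxB 0 _ _ b1 b1'.
  transitivity (lap p y' - lap p' y'); last by rewrite lp lp' subrr.
  by rewrite /lap opprD addrACA.
have [dq c1 c2] := cq; have [d1 c11 c12] := c1; have [d2 c21 c22] := c2.
have [A1 _ E1 _] := dxM dq d1; have [_ A2 _ E2] := dxM dq d2.
have kq := classC_cts cq; have k1 := @classC_cts 1 _ c1; have k2 := @classC_cts 1 _ c2.
have P1 := @periodic_dx1 1 _ cq pq; have P2 := @periodic_dx2 1 _ cq pq.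
have kk1 : continuous (fun y => q y * dx1 (dx1 q) y + dx1 q y * dx1 q y).
  by move=> z; apply: cvgD; apply: cvgM; [exact: kq|exact: c11|exact: k1|exact: k1].
have kk2 : continuous (fun y => q y * dx2 (dx2 q) y + dx2 q y * dx2 q y).
  by move=> z; apply: cvgD; apply: cvgM; [exact: kq|exact: c22|exact: k2|exact: k2].
have I1 : \int[leb2]_(y in square) (q y * dx1 (dx1 q) y + dx1 q y * dx1 q y) = 0.
  rewrite -E1; apply: (@int_dx1 _ (fun y => q y * dx1 q y)); [|exact: A1|by rewrite E1].
  by move=> z; have [-> ->] := pq z; have [-> ->] := P1 z.
have I2 : \int[leb2]_(y in square) (q y * dx2 (dx2 q) y + dx2 q y * dx2 q y) = 0.
  rewrite -E2; apply: (@int_dx2 _ (fun y => q y * dx2 q y)); [|exact: A2|by rewrite E2].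
  by move=> z; have [-> ->] := pq z; have [-> ->] := P2 z.
have II : \int[leb2]_(y in square) (dx1 q y * dx1 q y + dx2 q y * dx2 q y) = 0.
  transitivity (\int[leb2]_(y in square) ((q y * dx1 (dx1 q) y + dx1 q y * dx1 q y) + (q y * dx2 (dx2 q) y + dx2 q y * dx2 q y))).
    by apply: eq_Rintegral => z _; rewrite addrACA -mulrDr; have := lq z; rewrite /lap => ->; rewrite mulr0 add0r.
  by rewrite RintegralD; [rewrite I1 I2 addr0|exact: msquare|exact: cts2_int|exact: cts2_int].
have Z z : dx1 q z * dx1 q z + dx2 q z * dx2 q z = 0.
  apply: (@cts2_int0 (fun z => dx1 q z * dx1 q z + dx2 q z * dx2 q z)) => //.
  - by move=> w; apply: cvgD; apply: cvgM; [exact: k1|exact: k1|exact: k2|exact: k2].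
  - by move=> w; have [-> ->] := P1 w; have [-> ->] := P2 w.
  - by move=> w; rewrite -!expr2 addr_ge0// sqr_ge0.
have Z12 z : dx1 q z = 0 /\ dx2 q z = 0.
  have := Z z; rewrite -!expr2 => /eqP; rewrite paddr_eq0 ?sqr_ge0// !sqrf_eq0 => /andP[/eqP -> /eqP ->]//.
have qc z : q z = q (0, 0).
  case: z => x1 x2; transitivity (q (0, x2)); apply/eqP; rewrite -subr_eq0 -normr_le0.
    have := @lip_derive _ (fun s => q (s, x2)) 0 0 x1; rewrite mul0r; apply.
      by move=> s; exact (proj1 (dq (s, x2))).
    by move=> s _; have [h _] := Z12 (s, x2); rewrite -[derive1 _ _]/(dx1 q (s, x2)) h normr0.
  have := @lip_derive _ (fun s => q (0, s)) 0 0 x2; rewrite mul0r; apply.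
    by move=> s; exact (proj2 (dq (0, s))).
  by move=> s _; have [_ h] := Z12 (0, s); rewrite -[derive1 _ _]/(dx2 q (0, s)) h normr0.
rewrite qc -iq; under eq_Rintegral do rewrite qc.
rewrite Rintegral_cst; last exact: msquare.
have -> : fine (leb2 square) = 1 :> R by rewrite leb2_square.
by rewrite mulr1.
Qed.

Lemma inv_lapE g p : is_inv_lap g p -> inv_lap g = p.
Proof.
move=> h; have ex : exists p, is_inv_lap g p by exists p.
have h2 : is_inv_lap g (inv_lap g) := xgetPex (fun=> 0) ex.
exact: inv_lap_unique h2 h.
Qed.

End InverseLaplacian.

Lemma le_of_eq (R : realType) (x y : R) : x = y -> x <= y. Proof. by move=> ->. Qed.

(** * Trigonometric series *)

Section ComplexSums.
Context {R : realType}.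
Local Notation C := (R[i]).
Local Notation Re := (@complex.Re R).
Local Notation Im := (@complex.Im R).
Implicit Types (z w : C).

(** Used in place of the modulus: real and imaginary parts are summed separately, and this norm is
    additive in them while still submultiplicative. *)
Definition nc z : R := `|Re z| + `|Im z|.

Lemma cReD z w : Re (z + w) = Re z + Re w. Proof. by case: z; case: w. Qed.
Lemma cImD z w : Im (z + w) = Im z + Im w. Proof. by case: z; case: w. Qed.
Lemma cReN z : Re (- z) = - Re z. Proof. by case: z. Qed.
Lemma cImN z : Im (- z) = - Im z. Proof. by case: z. Qed.
Lemma cReM z w : Re (z * w) = Re z * Re w - Im z * Im w. Proof. by case: z; case: w. Qed.
Lemma cImM z w : Im (z * w) = Re z * Im w + Im z * Re w. Proof. by case: z => a b; case: w. Qed.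
Lemma cReJ z : Re (conjc z) = Re z. Proof. by case: z. Qed.
Lemma cImJ z : Im (conjc z) = - Im z. Proof. by case: z. Qed.
Lemma C_eq z w : Re z = Re w -> Im z = Im w -> z = w. Proof. by case: z; case: w => a b c d /= -> ->. Qed.

Lemma nc_ge0 z : 0 <= nc z. Proof. exact: addr_ge0. Qed.
Lemma Re_nc z : `|Re z| <= nc z. Proof. by rewrite lerDl. Qed.
Lemma Im_nc z : `|Im z| <= nc z. Proof. by rewrite lerDr. Qed.
Lemma nc0 : nc 0 = 0. Proof. by rewrite /nc /= normr0 addr0. Qed.
Lemma ncN z : nc (- z) = nc z. Proof. by rewrite /nc cReN cImN !normrN. Qed.
Lemma ncD z w : nc (z + w) <= nc z + nc w.
Proof. by rewrite /nc cReD cImD addrACA lerD// ler_normD. Qed.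
Lemma ncM z w : nc (z * w) <= nc z * nc w.
Proof.
rewrite /nc cReM cImM; apply: le_trans (lerD (ler_normB _ _) (ler_normD _ _)) _.
by rewrite !normrM; set a := `|_|; set b := `|_|; set c := `|_|; set d := `|_|; apply: le_of_eq; ring.
Qed.
Variable K : choiceType.
Implicit Types (f g : K -> C).

Definition csumm f := summ (nc \o f).
Definition csm f : C := Complex (sm (Re \o f)) (sm (Im \o f)).

Lemma csumm_Re f : csumm f -> summ (Re \o f). Proof. by apply: summ_le => k; exact: Re_nc. Qed.
Lemma csumm_Im f : csumm f -> summ (Im \o f). Proof. by apply: summ_le => k; exact: Im_nc. Qed.

Lemma csumm_le f (M : K -> R) : (forall k, nc (f k) <= M k) -> summ M -> csumm f.
Proof. by move=> fM; apply: summ_le => k /=; rewrite ger0_norm ?nc_ge0. Qed.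

Lemma eq_csm f g : f =1 g -> csm f = csm g.
Proof. by move=> fg; rewrite /csm; congr Complex; apply: eq_sm => k /=; rewrite fg. Qed.

Lemma csumD f g : csumm f -> csumm g -> csumm (fun k => f k + g k).
Proof. by move=> hf hg; apply: (csumm_le (M := fun k => nc (f k) + nc (g k))) => [k|]; [exact: ncD|exact: summD]. Qed.

Lemma csumN f : csumm f -> csumm (fun k => - f k).
Proof. by apply: summ_le => k /=; rewrite ncN ger0_norm ?nc_ge0. Qed.

Lemma csumZ z f : csumm f -> csumm (fun k => z * f k).
Proof. by move=> hf; apply: (csumm_le (M := fun k => nc z * nc (f k))) => [k|]; [exact: ncM|exact: summZ]. Qed.

Lemma csmD f g : csumm f -> csumm g -> csm (fun k => f k + g k) = csm f + csm g.
Proof.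
move=> hf hg; apply: C_eq; rewrite ?cReD ?cImD /=.
  by rewrite -smD; [apply: eq_sm => k /=; rewrite cReD|exact: csumm_Re|exact: csumm_Re].
by rewrite -smD; [apply: eq_sm => k /=; rewrite cImD|exact: csumm_Im|exact: csumm_Im].
Qed.

Lemma csmN f : csm (fun k => - f k) = - csm f.
Proof.
apply: C_eq; rewrite ?cReN ?cImN /= -smN; apply: eq_sm => k /=; [exact: cReN|exact: cImN].
Qed.

Lemma csmB f g : csumm f -> csumm g -> csm (fun k => f k - g k) = csm f - csm g.
Proof. by move=> hf hg; rewrite csmD ?csmN//; exact: csumN. Qed.

Lemma csmZ z f : csumm f -> csm (fun k => z * f k) = z * csm f.
Proof.
move=> hf; have h1 := csumm_Re hf; have h2 := csumm_Im hf.
apply: C_eq; rewrite ?cReM ?cImM /= -!smZ// -?smB -?smD; try exact: summZ.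
  by apply: eq_sm => k /=; rewrite cReM.
by apply: eq_sm => k /=; rewrite cImM.
Qed.

Lemma csm0 : csm (fun=> 0) = 0.
Proof. by rewrite /csm; apply: C_eq => /=; rewrite -[RHS](@sm0 R K); apply: eq_sm. Qed.

Lemma csm_conj f : csm (fun k => conjc (f k)) = conjc (csm f).
Proof.
apply: C_eq; rewrite ?cReJ ?cImJ /=; first by apply: eq_sm => k /=; rewrite cReJ.
by rewrite -smN; apply: eq_sm => k /=; rewrite cImJ.
Qed.

Lemma nc_csm f (M : K -> R) : (forall k, nc (f k) <= M k) -> summ M -> nc (csm f) <= sm M.
Proof.
move=> fM sM; have hf := csumm_le fM sM.
have h1 := summ_abs (csumm_Re hf); have h2 := summ_abs (csumm_Im hf).
apply: (@le_trans _ _ (sm (fun k => `|Re (f k)|) + sm (fun k => `|Im (f k)|))).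
  by rewrite /nc /=; apply: lerD; apply: le_norm_sm.
by rewrite -smD//; apply: le_sm => //; exact: summD.
Qed.

Lemma csm_reindex (e : K -> K) f : bijective e -> csm (f \o e) = csm f /\ (csumm (f \o e) <-> csumm f).
Proof.
move=> be; split; last by have [_] := sm_reindex (nc \o f) be.
by rewrite /csm; have [<- _] := sm_reindex (Re \o f) be; have [<- _] := sm_reindex (Im \o f) be.
Qed.

End ComplexSums.

(** * Termwise differentiation of trigonometric sums *)

Section TrigSeries.
Context {R : realType}.
Local Notation C := (R[i]).
Local Notation Re := (@complex.Re R).
Local Notation Im := (@complex.Im R).

Definition cis (t : R) : C := Complex (cos t) (sin t).

Lemma cisD s t : cis (s + t) = cis s * cis t.
Proof. by apply: C_eq; rewrite ?cReM ?cImM /= ?cosD ?sinD//; ring. Qed.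
Lemma cisN t : cis (- t) = conjc (cis t). Proof. by rewrite /cis cosN sinN. Qed.
Lemma nc_cis t : nc (cis t) <= 2.
Proof. by rewrite /nc /= -[2]/(1 + 1); apply: lerD; [exact: cos_le1'|exact: sin_le1']. Qed.

Lemma Re_cis_le (z : C) t : `|Re (z * cis t)| <= nc z.
Proof.
rewrite cReM /=; apply: le_trans (ler_normB _ _) _; rewrite !normrM.
by apply: lerD; rewrite -[leRHS]mulr1 ler_wpM2l// ?cos_le1' ?sin_le1'.
Qed.

Lemma nc_cisM_le (z : C) t : nc (z * cis t) <= 2 * nc z.
Proof. by rewrite mulrC; apply: le_trans (ncM _ _) _; rewrite ler_wpM2r ?nc_cis ?nc_ge0. Qed.

Let aff (p m x : R) : is_derive x 1 (fun s : R => p + m * s) m.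
Proof. by have := is_derive_affine p m (is_derive_id x 1); rewrite mulr1. Qed.

Lemma sin_shift_derive (a x : R) : is_derive x 1 (fun s : R => sin (a + 1 * s)) (cos (a + 1 * x)).
Proof. by have := @is_derive1_comp _ sin (fun s => a + 1 * s) x _ _ (is_derive_sin _) (aff a 1 x); rewrite mulr1. Qed.

Lemma cos_shift_derive (a x : R) : is_derive x 1 (fun s : R => cos (a + 1 * s)) (- sin (a + 1 * x)).
Proof. by have := @is_derive1_comp _ cos (fun s => a + 1 * s) x _ _ (is_derive_cos _) (aff a 1 x); rewrite mulr1. Qed.

Lemma sin_lip (a h : R) : `|sin (a + h) - sin a| <= `|h|.
Proof.
have := @lip_derive _ (fun s => sin (a + 1 * s)) 1 0 h; rewrite mulr0 addr0 subr0 !mul1r; apply.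
  by move=> s; have [] := is_derive_1 (sin_shift_derive a s).
by move=> s _; have [_ ->] := is_derive_1 (sin_shift_derive a s); exact: cos_le1'.
Qed.

Lemma cos_lip (a h : R) : `|cos (a + h) - cos a| <= `|h|.
Proof.
have := @lip_derive _ (fun s => cos (a + 1 * s)) 1 0 h; rewrite mulr0 addr0 subr0 !mul1r; apply.
  by move=> s; have [] := is_derive_1 (cos_shift_derive a s).
by move=> s _; have [_ ->] := is_derive_1 (cos_shift_derive a s); rewrite normrN; exact: sin_le1'.
Qed.

Lemma cos_taylor (a h : R) : `|cos (a + h) - cos a + h * sin a| <= `|h| * `|h|.
Proof.
have D (s : R) : is_derive s 1 (fun s => cos (a + 1 * s) + (0 + sin a * s)) (- sin (a + 1 * s) + sin a).
  exact: is_deriveD (cos_shift_derive a s) (aff 0 (sin a) s).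
have := @lip_derive _ (fun s => cos (a + 1 * s) + (0 + sin a * s)) `|h| 0 h.
rewrite !mulr0 !addr0 subr0 !mul1r add0r addrAC [sin a * h]mulrC; apply.
  by move=> s; have [] := is_derive_1 (D s).
move=> s hs; have [_ ->] := is_derive_1 (D s); rewrite addrC distrC mul1r.
by apply: le_trans (sin_lip _ _) _; move: hs; rewrite subr0.
Qed.

Lemma sin_taylor (a h : R) : `|sin (a + h) - sin a - h * cos a| <= `|h| * `|h|.
Proof.
have D (s : R) : is_derive s 1 (fun s => sin (a + 1 * s) + (0 + (- cos a) * s)) (cos (a + 1 * s) + - cos a).
  exact: is_deriveD (sin_shift_derive a s) (aff 0 (- cos a) s).
have := @lip_derive _ (fun s => sin (a + 1 * s) + (0 + (- cos a) * s)) `|h| 0 h.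
rewrite !mulr0 !addr0 subr0 !mul1r add0r addrAC mulNr [cos a * h]mulrC; apply.
  by move=> s; have [] := is_derive_1 (D s).
move=> s hs; have [_ ->] := is_derive_1 (D s); rewrite mul1r.
by apply: le_trans (cos_lip _ _) _; move: hs; rewrite subr0.
Qed.

(** A quadratic Taylor remainder can be summed over frequencies, which reduces termwise
    differentiation to one summability condition with two extra powers of the frequency. *)
Lemma is_derive_quad (F : R -> R) (s G M : R) : (forall h, `|F (s + h) - F s - h * G| <= M * (`|h| * `|h|)) -> is_derive s 1 F G.
Proof.
move=> hF; have M0 : 0 <= M by have := hF 1; rewrite normr1 !mulr1; apply: le_trans.
have L : h^-1 *: ((F \o shift s) (h *: 1) - F s) @[h --> 0^'] --> G.
  apply/cvgrPdist_le => e e0.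
  exists (e / (M + 1)) => /=; first by rewrite divr_gt0// ltr_wpDl.
  move=> h; rewrite /= sub0r normrN => he h0.
  have -> : G - h^-1 *: (F (h *: 1 + s) - F s) = - (h^-1 * (F (s + h) - F s - h * G)).
    rewrite -[h *: 1]/(h * 1) mulr1 [h + s]addrC -[_ *: _]/(_ * _); by field.
  rewrite normrN normrM normfV mulrC ler_pdivrMr ?normr_gt0//.
  apply: le_trans (hF h) _; rewrite mulrA ler_wpM2r//.
  apply: (@le_trans _ _ ((M + 1) * `|h|)); first by rewrite ler_wpM2r// lerDl.
  by rewrite mulrC -ler_pdivlMr ?ltr_wpDl// ltW.
split; first by apply/cvg_ex; exists G.
exact: cvg_lim L.
Qed.

Variable K : choiceType.

Lemma cis_taylor (z : C) (a h : R) : `|Re (z * cis (a + h)) - Re (z * cis a) - h * Re (Complex 0 1 * z * cis a)| <= nc z * (`|h| * `|h|).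
Proof.
have -> : Re (z * cis (a + h)) - Re (z * cis a) - h * Re (Complex 0 1 * z * cis a) =
  Re z * (cos (a + h) - cos a + h * sin a) - Im z * (sin (a + h) - sin a - h * cos a).
  by rewrite !cReM !cImM /=; ring.
apply: le_trans (ler_normB _ _) _; rewrite !normrM mulrDl.
by apply: lerD; apply: ler_wpM2l => //; [exact: cos_taylor|exact: sin_taylor].
Qed.

Lemma trig_derive (c : K -> C) (a w : K -> R) (s : R) : summ (fun k => nc (c k)) -> summ (fun k => `|w k| * nc (c k)) -> 
  summ (fun k => `|w k| * `|w k| * nc (c k)) ->
  is_derive s 1 (fun s => sm (fun k => Re (c k * cis (a k + w k * s)))) (sm (fun k => Re (Complex 0 (w k) * c k * cis (a k + w k * s)))).
Proof.
move=> h0 h1 h2.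
have s0 (t : R) : summ (fun k => Re (c k * cis (a k + w k * t))).
  by apply: summ_le h0 => k; exact: Re_cis_le.
have s1 : summ (fun k => Re (Complex 0 (w k) * c k * cis (a k + w k * s))).
  apply: summ_le h1 => k; apply: le_trans (Re_cis_le _ _) _; apply: le_trans (ncM _ _) _.
  by rewrite /nc /= normr0 add0r.
apply: (@is_derive_quad _ _ _ (sm (fun k => `|w k| * `|w k| * nc (c k)))) => h.
rewrite -smB// -smZ// -smB; last 2 first; [exact: summB|exact: summZ|].
rewrite -smZr; last exact: h2.
apply: le_norm_sm; first exact: summZr.
move=> k; have := cis_taylor (c k) (a k + w k * s) (w k * h).
rewrite !normrM mulrDr addrA.
have -> : h * Re (Complex 0 (w k) * c k * cis (a k + w k * s)) = w k * h * Re (Complex 0 1 * c k * cis (a k + w k * s)).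
  by rewrite ?(cReM,cImM) /=; ring.
move=> q; apply: le_trans q _; apply: le_of_eq; ring.
Qed.

End TrigSeries.

(** * Real Fourier series on the torus *)

Section Series.
Context {R : realType}.
Local Notation C := (R[i]).
Local Notation Re := (@complex.Re R).
Local Notation Im := (@complex.Im R).
Local Notation K := (int * int * int)%type.
Local Notation leb2 := (@leb2 R).
Local Notation leb3 := (@leb3 R).
Local Notation freq := (@freq R).
Local Notation phase := (@phase R).
Implicit Types (c d : K -> C) (k l m : K) (x : R * R * R).

Definition ek k x : C := cis (phase k x).

Lemma ekD k l x : ek (k + l) x = ek k x * ek l x.
Proof. by rewrite /ek phaseD cisD. Qed.

(** The real part is taken term by term, so the value is real for any [c]; for Hermitian [c] the
    imaginary parts cancel in the sum ([serI0]) and this is the full Fourier series. *)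
Definition ser c x : R := sm (fun k => Re (c k * ek k x)).
Definition herm c := forall k, c (- k) = conjc (c k).

Lemma bijN : bijective (fun k : K => - k).
Proof. by exists (fun k => - k) => k; rewrite opprK. Qed.

Lemma csumm_ek c x : csumm c -> csumm (fun k => c k * ek k x).
Proof. by move=> hc; apply: (csumm_le (M := fun k => 2 * nc (c k))) => [k|]; [exact: nc_cisM_le|exact: summZ]. Qed.

Lemma ser_bound c x (M : K -> R) : (forall k, nc (c k) <= M k) -> summ M -> `|ser c x| <= sm M.
Proof. by move=> cM sM; apply: le_norm_sm => // k; apply: le_trans (cM k); exact: Re_cis_le. Qed.

Lemma serI0 c x : csumm c -> herm c -> sm (fun k => Im (c k * ek k x)) = 0.
Proof.
move=> sc hc; have := sm_reindex (fun k => Im (c k * ek k x)) bijN; case=> h _.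
have : sm (fun k => Im (c k * ek k x)) = - sm (fun k => Im (c k * ek k x)).
  rewrite -{1}h -smN; apply: eq_sm => k /=; rewrite hc /ek phaseN cisN.
  by rewrite !cImM !cReJ !cImJ; ring.
by move=> q; lra.
Qed.

Lemma eq_ser c d x : c =1 d -> ser c x = ser d x.
Proof. by move=> cd; apply: eq_sm => k; rewrite cd. Qed.

Lemma serD c d x : csumm c -> csumm d -> ser (fun k => c k + d k) x = ser c x + ser d x.
Proof.
move=> hc hd; rewrite /ser -smD; [by apply: eq_sm => k; rewrite mulrDl cReD| |].
  exact: (csumm_Re (csumm_ek x hc)).
exact: (csumm_Re (csumm_ek x hd)).
Qed.

Lemma serN c x : ser (fun k => - c k) x = - ser c x.
Proof. by rewrite /ser -smN; apply: eq_sm => k; rewrite mulNr cReN. Qed.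

Lemma ser0 x : ser (fun=> 0) x = 0.
Proof. by rewrite /ser -[RHS](@sm0 R K); apply: eq_sm => k; rewrite mul0r. Qed.

Definition cconv c d k : C := csm (fun l => c l * d (k - l)).

Lemma summ_conv (U V : K -> R) : summ U -> summ V -> (forall k, 0 <= U k) -> (forall k, 0 <= V k) ->
  [/\ forall k, summ (fun l => U l * V (k - l)), summ (fun k => sm (fun l => U l * V (k - l))) &
     summ (fun kl : K * K => U kl.2 * V (kl.1 - kl.2))].
Proof.
move=> sU sV U0 V0.
have h := summ_mulpair sU sV.
have b : bijective (fun kl : K * K => (kl.2, kl.1 - kl.2)).
  exists (fun lm : K * K => (lm.1 + lm.2, lm.1)) => -[k l] /=; congr pair; first by rewrite addrC subrK.
  by rewrite addrC addKr.
have [_ hs] := sm_reindex (fun tu : K * K => U tu.1 * V tu.2) b.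
have h2 : summ (fun kl : K * K => U kl.2 * V (kl.1 - kl.2)) by apply/hs.
by have [h3 h4 _] := @sm_pair R K K (fun k l => U l * V (k - l)) h2.
Qed.

Lemma conv_bound c d (U V : K -> R) k : summ (fun l => U l * V (k - l)) -> (forall k, nc (c k) <= U k) -> (forall k, nc (d k) <= V k) ->
  csumm (fun l => c l * d (k - l)) /\ nc (cconv c d k) <= sm (fun l => U l * V (k - l)).
Proof.
move=> sUV cU dV; have h l : nc (c l * d (k - l)) <= U l * V (k - l).
  by apply: le_trans (ncM _ _) _; apply: ler_pM; rewrite ?nc_ge0.
by split; [exact: csumm_le h sUV|exact: nc_csm h sUV].
Qed.

(** Re a Re b exceeds Re (a b) by Im a Im b, and the double sum of the latter factors through the
    imaginary part of the series of [d], which is zero. *)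
Lemma serM c d x : csumm c -> csumm d -> herm d -> ser c x * ser d x = ser (cconv c d) x.
Proof.
move=> hc hd hhd.
have ec := csumm_ek x hc; have ed := csumm_ek x hd.
have [h1 h2 h3] := summ_conv ec ed (fun k => nc_ge0 _) (fun k => nc_ge0 _).
pose T k l := (c l * ek l x) * (d (k - l) * ek (k - l) x).
have TE k l : T k l = c l * d (k - l) * ek k x.
  by rewrite /T mulrACA -ekD; congr (_ * ek _ x); rewrite addrC subrK.
have hT k l : nc (T k l) <= (nc \o (fun k => c k * ek k x)) l * (nc \o (fun k => d k * ek k x)) (k - l) by exact: ncM.
have sT : summ (fun kl : K * K => Re (T kl.1 kl.2)).
  apply: summ_le h3 => kl; apply: le_trans (Re_nc _) (hT _ _).
have [p1 p2 p3] := @sm_pair R K K (fun k l => Re (T k l)) sT.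
have -> : ser (cconv c d) x = sm (fun k => sm (fun l => Re (T k l))).
  apply: eq_sm => k; have kk : csumm (fun l => c l * d (k - l)).
    by have [g1 _ _] := summ_conv hc hd (fun k => nc_ge0 _) (fun k => nc_ge0 _); have [] := @conv_bound c d (nc \o c) (nc \o d) k (g1 k) (fun k => lexx _) (fun k => lexx _).
  rewrite mulrC /cconv -csmZ//; apply: eq_sm => l /=; rewrite TE; congr Re; ring.
rewrite p3.
have b : bijective (fun lm : K * K => (lm.1 + lm.2, lm.1)).
  exists (fun kl : K * K => (kl.2, kl.1 - kl.2)) => -[k l] /=; congr pair.
    by rewrite addrC addKr.
  by rewrite addrC subrK.
have [<- hs] := sm_reindex (fun kl : K * K => Re (T kl.1 kl.2)) b.
have s1 : summ (fun lm : K * K => Re (c lm.1 * ek lm.1 x) * Re (d lm.2 * ek lm.2 x)).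
  by exact: (summ_mulpair (csumm_Re ec) (csumm_Re ed)).
have s2 : summ (fun lm : K * K => Im (c lm.1 * ek lm.1 x) * Im (d lm.2 * ek lm.2 x)).
  by exact: (summ_mulpair (csumm_Im ec) (csumm_Im ed)).
have -> : sm ((fun kl : K * K => Re (T kl.1 kl.2)) \o (fun lm : K * K => (lm.1 + lm.2, lm.1))) =
  sm (fun lm : K * K => Re (c lm.1 * ek lm.1 x) * Re (d lm.2 * ek lm.2 x) - Im (c lm.1 * ek lm.1 x) * Im (d lm.2 * ek lm.2 x)).
  by apply: eq_sm => -[l m] /=; rewrite /T cReM [l + m]addrC addrK.
rewrite smB//.
have [_ _ <-] := @sm_pair R K K (fun l m => Re (c l * ek l x) * Re (d m * ek m x)) s1.
have [_ _ <-] := @sm_pair R K K (fun l m => Im (c l * ek l x) * Im (d m * ek m x)) s2.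
have -> : sm (fun l => sm (fun m => Im (c l * ek l x) * Im (d m * ek m x))) = 0.
  rewrite -[RHS](@sm0 R K); apply: eq_sm => l; rewrite smZ ?serI0 ?mulr0//; exact: (csumm_Im ed).
rewrite subr0 /ser -smZr; last exact: (csumm_Re ec).
by apply: eq_sm => l; rewrite smZ//; exact: (csumm_Re ed).
Qed.

Lemma phase_cts k : continuous (phase k).
Proof.
move=> x; apply: cvgMr; apply: cvgD; first apply: cvgD; apply: cvgMr; last exact: cvg_snd.
  by apply: (@cvg_comp _ _ _ fst fst (nbhs x) (nbhs x.1)); exact: cvg_fst.
by apply: (@cvg_comp _ _ _ fst snd (nbhs x) (nbhs x.1)); [exact: cvg_fst|exact: cvg_snd].
Qed.

Lemma ek_term_cts (z : C) k : continuous (fun x => Re (z * ek k x)).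
Proof.
move=> x; rewrite (_ : (fun x => _) = (fun x => Re z * cos (phase k x) - Im z * sin (phase k x))); last first.
  by apply/funext => t; rewrite cReM.
apply: cvgB; apply: cvgMr.
  by apply: (@continuous_comp _ _ _ (phase k) cos); [exact: phase_cts|exact: continuous_cos].
by apply: (@continuous_comp _ _ _ (phase k) sin); [exact: phase_cts|exact: continuous_sin].
Qed.

Lemma ser_cts c : csumm c -> continuous (ser c).
Proof.
move=> hc x; apply: (@sm_cvg _ _ _ _ _ (fun x k => Re (c k * ek k x)) _ (nc \o c) hc).
- by apply: nearW => y k; exact: Re_cis_le.
- by move=> k; exact: Re_cis_le.
- by move=> k; exact: ek_term_cts.
Qed.

Lemma ek_per k x : [/\ ek k (x.1.1 + 1, x.1.2, x.2) = ek k x, ek k (x.1.1, x.1.2 + 1, x.2) = ek k x & ek k (x.1, x.2 + 1) = ek k x].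
Proof.
have H (n : int) (a : R) : cis (a + n%:~R * (2 * pi)) = cis a by rewrite /cis; have [-> ->] := trig_per a n.
rewrite /ek; split.
- by rewrite -[RHS](H k.1.1); congr cis; rewrite /Defs.phase /=; ring.
- by rewrite -[RHS](H k.1.2); congr cis; rewrite /Defs.phase /=; ring.
- by rewrite -[RHS](H k.2); congr cis; rewrite /Defs.phase /=; ring.
Qed.

Lemma ser_per c : periodic3 (ser c).
Proof. by move=> x; split; apply: eq_sm => k; have [h1 h2 h3] := ek_per k x; rewrite ?h1 ?h2 ?h3. Qed.

Lemma ek_int (z : C) k : \int[leb3]_(x in cube) Re (z * ek k x) = (if k == 0 then Re z else 0) /\
   \int[leb3]_(x in cube) Im (z * ek k x) = (if k == 0 then Im z else 0).
Proof.
have wi b : leb3.-integrable cube (EFin \o (fun x => wv b k x)).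
  apply: (@bounded_integrable _ _ _ leb3 _ _ 1); [exact: mcube|exact: leb3_cube_fin| |by move=> *; exact: wv_le1].
  by apply: measurable_funTS; exact: wv_meas.
have h b (a : R) : \int[leb3]_(x in cube) (a * wv b k x) = a * (b && (k == 0))%:R.
  by rewrite -wv_int; apply: RintegralZl; [exact: mcube|exact: wi].
have i b (a : R) : leb3.-integrable cube (EFin \o (fun x => a * wv b k x)).
  by apply: integrableZE; [exact: mcube|exact: wi].
split.
  transitivity (\int[leb3]_(x in cube) (Re z * wv true k x - Im z * wv false k x)).
    by apply: eq_Rintegral => x _; rewrite cReM.
  rewrite (_ : \int[leb3]_(x in cube) _ = \int[leb3]_(x in cube) (Re z * wv true k x) - \int[leb3]_(x in cube) (Im z * wv false k x)); last first.
    by apply: RintegralB; [exact: mcube|exact: i|exact: i].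
  by rewrite !h /= mulr0 subr0; case: ifP; rewrite ?mulr1 ?mulr0.
transitivity (\int[leb3]_(x in cube) (Re z * wv false k x + Im z * wv true k x)).
  by apply: eq_Rintegral => x _; rewrite cImM.
rewrite (_ : \int[leb3]_(x in cube) _ = \int[leb3]_(x in cube) (Re z * wv false k x) + \int[leb3]_(x in cube) (Im z * wv true k x)); last first.
  by apply: RintegralD; [exact: mcube|exact: i|exact: i].
by rewrite !h /= mulr0 add0r; case: ifP; rewrite ?mulr1 ?mulr0.
Qed.

Lemma ser_wv_int c b k : csumm c -> \int[leb3]_(x in cube) (ser c x * wv b k x) =
  (if b then (Re (c k) + Re (c (- k))) / 2 else (Im (c (- k)) - Im (c k)) / 2).
Proof.
move=> hc.
transitivity (\int[leb3]_(x in cube) sm (fun m => Re (c m * ek m x) * wv b k x)).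
  by apply: eq_Rintegral => x _; rewrite -smZr//; exact: (csumm_Re (csumm_ek x hc)).
have hm m : measurable_fun cube (fun x => Re (c m * ek m x) * wv b k x).
  apply: measurable_funTS; apply: measurable_funM; last exact: wv_meas.
  by apply: cts3_meas; exact: ek_term_cts.
have hb m x : cube x -> `|Re (c m * ek m x) * wv b k x| <= (nc \o c) m.
  by move=> _; rewrite normrM -[leRHS]mulr1; apply: ler_pM => //; [exact: Re_cis_le|exact: wv_le1].
have [_ _ _ ->] := sm_integral (mu := leb3) mcube leb3_cube_fin hm hb hc.
have E (m : K) : \int[leb3]_(x in cube) (Re (c m * ek m x) * wv b k x) =
   (if b then (if m == - k then Re (c m) / 2 else 0) + (if m == k then Re (c m) / 2 else 0)
    else (if m == - k then Im (c m) / 2 else 0) - (if m == k then Im (c m) / 2 else 0)).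
  have e1 : (m + k == 0) = (m == - k) by rewrite addr_eq0.
  have e2 : (m - k == 0) = (m == k) by rewrite subr_eq0.
  have hh : (2 : R) != 0 by rewrite pnatr_eq0.
  have Re2 (z : C) : Re (Complex 2^-1 0 * z) = Re z / 2 by rewrite cReM /= mul0r subr0 mulrC.
  have Im2 (z : C) : Im (Complex 2^-1 0 * z) = Im z / 2 by rewrite cImM /= mul0r addr0 mulrC.
  have iR (z : C) (n : K) : leb3.-integrable cube (EFin \o (fun x => Re (z * ek n x))) by apply: cts3_int; exact: ek_term_cts.
  have iI (z : C) (n : K) : leb3.-integrable cube (EFin \o (fun x => Im (z * ek n x))).
    rewrite (_ : (fun x => _) = (fun x => Re (Complex 0 (-1) * z * ek n x))) //.
    by apply/funext => x; rewrite ?(cReM,cImM) /=; ring.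
  have [r1 i1] := ek_int (Complex 2^-1 0 * c m) (m + k); have [r2 i2] := ek_int (Complex 2^-1 0 * c m) (m - k).
  rewrite e1 e2 Re2 Im2 in r1 i1 r2 i2; case: (b).
    rewrite -r1 -r2 -[RHS]RintegralD; [|exact: mcube|exact: iR|exact: iR].
    by apply: eq_Rintegral => x _; rewrite /ek /wv phaseD (phaseD m) phaseN !cisD cisN ?(cReM,cImM,cReJ,cImJ) /=; field.
  rewrite -i1 -i2 -[RHS]RintegralB; [|exact: mcube|exact: iI|exact: iI].
  by apply: eq_Rintegral => x _; rewrite /ek /wv phaseD (phaseD m) phaseN !cisD cisN ?(cReM,cImM,cReJ,cImJ) /=; field.
under eq_sm => m do rewrite E.
have P (f : K -> R) n : summ (fun m => if m == n then f m else 0) /\ sm (fun m => if m == n then f m else 0) = f n.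
  have [] := @sm_fin R K [fset n]%fset (fun m => if m == n then f m else 0).
    by move=> m; rewrite inE => /negbTE ->.
  by rewrite big_seq_fset1 eqxx.
case: (b).
  have [p1 p2] := P (fun m => Re (c m) / 2) (- k); have [q1 q2] := P (fun m => Re (c m) / 2) k.
  by rewrite smD// p2 q2 addrC mulrDl.
have [p1 p2] := P (fun m => Im (c m) / 2) (- k); have [q1 q2] := P (fun m => Im (c m) / 2) k.
by rewrite smB// p2 q2 mulrBl.
Qed.

Lemma fourier_ser c : csumm c -> herm c -> fourier (ser c) = c.
Proof.
move=> hc hhc; apply/funext => k; apply: C_eq => /=.
  have := ser_wv_int true k hc; rewrite /wv => ->; rewrite hhc cReJ; lra.
have := ser_wv_int false k hc; rewrite /wv => ->; rewrite hhc cImJ; lra.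
Qed.

Lemma fourier_wv (f : R * R * R -> R) k : fourier f k =
  Complex (\int[leb3]_(x in cube) (f x * wv true k x)) (- \int[leb3]_(x in cube) (f x * wv false k x)).
Proof. by []. Qed.

Lemma wv_integrable (f : R * R * R -> R) b k : leb3.-integrable cube (EFin \o f) -> leb3.-integrable cube (EFin \o (fun x => f x * wv b k x)).
Proof.
move=> fi; apply: (integrable_bddM _ fi _ (M := 1)) => [||x]; [exact: mcube|exact: wv_meas|exact: wv_le1].
Qed.

Lemma fourier_herm (f : R * R * R -> R) : leb3.-integrable cube (EFin \o f) -> herm (fourier f).
Proof.
move=> fi k; rewrite !fourier_wv; apply: C_eq => /=.
  by apply: eq_Rintegral => x _; rewrite /wv phaseN cosN.
rewrite opprK.
have -> : \int[leb3]_(x in cube) (f x * wv false (- k) x) = \int[leb3]_(x in cube) (-1 * (f x * wv false k x)).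
  by apply: eq_Rintegral => x _; rewrite /wv phaseN sinN; ring.
by rewrite RintegralZl; [ring|exact: mcube|exact: wv_integrable].
Qed.

Lemma fourierB (f g : R * R * R -> R) k : leb3.-integrable cube (EFin \o f) -> leb3.-integrable cube (EFin \o g) ->
  fourier (f \- g) k = fourier f k - fourier g k.
Proof.
move=> fi gi; rewrite !fourier_wv.
have h b : \int[leb3]_(x in cube) ((f \- g) x * wv b k x) = \int[leb3]_(x in cube) (f x * wv b k x) - \int[leb3]_(x in cube) (g x * wv b k x).
  transitivity (\int[leb3]_(x in cube) (f x * wv b k x - g x * wv b k x)).
    by apply: eq_Rintegral => x _ /=; rewrite mulrBl.
  by apply: RintegralB; [exact: mcube|exact: wv_integrable|exact: wv_integrable].
by rewrite !h; apply: C_eq => //=; rewrite opprB opprK addrC.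
Qed.

(** Both sides have the same Fourier coefficients, hence agree almost everywhere, and by continuity
    everywhere. *)
Lemma ser_fourier (f : R * R * R -> R) : continuous f -> periodic3 f -> csumm (fourier f) -> ser (fourier f) = f.
Proof.
move=> cf pf sf; have fi := cts3_int cf; have cs := ser_cts sf; have si := cts3_int cs.
have hf := fourier_herm fi.
have z : {ae leb3, forall x, cube x -> (ser (fourier f) \- f) x = 0}.
  apply: fourier_unique; first by apply: cts3_int => x; apply: cvgB; [exact: cs|exact: cf].
  by move=> k; rewrite fourierB// fourier_ser// subrr.
apply: cts_ae_eq => //; first exact: ser_per.
by apply: (ae1 z) => x + cx => /(_ cx) /= /eqP; rewrite subr_eq0 => /eqP.
Qed.

Lemma ae_ser_fourier (f : R * R * R -> R) : leb3.-integrable cube (EFin \o f) -> csumm (fourier f) ->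
  {ae leb3, forall x, cube x -> ser (fourier f) x = f x}.
Proof.
move=> fi sf; have cs := ser_cts sf; have si := cts3_int cs; have hf := fourier_herm fi.
have z : {ae leb3, forall x, cube x -> (ser (fourier f) \- f) x = 0}.
  apply: fourier_unique.
    rewrite (_ : EFin \o _ = (EFin \o ser (fourier f)) \- (EFin \o f))%E; last by apply/funext.
    by apply: integrableB; [exact: mcube|exact: si|exact: fi].
  by move=> k; rewrite fourierB// fourier_ser// subrr.
by apply: (ae1 z) => x + cx => /(_ cx) /= /eqP; rewrite subr_eq0 => /eqP.
Qed.

Lemma ae_fourier (f g : R * R * R -> R) : leb3.-integrable cube (EFin \o f) -> leb3.-integrable cube (EFin \o g) ->
  {ae leb3, forall x, cube x -> f x = g x} -> fourier f = fourier g.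
Proof.
move=> fi gi fg; apply/funext => k; rewrite !fourier_wv.
have h b : \int[leb3]_(x in cube) (f x * wv b k x) = \int[leb3]_(x in cube) (g x * wv b k x).
  congr fine; apply: ae_eq_integral; [exact: mcube|exact: (measurable_int _ (wv_integrable b k fi))|exact: (measurable_int _ (wv_integrable b k gi))|].
  by apply: (ae1 fg) => x + cx => /(_ cx) ->.
by rewrite !h.
Qed.

End Series.

(** * Fourier multipliers, vertical integration and the Leray projection *)

Section Calculus.
Context {R : realType}.
Local Notation C := (R[i]).
Local Notation Re := (@complex.Re R).
Local Notation Im := (@complex.Im R).
Local Notation K := (int * int * int)%type.
Local Notation leb := (@lebesgue_measure R).
Local Notation leb2 := (@leb2 R).
Local Notation leb3 := (@leb3 R).
Local Notation I01 := (`[0%R, 1%R]%classic : set R).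
Local Notation freq := (@freq R).
Local Notation phase := (@phase R).
Implicit Types (c d : K -> C) (k l m : K) (x : R * R * R).

Definition kx (b : bool) k : R := if b then k.1.2%:~R else k.1.1%:~R.
Definition kz k : R := k.2%:~R.
Definition D (b : bool) c k : C := Complex 0 (2 * pi * kx b k) * c k.
Definition Dz c k : C := Complex 0 (2 * pi * kz k) * c k.
(* inverse of [Dz], with 0 on the modes [kz = 0] because [0^-1 = 0] *)
Definition Vz c k : C := Complex 0 (- (2 * pi * kz k)^-1) * c k.
Definition Zz c k : C := if k.2 == 0 then c k else 0.
Definition K2 k : R := kx false k ^+ 2 + kx true k ^+ 2.

Definition pw (n : nat) k : R := (1 + freq k) ^+ n.
(** Rapid decrease: stable under multipliers of polynomial growth and under convolution, and enough
    to differentiate the series any number of times. *)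
Definition rd c := forall n, summ (fun k => pw n k * nc (c k)).

Lemma pw_ge1 n k : 1 <= pw n k.
Proof. by rewrite /pw exprn_ege1// lerDl freq_ge0. Qed.
Lemma pw_ge0 n k : 0 <= pw n k. Proof. exact: le_trans ler01 (pw_ge1 n k). Qed.
Lemma pwM n p k : pw n k * pw p k = pw (n + p) k. Proof. by rewrite /pw exprD. Qed.
Lemma pwD n k l : pw n k <= pw n l * pw n (k - l).
Proof.
rewrite /pw -exprMn; apply: lerXn2r; rewrite ?nnegrE ?mulr_ge0 ?addr_ge0 ?freq_ge0//.
have h := @freq_sub R k l; have b := @freq_ge0 R l; have a := @freq_ge0 R (k - l).
by have := mulr_ge0 a b; lra.
Qed.

Lemma kx_le b k : `|kx b k| <= freq k.
Proof. by have [h1 h2 h3] := le_freq (R := R) k; rewrite /kx; case: b. Qed.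
Lemma kz_le k : `|kz k| <= freq k.
Proof. by have [h1 h2 h3] := le_freq (R := R) k. Qed.

Lemma rd_summ c : rd c -> csumm c.
Proof. by move=> /(_ 0%N); apply: summ_le => k /=; rewrite /pw expr0 mul1r ger0_norm ?nc_ge0. Qed.

Lemma rd_le c (U : K -> R) : (forall k, nc (c k) <= U k) -> (forall n, summ (fun k => pw n k * U k)) -> rd c.
Proof.
move=> cU sU n; apply: summ_le (sU n) => k; rewrite ger0_norm ?mulr_ge0 ?pw_ge0 ?nc_ge0//.
by rewrite ler_wpM2l ?pw_ge0.
Qed.

Lemma rd_mul (m : K -> C) c (p : nat) (A : R) : 0 <= A -> (forall k, nc (m k) <= A * pw p k) -> rd c -> rd (fun k => m k * c k).
Proof.
move=> A0 hm hc; apply: (rd_le (U := fun k => A * pw p k * nc (c k))) => [k|n].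
  by apply: le_trans (ncM _ _) _; rewrite ler_wpM2r ?nc_ge0.
have := summZ A (hc (n + p)%N); apply: summ_le => k; rewrite -pwM ger0_norm.
  by apply: le_of_eq; ring.
by apply: mulr_ge0; [exact: pw_ge0|apply: mulr_ge0; [apply: mulr_ge0 => //; exact: pw_ge0|exact: nc_ge0]].
Qed.

Lemma rdD c d : rd c -> rd d -> rd (fun k => c k + d k).
Proof.
move=> hc hd; apply: (rd_le (U := fun k => nc (c k) + nc (d k))) => [k|n]; first exact: ncD.
by under eq_fun do rewrite mulrDr; exact: summD.
Qed.

Lemma rdN c : rd c -> rd (fun k => - c k).
Proof. by move=> hc; apply: (rd_le (U := fun k => nc (c k))) => // k; rewrite ncN. Qed.

Lemma rdZz c : rd c -> rd (Zz c).
Proof.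
by move=> hc; apply: (rd_le (U := fun k => nc (c k))) => // k; rewrite /Zz; case: ifP => // _; rewrite nc0 nc_ge0.
Qed.

Lemma nc_im (t : R) : nc (Complex 0 t) = `|t|. Proof. by rewrite /nc /= normr0 add0r. Qed.
Lemma nc_re (t : R) : nc (Complex t 0) = `|t|. Proof. by rewrite /nc /= normr0 addr0. Qed.

Lemma twopi_ge0 : 0 <= 2 * pi :> R. Proof. by rewrite mulr_ge0// pi_ge0. Qed.
Lemma twopi_gt0 : 0 < 2 * pi :> R. Proof. by rewrite mulr_gt0// pi_gt0. Qed.

Lemma freq_pw k : freq k <= pw 1 k. Proof. by rewrite /pw expr1 lerDr. Qed.

Lemma rdDx b c : rd c -> rd (D b c).
Proof.
apply: (@rd_mul _ _ 1 (2 * pi)); first exact: twopi_ge0.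
move=> k; rewrite nc_im normrM ger0_norm ?twopi_ge0// ler_wpM2l ?twopi_ge0//.
exact: le_trans (kx_le _ _) (freq_pw _).
Qed.

Lemma rdDz c : rd c -> rd (Dz c).
Proof.
apply: (@rd_mul _ _ 1 (2 * pi)); first exact: twopi_ge0.
move=> k; rewrite nc_im normrM ger0_norm ?twopi_ge0// ler_wpM2l ?twopi_ge0//.
exact: le_trans (kz_le _) (freq_pw _).
Qed.

Lemma kz_ge1 k : k.2 != 0 -> 1 <= `|kz k|.
Proof. by rewrite /kz -intr_norm ler1z -gtz0_ge1 normr_gt0. Qed.

Lemma kz_inv_le k : `|(kz k)^-1| <= 1.
Proof.
rewrite normfV; have [k0|k0] := eqVneq k.2 0; first by rewrite /kz k0 normr0 invr0.
by rewrite invf_le1 ?(lt_le_trans ltr01)// kz_ge1.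
Qed.

Lemma rdVz c : rd c -> rd (Vz c).
Proof.
apply: (@rd_mul _ _ 0 (2 * pi)^-1); first by rewrite invr_ge0 twopi_ge0.
move=> k; rewrite nc_im normrN invfM normrM ger0_norm ?invr_ge0 ?twopi_ge0// ler_wpM2l ?invr_ge0 ?twopi_ge0//.
by rewrite /pw expr0 kz_inv_le.
Qed.

Lemma summ_pw_conv (U V : K -> R) n : (forall k, 0 <= U k) -> (forall k, 0 <= V k) -> summ (fun k => pw n k * U k) -> summ (fun k => pw n k * V k) ->
  summ U -> summ V -> summ (fun k => pw n k * sm (fun l => U l * V (k - l))).
Proof.
move=> U0 V0 sU sV tU tV.
have [h1 h2 _] := summ_conv sU sV (fun k => mulr_ge0 (pw_ge0 n k) (U0 k)) (fun k => mulr_ge0 (pw_ge0 n k) (V0 k)).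
have [g1 _ _] := summ_conv tU tV U0 V0.
apply: summ_le h2 => k; rewrite -smZ// ger0_norm; last first.
  by apply: sm_ge0 => l; apply: mulr_ge0; [exact: pw_ge0|apply: mulr_ge0].
apply: le_sm => [||l]; [exact: summZ|exact: h1|].
rewrite mulrACA; apply: ler_wpM2r; first exact: mulr_ge0.
exact: pwD.
Qed.

Lemma rd_conv c d : rd c -> rd d -> rd (cconv c d).
Proof.
move=> hc hd; have tc := rd_summ hc; have td := rd_summ hd.
apply: (rd_le (U := fun k => sm (fun l => nc (c l) * nc (d (k - l))))) => [k|n].
  have [g1 _ _] := summ_conv tc td (fun k => nc_ge0 _) (fun k => nc_ge0 _).
  by have [] := @conv_bound _ c d (nc \o c) (nc \o d) k (g1 k) (fun k => lexx _) (fun k => lexx _).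
by apply: (@summ_pw_conv (nc \o c) (nc \o d) n) => //; move=> k; exact: nc_ge0.
Qed.

Lemma csumm_convt c d k : csumm c -> csumm d -> csumm (fun l => c l * d (k - l)).
Proof.
move=> hc hd; have [g1 _ _] := summ_conv hc hd (fun k => nc_ge0 _) (fun k => nc_ge0 _).
by have [] := @conv_bound _ c d (nc \o c) (nc \o d) k (g1 k) (fun k => lexx _) (fun k => lexx _).
Qed.

Lemma herm_conv c d : herm c -> herm d -> herm (cconv c d).
Proof.
move=> hc hd k; rewrite /cconv -csm_conj; have [<- _] := csm_reindex (fun l => c l * d (- k - l)) (@bijN).
apply: eq_csm => l /=; have -> : - k - - l = - (k - l) by rewrite opprB opprK addrC.
by rewrite hc hd rmorphM.
Qed.

Lemma herm_mul (m : K -> C) c : herm m -> herm c -> herm (fun k => m k * c k).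
Proof. by move=> hm hc k; rewrite hm hc rmorphM. Qed.

Lemma hermD c d : herm c -> herm d -> herm (fun k => c k + d k).
Proof. by move=> hc hd k; rewrite hc hd rmorphD. Qed.

Lemma hermN c : herm c -> herm (fun k => - c k).
Proof. by move=> hc k; rewrite hc rmorphN. Qed.

Lemma kxN b k : kx b (- k) = - kx b k.
Proof. by rewrite /kx; case: b => /=; rewrite mulrNz. Qed.
Lemma kzN k : kz (- k) = - kz k. Proof. by rewrite /kz /= mulrNz. Qed.

Lemma hermDx b c : herm c -> herm (D b c).
Proof. by move=> hc k; rewrite /D hc kxN; apply: C_eq; rewrite ?(cReM,cImM,cReJ,cImJ) /=; ring. Qed.
Lemma hermDz c : herm c -> herm (Dz c).
Proof. by move=> hc k; rewrite /Dz hc kzN; apply: C_eq; rewrite ?(cReM,cImM,cReJ,cImJ) /=; ring. Qed.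
Lemma hermVz c : herm c -> herm (Vz c).
Proof. by move=> hc k; rewrite /Vz hc kzN mulrN invrN; apply: C_eq; rewrite ?(cReM,cImM,cReJ,cImJ) /=; ring. Qed.
Lemma rd_pwsumm c n : rd c -> summ (fun k => freq k ^+ n * nc (c k)).
Proof.
move=> /(_ n); apply: summ_le => k; rewrite ger0_norm ?mulr_ge0 ?exprn_ge0 ?freq_ge0 ?nc_ge0//.
rewrite ler_wpM2r ?nc_ge0//; apply: lerXn2r; rewrite ?nnegrE ?freq_ge0 ?addr_ge0 ?freq_ge0//.
by rewrite lerDr.
Qed.

Let line_derive c (w a : K -> R) (s : R) : rd c -> (forall k, `|w k| <= freq k) ->
  is_derive s 1 (fun s => sm (fun k => Re (c k * cis (a k + 2 * pi * w k * s)))) (sm (fun k => Re (Complex 0 (2 * pi * w k) * c k * cis (a k + 2 * pi * w k * s)))).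
Proof.
move=> hc hw; have w2 k : `|2 * pi * w k| <= 2 * pi * freq k.
  by rewrite normrM ger0_norm ?twopi_ge0// ler_wpM2l ?twopi_ge0.
have q := twopi_ge0.
apply: (@trig_derive _ _ c a (fun k => 2 * pi * w k)).
- exact: rd_summ.
- have := summZ (2 * pi) (rd_pwsumm 1 hc); apply: summ_le => k.
  rewrite normrM normr_id (ger0_norm (nc_ge0 _)) expr1 mulrA ler_wpM2r ?nc_ge0//.
- have := summZ ((2 * pi) * (2 * pi)) (rd_pwsumm 2 hc); apply: summ_le => k.
  have nw := normr_ge0 (2 * pi * w k).
  rewrite ger0_norm; last by rewrite !mulr_ge0// nc_ge0.
  by rewrite mulrA ler_wpM2r ?nc_ge0// expr2 mulrACA ler_pM.
Qed.

Lemma ser_derive1 c (y : R * R) (z s : R) : rd c -> is_derive s 1 (fun s => ser c (s, y.2, z)) (ser (D false c) (s, y.2, z)).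
Proof.
move=> hc; have := @line_derive c (kx false) (fun k => 2 * pi * (k.1.2%:~R * y.2 + k.2%:~R * z)) s hc (kx_le false).
have E k t : cis (2 * pi * (k.1.2%:~R * y.2 + k.2%:~R * z) + 2 * pi * kx false k * t) = ek k (t, y.2, z).
  by rewrite /ek; congr cis; rewrite /Defs.phase /kx /=; ring.
by under eq_fun do under eq_sm do rewrite E; under eq_sm do rewrite E.
Qed.

Lemma ser_derive2 c (y : R * R) (z s : R) : rd c -> is_derive s 1 (fun s => ser c (y.1, s, z)) (ser (D true c) (y.1, s, z)).
Proof.
move=> hc; have := @line_derive c (kx true) (fun k => 2 * pi * (k.1.1%:~R * y.1 + k.2%:~R * z)) s hc (kx_le true).
have E k t : cis (2 * pi * (k.1.1%:~R * y.1 + k.2%:~R * z) + 2 * pi * kx true k * t) = ek k (y.1, t, z).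
  by rewrite /ek; congr cis; rewrite /Defs.phase /kx /=; ring.
by under eq_fun do under eq_sm do rewrite E; under eq_sm do rewrite E.
Qed.

Lemma ser_derive3 c (y : R * R) (s : R) : rd c -> is_derive s 1 (fun s => ser c (y, s)) (ser (Dz c) (y, s)).
Proof.
move=> hc; have := @line_derive c kz (fun k => 2 * pi * (k.1.1%:~R * y.1 + k.1.2%:~R * y.2)) s hc kz_le.
have E k t : cis (2 * pi * (k.1.1%:~R * y.1 + k.1.2%:~R * y.2) + 2 * pi * kz k * t) = ek k (y, t).
  by rewrite /ek; congr cis; rewrite /Defs.phase /kz /=; ring.
by under eq_fun do under eq_sm do rewrite E; under eq_sm do rewrite E.
Qed.

Lemma dx1_ser c z : rd c -> dx1 (fun y => ser c (y, z)) = (fun y => ser (D false c) (y, z)).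
Proof.
move=> hc; apply/funext => y; have [_] := is_derive_1 (ser_derive1 y z y.1 hc).
by rewrite /dx1 => ->; case: y.
Qed.

Lemma dx2_ser c z : rd c -> dx2 (fun y => ser c (y, z)) = (fun y => ser (D true c) (y, z)).
Proof.
move=> hc; apply/funext => y; have [_] := is_derive_1 (ser_derive2 y z y.2 hc).
by rewrite /dx2 => ->; case: y.
Qed.

Lemma classC_ser n c z : rd c -> classC n (fun y => ser c (y, z)).
Proof.
elim: n c => [|n IH] c hc.
  move=> y; apply: (@continuous_comp _ _ _ (fun y => (y, z)) (ser c)); first exact: pair1_cts.
  exact: (ser_cts (rd_summ hc)).
split; last 2 first.
- by rewrite dx1_ser//; apply: IH; exact: rdDx.
- by rewrite dx2_ser//; apply: IH; exact: rdDx.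
move=> y; split; first by have [] := is_derive_1 (ser_derive1 y z y.1 hc).
by have [] := is_derive_1 (ser_derive2 y z y.2 hc).
Qed.

Lemma int_z c (y : R * R) : csumm c -> \int[leb]_(z in I01) ser c (y, z) = ser (Zz c) (y, 0).
Proof.
move=> hc; rewrite /ser.
have mI := @mI01 R.
have ct k : continuous (fun z => Re (c k * ek k (y, z))).
  by apply: (@slice2_cts _ _ (fun x => Re (c k * ek k x))); exact: ek_term_cts.
have hm k : measurable_fun I01 (fun z => Re (c k * ek k (y, z))) by apply: cts_measurable.
have hb k z : I01 z -> `|Re (c k * ek k (y, z))| <= (nc \o c) k by move=> _; exact: Re_cis_le.
have [_ _ _ ->] := sm_integral (mu := leb) mI leb01_fin hm hb hc.
apply: eq_sm => k.
have cc (f : R -> R) (p m : R) : continuous f -> continuous (fun z => f (p + m * z)).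
  move=> cf z; apply: (@continuous_comp _ _ _ (fun z => p + m * z) f); last exact: cf.
  by apply: cvgD; [exact: cvg_cst|apply: cvgMr; exact: cvg_id].
have iC := cts_integrable 0 1 (cc cos (phase (k.1, 0) (y, 0)) (2 * pi * k.2%:~R) (@continuous_cos R)).
have iS := cts_integrable 0 1 (cc sin (phase (k.1, 0) (y, 0)) (2 * pi * k.2%:~R) (@continuous_sin R)).
transitivity (\int[leb]_(z in I01) (Re (c k) * cos (phase (k.1, 0) (y, 0) + 2 * pi * k.2%:~R * z) - Im (c k) * sin (phase (k.1, 0) (y, 0) + 2 * pi * k.2%:~R * z))).
  by apply: eq_Rintegral => z _; rewrite cReM /= phase_z.
rewrite RintegralB//; try exact: integrableZE.
rewrite !RintegralZl//; have [-> ->] := int01_cos (phase (k.1, 0) (y, 0)) k.2.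
have <- : phase k (y, 0) = phase (k.1, 0) (y, 0) by rewrite (phase_z k) mulr0 addr0.
by rewrite /Zz; case: ifP => [_|_]; [rewrite cReM|rewrite !mulr0 subr0 mul0r].
Qed.

Lemma int0_FTC (h F : R -> R) (z : R) : continuous h -> (forall s : R, is_derive s 1 F (h s)) -> int0 h z = F z - F 0.
Proof.
move=> ch dF; have cF : continuous F by move=> s; exact: is_derive_cts (dF s).
rewrite /int0; case: ifP => [z0|/negbT]; first by rewrite -[LHS]/(ig h z); apply: ig_FTC2 => //; exact: cts_within.
rewrite -ltNge => z0; apply: (@oppr_inj R); rewrite opprK opprB.
have -> : F 0 - F z = fine ((F 0)%:E - (F z)%:E)%E by rewrite -EFinB.
rewrite /Rintegral; congr fine; apply: continuous_FTC2 => //.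
- exact: cts_within.
- split; first by move=> s _; have [] := is_derive_1 (dF s).
    by apply: cvg_at_right_filter; exact: cF.
  by apply: cvg_at_left_filter; exact: cF.
- by move=> s _; have [_ ->] := is_derive_1 (dF s).
Qed.

Definition zr k : K := (k.1, - k.2).
Lemma bijzr : bijective zr. Proof. by exists zr => -[k1 k2]; rewrite /zr /= opprK. Qed.

Lemma ser_odd0 c (y : R * R) : (forall k, c (zr k) = - c k) -> ser c (y, 0) = 0.
Proof.
move=> oc; have [h _] := sm_reindex (fun k => Re (c k * ek k (y, 0))) bijzr.
suff : ser c (y, 0) = - ser c (y, 0) by move=> q; lra.
rewrite {1}/ser -h -serN; apply: eq_sm => k /=; rewrite oc; congr (Re (_ * cis _)).
by rewrite /Defs.phase /=; ring.
Qed.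

(** With no modes at k.2 = 0, dividing by the vertical frequency gives an antiderivative. Evenness
    of [d] makes it odd in z, so it vanishes at z = 0 and is the integral from 0. *)
Lemma int0_ser d (y : R * R) z : rd d -> (forall k, k.2 = 0 -> d k = 0) -> (forall k, d (zr k) = d k) ->
  int0 (fun s => ser d (y, s)) z = ser (Vz d) (y, z).
Proof.
move=> hd d0 ed; have hV := rdVz hd.
have := @int0_FTC (fun s => ser d (y, s)) (fun s => ser (Vz d) (y, s)) z.
rewrite (@ser_odd0 (Vz d)) ?subr0; last first.
  move=> k; rewrite /Vz /kz /= ed mulrNz mulrN invrN opprK.
  by apply: C_eq; rewrite ?(cReN,cImN,cReM,cImM) /=; ring.
apply.
  exact: (@slice2_cts _ _ (ser d) y (ser_cts (rd_summ hd))).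
move=> s; have := ser_derive3 y s hV.
have -> : ser (Dz (Vz d)) (y, s) = ser d (y, s) => //.
apply: eq_ser => k.
rewrite /Dz /Vz; have [k0|k0] := eqVneq k.2 0; first by rewrite d0// !mulr0.
have kn : kz k != 0 by rewrite /kz intr_eq0.
have un : 2 * pi * kz k != 0 by rewrite mulf_neq0// gt_eqF// twopi_gt0.
by apply: C_eq; rewrite ?(cReM,cImM) /=; move: (2 * pi * kz k) un => u un; field.
Qed.

Lemma ser_z0 c y z : (forall k, k.2 != 0 -> c k = 0) -> ser c (y, z) = ser c (y, 0).
Proof.
move=> c0; apply: eq_sm => k; have [k0|k0] := eqVneq k.2 0; last by rewrite c0// !mul0r.
by rewrite /ek /Defs.phase /= k0 !mul0r.
Qed.

(** The convention 0^-1 = 0 sets the mode K2 = 0 to zero, which is the zero-mean normalisation. *)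
Definition lapinv c k : C := Complex (- (2 * pi * (2 * pi) * K2 k)^-1) 0 * c k.
Definition cdiv (n : bool -> K -> C) k : C := D false (n false) k + D true (n true) k.
Definition Lr (n : bool -> K -> C) b k : C := n b k - D b (lapinv (cdiv n)) k.
Definition vser (n : bool -> K -> C) x : R * R := (ser (n false) x, ser (n true) x).

Lemma K2_int k : K2 k = (k.1.1 ^+ 2 + k.1.2 ^+ 2)%:~R.
Proof. by rewrite /K2 /kx !rmorphD /= !rmorphXn. Qed.

Lemma K2_eq0 k : k.2 = 0 -> (K2 k == 0) = (k == 0).
Proof.
case: k => -[k1 k2] k3 /= ->; rewrite K2_int intr_eq0 paddr_eq0 ?sqr_ge0//= !sqrf_eq0.
by rewrite !xpair_eqE andbT.
Qed.

Lemma K2_inv_le k : `|(K2 k)^-1| <= 1.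
Proof.
rewrite K2_int; set n : int := _ + _; have n0 : 0 <= n by rewrite addr_ge0 ?sqr_ge0.
have [->|nn] := eqVneq n 0; first by rewrite invr0 normr0.
have n1 : 1 <= n by rewrite -gtz0_ge1 lt_neqAle eq_sym nn.
by rewrite normfV ger0_norm ?ler0z// invf_le1 ?ltr0z ?(lt_le_trans _ n1)// ler1z.
Qed.

Lemma rd_lapinv c : rd c -> rd (lapinv c).
Proof.
apply: (@rd_mul _ _ 0 ((2 * pi * (2 * pi))^-1)); first by rewrite invr_ge0 mulr_ge0 ?twopi_ge0.
move=> k; rewrite nc_re normrN invfM normrM ger0_norm ?invr_ge0 ?mulr_ge0 ?twopi_ge0// ?pi_ge0//.
by apply: ler_wpM2l; [rewrite invr_ge0 mulr_ge0 ?twopi_ge0|rewrite /pw expr0 K2_inv_le].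
Qed.

Lemma rd_cdiv n : (forall b, rd (n b)) -> rd (cdiv n).
Proof. by move=> hn; apply: rdD; apply: rdDx. Qed.

Lemma K2N k : K2 (- k) = K2 k. Proof. by rewrite /K2 !kxN !sqrrN. Qed.

Lemma herm_lapinv c : herm c -> herm (lapinv c).
Proof. by apply: herm_mul => k; rewrite K2N; apply: C_eq; rewrite ?(cReJ,cImJ) /= ?oppr0. Qed.

Lemma herm_cdiv n : (forall b, herm (n b)) -> herm (cdiv n).
Proof. by move=> hn; apply: hermD; apply: hermDx. Qed.

Lemma ser2_int c : csumm c -> (forall k, k.2 != 0 -> c k = 0) -> 
  \int[leb2]_(y in square) ser c (y, 0) = Re (c 0).
Proof.
move=> hc c0.
have E : lift3 (fun y => ser c (y, 0)) = ser c.
  by apply/funext => -[y z]; exact/esym/ser_z0.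
have i3 : leb3.-integrable cube (EFin \o lift3 (fun y => ser c (y, 0))).
  by rewrite E; apply: cts3_int; exact: ser_cts.
have [_ <-] := lift_int i3; rewrite E.
transitivity (\int[leb3]_(x in cube) (ser c x * wv true 0 x)).
  by apply: eq_Rintegral => x _; rewrite /wv phase0 cos0 mulr1.
by rewrite ser_wv_int// oppr0; field.
Qed.

Lemma is_inv_lap_ser c : rd c -> (forall k, k.2 != 0 -> c k = 0) -> c 0 = 0 ->
  is_inv_lap (fun y => ser c (y, 0)) (fun y => ser (lapinv c) (y, 0)).
Proof.
move=> hc c0 c00; have hp := rd_lapinv hc; split.
- by move=> y; have [h1 h2 _] := ser_per (lapinv c) (y, 0).
- exact: classC_ser.
- rewrite ser2_int.
  + by rewrite /lapinv c00 mulr0.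
  + exact: rd_summ.
  + by move=> k k0; rewrite /lapinv c0// mulr0.
- move=> y; rewrite /lap !dx1_ser ?dx2_ser//; try exact: rdDx.
  rewrite -serD; [|by apply: rd_summ; apply: rdDx; apply: rdDx|by apply: rd_summ; apply: rdDx; apply: rdDx].
  apply: eq_ser => k; have [k2|k2] := eqVneq k.2 0; last by rewrite /D /lapinv c0// !mulr0 addr0.
  have [->|kn] := eqVneq k 0; first by rewrite /D /lapinv c00 !mulr0 addr0.
  have kk : K2 k != 0 by rewrite K2_eq0.
  have pn : 2 * pi != 0 :> R by rewrite gt_eqF// twopi_gt0.
  rewrite /D /lapinv; move: kk; rewrite /K2; move: (kx false k) (kx true k) (c k) (2 * pi) pn => a b z p pn kk.
  transitivity (Complex ((p * a * (p * a) + p * b * (p * b)) * (p * p * (a ^+ 2 + b ^+ 2))^-1) 0 * z).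
    by apply: C_eq; rewrite ?(cReD,cImD,cReM,cImM) /=; ring.
  have -> : (p * a * (p * a) + p * b * (p * b)) * (p * p * (a ^+ 2 + b ^+ 2))^-1 = 1.
    by rewrite -[X in X / _](_ : p * p * (a ^+ 2 + b ^+ 2) = _) ?divff ?mulf_neq0//; ring.
  by rewrite -[Complex 1 0]/(1 : C) mul1r.
Qed.

(** The series of [lapinv] is a classical zero-mean solution, and by uniqueness it is the one
    selected inside [leray]. *)
Lemma leray_ser (n : bool -> K -> C) : (forall b, rd (n b)) -> (forall b k, k.2 != 0 -> n b k = 0) ->
  leray (fun y => vser n (y, 0)) = (fun y => vser (Lr n) (y, 0)).
Proof.
move=> hn n0; have hd := rd_cdiv hn; have hp := rd_lapinv hd.
have dE : div (fun y => vser n (y, 0)) = (fun y => ser (cdiv n) (y, 0)).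
  apply/funext => y; rewrite /div (@dx1_ser (n false))// (@dx2_ser (n true))//.
  by rewrite -serD//; apply: rd_summ; apply: rdDx.
have iE : inv_lap (div (fun y => vser n (y, 0))) = (fun y => ser (lapinv (cdiv n)) (y, 0)).
  apply: inv_lapE; rewrite dE; apply: is_inv_lap_ser => //.
    by move=> k k0; rewrite /cdiv /D !n0// !mulr0 addr0.
  by rewrite /cdiv /D /kx /= !mulr0; apply: C_eq; rewrite ?(cReD,cImD,cReM,cImM) /=; ring.
apply/funext => y; rewrite /leray iE /grad dx1_ser// dx2_ser//.
have h b : ser (Lr n b) (y, 0) = ser (n b) (y, 0) - ser (D b (lapinv (cdiv n))) (y, 0).
  rewrite /Lr serD ?serN//; first exact: rd_summ.
  by apply: rd_summ; apply: rdN; exact: rdDx.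
by rewrite /vser !h.
Qed.

Lemma rd_Lr n b : (forall b, rd (n b)) -> rd (Lr n b).
Proof. by move=> hn; apply: rdD => //; apply: rdN; apply: rdDx; apply: rd_lapinv; exact: rd_cdiv. Qed.

Lemma Lr_supp n b k : (forall b k, k.2 != 0 -> n b k = 0) -> k.2 != 0 -> Lr n b k = 0.
Proof. by move=> n0 k0; rewrite /Lr /D /lapinv /cdiv /D !n0// !mulr0 addr0 !mulr0 subr0. Qed.

Lemma P0_ser (n : bool -> K -> C) : (forall b, csumm (n b)) -> P0 (vser n) = (fun y => vser (fun b => Zz (n b)) (y, 0)).
Proof. by move=> hn; apply/funext => y; rewrite /P0 /vser /= !int_z. Qed.

Definition delta (z : C) k : K -> C := fun l => if l == k then z else 0.

Lemma delta_ser z k : rd (delta z k) /\ forall x, ser (delta z k) x = Re (z * ek k x).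
Proof.
split.
  move=> n; have [] := @sm_fin R K [fset k]%fset (fun l => pw n l * nc (delta z k l)); last by [].
  by move=> l; rewrite inE /delta => /negbTE ->; rewrite nc0 mulr0.
move=> x; have [] := @sm_fin R K [fset k]%fset (fun l => Re (delta z k l * ek l x)).
  by move=> l; rewrite inE /delta => /negbTE ->; rewrite mul0r.
by rewrite /ser => _ ->; rewrite big_seq_fset1 /delta eqxx.
Qed.

Lemma D_delta b z k : D b (delta z k) = delta (Complex 0 (2 * pi * kx b k) * z) k.
Proof. by apply/funext => l; rewrite /D /delta; case: eqP => [->|_]; rewrite ?mulr0. Qed.

(** The test functions are single waves Re (z e_k); z = 1 and z = -i give the two real equations
    contained in the complex one. *)
Lemma weak_div_coef (phi : R * R * R -> R * R) k : 
  leb3.-integrable cube (EFin \o (fst \o phi)) -> leb3.-integrable cube (EFin \o (snd \o phi)) ->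
  weak_div_free (P0 phi) -> k.2 = 0 ->
  cdiv (fun b => if b then fourier (snd \o phi) else fourier (fst \o phi)) k = 0.
Proof.
move=> i1 i2 wd k0.
have pE (y : R * R) z : phase k (y, z) = phase k (y, 0) by rewrite /Defs.phase /= k0 !mul0r.
have fI b (f : R * R * R -> R) : leb3.-integrable cube (EFin \o f) ->
    \int[leb3]_(x in cube) (f x * wv b k x) = \int[leb2]_(y in square) ((\int[leb]_(z in I01) f (y, z)) * wv b k (y, 0)) /\
    leb2.-integrable square (EFin \o (fun y => (\int[leb]_(z in I01) f (y, z)) * wv b k (y, 0))).
  move=> fi; have [a1 j1 ->] := fubini3 (wv_integrable b k fi).
  have [a0 j0 _] := fubini3 fi.
  have wE (y : R * R) z : wv b k (y, z) = wv b k (y, 0) by rewrite /wv pE.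
  have mw : measurable_fun setT (fun y : measurableTypeR R * measurableTypeR R => wv b k (y, 0)).
    apply: (@cts2_meas R (fun y => wv b k (y, 0))) => y; rewrite /wv; case: (b).
      apply: (@continuous_comp _ _ _ (fun y => phase k (y, 0)) cos); last exact: continuous_cos.
      by apply: (@continuous_comp _ _ _ (fun y => (y, 0)) (phase k)); [exact: pair1_cts|exact: phase_cts].
    apply: (@continuous_comp _ _ _ (fun y => phase k (y, 0)) sin); last exact: continuous_sin.
    by apply: (@continuous_comp _ _ _ (fun y => (y, 0)) (phase k)); [exact: pair1_cts|exact: phase_cts].
  have ii : leb2.-integrable square (EFin \o (fun y => (\int[leb]_(z in I01) f (y, z)) * wv b k (y, 0))).
    by apply: (integrable_bddM _ j0 mw (M := 1)) => [|y]; [exact: msquare|exact: wv_le1].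
  split=> //; congr fine; apply: ae_eq_integral; [exact: msquare|exact: measurable_int j1|exact: measurable_int ii|].
  apply: (ae1 a0) => y fy Sy; congr EFin.
  transitivity (\int[leb]_(z in I01) (f (y, z) * wv b k (y, 0))).
    by apply: eq_Rintegral => z _; rewrite wE.
  by apply: RintegralZr; [exact: mI01|exact: fy].
have T (z : C) : \int[leb2]_(y in square)
    ((P0 phi y).1 * Re (Complex 0 (2 * pi * kx false k) * z * ek k (y, 0)) + (P0 phi y).2 * Re (Complex 0 (2 * pi * kx true k) * z * ek k (y, 0))) = 0.
  have [rz sz] := delta_ser z k.
  have [_ s1] := delta_ser (Complex 0 (2 * pi * kx false k) * z) k; have [_ s2] := delta_ser (Complex 0 (2 * pi * kx true k) * z) k.
  have pz : periodic2 (fun y => ser (delta z k) (y, 0)).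
    by move=> y; have [h1 h2 _] := ser_per (delta z k) (y, 0).
  have := wd (fun y => ser (delta z k) (y, 0)) pz (fun n => classC_ser n 0 rz).
  rewrite dx1_ser// dx2_ser// !D_delta => W; rewrite -[RHS]W.
  by apply: eq_Rintegral => y _; rewrite s1 s2.
have L b (q : bool -> R) : \int[leb2]_(y in square)
    ((P0 phi y).1 * (q false * wv b k (y, 0)) + (P0 phi y).2 * (q true * wv b k (y, 0))) =
    q false * \int[leb3]_(x in cube) ((phi x).1 * wv b k x) + q true * \int[leb3]_(x in cube) ((phi x).2 * wv b k x).
  have [e1 j1] := fI b _ i1; have [e2 j2] := fI b _ i2; rewrite e1 e2.
  transitivity (\int[leb2]_(y in square) (q false * ((P0 phi y).1 * wv b k (y, 0)) + q true * ((P0 phi y).2 * wv b k (y, 0)))).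
    by apply: eq_Rintegral => y _; ring.
  rewrite RintegralD; [|exact: msquare|by apply: integrableZE; [exact: msquare|exact: j1]|by apply: integrableZE; [exact: msquare|exact: j2]].
  by rewrite !RintegralZl//; exact: msquare.
have p0 := twopi_gt0.
have h1 := L true (fun b => 2 * pi * kx b k); have h2 := L false (fun b => - (2 * pi * kx b k)).
have g1 := T (Complex 0 (-1)); have g2 := T 1.
have e1 : 2 * pi * kx false k * \int[leb3]_(x in cube) ((phi x).1 * wv true k x) + 2 * pi * kx true k * \int[leb3]_(x in cube) ((phi x).2 * wv true k x) = 0.
  rewrite -h1 -[RHS]g1; apply: eq_Rintegral => y _; rewrite ?(cReM,cImM) /wv /=; ring.
have e2 : - (2 * pi * kx false k) * \int[leb3]_(x in cube) ((phi x).1 * wv false k x) + - (2 * pi * kx true k) * \int[leb3]_(x in cube) ((phi x).2 * wv false k x) = 0.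
  rewrite -h2 -[RHS]g2; apply: eq_Rintegral => y _; rewrite ?(cReM,cImM) /wv /=; ring.
apply: C_eq; rewrite /cdiv /D ?(cReD,cImD,cReM,cImM) /= -?[cos (phase k _)]/(wv true k _).
  by have e3 := congr1 -%R e2; rewrite oppr0 in e3; rewrite -[RHS]e3 /wv /=; ring.
by rewrite -[RHS]e1 /wv /=; ring.
Qed.

End Calculus.

(** * The nonlinearity in Fourier variables *)

Section Nonlinearity.
Context {R : realType}.
Local Notation C := (R[i]).
Local Notation Re := (@complex.Re R).
Local Notation Im := (@complex.Im R).
Local Notation K := (int * int * int)%type.
Local Notation freq := (@freq R).
Implicit Types (c d : K -> C) (k l m : K) (x : R * R * R) (b t n : bool -> K -> C).

Definition advc a n i k : C := cconv (a false) (D false (n i)) k + cconv (a true) (D true (n i)) k.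
Definition divc t i k : C := cconv (D false (t false)) (t i) k + cconv (D true (t true)) (t i) k.
Definition vertc t i k : C := cconv (Vz (D false (t false))) (Dz (t i)) k + cconv (Vz (D true (t true))) (Dz (t i)) k.

Definition nbar b t i k : C := advc b b i k + (divc t i k + advc t t i k).
Definition Nb b t i k : C := if (k == 0) || (k.2 != 0) then 0 else - Lr (nbar b t) i k.
(** On modes with k.2 = 0 the average in the equation cancels the advection of the fluctuation by
    itself and leaves div + vertical term, which vanishes by integration by parts in z ([divvert0]);
    only the two mixed terms remain. *)
Definition Nt b t i k : C :=
  if k == 0 then 0 else - (advc t b i k + advc b t i k) + (if k.2 == 0 then 0 else vertc t i k - advc t t i k).

(* [I] indexes the real unknowns: (fluctuation?, component, imaginary part?) *)
Definition Ix : finType := (bool * bool * bool)%type.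
Local Notation st := (Ix -> K -> R).
Implicit Types (u v : st) (U V W : K -> R).

(** The zero mode is discarded so that every factor of the nonlinearity can be bounded by a multiple
    of |k|, including at k = 0. *)
Definition zc (s i : bool) u k : C := if k == 0 then 0 else Complex (u (s, i, false) k) (u (s, i, true) k).
Definition zb u i := zc false i u.
Definition zt u i := zc true i u.
Definition part (p : bool) (z : C) : R := if p then Im z else Re z.
Definition N0 u : st := fun i k => part i.2 (if i.1.1 then Nt (zb u) (zt u) i.1.2 k else Nb (zb u) (zt u) i.1.2 k).

(** The property [quad] for one complex-valued component with an explicit constant; stable under
    sums, bounded multipliers and restriction to modes, so the nonlinearity is assembled from
    convolutions. *)
Definition qb (F : st -> K -> C) (A : R) : Prop :=
  [/\ forall u v U V W, smallw U -> smallw V -> smallw W -> bdd u U -> bdd v V -> bdd (sdiff u v) W ->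
        forall k, nc (F u k - F v k) <= A * (Q U W k + Q W V k),
      forall k, F (fun _ _ => 0) k = 0 &
      forall (u : R -> st) U, smallw U -> (forall s, bdd (u s) U) -> (forall i k, continuous (fun s => u s i k)) ->
        forall p k, continuous (fun s => part p (F (u s) k))].

Lemma QQ_ge0 U V W k : smallw U -> smallw V -> smallw W -> 0 <= Q U W k + Q W V k.
Proof. by move=> [U0 _] [V0 _] [W0 _]; apply: addr_ge0; apply: Q_ge0. Qed.

Lemma qbD F G A B : qb F A -> qb G B -> qb (fun u k => F u k + G u k) (A + B).
Proof.
move=> [f1 f2 f3] [g1 g2 g3]; split.
- move=> u v U V W sU sV sW bU bV bW k; rewrite opprD addrACA mulrDl.
  by apply: le_trans (ncD _ _) _; apply: lerD; [exact: f1|exact: g1].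
- by move=> k; rewrite f2 g2 addr0.
- move=> u U sU bU cU p k; rewrite (_ : (fun s => _) = (fun s => part p (F (u s) k) + part p (G (u s) k))).
    by move=> s; apply: cvgD; [exact: (f3 u U)|exact: (g3 u U)].
  by apply/funext => s; rewrite /part; case: p; rewrite ?cReD ?cImD.
Qed.

Lemma qbM (mu : K -> C) F A B : 0 <= B -> (forall k, nc (mu k) <= B) -> qb F A -> qb (fun u k => mu k * F u k) (B * A).
Proof.
move=> B0 hm [f1 f2 f3]; split.
- move=> u v U V W sU sV sW bU bV bW k; rewrite -mulrBr -mulrA.
  apply: le_trans (ncM _ _) _; apply: ler_pM; [exact: nc_ge0|exact: nc_ge0|exact: hm|exact: f1].
- by move=> k; rewrite f2 mulr0.
- move=> u U sU bU cU p k; have hr := f3 u U sU bU cU false k; have hi := f3 u U sU bU cU true k.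
  rewrite /part; case: p.
    rewrite (_ : (fun s => _) = (fun s => Re (mu k) * Im (F (u s) k) + Im (mu k) * Re (F (u s) k))).
      by move=> s; apply: cvgD; apply: cvgMr; [exact: hi|exact: hr].
    by apply/funext => s; rewrite cImM.
  rewrite (_ : (fun s => _) = (fun s => Re (mu k) * Re (F (u s) k) - Im (mu k) * Im (F (u s) k))).
    by move=> s; apply: cvgB; apply: cvgMr; [exact: hr|exact: hi].
  by apply/funext => s; rewrite cReM.
Qed.

Lemma qbN F A : qb F A -> qb (fun u k => - F u k) A.
Proof.
move=> h; have := @qbM (fun=> -1) F A 1 ler01 _ h; rewrite mul1r => q.
have -> : (fun u k => - F u k) = (fun u k => -1 * F u k) by apply/funext => u; apply/funext => k; rewrite mulN1r.
by apply: q => k; rewrite ncN /nc /= normr1 normr0 addr0.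
Qed.

Lemma qb0 : qb (fun _ _ => 0) 0.
Proof.
split=> //.
- by move=> *; rewrite subrr nc0 mul0r.
- by move=> u U _ _ _ p k s; rewrite /part; case: p => /=; exact: cvg_cst.
Qed.

Lemma qbW F A B : A <= B -> qb F A -> qb F B.
Proof.
move=> AB [f1 f2 f3]; split=> // u v U V W sU sV sW bU bV bW k.
by apply: le_trans (f1 u v U V W sU sV sW bU bV bW k) _; apply: ler_wpM2r => //; exact: QQ_ge0.
Qed.

Lemma qb_if (P : pred K) F G A : qb F A -> qb G A -> qb (fun u k => if P k then F u k else G u k) A.
Proof.
move=> [f1 f2 f3] [g1 g2 g3]; split.
- by move=> u v U V W sU sV sW bU bV bW k; case: ifP => _; [exact: f1|exact: g1].
- by move=> k; case: ifP.
- by move=> u U sU bU cU p k; case: (P k); [exact: (f3 u U)|exact: (g3 u U)].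
Qed.

(* factors: frequency multipliers of order at most one applied to an unknown *)
Definition fac (B : R) (f : st -> K -> C) : Prop :=
  exists mu : K -> C, exists s i : bool, (forall k, k != 0 -> nc (mu k) <= B * freq k) /\ forall u k, f u k = mu k * zc s i u k.

Lemma zc_le s i u U k : bdd u U -> 0 <= U k -> nc (zc s i u k) <= 2 * U k.
Proof.
move=> bU U0; rewrite /zc; case: ifP => _; first by rewrite nc0 mulr_ge0.
by rewrite /nc /= mulr_natl mulr2n; apply: lerD; exact: bU.
Qed.

Lemma zcB s i u v k : zc s i u k - zc s i v k = zc s i (sdiff u v) k.
Proof. by rewrite /zc; case: ifP => _; [rewrite subrr|rewrite /sdiff]. Qed.

Lemma fac_le B f u U k : 0 <= B -> fac B f -> bdd u U -> (forall k, 0 <= U k) -> nc (f u k) <= 2 * B * (freq k * U k).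
Proof.
move=> B0 [mu [s [i [hm hf]]]] bU U0; rewrite hf; have [->|k0] := eqVneq k 0.
  by rewrite /zc eqxx mulr0 nc0 mulr_ge0// mulr_ge0// ?mulr_ge0// freq_ge0.
apply: le_trans (ncM _ _) _; apply: le_trans (ler_pM (nc_ge0 _) (nc_ge0 _) (hm k k0) (zc_le s i bU (U0 k))) _.
by apply: le_of_eq; ring.
Qed.

Lemma fac_sub B f u v k : fac B f -> f u k - f v k = f (sdiff u v) k.
Proof. by move=> [mu [s [i [hm hf]]]]; rewrite !hf -mulrBr zcB. Qed.

Lemma smallw_QS U V k : smallw U -> smallw V -> summ (fun l => freq l * U l * (freq (k - l) * V (k - l))).
Proof. by move=> [U0 sU] [V0 sV]; exact: Q_summ1. Qed.

Lemma fac_summ B f g u U v V k : 0 <= B -> fac B f -> fac B g -> smallw U -> smallw V -> bdd u U -> bdd v V ->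
  csumm (fun l => f u l * g v (k - l)) /\ nc (csm (fun l => f u l * g v (k - l))) <= 2 * B * (2 * B) * Q U V k.
Proof.
move=> B0 ff fg sU sV bU bV; have [U0 _] := sU; have [V0 _] := sV.
have h l : nc (f u l * g v (k - l)) <= 2 * B * (2 * B) * (freq l * U l * (freq (k - l) * V (k - l))).
  apply: le_trans (ncM _ _) _.
  have := ler_pM (nc_ge0 _) (nc_ge0 _) (fac_le l B0 ff bU U0) (fac_le (k - l) B0 fg bV V0).
  by move=> q; apply: le_trans q _; apply: le_of_eq; ring.
have sS := summZ (2 * B * (2 * B)) (smallw_QS k sU sV).
split; first exact: csumm_le h sS.
by apply: le_trans (nc_csm h sS) _; rewrite /Q smZ//; exact: smallw_QS.
Qed.

(** f(u) g(u) - f(v) g(v) = f(u) g(u - v) + f(u - v) g(v), the factors being linear. Each factor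
    costs 2 B: B from its multiplier, 2 from adding real and imaginary parts in [nc]. *)
Lemma qb_conv B f g : 0 <= B -> fac B f -> fac B g -> qb (fun u => cconv (f u) (g u)) (2 * B * (2 * B)).
Proof.
move=> B0 ff fg; split.
- move=> u v U V W sU sV sW bU bV bW k; rewrite /cconv.
  have [s1 _] := fac_summ k B0 ff fg sU sU bU bU; have [s2 _] := fac_summ k B0 ff fg sV sV bV bV.
  have [s3 h3] := fac_summ k B0 ff fg sU sW bU bW; have [s4 h4] := fac_summ k B0 ff fg sW sV bW bV.
  rewrite -csmB// (_ : csm _ = csm (fun l => f u l * g (sdiff u v) (k - l) + f (sdiff u v) l * g v (k - l))); last first.
    by apply: eq_csm => l; rewrite -(fac_sub _ _ _ ff) -(fac_sub _ _ _ fg); ring.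
  by rewrite csmD// mulrDr; apply: le_trans (ncD _ _) _; apply: lerD.
- move=> k; rewrite /cconv -[RHS](@csm0 R K); apply: eq_csm => l.
  have [mu [s [i [hm hf]]]] := ff; rewrite hf /zc.
  by rewrite (_ : Complex 0 0 = 0) // if_same mulr0 mul0r.
- move=> u U sU bU cU p k.
  have cz s i l q : continuous (fun t : R => part q (zc s i (u t) l)).
    by move=> t; rewrite /part /zc; case: q; case: (l == 0) => /=; do ?[exact: cvg_cst|exact: cU].
  have cf h q l : fac B h -> continuous (fun t : R => part q (h (u t) l)).
    move=> [mu [s [i [hm hf]]]]; have hr := cz s i l false; have hi := cz s i l true.
    rewrite /part in hr hi *; case: q.
      rewrite (_ : (fun t : R => _) = (fun t : R => Re (mu l) * Im (zc s i (u t) l) + Im (mu l) * Re (zc s i (u t) l))).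
        by move=> t; apply: cvgD; apply: cvgMr; [exact: hi|exact: hr].
      by apply/funext => t; rewrite hf cImM.
    rewrite (_ : (fun t : R => _) = (fun t : R => Re (mu l) * Re (zc s i (u t) l) - Im (mu l) * Im (zc s i (u t) l))).
      by move=> t; apply: cvgB; apply: cvgMr; [exact: hr|exact: hi].
    by apply/funext => t; rewrite hf cReM.
  have [U0 _] := sU.
  have bnd q (t : R) l : `|part q (f (u t) l * g (u t) (k - l))| <= 2 * B * (2 * B) * (freq l * U l * (freq (k - l) * U (k - l))).
    apply: (@le_trans _ _ (nc (f (u t) l * g (u t) (k - l)))); first by rewrite /part; case: q; [exact: Im_nc|exact: Re_nc].
    apply: le_trans (ncM _ _) _.
    have := ler_pM (nc_ge0 _) (nc_ge0 _) (fac_le l B0 ff (bU t) U0) (fac_le (k - l) B0 fg (bU t) U0).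
    by move=> q'; apply: le_trans q' _; apply: le_of_eq; ring.
  have sS := summZ (2 * B * (2 * B)) (smallw_QS k sU sU).
  have -> : (fun t : R => part p (cconv (f (u t)) (g (u t)) k)) = (fun t : R => sm (fun l => part p (f (u t) l * g (u t) (k - l)))).
    by apply/funext => t; rewrite /part; case: p.
  move=> t; apply: (@sm_cvg _ _ _ _ _ (fun (t : R) l => part p (f (u t) l * g (u t) (k - l))) _ _ sS).
  + by apply: nearW => t' l; exact: bnd.
  + by move=> l; exact: bnd.
  + move=> l; have f1 := cf f false l ff; have f2 := cf f true l ff; have g1 := cf g false (k - l) fg; have g2 := cf g true (k - l) fg.
    rewrite /part in f1 f2 g1 g2 *; case: p.
      under eq_fun do rewrite cImM; rewrite cImM.
      by apply: cvgD; apply: cvgM; [exact: f1|exact: g2|exact: f2|exact: g1].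
    under eq_fun do rewrite cReM; rewrite cReM.
    by apply: cvgB; apply: cvgM; [exact: f1|exact: g1|exact: f2|exact: g2].
Qed.

(** A common constant for the four kinds of factors: 2 pi for derivatives, at least 1 for the
    identity and for the vertical integral of a horizontal derivative. *)
Definition kB : R := 2 * pi + 1.

Lemma kB_ge0 : 0 <= kB. Proof. by rewrite addr_ge0 ?twopi_ge0. Qed.
Lemma kB_ge1 : 1 <= kB. Proof. by rewrite lerDr twopi_ge0. Qed.

Lemma fac_id s i : fac kB (zc s i).
Proof.
exists (fun=> 1), s, i; split => [k k0|u k]; last by rewrite mul1r.
rewrite /nc /= normr1 normr0 addr0; have h1 := @freq_ge1 R k k0; have h2 := kB_ge1.
by rewrite -[1]mulr1 ler_pM.
Qed.

Lemma fac_D j s i : fac kB (fun u => D j (zc s i u)).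
Proof.
exists (fun k => Complex 0 (2 * pi * kx j k)), s, i; split => // k k0.
rewrite nc_im normrM ger0_norm ?twopi_ge0//.
by rewrite ler_pM// ?twopi_ge0// ?kx_le// lerDl.
Qed.

Lemma fac_Dz s i : fac kB (fun u => Dz (zc s i u)).
Proof.
exists (fun k => Complex 0 (2 * pi * kz k)), s, i; split => // k k0.
rewrite nc_im normrM ger0_norm ?twopi_ge0//.
by rewrite ler_pM// ?twopi_ge0// ?kz_le// lerDl.
Qed.

Lemma VzDE j c k : Vz (D j c) k = Complex (kx j k * (kz k)^-1) 0 * c k.
Proof.
have pn : 2 * pi != 0 :> R by rewrite gt_eqF// twopi_gt0.
rewrite /Vz /D mulrA; congr (_ * _); rewrite invfM; move: (2 * pi) pn (kz k)^-1 (kx j k) => p pn a e.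
by apply: C_eq; rewrite ?(cReM,cImM) /=; field.
Qed.

(** The multiplier is k_j / k_z with |k_z| >= 1 on the modes kept: vertical integration gains
    nothing in general, and the vertical velocity costs a full derivative. *)
Lemma fac_V j s i : fac kB (fun u => Vz (D j (zc s i u))).
Proof.
exists (fun k => Complex (kx j k * (kz k)^-1) 0), s, i; split => [k k0|u k]; last exact: VzDE.
rewrite nc_re normrM -[leLHS]mulrC; apply: ler_pM => //; last exact: kx_le.
exact: le_trans (kz_inv_le k) kB_ge1.
Qed.

Local Notation q1 := (2 * kB * (2 * kB)).

Lemma q1_ge0 : 0 <= q1. Proof. by rewrite !mulr_ge0 ?kB_ge0. Qed.

Lemma qb_adv s s' i : qb (fun u => advc (fun j => zc s j u) (fun j => zc s' j u) i) (q1 + q1).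
Proof.
have h j : qb (fun u => cconv (zc s j u) (D j (zc s' i u))) q1 := qb_conv kB_ge0 (fac_id s j) (fac_D j s' i).
exact: qbD (h false) (h true).
Qed.

Lemma qb_div i : qb (fun u => divc (zt u) i) (q1 + q1).
Proof.
have h j : qb (fun u => cconv (D j (zt u j)) (zt u i)) q1 := qb_conv kB_ge0 (fac_D j true j) (fac_id true i).
exact: qbD (h false) (h true).
Qed.

Lemma qb_vert i : qb (fun u => vertc (zt u) i) (q1 + q1).
Proof.
have h j : qb (fun u => cconv (Vz (D j (zt u j))) (Dz (zt u i))) q1 := qb_conv kB_ge0 (fac_V j true j) (fac_Dz true i).
exact: qbD (h false) (h true).
Qed.

(** The powers of 2 pi cancel and exhibit the projection as a matrix multiplier with entries bounded
    by 1, costing no derivative. *)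
Lemma LrE n i k : Lr n i k = n i k - (Complex (kx i k * kx false k / K2 k) 0 * n false k + Complex (kx i k * kx true k / K2 k) 0 * n true k).
Proof.
have pn : 2 * pi != 0 :> R by rewrite gt_eqF// twopi_gt0.
rewrite /Lr /D /lapinv /cdiv /D; move: (2 * pi) pn => p pn; rewrite !invfM; move: (K2 k)^-1 (kx i k) (kx false k) (kx true k) => w a e f.
by apply: C_eq; rewrite ?(cReD,cImD,cReN,cImN,cReM,cImM) /=; field.
Qed.

Lemma Lr_mult_le i j k : nc (Complex (kx i k * kx j k / K2 k) 0 : C) <= 1.
Proof.
rewrite nc_re normrM normfV.
have h : `|kx i k * kx j k| <= K2 k :> R.
  rewrite normrM /K2; have := sqr_ge0 (`|kx false k| - `|kx true k|).
  rewrite -[kx false k ^+ 2]real_normK ?num_real// -[kx true k ^+ 2]real_normK ?num_real//.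
  have := normr_ge0 (kx false k); have := normr_ge0 (kx true k).
  by case: i; case: j; move: `|kx false k| `|kx true k| => a e; nra.
have K20 : 0 <= K2 k :> R := le_trans (normr_ge0 _) h.
rewrite (ger0_norm K20); have [->|kn] := eqVneq (K2 k : R) 0; first by rewrite invr0 mulr0.
by rewrite ler_pdivrMr ?mul1r// lt_neqAle eq_sym kn.
Qed.

Lemma qb_nbar i : qb (fun u => nbar (zb u) (zt u) i) (6 * q1).
Proof.
have -> : 6 * q1 = (q1 + q1) + ((q1 + q1) + (q1 + q1)) by ring.
by apply: qbD; [exact: qb_adv|apply: qbD; [exact: qb_div|exact: qb_adv]].
Qed.

(** The three quadratic terms of [nbar] give 6 q1; the identity and the two multipliers of the Leray
    projection make it 18 q1. The value 24 is a common bound shared with [Nt]. *)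
Lemma qb_Nb i : qb (fun u => Nb (zb u) (zt u) i) (24 * q1).
Proof.
have q0 := q1_ge0.
apply: (@qb_if (fun k => (k == 0) || (k.2 != 0))); first by apply: (qbW _ qb0); rewrite mulr_ge0.
apply: (@qbW _ (6 * q1 + (1 * (6 * q1) + 1 * (6 * q1)))); first by move: (q1) q0 => q q0; lra.
apply: qbN; rewrite (_ : (fun u k => _) = (fun u k => nbar (zb u) (zt u) i k +
   - (Complex (kx i k * kx false k / K2 k) 0 * nbar (zb u) (zt u) false k + Complex (kx i k * kx true k / K2 k) 0 * nbar (zb u) (zt u) true k))).
  apply: qbD; first exact: qb_nbar.
  have h j := @qbM _ _ (6 * q1) 1 ler01 (fun k => Lr_mult_le i j k) (qb_nbar j).
  exact: qbN (qbD (h false) (h true)).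
by apply/funext => u; apply/funext => k; rewrite LrE.
Qed.

Lemma qb_Nt i : qb (fun u => Nt (zb u) (zt u) i) (24 * q1).
Proof.
have q0 := q1_ge0.
apply: (@qb_if (fun k => k == 0)); first by apply: (qbW _ qb0); rewrite mulr_ge0.
apply: (@qbW _ (((q1 + q1) + (q1 + q1)) + ((q1 + q1) + (q1 + q1)))); first by move: (q1) q0 => q q0; lra.
apply: qbD; first by apply: qbN; apply: qbD; exact: qb_adv.
apply: (@qb_if (fun k => k.2 == 0)); first by apply: (qbW _ qb0); rewrite !addr_ge0.
by apply: qbD; [exact: qb_vert|apply: qbN; exact: qb_adv].
Qed.

Lemma quad_N0 : quad (fun=> N0) (24 * q1).
Proof.
have P p z : `|part p z| <= nc z by rewrite /part; case: p; [exact: Im_nc|exact: Re_nc].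
have PB p z w : part p z - part p w = part p (z - w).
  by rewrite /part; case: p; rewrite ?cReD ?cImD ?cReN ?cImN.
split.
- move=> s u v U V W sU sV sW bU bV bW i k; rewrite /N0 PB; apply: le_trans (P _ _) _.
  have [h1 _ _] := qb_Nt i.1.2; have [h2 _ _] := qb_Nb i.1.2.
  by case: (i.1.1); [exact: h1|exact: h2].
- move=> s i k; rewrite /N0; have [_ h1 _] := qb_Nt i.1.2; have [_ h2 _] := qb_Nb i.1.2.
  by case: (i.1.1); rewrite ?h1 ?h2 /part; case: (i.2).
- by move=> s u i; rewrite /N0 /Nt /Nb eqxx /= if_same /part; case: (i.2).
- move=> u U sU bU cU i k; rewrite /N0.
  have [_ _ h1] := qb_Nt i.1.2; have [_ _ h2] := qb_Nb i.1.2.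
  by case: (i.1.1); [exact: (h1 u U)|exact: (h2 u U)].
Qed.

Definition rota (th : R) u : st := fun i k =>
  if i.1.1 then
    (if i.1.2 then sin th * u (true, false, i.2) k + cos th * u (true, true, i.2) k
     else cos th * u (true, false, i.2) k - sin th * u (true, true, i.2) k)
  else u i k.

Lemma rotaK th u : rota th (rota (- th) u) = u.
Proof.
apply/funext => -[[[] []] p]; apply/funext => k; rewrite /rota //= cosN sinN; have := cos2Dsin2 th => h.
  transitivity ((cos th ^+ 2 + sin th ^+ 2) * u (true, true, p) k); first by ring.
  by rewrite h mul1r.
transitivity ((cos th ^+ 2 + sin th ^+ 2) * u (true, false, p) k); first by ring.
by rewrite h mul1r.
Qed.

Lemma rotaB th u v : sdiff (rota th u) (rota th v) = rota th (sdiff u v).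
Proof. by apply/funext => -[[[] []] p]; apply/funext => k; rewrite /rota /sdiff //=; ring. Qed.

Lemma rota0 th : rota th (fun _ _ => 0) = (fun _ _ => 0).
Proof. by apply/funext => -[[[] []] p]; apply/funext => k; rewrite /rota //= !mulr0 ?addr0 ?subr0. Qed.

Lemma rota_id u : rota 0 u = u.
Proof. by apply/funext => -[[[] []] p]; apply/funext => k; rewrite /rota //= cos0 sin0; ring. Qed.

Lemma rota_le th u (B : R) k : (forall i, `|u i k| <= B) -> forall i, `|rota th u i k| <= 2 * B.
Proof.
move=> h [[s i] p]; have B0 : 0 <= B := le_trans (normr_ge0 _) (h (s, i, p)).
have le1 (a b c d : R) : `|a| <= 1 -> `|c| <= 1 -> `|b| <= B -> `|d| <= B -> `|a * b| + `|c * d| <= 2 * B.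
  by move=> a1 c1 b1 d1; rewrite mulr_natl mulr2n !normrM; apply: lerD; rewrite -[leRHS]mul1r ler_pM.
rewrite /rota /=; case: s; last by apply: le_trans (h _) _; rewrite mulr_natl mulr2n lerDl.
case: i; [apply: le_trans (ler_normD _ _) _|apply: le_trans (ler_normB _ _) _];
  by apply: le1; rewrite ?h// ?cos_le1' ?sin_le1'.
Qed.

Lemma rota_cts (th : R -> R) (u : R -> st) : continuous th -> (forall i k, continuous (fun s => u s i k)) ->
  forall i k, continuous (fun s => rota (th s) (u s) i k).
Proof.
move=> ct cu [[s i] p] k; rewrite /rota /=; case: s; last exact: cu.
have cc : continuous (fun s => cos (th s)) by move=> s; apply: (@continuous_comp _ _ _ th cos); [exact: ct|exact: continuous_cos].
have cs : continuous (fun s => sin (th s)) by move=> s; apply: (@continuous_comp _ _ _ th sin); [exact: ct|exact: continuous_sin].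
case: i => s; [apply: cvgD|apply: cvgB]; apply: cvgM; do ?[exact: cc|exact: cs|exact: cu].
Qed.

Definition NR (Om t : R) u : st := rota (Om * t) (N0 (rota (- (Om * t)) u)).

Lemma smallw2 U : smallw U -> smallw (fun k => 2 * U k).
Proof.
move=> [U0 sU]; split=> [k|]; first by rewrite mulr_ge0.
by have := summZ 2 sU; apply: summ_le => k; rewrite le_eqVlt ger0_norm ?mulr_ge0 ?freq_ge0//; apply/orP; left; apply/eqP; ring.
Qed.

Lemma Q2 U V k : smallw U -> smallw V -> Q (fun k => 2 * U k) (fun k => 2 * V k) k = 4 * Q U V k.
Proof.
move=> sU sV; rewrite /Q -smZ; last exact: smallw_QS.
by apply: eq_sm => l; ring.
Qed.

(** Componentwise a rotation at most doubles a bound. The inner one acts on both arguments of a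
    quadratic expression (factor 4), the outer one on the result (factor 2); neither depends on the
    angle, so the constant is independent of [Om]. *)
Lemma quad_NR Om : quad (NR Om) (8 * (24 * q1)).
Proof.
have [n1 n2 n3 n4] := quad_N0; split.
- move=> s u v U V W sU sV sW bU bV bW i k.
  have b2 w (Z : K -> R) : bdd w Z -> bdd (rota (- (Om * s)) w) (fun k => 2 * Z k).
    by move=> bZ j l; apply: rota_le => j'; exact: bZ.
  have h i' := n1 0 (rota (- (Om * s)) u) (rota (- (Om * s)) v) _ _ _ (smallw2 sU) (smallw2 sV) (smallw2 sW) (b2 u U bU) (b2 v V bV) _ i' k.
  have bW' : bdd (sdiff (rota (- (Om * s)) u) (rota (- (Om * s)) v)) (fun k => 2 * W k) by rewrite rotaB; exact: b2.
  rewrite -[X in `|X|]/(sdiff (NR Om s u) (NR Om s v) i k) /NR rotaB.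
  have hh := @rota_le (Om * s) (sdiff (N0 (rota (- (Om * s)) u)) (N0 (rota (- (Om * s)) v))) _ k (h bW') i.
  apply: le_trans hh _.
  by rewrite !Q2//; apply: le_of_eq; ring.
- move=> s i k; rewrite /NR rota0.
  have -> : N0 (fun _ _ => 0) = (fun _ _ => 0) by apply/funext => i'; apply/funext => k'; exact: (n2 0).
  by rewrite rota0.
- move=> s u [[j i] p]; rewrite /NR /rota /=; case: j; last exact: (n3 0).
  by rewrite !(n3 0) !mulr0; case: i; rewrite ?addr0 ?subr0.
- move=> u U sU bU cU i k; apply: rota_cts.
    by move=> s; apply: cvgMr; exact: cvg_id.
  apply: (n4 (fun s => rota (- (Om * s)) (u s)) (fun k => 2 * U k) (smallw2 sU)).
    by move=> s j l; apply: rota_le => j'; exact: bU.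
  apply: rota_cts => // s; apply: cvgN; apply: cvgMr; exact: cvg_id.
Qed.

End Nonlinearity.

(** * Identification of the coefficient system with the physical equations *)

Section Physical.
Context {R : realType}.
Local Notation C := (R[i]).
Local Notation K := (int * int * int)%type.
Local Notation freq := (@freq R).
Implicit Types (c d : K -> C) (k l m : K) (x : R * R * R) (b t n : bool -> K -> C).

(** The conditions on the coefficients of the barotropic field [b] and of the fluctuation [t] under
    which every operator of the system acts on their series by its coefficient formula. *)
Record pgood b t : Prop := PGood {
  pg_rb : forall i, rd (b i); pg_rt : forall i, rd (t i);
  pg_hb : forall i, herm (b i); pg_ht : forall i, herm (t i);
  pg_ev : forall i k, t i (zr k) = t i k;
  pg_sb : forall i k, k.2 != 0 -> b i k = 0;
  pg_db : forall k, cdiv b k = 0;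
  pg_dt : forall k, k.2 = 0 -> cdiv t k = 0 }.

Lemma advcE a n i k : (forall i, csumm (a i)) -> (forall j i, csumm (D j (n i))) ->
  let T l := a false l * D false (n i) (k - l) + a true l * D true (n i) (k - l) in csumm T /\ advc a n i k = csm T.
Proof.
move=> ha hn T; have h j := csumm_convt k (ha j) (hn j i).
by split; [exact: csumD|rewrite /advc /cconv -csmD].
Qed.

Lemma divcE t i k : (forall i, csumm (t i)) -> (forall j i, csumm (D j (t i))) ->
  let T l := cdiv t l * t i (k - l) in csumm T /\ divc t i k = csm T.
Proof.
move=> ha hn T; have h j := csumm_convt k (hn j j) (ha i).
have -> : T = (fun l => D false (t false) l * t i (k - l) + D true (t true) l * t i (k - l)).
  by apply/funext => l; rewrite /T /cdiv mulrDl.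
by split; [exact: csumD|rewrite /divc /cconv -csmD].
Qed.

Lemma vertcE t i k : (forall i, csumm (Dz (t i))) -> (forall j, csumm (Vz (D j (t j)))) ->
  let T l := Vz (cdiv t) l * Dz (t i) (k - l) in csumm T /\ vertc t i k = csm T.
Proof.
move=> ha hn T; have h j := csumm_convt k (hn j) (ha i).
have -> : T = (fun l => Vz (D false (t false)) l * Dz (t i) (k - l) + Vz (D true (t true)) l * Dz (t i) (k - l)).
  by apply/funext => l; rewrite /T /Vz /cdiv mulrDr mulrDl.
by split; [exact: csumD|rewrite /vertc /cconv -csmD].
Qed.

(** Integration by parts, term by term: the mean of a . grad n is minus the mean of (div a) n. It
    makes the zero modes of the nonlinearity vanish. *)
Lemma adv0 a n i l : a false l * D false (n i) (0 - l) + a true l * D true (n i) (0 - l) = - (cdiv a l * n i (0 - l)).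
Proof. by rewrite /cdiv /D sub0r !kxN; apply: C_eq; rewrite ?(cReD,cImD,cReN,cImN,cReM,cImM) /=; ring. Qed.

Lemma csm_zero (f : K -> C) : (forall k, f k = 0) -> csm f = 0.
Proof. by move=> h; rewrite -[RHS](@csm0 R K); apply: eq_csm. Qed.

Section PG.
Variables b t : bool -> K -> C.
Hypothesis pg : pgood b t.

Let rb := pg_rb pg. Let rt := pg_rt pg.
Let sb i : csumm (b i) := rd_summ (rb i).
Let st i : csumm (t i) := rd_summ (rt i).
Let sDb j i : csumm (D j (b i)) := rd_summ (rdDx j (rb i)).
Let sDt j i : csumm (D j (t i)) := rd_summ (rdDx j (rt i)).
Let sDz i : csumm (Dz (t i)) := rd_summ (rdDz (rt i)).
Let sV j : csumm (Vz (D j (t j))) := rd_summ (rdVz (rdDx j (rt j))).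

Lemma nbar0 i : nbar b t i 0 = 0.
Proof.
rewrite /nbar; have [_ ->] := advcE i 0 sb sDb.
have [s1 ->] := divcE i 0 st sDt; have [s2 ->] := advcE i 0 st sDt.
rewrite csm_zero => [|l]; last by rewrite adv0 (pg_db pg) mul0r oppr0.
rewrite add0r -csmD// csm_zero// => l; rewrite adv0; exact: subrr.
Qed.

Lemma advtb0 i : advc t b i 0 = 0.
Proof.
have [_ ->] := advcE i 0 st sDb; apply: csm_zero => l; rewrite adv0.
have [l0|l0] := eqVneq l.2 0; first by rewrite (pg_dt pg)// mul0r oppr0.
by rewrite sub0r (pg_sb pg) ?mulr0 ?oppr0//= oppr_eq0.
Qed.

Lemma advbt0 i : advc b t i 0 = 0.
Proof. by have [_ ->] := advcE i 0 sb sDt; apply: csm_zero => l; rewrite adv0 (pg_db pg) mul0r oppr0. Qed.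

(** Integration by parts in z of the vertical average: when k.2 = 0 the two factors have opposite
    vertical frequencies, so the division by one and the multiplication by the other leave exactly
    -1. *)
Lemma divvert0 i k : k.2 = 0 -> divc t i k + vertc t i k = 0.
Proof.
move=> k0; have [s1 ->] := divcE i k st sDt; have [s2 ->] := vertcE i k sDz sV.
rewrite -csmD// csm_zero// => l; rewrite /Vz /Dz.
have [l0|l0] := eqVneq l.2 0; first by rewrite (pg_dt pg)// mulr0 !mul0r addr0.
have -> : kz (k - l) = - kz l :> R by rewrite /kz /= k0 sub0r mulrNz.
have un : 2 * pi * kz l != 0 :> R by rewrite mulf_neq0 ?intr_eq0// gt_eqF// twopi_gt0.
rewrite mulrN; move: (2 * pi * kz l) un (cdiv t l) (t i (k - l)) => u un z w.
transitivity (z * w + (Complex 0 (- u^-1) * Complex 0 (- u)) * (z * w)); first by ring.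
have -> : Complex 0 (- u^-1) * Complex 0 (- u) = -1.
  by apply: C_eq; rewrite ?(cReM,cImM) /=; field.
by rewrite mulN1r subrr.
Qed.

Lemma advc_rd a n i : (forall i, rd (a i)) -> (forall i, rd (n i)) -> rd (advc a n i).
Proof. by move=> ra rn; exact (rdD (rd_conv (ra false) (rdDx false (rn i))) (rd_conv (ra true) (rdDx true (rn i)))). Qed.
Lemma divc_rd i : rd (divc t i).
Proof. exact (rdD (rd_conv (rdDx false (rt false)) (rt i)) (rd_conv (rdDx true (rt true)) (rt i))). Qed.
Lemma vertc_rd i : rd (vertc t i).
Proof. exact (rdD (rd_conv (rdVz (rdDx false (rt false))) (rdDz (rt i))) (rd_conv (rdVz (rdDx true (rt true))) (rdDz (rt i)))). Qed.

Lemma advc_supp i k : k.2 != 0 -> advc b b i k = 0.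
Proof.
move=> k0; have [_ ->] := advcE i k sb sDb; apply: csm_zero => l.
have [l0|l0] := eqVneq l.2 0; last by rewrite !(pg_sb pg)// !mul0r addr0.
have h : (k - l).2 != 0 by rewrite /= l0 subr0.
by have e := pg_sb pg i h; rewrite /D e !mulr0 addr0.
Qed.

Lemma Lr_zz n i k : k.2 = 0 -> Lr (fun i => Zz (n i)) i k = Lr n i k.
Proof. by move=> k0; rewrite !LrE /Zz k0 eqxx. Qed.

Lemma Lr_add n n' i k : Lr (fun i k => n i k + n' i k) i k = Lr n i k + Lr n' i k.
Proof. by rewrite !LrE; ring. Qed.

Lemma adv_ser a n z (y : R * R) : (forall i, rd (a i)) -> (forall i, rd (n i)) -> (forall i, herm (n i)) ->
  adv (fun y => vser a (y, z)) (fun y => vser n (y, z)) y = vser (advc a n) (y, z).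
Proof.
move=> ra rn hn; rewrite /adv.
have h i : ser (a false) (y, z) * ser (D false (n i)) (y, z) + ser (a true) (y, z) * ser (D true (n i)) (y, z) = ser (advc a n i) (y, z).
  have sc j := rd_summ (rd_conv (ra j) (rdDx j (rn i))).
  have sm j := serM (y, z) (rd_summ (ra j)) (rd_summ (rdDx j (rn i))) (hermDx j (hn i)).
  by rewrite !sm -(serD _ (sc false) (sc true)).
have e1 i : dx1 (fun y => ser (n i) (y, z)) y = ser (D false (n i)) (y, z) by rewrite dx1_ser.
have e2 i : dx2 (fun y => ser (n i) (y, z)) y = ser (D true (n i)) (y, z) by rewrite dx2_ser.
rewrite /vser -!h.
by rewrite -(e1 false) -(e2 false) -(e1 true) -(e2 true).
Qed.

Definition vbP : R * R -> R * R := fun y => vser b (y, 0).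
Definition vtP : R * R * R -> R * R := vser t.

Lemma div_vt x : div3 vtP x = ser (cdiv t) x.
Proof.
case: x => y z; rewrite /div3 /div /=.
have e1 : dx1 (fun y => ser (t false) (y, z)) y = ser (D false (t false)) (y, z) by rewrite dx1_ser.
have e2 : dx2 (fun y => ser (t true) (y, z)) y = ser (D true (t true)) (y, z) by rewrite dx2_ser.
by rewrite [X in X + _]e1 [X in _ + X]e2 -(serD _ (sDt false false) (sDt true true)).
Qed.

Lemma adv_vt x : adv3 vtP vtP x = vser (advc t t) x.
Proof. by case: x => y z; exact: (adv_ser z y rt rt (pg_ht pg)). Qed.

Lemma slice_vb z : slice (lift3 vbP) z = (fun y => vser b (y, z)).
Proof. by apply/funext => y; rewrite /slice /lift3 /vbP /vser /= !(@ser_z0 _ _ y z) //; exact: (pg_sb pg). Qed.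

Lemma divt_vt x : div3 vtP x *: vtP x = vser (divc t) x.
Proof.
rewrite div_vt.
have h i : ser (cdiv t) x * ser (t i) x = ser (divc t i) x.
  have sc j := rd_summ (rd_conv (rdDx j (rt j)) (rt i)).
  have sm j := serM x (sDt j j) (st i) (pg_ht pg i).
  by rewrite /cdiv (serD _ (sDt false false) (sDt true true)) mulrDl !sm -(serD _ (sc false) (sc true)).
by rewrite /vtP /vser -!h.
Qed.

Lemma vserD n n' x : (forall i, csumm (n i)) -> (forall i, csumm (n' i)) -> vser (fun i k => n i k + n' i k) x = vser n x + vser n' x.
Proof. by move=> hn hn'; rewrite /vser !serD. Qed.

Lemma vserN n x : vser (fun i k => - n i k) x = - vser n x.
Proof. by rewrite /vser !serN. Qed.

Lemma eq_vser n n' x : (forall i k, n i k = n' i k) -> vser n x = vser n' x.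
Proof. by move=> h; rewrite /vser; congr pair; apply: eq_ser => k. Qed.

Let s_tt i : csumm (advc t t i) := rd_summ (advc_rd i rt rt).
Let s_bb i : csumm (advc b b i) := rd_summ (advc_rd i rb rb).
Let s_tb i : csumm (advc t b i) := rd_summ (advc_rd i rt rb).
Let s_bt i : csumm (advc b t i) := rd_summ (advc_rd i rb rt).
Let s_d i : csumm (divc t i) := rd_summ (divc_rd i).
Let s_v i : csumm (vertc t i) := rd_summ (vertc_rd i).

Lemma P0_adv : P0 (fun x => div3 vtP x *: vtP x + adv3 vtP vtP x) =
  (fun y => vser (fun i => Zz (fun k => divc t i k + advc t t i k)) (y, 0)).
Proof.
rewrite -P0_ser; last by move=> i; exact: csumD.
by congr P0; apply/funext => x; rewrite vserD// adv_vt divt_vt.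
Qed.

Lemma phys_bar y : leray (adv vbP vbP) y + leray (P0 (fun x => div3 vtP x *: vtP x + adv3 vtP vtP x)) y = - vser (Nb b t) (y, 0).
Proof.
rewrite P0_adv.
have -> : adv vbP vbP = (fun y => vser (advc b b) (y, 0)).
  by apply/funext => y'; exact: (adv_ser 0 y' rb rb (pg_hb pg)).
have r2 i : rd (Zz (fun k => divc t i k + advc t t i k)) by exact: (rdZz (rdD (divc_rd i) (advc_rd i rt rt))).
have r1 i := advc_rd i rb rb.
rewrite !leray_ser//; last 2 first.
- by move=> i k k0; rewrite /Zz (negbTE k0).
- by move=> i k k0; exact: advc_supp.
have z2 i k : k.2 != 0 -> Zz (fun k => divc t i k + advc t t i k) k = 0 by move=> k0; rewrite /Zz (negbTE k0).
rewrite -vserD; [|by move=> i; exact: (rd_summ (rd_Lr i r1))|by move=> i; exact: (rd_summ (rd_Lr i r2))].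
rewrite -vserN; apply: eq_vser => i k; rewrite /Nb.
have [k0|k0] /= := eqVneq k.2 0; last first.
  by rewrite orbT !Lr_supp ?addr0 ?oppr0// => i' k' k0'; exact: advc_supp.
rewrite orbF Lr_zz// -Lr_add -[X in Lr X]/(nbar b t).
case: eqP => [->|_]; last by rewrite opprK.
by rewrite oppr0 LrE !nbar0 !mulr0 addr0 subr0.
Qed.

Lemma int0_vt x : int0 (fun s => div3 vtP (x.1, s)) x.2 = ser (Vz (cdiv t)) x.
Proof.
have -> : (fun s => div3 vtP (x.1, s)) = (fun s => ser (cdiv t) (x.1, s)) by apply/funext => s; exact: div_vt.
case: x => y z; apply: int0_ser; [exact: rd_cdiv|exact: (pg_dt pg)|].
by move=> k; rewrite /cdiv /D !(pg_ev pg) /kx.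
Qed.

Lemma dz_vt x : int0 (fun s => div3 vtP (x.1, s)) x.2 *: dz vtP x = vser (vertc t) x.
Proof.
rewrite int0_vt.
have e i : derive1 (fun s => ser (t i) (x.1, s)) x.2 = ser (Dz (t i)) x.
  by have [_ ->] := is_derive_1 (ser_derive3 x.1 x.2 (rt i)); case: (x).
have h i : ser (Vz (cdiv t)) x * ser (Dz (t i)) x = ser (vertc t i) x.
  have -> : ser (Vz (cdiv t)) x = ser (Vz (D false (t false))) x + ser (Vz (D true (t true))) x.
    by rewrite -(serD _ (sV false) (sV true)); apply: eq_ser => k; rewrite /Vz /cdiv mulrDr.
  have sc j := rd_summ (rd_conv (rdVz (rdDx j (rt j))) (rdDz (rt i))).
  have sm j := serM x (sV j) (sDz i) (hermDz (pg_ht pg i)).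
  by rewrite mulrDl !sm -(serD _ (sc false) (sc true)).
by rewrite /vser -!h /dz -!e.
Qed.

Lemma phys_til x : adv3 vtP vtP x + adv3 vtP (lift3 vbP) x + adv3 (lift3 vbP) vtP x
    - P0 (fun x' => adv3 vtP vtP x' + div3 vtP x' *: vtP x') x.1
    - int0 (fun s => div3 vtP (x.1, s)) x.2 *: dz vtP x = - vser (Nt b t) x.
Proof.
rewrite dz_vt adv_vt.
have -> : P0 (fun x' => adv3 vtP vtP x' + div3 vtP x' *: vtP x') = P0 (fun x => div3 vtP x *: vtP x + adv3 vtP vtP x).
  by congr P0; apply/funext => x'; rewrite addrC.
rewrite P0_adv.
have -> : adv3 vtP (lift3 vbP) x = vser (advc t b) x.
  by case: x => y z; rewrite /adv3 slice_vb; exact: (adv_ser z y rt rb (pg_hb pg)).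
have -> : adv3 (lift3 vbP) vtP x = vser (advc b t) x.
  by case: x => y z; rewrite /adv3 slice_vb; exact: (adv_ser z y rb rt (pg_ht pg)).
have -> : vser (fun i => Zz (fun k => divc t i k + advc t t i k)) (x.1, 0) = vser (fun i => Zz (fun k => divc t i k + advc t t i k)) x.
  case: x => y z; rewrite /vser; congr pair; apply/esym/ser_z0 => k k0; by rewrite /Zz (negbTE k0).
have sZ i : csumm (Zz (fun k => divc t i k + advc t t i k)).
  exact: (rd_summ (rdZz (rdD (divc_rd i) (advc_rd i rt rt)))).
suff h i : ser (advc t t i) x + ser (advc t b i) x + ser (advc b t i) x - ser (Zz (fun k => divc t i k + advc t t i k)) x - ser (vertc t i) x
    = - ser (Nt b t i) x.
  exact (f_equal2 pair (h false) (h true)).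
rewrite -!serN -(serD _ (s_tt i) (s_tb i)) -(serD _ (csumD (s_tt i) (s_tb i)) (s_bt i)).
rewrite -(serD _ (csumD (csumD (s_tt i) (s_tb i)) (s_bt i)) (csumN (sZ i))).
rewrite -(serD _ (csumD (csumD (csumD (s_tt i) (s_tb i)) (s_bt i)) (csumN (sZ i))) (csumN (s_v i))).
apply: eq_ser => k; rewrite /Nt /Zz.
have [->|k0] := eqVneq k 0.
  rewrite advtb0 advbt0 !addr0 oppr0.
  have -> : (if (0 : K).2 == 0 then divc t i 0 + advc t t i 0 else 0) = divc t i 0 + advc t t i 0 by [].
  have h := divvert0 i (k := 0) erefl.
  by transitivity (- (divc t i 0 + vertc t i 0)); [ring|rewrite h oppr0].
have [k2|k2] := eqVneq k.2 0; last by ring.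
have h := divvert0 i k2; rewrite addr0; move: h.
move: (advc t t i k) (divc t i k) (vertc t i k) (advc t b i k) (advc b t i k) => p1 p2 p3 p4 p5 h.
transitivity (p4 + p5 - (p2 + p3)); first by ring.
by rewrite h subr0 opprK.
Qed.

End PG.

Local Notation st := (Ix -> K -> R).
Implicit Types (u v : st).

(** The constraints of [pgood] other than decay, written on the real unknowns as linear relations so
    that they can be propagated. A fluctuation without modes at k.2 = 0 is in particular free of
    averaged divergence. *)
Record good u : Prop := Good {
  gd_h : forall s i p k, u (s, i, p) (- k) = (if p then -1 else 1) * u (s, i, p) k;
  gd_e : forall i p k, u (true, i, p) (zr k) = u (true, i, p) k;
  gd_s : forall i p k, k.2 != 0 -> u (false, i, p) k = 0;
  gd_d : forall p k, kx false k * u (false, false, p) k + kx true k * u (false, true, p) k = 0;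
  gd_z : forall i p k, k.2 = 0 -> u (true, i, p) k = 0;
  gd_0 : forall i, u i 0 = 0 }.

Lemma good_rota th u : good u -> good (rota th u).
Proof.
case=> h e s d z o; split.
- move=> [] i p k; rewrite /rota /=; last exact: h.
  by case: i; rewrite !h; case: p; ring.
- by move=> i p k; rewrite /rota /= !e.
- by move=> i p k k0; rewrite /rota /= s.
- by move=> p k; rewrite /rota /= d.
- by move=> i p k k0; rewrite /rota /= !z//; case: i; rewrite !mulr0 ?addr0 ?subr0.
- by move=> [[s' i] p]; rewrite /rota /= !o; case: s'; case: i; rewrite ?mulr0 ?addr0 ?subr0.
Qed.

Lemma good_zc_herm u s i : good u -> herm (zc s i u).
Proof.
move=> g k; rewrite /zc oppr_eq0; case: ifP => _; first by rewrite rmorph0.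
by apply: C_eq; rewrite ?(cReJ,cImJ) /= (gd_h g); ring.
Qed.

Lemma good_cdiv u k : (forall p, kx false k * u (true, false, p) k + kx true k * u (true, true, p) k = 0) -> cdiv (zt u) k = 0.
Proof.
move=> h; rewrite /cdiv /D /zt /zc; case: ifP => _; first by rewrite !mulr0 addr0.
have hf := h false; have ht := h true.
apply: C_eq; rewrite ?(cReD,cImD,cReM,cImM) /=.
  by have e := congr1 (fun s => - (2 * pi) * s) ht; rewrite mulr0 in e; rewrite -[RHS]e /kx /=; ring.
by have e := congr1 (fun s => 2 * pi * s) hf; rewrite mulr0 in e; rewrite -[RHS]e /kx /=; ring.
Qed.

Lemma good_pgood u : good u -> (forall s i, rd (zc s i u)) -> pgood (zb u) (zt u).
Proof.
move=> g r; split.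
- by move=> i; exact: r.
- by move=> i; exact: r.
- by move=> i; exact: good_zc_herm.
- by move=> i; exact: good_zc_herm.
- move=> i k; rewrite /zt /zc.
  have -> : (zr k == 0) = (k == 0) by case: k => k1 k2; rewrite /zr !xpair_eqE oppr_eq0.
  by rewrite !(gd_e g).
- by move=> i k k0; rewrite /zb /zc !(gd_s g)// -[Complex 0 0]/(0 : C) if_same.
- move=> k; rewrite /cdiv /D /zb /zc; case: ifP => _; first by rewrite !mulr0 addr0.
  have hf := gd_d g false k; have ht := gd_d g true k.
  apply: C_eq; rewrite ?(cReD,cImD,cReM,cImM) /=.
    by have e := congr1 (fun s => - (2 * pi) * s) ht; rewrite mulr0 in e; rewrite -[RHS]e /kx /=; ring.
  by have e := congr1 (fun s => 2 * pi * s) hf; rewrite mulr0 in e; rewrite -[RHS]e /kx /=; ring.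
- by move=> k k0; apply: good_cdiv => p; rewrite !(gd_z g)// !mulr0 addr0.
Qed.

Lemma cconv_zr c d (e e' : C) k : (forall k, c (zr k) = e * c k) -> (forall k, d (zr k) = e' * d k) -> e * e' = 1 ->
  cconv c d (zr k) = cconv c d k.
Proof.
move=> hc hd ee; rewrite /cconv; have [<- _] := csm_reindex (fun l => c l * d (zr k - l)) (@bijzr).
apply: eq_csm => l /=; have -> : zr k - zr l = zr (k - l).
  by apply/pair_equal_spec; split => //=; rewrite opprB opprK addrC.
by rewrite hc hd mulrACA ee mul1r.
Qed.

Lemma N_herm u : (forall s i, herm (zc s i u)) ->
  (forall i, herm (Nb (zb u) (zt u) i)) /\ (forall i, herm (Nt (zb u) (zt u) i)).
Proof.
move=> hz.
have ha s s' i : herm (advc (fun j => zc s j u) (fun j => zc s' j u) i).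
  exact (hermD (herm_conv (hz s false) (hermDx false (hz s' i))) (herm_conv (hz s true) (hermDx true (hz s' i)))).
have hd i : herm (divc (zt u) i).
  exact (hermD (herm_conv (hermDx false (hz true false)) (hz true i)) (herm_conv (hermDx true (hz true true)) (hz true i))).
have hv i : herm (vertc (zt u) i).
  exact (hermD (herm_conv (hermVz (hermDx false (hz true false))) (hermDz (hz true i))) (herm_conv (hermVz (hermDx true (hz true true))) (hermDz (hz true i)))).
have hn i : herm (nbar (zb u) (zt u) i) := hermD (ha false false i) (hermD (hd i) (ha true true i)).
have hL i : herm (Lr (nbar (zb u) (zt u)) i) := hermD (hn i) (hermN (hermDx i (herm_lapinv (herm_cdiv hn)))).
have hNb i : herm (Nb (zb u) (zt u) i).
  move=> k; rewrite /Nb /= !oppr_eq0; case: ifP => _; first by rewrite rmorph0.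
  by rewrite hL rmorphN.
have hNt i : herm (Nt (zb u) (zt u) i).
  move=> k; rewrite /Nt /= !oppr_eq0; case: ifP => _; first by rewrite rmorph0.
  have a1 : herm (advc (zt u) (zb u) i) := ha true false i.
  have a2 : herm (advc (zb u) (zt u) i) := ha false true i.
  have a3 : herm (advc (zt u) (zt u) i) := ha true true i.
  case: ifP => _; first by rewrite !addr0; exact (hermN (hermD a1 a2) k).
  exact (hermD (hermN (hermD a1 a2)) (hermD (hv i) (hermN a3)) k).
by split.
Qed.

(** Reality and evenness pass through convolutions; in the vertical term both factors are odd under
    k.2 -> -k.2 and the signs cancel. The divergence is removed by the projection, and on modes k.2
    = 0 a mixed product needs a fluctuation mode that is absent. *)
Lemma good_N0 u : good u -> good (N0 u).
Proof.
move=> g.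
have hz s i : herm (zc s i u) := good_zc_herm s i g.
have [hNb hNt] := N_herm hz.
have ez s i k : zc s i u (zr k) = zc s i u k.
  rewrite /zc; have -> : (zr k == 0) = (k == 0) by case: k => k1 k2; rewrite /zr !xpair_eqE oppr_eq0.
  case: s; first by rewrite !(gd_e g).
  have [k0|k0] := eqVneq k.2 0; last by rewrite !(gd_s g)//= oppr_eq0.
  by have -> : zr k = k by case: k k0 => k1 k2 /= ->; rewrite /zr oppr0.
have e1 s i k : zc s i u (zr k) = 1 * zc s i u k by rewrite mul1r.
have eD j s i k : D j (zc s i u) (zr k) = 1 * D j (zc s i u) k by rewrite mul1r /D ez /kx.
have ea s s' i k : advc (fun j => zc s j u) (fun j => zc s' j u) i (zr k) = advc (fun j => zc s j u) (fun j => zc s' j u) i k.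
  by rewrite /advc (cconv_zr k (e1 s false) (eD false s' i) (mul1r 1)) (cconv_zr k (e1 s true) (eD true s' i) (mul1r 1)).
have eV j k : Vz (D j (zt u j)) (zr k) = -1 * Vz (D j (zt u j)) k.
  rewrite /Vz eD mul1r (_ : kz (zr k) = - kz k); last by rewrite /kz /= mulrNz.
  by rewrite mulrN invrN; apply: C_eq; rewrite ?(cReM,cImM) /=; ring.
have eDz i k : Dz (zt u i) (zr k) = -1 * Dz (zt u i) k.
  rewrite /Dz /zt ez (_ : kz (zr k) = - kz k); last by rewrite /kz /= mulrNz.
  by apply: C_eq; rewrite ?(cReM,cImM) /=; ring.
have m1 : (-1 : C) * -1 = 1 by rewrite mulrNN mul1r.
have ev i k : vertc (zt u) i (zr k) = vertc (zt u) i k.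
  by rewrite /vertc (cconv_zr k (eV false) (eDz i) m1) (cconv_zr k (eV true) (eDz i) m1).
have [_ _ q0 _] := @quad_N0 R.
have P p z : part p (conjc z) = (if p then -1 else 1) * part p z.
  by rewrite /part; case: p; rewrite ?(cReJ,cImJ); ring.
split.
- by move=> s i p k; rewrite /N0 /=; case: s; rewrite ?hNt ?hNb P.
- move=> i p k; rewrite /N0 /=; congr part; rewrite /Nt /=.
  have -> : (zr k == 0) = (k == 0) by case: k => k1 k2; rewrite /zr !xpair_eqE oppr_eq0.
  have a1 : advc (zt u) (zb u) i (zr k) = advc (zt u) (zb u) i k := ea true false i k.
  have a2 : advc (zb u) (zt u) i (zr k) = advc (zb u) (zt u) i k := ea false true i k.
  have a3 : advc (zt u) (zt u) i (zr k) = advc (zt u) (zt u) i k := ea true true i k.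
  by rewrite oppr_eq0 ev a1 a2 a3.
- by move=> i p k k0; rewrite /N0 /= /Nb k0 orbT /part; case: p.
- move=> p k; rewrite /N0 /= /Nb; case: ifP => [_|/negbT]; first by rewrite /part; case: p; rewrite !mulr0 addr0.
  rewrite negb_or negbK => /andP[k0 /eqP k2].
  have kk : K2 k != 0 :> R by rewrite K2_eq0.
  rewrite -[k.1.1%:~R]/(kx false k) -[k.1.2%:~R]/(kx true k) !LrE; move: kk; rewrite /K2.
  move: (kx false k) (kx true k) (nbar _ _ _ _) (nbar _ _ _ _) => a b z w kk.
  by rewrite /part; case: p; rewrite ?(cReN,cImN,cReD,cImD,cReM,cImM) /= ?(cReN,cImN,cReD,cImD,cReM,cImM) /=; field.
- move=> i p k k2; rewrite /N0 /= /Nt k2 eqxx addr0.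
  have sb' j l : l.2 != 0 -> zb u j l = 0 by move=> l0; rewrite /zb /zc !(gd_s g)// -[Complex 0 0]/(0 : C) if_same.
  have zt' j l : l.2 = 0 -> zt u j l = 0 by move=> l0; rewrite /zt /zc !(gd_z g)// -[Complex 0 0]/(0 : C) if_same.
  have z1 j j' : cconv (zt u j) (D j' (zb u i)) k = 0.
    apply: csm_zero => l; have [l0|l0] := eqVneq l.2 0; first by rewrite zt'// mul0r.
    by rewrite /D sb' ?mulr0//= k2 sub0r oppr_eq0.
  have z2 j j' : cconv (zb u j) (D j' (zt u i)) k = 0.
    apply: csm_zero => l; have [l0|l0] := eqVneq l.2 0; last by rewrite sb'// mul0r.
    by rewrite /D zt' ?mulr0//= k2 l0 subr0.
  by rewrite /advc !z1 !z2 !addr0 oppr0 if_same /part; case: p.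
- by move=> i; exact: (q0 0).
Qed.

(** All two-term functionals that vanish on good states. Since good states are conversely the common
    zeros of this set, preservation of [good] is preservation of linear relations. *)
Definition good_lin : set (R * (Ix * K) * (R * (Ix * K))) := [set l | forall u, good u -> ev2 l u = 0].

Lemma good_linP u : (forall l : R * (Ix * K) * (R * (Ix * K)), good_lin l -> ev2 l u = 0) -> good u.
Proof.
move=> h; split.
- move=> s i p k; have := h ((1, ((s, i, p), - k)), (- (if p then -1 else 1), ((s, i, p), k))).
  rewrite /ev2 /= mul1r mulNr => /(_ _) /eqP; rewrite subr_eq0 => q; apply/eqP/q => v g /=.
  by rewrite /ev2 /= mul1r mulNr (gd_h g) subrr.
- move=> i p k; have := h ((1, ((true, i, p), zr k)), (-1, ((true, i, p), k))).
  rewrite /ev2 /= mul1r mulN1r => /(_ _) /eqP; rewrite subr_eq0 => q; apply/eqP/q => v g /=.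
  by rewrite /ev2 /= mul1r mulN1r (gd_e g) subrr.
- move=> i p k k0; have := h ((1, ((false, i, p), k)), (0, ((false, i, p), k))).
  rewrite /ev2 /= mul1r mul0r addr0; apply => v g /=.
  by rewrite /ev2 /= (gd_s g)// !mulr0 addr0.
- move=> p k; have := h ((kx false k, ((false, false, p), k)), (kx true k, ((false, true, p), k))).
  by rewrite /ev2 /=; apply => v g; exact: (gd_d g).
- move=> i p k k0; have := h ((1, ((true, i, p), k)), (0, ((true, i, p), k))).
  rewrite /ev2 /= mul1r mul0r addr0; apply => v g /=.
  by rewrite /ev2 /= (gd_z g)// !mulr0 addr0.
- move=> i; have := h ((1, (i, 0)), (0, (i, 0))).
  rewrite /ev2 /= mul1r mul0r addr0; apply => v g /=.
  by rewrite /ev2 /= (gd_0 g) !mulr0 addr0.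
Qed.

End Physical.

(** * Exponential weights against polynomial ones *)

Section Bounds.
Context {R : realType}.
Local Notation K := (int * int * int)%type.
Local Notation freq := (@freq R).
Implicit Types (k l m : K) (U V W S : K -> R).

(** Each factor 1 + x is paid for by half of the current exponential rate: 1 + x <= (1 + 2/s) e^(s x
    / 2). *)
Lemma pw_exp_bound (s : R) n : 0 < s -> exists2 B : R, 0 <= B & forall x, 0 <= x -> (1 + x) ^+ n * expR (- (s * x)) <= B.
Proof.
elim: n s => [|n IH] s s0.
  by exists 1 => // x x0; rewrite expr0 mul1r -expR0 ler_expR oppr_le0 mulr_ge0// ltW.
have s2 : 0 < s / 2 by rewrite divr_gt0.
have [B B0 hB] := IH _ s2; have is2 : 0 <= (s / 2)^-1 by rewrite invr_ge0 ltW.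
have m0 : 0 <= 1 + (s / 2)^-1 by rewrite addr_ge0.
exists ((1 + (s / 2)^-1) * B); first exact: mulr_ge0.
move=> x x0; have -> : - (s * x) = - (s / 2 * x) + - (s / 2 * x) by field.
rewrite expRD exprS mulrACA; apply: ler_pM; rewrite ?mulr_ge0 ?expR_ge0 ?addr_ge0 ?exprn_ge0 ?addr_ge0//; last exact: hB.
rewrite expRN ler_pdivrMr ?expR_gt0//.
have h := expR_ge1Dx (s / 2 * x).
apply: (@le_trans _ _ ((1 + (s / 2)^-1) * (1 + s / 2 * x))); last exact: ler_wpM2l.
have e : (s / 2)^-1 * (s / 2) = 1 by rewrite mulVf// gt_eqF.
rewrite mulrDr mulr1 mulrA mulrDl e mul1r.
have q : 0 <= s / 2 * x by rewrite mulr_ge0// ltW.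
by move: ((s / 2)^-1) is2 => a a0; lra.
Qed.

Lemma summ_one k0 (a : R) : summ (fun k => if k == k0 then a else 0).
Proof.
have [] := @sm_fin R K [fset k0]%fset (fun m => if m == k0 then a else 0) => //.
by move=> m; rewrite inE => /negbTE ->.
Qed.

Lemma smallw_summ U : smallw U -> summ U.
Proof.
move=> [U0 sU]; have := summD sU (summ_one 0 (U 0)); apply: summ_le => k; rewrite ger0_norm//.
have [->|k0] := eqVneq k 0; first by rewrite lerDr mulr_ge0// freq_ge0.
by rewrite addr0 ler_peMl// freq_ge1.
Qed.

Lemma summ_pw_exp (s : R) S n : 0 < s -> (forall k, 0 <= S k) -> summ S -> summ (fun k => pw n k * (expR (- (s * freq k)) * S k)).
Proof.
move=> s0 S0 sS; have [B B0 hB] := pw_exp_bound n s0.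
have := summZ B sS; apply: summ_le => k; rewrite mulrA ger0_norm ?mulr_ge0 ?pw_ge0 ?expR_ge0//.
by apply: ler_wpM2r => //; exact: hB (freq_ge0 k).
Qed.

Lemma summ_Q U V : smallw U -> smallw V -> summ (Q U V).
Proof.
move=> [U0 sU] [V0 sV].
have fU k : 0 <= freq k * U k by rewrite mulr_ge0 ?freq_ge0.
have fV k : 0 <= freq k * V k by rewrite mulr_ge0 ?freq_ge0.
by have [_ h _] := summ_conv sU sV fU fV.
Qed.

End Bounds.

(** * Passing between the fixed and the rotating frame *)

Section RotatedIntegral.
Context {R : realType}.
Local Notation K := (int * int * int)%type.
Local Notation st := (Ix -> K -> R).

Lemma cl_ig_derive (T a t : R) (g : R -> R) : continuous g -> 0 < t < T -> is_derive t 1 (fun t => a + ig g (cl T t)) (g t).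
Proof.
move=> cg /andP[t0 tT].
have h : is_derive t 1 (fun t => a + 1 * ig g t) (g t).
  by have := is_derive_affine a 1 (ig_derive cg t0); rewrite mul1r.
apply: near_eq_is_derive h => //; near=> s.
rewrite mul1r cl_id//; apply/andP; split; apply: ltW.
  by near: s; exact: lt_nbhsr.
by near: s; exact: lt_nbhsl.
Unshelve. all: by end_near.
Qed.

(** The generator of the rotations [rota (Om * t)]; with speed -Om it is the Coriolis term moved to
    the right-hand side. *)
Definition JJ (Om : R) (v : st) : st := fun i k =>
  if i.1.1 then (if i.1.2 then Om * v (true, false, i.2) k else - Om * v (true, true, i.2) k) else 0.

Lemma cos_lin_derive (Om t : R) : is_derive t 1 (fun s => cos (Om * s)) (- sin (Om * t) * Om).
Proof.
have h : is_derive t 1 (fun s : R => Om * s) Om.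
  have := is_derive_affine 0 Om (is_derive_id t 1); rewrite mulr1.
  by under eq_fun do rewrite add0r.
exact: (@is_derive1_comp _ cos (fun s => Om * s) t _ _ (is_derive_cos _) h).
Qed.

Lemma sin_lin_derive (Om t : R) : is_derive t 1 (fun s => sin (Om * s)) (cos (Om * t) * Om).
Proof.
have h : is_derive t 1 (fun s : R => Om * s) Om.
  have := is_derive_affine 0 Om (is_derive_id t 1); rewrite mulr1.
  by under eq_fun do rewrite add0r.
exact: (@is_derive1_comp _ sin (fun s => Om * s) t _ _ (is_derive_sin _) h).
Qed.

Lemma rota_int (Om T : R) (x g : R -> st) (a : st) : 0 <= T -> (forall j k, continuous (fun s => g s j k)) ->
  (forall t j k, x t j k = a j k + ig (fun s => g s j k) (cl T t)) ->
  forall t, 0 <= t <= T -> forall j k,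
    rota (Om * t) (x t) j k = a j k + ig (fun s => rota (Om * s) (g s) j k + JJ Om (rota (Om * s) (x s)) j k) t.
Proof.
move=> T0 cg hx t /andP[t0 tT] j k.
have cx j' k' : continuous (fun s => x s j' k').
  under eq_fun do rewrite hx.
  by move=> s; apply: cvgD; [exact: cvg_cst|exact: ig_cl_cts].
have cl0 : cl T 0 = 0 by rewrite cl_id// lexx T0.
have x0 j' k' : x 0 j' k' = a j' k' by rewrite hx cl0 ig0 addr0.
have cO : continuous (fun s : R => Om * s) by move=> s; apply: cvgMr; exact: cvg_id.
have crg := rota_cts cO cg; have crx := rota_cts cO cx.
have cJ : continuous (fun s => JJ Om (rota (Om * s) (x s)) j k).
  case: j => -[[] []] p; rewrite /JJ /= => s; do ?[exact: cvg_cst].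
    by apply: cvgMr; exact: crx.
  by apply: cvgMr; exact: crx.
have cG : continuous (fun s => rota (Om * s) (g s) j k + JJ Om (rota (Om * s) (x s)) j k).
  by move=> s; apply: cvgD; [exact: crg|exact: cJ].
have dF s : 0 < s < t -> is_derive s 1 (fun s => rota (Om * s) (x s) j k) (rota (Om * s) (g s) j k + JJ Om (rota (Om * s) (x s)) j k).
  move=> /andP[s0 st].
  have dx j' k' : is_derive s 1 (fun s => x s j' k') (g s j' k').
    by under eq_fun do rewrite hx; apply: cl_ig_derive => //; rewrite s0 (lt_le_trans st tT).
  have dc := cos_lin_derive Om s; have ds := sin_lin_derive Om s.
  case: j {cJ cG} => -[[] []] p.
  - have h := is_deriveD (is_deriveM ds (dx (true, false, p) k)) (is_deriveM dc (dx (true, true, p) k)).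
    by rewrite /rota /JJ /=; apply: is_derive_eq h _; rewrite /GRing.scale /=; ring.
  - have h := is_deriveB (is_deriveM dc (dx (true, false, p) k)) (is_deriveM ds (dx (true, true, p) k)).
    by rewrite /rota /JJ /=; apply: is_derive_eq h _; rewrite /GRing.scale /=; ring.
  - by rewrite /rota /JJ /= addr0; exact: dx.
  - by rewrite /rota /JJ /= addr0; exact: dx.
have cw : {within `[0, t], continuous (fun s => rota (Om * s) (x s) j k)}.
  by apply: cts_within => s; exact: crx.
have E := ig_FTC2 cG dF cw t0.
by rewrite E mulr0 rota_id x0 addrC subrK.
Qed.

End RotatedIntegral.

(** * Series with time-dependent coefficients *)

Section SeriesInTime.
Context {R : realType}.
Local Notation C := (R[i]).
Local Notation Re := (@complex.Re R).
Local Notation Im := (@complex.Im R).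
Local Notation K := (int * int * int)%type.
Local Notation leb := (@lebesgue_measure R).

Lemma ser_time_cts (g : R -> K -> C) (U : K -> R) x : summ U -> (forall s k, nc (g s k) <= U k) ->
  (forall p k, continuous (fun s => part p (g s k))) -> continuous (fun s => ser (g s) x).
Proof.
move=> sU gU cg s; apply: (@sm_cvg _ _ _ _ _ (fun s k => Re (g s k * ek k x)) _ U sU).
- by apply: nearW => s' k; apply: le_trans (Re_cis_le _ _) (gU _ _).
- by move=> k; apply: le_trans (Re_cis_le _ _) (gU _ _).
- move=> k; have h1 := cg false k; have h2 := cg true k; rewrite /part in h1 h2.
  under eq_fun do rewrite cReM; rewrite cReM.
  by apply: cvgB; apply: cvgMl; [exact: h1|exact: h2].
Qed.

Lemma ser_time (c0 c : K -> C) (g : R -> K -> C) (U : K -> R) x t : 0 <= t -> summ U -> (forall s k, nc (g s k) <= U k) ->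
  (forall p k, continuous (fun s => part p (g s k))) -> csumm c0 ->
  (forall p k, part p (c k) = part p (c0 k) + ig (fun s => part p (g s k)) t) ->
  ser c x = ser c0 x + ig (fun s => ser (g s) x) t.
Proof.
move=> t0 sU gU cg sc0 hc.
have mD : measurable (`[0, t]%classic : set (measurableTypeR R)) by exact: measurable_itv.
have fD : (leb `[0%R, t] < +oo)%E by rewrite lebesgue_measure_itv/=; case: ifP => _; rewrite ?ltry// -EFinB ltry.
have ct k : continuous (fun s => Re (g s k * ek k x)).
  have h1 := cg false k; have h2 := cg true k; rewrite /part in h1 h2.
  under eq_fun do rewrite cReM.
  by move=> s; apply: cvgB; apply: cvgMl; [exact: h1|exact: h2].
have hm k : measurable_fun `[0, t]%classic (fun s => Re (g s k * ek k x)) by apply: cts_measurable.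
have hb k s : `[0, t]%classic s -> `|Re (g s k * ek k x)| <= U k by move=> _; apply: le_trans (Re_cis_le _ _) (gU _ _).
have [_ _ si E] := sm_integral (mu := leb) mD fD hm hb sU.
rewrite /ig -[X in _ + X]/(\int[leb]_(s in `[0, t]) sm (fun k => Re (g s k * ek k x))) E.
rewrite /ser -smD//; last exact: (csumm_Re (csumm_ek x sc0)).
apply: eq_sm => k; have hr := hc false k; have hi := hc true k; rewrite /part in hr hi.
rewrite cReM hr hi cReM.
have h1 := cg false k; have h2 := cg true k; rewrite /part in h1 h2.
have -> : \int[leb]_(s in `[0, t]) Re (g s k * ek k x) = ig (fun s => Re (ek k x) * Re (g s k) - Im (ek k x) * Im (g s k)) t.
  by apply: eq_Rintegral => s _; rewrite cReM; ring.
rewrite igB ?igZ//; first by ring.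
  by move=> s; apply: cvgMr; exact: h1.
by move=> s; apply: cvgMr; exact: h2.
Qed.

End SeriesInTime.

(** * Analytic norms and weak divergence in Fourier variables *)

Section Norms.
Context {R : realType}.
Local Notation C := (R[i]).
Local Notation K := (int * int * int)%type.
Local Notation leb2 := (@leb2 R).
Local Notation leb3 := (@leb3 R).
Local Notation freq := (@freq R).
Implicit Types (phi : R * R * R -> R * R).

Definition wgt (tau q : R) (k : K) : R := 1 + freq k `^ (2 * q) * expR (2 * tau * freq k).

Lemma wgt_ge1 tau q k : 1 <= wgt tau q k.
Proof. by rewrite lerDl mulr_ge0 ?powR_ge0 ?expR_ge0. Qed.

Lemma fsq_ge0 phi k : 0 <= fourier_sq phi k.
Proof. by rewrite addr_ge0// sqr_ge0. Qed.

Lemma normc_sqr (z : C) : ComplexField.Normc.normc z ^+ 2 = complex.Re z ^+ 2 + complex.Im z ^+ 2.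
Proof. by case: z => a b; rewrite /= sqr_sqrtr// addr_ge0// sqr_ge0. Qed.

Lemma anorm_sqrt tau q phi : anorm tau q phi = sqrte (\esum_(k in [set: K]) (wgt tau q k * fourier_sq phi k)%:E).
Proof. by rewrite /anorm poweR12_sqrt//; apply: esum_ge0 => k _; rewrite lee_fin mulr_ge0 ?fsq_ge0// (le_trans ler01)// wgt_ge1. Qed.

Lemma anorm_sqr tau q phi : (anorm tau q phi ^+ 2 = \esum_(k in [set: K]) (wgt tau q k * fourier_sq phi k)%:E)%E.
Proof.
rewrite anorm_sqrt sqr_sqrte//; apply: esum_ge0 => k _; rewrite lee_fin mulr_ge0 ?fsq_ge0//.
by rewrite (le_trans ler01)// wgt_ge1.
Qed.

Lemma anorm_ge0 tau q phi : (0 <= anorm tau q phi)%E.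
Proof. by rewrite anorm_sqrt; exact: sqrte_ge0. Qed.

Lemma anorm_fin tau q phi : (anorm tau q phi < +oo)%E <-> summ (fun k => wgt tau q k * fourier_sq phi k).
Proof.
have w0 k : 0 <= wgt tau q k * fourier_sq phi k by rewrite mulr_ge0 ?fsq_ge0// (le_trans ler01)// wgt_ge1.
have E : (\esum_(k in [set: K]) `|wgt tau q k * fourier_sq phi k|%:E = \esum_(k in [set: K]) (wgt tau q k * fourier_sq phi k)%:E)%E.
  by apply: eq_esum => k _; rewrite ger0_norm.
rewrite /summ E anorm_sqrt; split=> h.
  have : (sqrte (\esum_(k in [set: K]) (wgt tau q k * fourier_sq phi k)%:E) ^+ 2 < +oo)%E.
    by rewrite expe2 lte_mul_pinfty// ?sqrte_ge0// ge0_fin_numE// sqrte_ge0.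
  by rewrite sqr_sqrte//; apply: esum_ge0 => k _; rewrite lee_fin.
have e0 : (0 <= \esum_(k in [set: K]) (wgt tau q k * fourier_sq phi k)%:E)%E by apply: esum_ge0 => k _; rewrite lee_fin.
by move: e0 h; case: (esum _ _) => //= s _ _; rewrite ltry.
Qed.

Lemma anormE tau q phi : summ (fun k => wgt tau q k * fourier_sq phi k) ->
  anorm tau q phi = (Num.sqrt (sm (fun k => wgt tau q k * fourier_sq phi k)))%:E.
Proof.
move=> h; rewrite anorm_sqrt sm_esum//.
by move=> k; rewrite mulr_ge0 ?fsq_ge0// (le_trans ler01)// wgt_ge1.
Qed.

Lemma powR_sqr (x q : R) : 0 <= x -> (x `^ q) ^+ 2 = x `^ (2 * q).
Proof. by move=> x0; rewrite -powR_mulrn ?powR_ge0// -powRrM mulrC. Qed.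

Lemma L2scalar_int (f : R * R * R -> R) : L2scalar f -> leb3.-integrable cube (EFin \o f).
Proof.
move=> [_ mf f2].
have h1 : leb3.-integrable cube (EFin \o (fun=> 1 : R)).
  apply: (@bounded_integrable _ _ _ leb3 _ _ 1); [exact: mcube|exact: leb3_cube_fin|exact: measurable_cst|by move=> *; rewrite normr1].
have h2 : leb3.-integrable cube (fun x => (1 + f x ^+ 2)%:E).
  rewrite (_ : (fun x => _) = (EFin \o (fun=> 1%R : R)) \+ (fun x => (f x ^+ 2)%:E))%E; last by apply/funext.
  by apply: integrableD; [exact: mcube|exact: h1|exact: f2].
apply: (le_integrable _ _ _ h2); [exact: mcube|exact/measurable_EFinP|move=> x _ /=]; rewrite lee_fin [leRHS]ger0_norm ?addr_ge0 ?sqr_ge0//.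
by have := sqr_ge0 (`|f x| - 1); rewrite -[f x ^+ 2]real_normK ?num_real//; move: `|f x| (normr_ge0 (f x)) => a a0; nra.
Qed.

Lemma cts_L2scalar (f : R * R * R -> R) : continuous f -> periodic3 f -> L2scalar f.
Proof.
move=> cf pf; split=> //; first by apply: measurable_funTS; exact: cts3_meas.
by apply: (@cts3_int _ (fun x => f x ^+ 2)) => x; under eq_fun do rewrite expr2; apply: cvgM; exact: cf.
Qed.

Lemma weak_div_ser (u : R * R -> R * R) : periodic2 u -> classC 1 (fst \o u) -> classC 1 (snd \o u) -> (forall y, div u y = 0) -> weak_div_free u.
Proof.
move=> pu c1 c2 du psi pp cp; have [d1 k11 k12] := c1; have [d2 k21 k22] := c2; have [dp p1 p2] := cp 1%N.
have [A1 _ E1 _] := dxM d1 dp; have [_ A2 _ E2] := dxM d2 dp.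
have cc1 := @classC_cts R 1 _ c1; have cc2 := @classC_cts R 1 _ c2; have ccp := classC_cts (cp 0%N).
have g1 : continuous (fun y => (fst \o u) y * dx1 psi y + psi y * dx1 (fst \o u) y).
  by move=> y; apply: cvgD; apply: cvgM; [exact: cc1|exact: p1|exact: ccp|exact: k11].
have g2 : continuous (fun y => (snd \o u) y * dx2 psi y + psi y * dx2 (snd \o u) y).
  by move=> y; apply: cvgD; apply: cvgM; [exact: cc2|exact: p2|exact: ccp|exact: k22].
have I1 : \int[leb2]_(y in square) ((fst \o u) y * dx1 psi y + psi y * dx1 (fst \o u) y) = 0.
  rewrite -E1; apply: (@int_dx1 _ (fun y => (fst \o u) y * psi y)); [|exact: A1|by rewrite E1].
  by move=> y /=; have [-> ->] := pu y; have [-> ->] := pp y.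
have I2 : \int[leb2]_(y in square) ((snd \o u) y * dx2 psi y + psi y * dx2 (snd \o u) y) = 0.
  rewrite -E2; apply: (@int_dx2 _ (fun y => (snd \o u) y * psi y)); [|exact: A2|by rewrite E2].
  by move=> y /=; have [-> ->] := pu y; have [-> ->] := pp y.
transitivity (\int[leb2]_(y in square) (((fst \o u) y * dx1 psi y + psi y * dx1 (fst \o u) y) + ((snd \o u) y * dx2 psi y + psi y * dx2 (snd \o u) y))).
  apply: eq_Rintegral => y _; rewrite addrACA -mulrDr.
  have := du y; rewrite /div => ->; by rewrite mulr0 addr0.
by rewrite RintegralD; [rewrite I1 I2 addr0|exact: msquare|exact: (cts2_int g1)|exact: (cts2_int g2)].
Qed.

End Norms.

Lemma sm_measurable d (T : measurableType d) (R : realType) (K : countType) (D : set T) (F : K -> T -> R) :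
  measurable D -> (forall k, measurable_fun D (F k)) -> (forall x, D x -> summ (F^~ x)) -> measurable_fun D (fun x => sm (F^~ x)).
Proof.
move=> mD mF sF; apply: (@measurable_fun_cvg _ _ _ _ (fun n x => \sum_(k <- trunc K n) F k x)).
  by move=> n; apply: measurable_sum.
by move=> x Dx; exact: (sm_trunc (sF x Dx)).
Qed.

(** Monotone convergence along [trunc]. Nothing dominates the integrands uniformly here: for the
    L^2-in-time norm only their time integrals are bounded by a summable family. *)
Lemma le_int_sm d (T : measurableType d) (R : realType) (mu : {measure set T -> \bar R}) (K : countType) (D : set T) (F : K -> T -> R) (B : K -> R) :
  measurable D -> (forall k, measurable_fun D (F k)) -> (forall k x, D x -> 0 <= F k x) -> (forall x, D x -> summ (F^~ x)) ->
  (forall k, (\int[mu]_(x in D) (F k x)%:E <= (B k)%:E)%E) -> (forall k, 0 <= B k) -> summ B ->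
  (\int[mu]_(x in D) (sm (F^~ x))%:E <= (sm B)%:E)%E.
Proof.
move=> mD mF F0 sF FB B0 sB.
pose g n x : \bar R := (\sum_(k <- trunc K n) F k x)%:E.
have mg n : measurable_fun D (g n) by apply/measurable_EFinP; apply: measurable_sum.
have g0 n x : D x -> (0 <= g n x)%E by move=> Dx; rewrite lee_fin; apply: sumr_ge0 => k _; exact: F0.
have gm x : D x -> {homo g^~ x : n m / (n <= m)%N >-> (n <= m)%E}.
  move=> Dx n m nm; rewrite lee_fin.
  pose F' k := Num.max (F k x) 0.
  have FE k : F k x = F' k by rewrite /F' max_l// F0.
  under eq_bigr do rewrite FE; under [leRHS]eq_bigr do rewrite FE.
  apply: le_fsum; first by move=> k; rewrite le_max lexx orbT.
  have inT k p : (k \in trunc K p) = (Some k \in map (@choice.unpickle K) (iota 0 p)).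
    by rewrite /trunc !inE /= mem_pmap.
  move=> k; rewrite !inT => /seq.mapP[p]; rewrite mem_iota add0n => /andP[_ i1] e.
  by apply/seq.mapP; exists p => //; rewrite mem_iota add0n (leq_trans i1).
have L x : D x -> (sm (F^~ x))%:E = limn (g^~ x).
  by move=> Dx; apply/esym/cvg_lim => //; apply: cvg_EFin; [exact: nearW|exact: (sm_trunc (sF x Dx))].
rewrite (eq_integral (fun x => limn (g^~ x))); last by move=> x; rewrite inE => Dx; exact: L.
rewrite monotone_convergence//; apply: lime_le.
  apply: ereal_nondecreasing_is_cvgn => n m nm; apply: ge0_le_integral => //; first by move=> x Dx; exact: g0.
  by move=> x Dx; exact: gm.
apply: nearW => n; rewrite /g.
under eq_integral do rewrite -sumEFin.
have mk k : measurable_fun D (fun x => (F k x)%:E) by exact/measurable_EFinP.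
have F0' k x : D x -> (0 <= (F k x)%:E)%E by move=> Dx; rewrite lee_fin; exact: F0.
rewrite ge0_integral_sum//; apply: (@le_trans _ _ (\sum_(k <- trunc K n) (B k)%:E)%E); first by apply: lee_sum.
by rewrite sumEFin lee_fin; exact: fsum_le_sm.
Qed.

(** * Fourier states and the initial data *)

Section FourierState.
Context {R : realType}.
Local Notation K := (int * int * int)%type.
Local Notation leb := (@lebesgue_measure R).
Local Notation leb2 := (@leb2 R).
Local Notation leb3 := (@leb3 R).
Local Notation I01 := (`[0%R, 1%R]%classic : set R).
Local Notation freq := (@freq R).
Local Notation st := (Ix -> K -> R).
Implicit Types (phi : R * R * R -> R * R) (k : K).

Definition cmpt (i : bool) phi : R * R * R -> R := if i then snd \o phi else fst \o phi.
Definition fstate (phib phit : R * R * R -> R * R) : st := fun i k => part i.2 (fourier (cmpt i.1.2 (if i.1.1 then phit else phib)) k).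

Definition intg phi := forall i, leb3.-integrable cube (EFin \o cmpt i phi).

Lemma L2_intg phi : L2 phi -> intg phi.
Proof. by move=> [h1 h2] i; case: i; exact: L2scalar_int. Qed.

Lemma L2_per phi : L2 phi -> forall i, periodic3 (cmpt i phi).
Proof. by move=> [[h1 _ _] [h2 _ _]] i; case: i. Qed.

Lemma fstate_h phib phit : intg phib -> intg phit ->
  forall s i p k, fstate phib phit (s, i, p) (- k) = (if p then -1 else 1) * fstate phib phit (s, i, p) k.
Proof.
move=> ib it s i p k; have hi : leb3.-integrable cube (EFin \o cmpt i (if s then phit else phib)) by case: s; [exact: it|exact: ib].
by rewrite /fstate /= (fourier_herm hi) /part; case: p; rewrite ?(cReJ,cImJ); ring.
Qed.

Lemma fstate_e phib phit : intg phit -> (forall i, periodic3 (cmpt i phit)) -> even_z phit ->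
  forall i p k, fstate phib phit (true, i, p) (zr k) = fstate phib phit (true, i, p) k.
Proof.
move=> it pt et i p k; rewrite /fstate /= -[zr k]/(k.1, - k.2) fourier_even//.
by move=> x; have := et x; rewrite /cmpt; case: i => /= ->.
Qed.

Lemma fourier_lift0 (g : R * R -> R) k : leb3.-integrable cube (EFin \o lift3 g) -> k.2 != 0 -> fourier (lift3 g) k = 0.
Proof.
move=> gi k0; rewrite fourier_wv.
have h b : \int[leb3]_(x in cube) (lift3 g x * wv b k x) = 0.
  have [_ _ ->] := fubini3 (wv_integrable b k gi).
  rewrite -[RHS](mul0r (fine (leb2 square))) -Rintegral_cst; last exact: msquare.
  apply: eq_Rintegral => y _.
  have iw : leb.-integrable I01 (EFin \o (fun z => wv b k (y, z))).
    apply: cts_integrable => z; rewrite /wv; case: (b).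
      by apply: (@continuous_comp _ _ _ (fun z => phase k (y, z)) cos); [exact: (@slice2_cts _ _ (phase k) y (@phase_cts R k))|exact: continuous_cos].
    by apply: (@continuous_comp _ _ _ (fun z => phase k (y, z)) sin); [exact: (@slice2_cts _ _ (phase k) y (@phase_cts R k))|exact: continuous_sin].
  transitivity (g y * \int[leb]_(z in I01) wv b k (y, z)).
    by rewrite -RintegralZl//; exact: mI01.
  have [h1 h2] := int01_cos (phase (k.1, 0) (y, 0)) k.2.
  by rewrite /wv; case: (b); under eq_Rintegral do rewrite phase_z; rewrite ?h1 ?h2 (negbTE k0) mulr0.
by rewrite !h oppr0.
Qed.

Lemma fstate_s (g : R * R -> R * R) phit : intg (lift3 g) -> forall i p k, k.2 != 0 -> fstate (lift3 g) phit (false, i, p) k = 0.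
Proof.
move=> ig i p k k0; rewrite /fstate /=.
have E : cmpt i (lift3 g) = lift3 (fun y => if i then (g y).2 else (g y).1) by rewrite /cmpt; case: i.
by rewrite E fourier_lift0 -?E// /part; case: p.
Qed.

(** When k.2 = 0 the wave does not depend on z, so integrating first in z produces the vertical mean
    of f. The mean vanishes only for almost every y, since the data are merely integrable on almost
    every vertical line. *)
Lemma fourier_mean0 (f : R * R * R -> R) k : leb3.-integrable cube (EFin \o f) ->
  {ae leb2, forall y, square y -> \int[leb]_(z in I01) f (y, z) = 0} -> k.2 = 0 -> fourier f k = 0.
Proof.
move=> fi f0 k0; rewrite fourier_wv.
have h b : \int[leb3]_(x in cube) (f x * wv b k x) = 0.
  have [_ j1 ->] := fubini3 (wv_integrable b k fi); have [a0 j0 _] := fubini3 fi.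
  rewrite -[RHS](mul0r (fine (leb2 square))) -Rintegral_cst; last exact: msquare.
  congr fine; apply: ae_eq_integral; [exact: msquare|exact: measurable_int j1|exact: measurable_cst|].
  apply: (ae2 a0 f0) => y fy f0y Sy; congr EFin.
  have wE z : wv b k (y, z) = wv b k (y, 0) by rewrite /wv /Defs.phase /= k0 !mul0r.
  transitivity (\int[leb]_(z in I01) (f (y, z) * wv b k (y, 0))); first by apply: eq_Rintegral => z _; rewrite wE.
  by rewrite RintegralZr; [rewrite f0y// mul0r|exact: mI01|exact: fy].
by rewrite !h oppr0.
Qed.

Lemma fluct_mean0 (f : R * R * R -> R) : leb3.-integrable cube (EFin \o (fun x => f x - \int[leb]_(z in I01) f (x.1, z))) ->
  {ae leb2, forall y, square y -> \int[leb]_(z in I01) (f (y, z) - \int[leb]_(z in I01) f (y, z)) = 0}.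
Proof.
move=> fi; have [a0 _ _] := fubini3 fi.
apply: (ae1 a0) => y fy Sy; have {}fy := fy Sy; rewrite /= in fy.
set c := \int[leb]_(z in I01) f (y, z) in fy *.
have ci : leb.-integrable I01 (EFin \o (fun=> c)) by apply: cts_integrable => s; exact: cvg_cst.
have E : c = \int[leb]_(z in I01) (f (y, z) - c) + \int[leb]_(z in I01) c.
  rewrite -RintegralD; [|exact: mI01|exact: fy|exact: ci].
  by apply: eq_Rintegral => z _; rewrite subrK.
by move: E; rewrite int01_cst => E; lra.
Qed.

Lemma fstate_z (v0 : R * R * R -> R * R) phib : intg (fluct v0) -> forall i p k, k.2 = 0 -> fstate phib (fluct v0) (true, i, p) k = 0.
Proof.
move=> iv i p k k0; rewrite /fstate /=.
have E : cmpt i (fluct v0) = (fun x => cmpt i v0 x - \int[leb]_(z in I01) cmpt i v0 (x.1, z)) by rewrite /cmpt; case: i.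
have h := iv i; rewrite E in h *.
by rewrite fourier_mean0//; [rewrite /part; case: p|exact: fluct_mean0].
Qed.

Lemma fstate_d phib phit s : intg (if s then phit else phib) -> weak_div_free (P0 (if s then phit else phib)) ->
  forall p k, k.2 = 0 -> kx false k * fstate phib phit (s, false, p) k + kx true k * fstate phib phit (s, true, p) k = 0.
Proof.
move=> ii wd p k k0; have := weak_div_coef (ii false) (ii true) wd k0.
rewrite /cdiv /D /fstate /= -/(cmpt false (if s then phit else phib)) -/(cmpt true (if s then phit else phib)).
set F := fourier _ k; set G := fourier _ k => H.
have pn := @twopi_gt0 R.
have hr := congr1 (@complex.Re R) H; have hi := congr1 (@complex.Im R) H.
rewrite ?(cReD,cImD,cReM,cImM) /= !mul0r in hr hi.
apply/eqP; rewrite -(mulrI_eq0 _ (lregP (lt0r_neq0 pn))); apply/eqP.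
rewrite /part; case: p; rewrite /kx /=.
  by have e := congr1 -%R hr; rewrite oppr0 in e; rewrite -[RHS]e; ring.
by rewrite -[RHS]hi; ring.
Qed.

Lemma fstate_0 phib phit s i p : (\int[leb3]_(x in cube) cmpt i (if s then phit else phib) x) = 0 -> fstate phib phit (s, i, p) 0 = 0.
Proof.
rewrite /fstate /= fourier_wv => h0.
have -> : \int[leb3]_(x in cube) (cmpt i (if s then phit else phib) x * wv true 0 x) = 0.
  by rewrite -[RHS]h0; apply: eq_Rintegral => x _; rewrite /wv phase0 cos0 mulr1.
have -> : \int[leb3]_(x in cube) (cmpt i (if s then phit else phib) x * wv false 0 x) = 0.
  rewrite -[RHS](mul0r (fine (leb3 cube))) -Rintegral_cst; last exact: mcube.
  by apply: eq_Rintegral => x _; rewrite /wv phase0 sin0 mulr0.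
by rewrite oppr0 /part; case: p.
Qed.

Lemma spaceS_0 phi i : spaceS phi -> \int[leb3]_(x in cube) cmpt i phi x = 0.
Proof. by move=> [[_ h1 h2] _]; case: i. Qed.

Lemma fstate_sq phib phit (s : bool) k : fourier_sq (if s then phit else phib) k = \sum_(i : bool) \sum_(p : bool) fstate phib phit (s, i, p) k ^+ 2.
Proof. by rewrite /fourier_sq !normc_sqr !big_bool /= /fstate /part /= /cmpt; ring. Qed.

Lemma sum_Ix (F : Ix -> R) : \sum_(j : Ix) F j = \sum_(s : bool) \sum_(i : bool) \sum_(p : bool) F (s, i, p).
Proof. by rewrite pair_bigA pair_bigA; apply: eq_bigr => -[[s i] p]. Qed.

Lemma fstate_sum phib phit k : fourier_sq phib k + fourier_sq phit k = \sum_(j : Ix) fstate phib phit j k ^+ 2.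
Proof.
rewrite sum_Ix big_bool addrC; congr (_ + _).
  exact: (fstate_sq phib phit true k).
exact: (fstate_sq phib phit false k).
Qed.

Lemma anorm_fine_sqr tau q phi : summ (fun k => wgt tau q k * fourier_sq phi k) ->
  fine (anorm tau q phi) ^+ 2 = sm (fun k => wgt tau q k * fourier_sq phi k).
Proof.
move=> h; rewrite (anormE h) -[fine _]/(Num.sqrt _) sqr_sqrtr//; apply: sm_ge0 => k.
by rewrite mulr_ge0 ?fsq_ge0// (le_trans ler01)// wgt_ge1.
Qed.

Section Data.
Variables (r tau0 : R) (v0 : R * R * R -> R * R).
Hypotheses (t00 : 0 < tau0) (adm : admissible r tau0 v0).
Let M := data_size r tau0 v0.
Let pb := lift3 (P0 v0).
Let pt := fluct v0.

Definition dstate : st := fstate (lift3 (P0 v0)) (fluct v0).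
Definition dmaj k : R := expR (tau0 * freq k) * Num.sqrt (fourier_sq (lift3 (P0 v0)) k + fourier_sq (fluct v0) k).

Lemma data_intg : intg (lift3 (P0 v0)) /\ intg (fluct v0).
Proof. by have [_ [[[h1 _ _] _] _] [[[h2 _ _] _] _]] := adm; split; exact: L2_intg. Qed.

Lemma dstate_good : good dstate.
Proof.
have [ib it] := data_intg; have [ev [Sb _] [St _]] := adm.
have [[l2b _ _] wb] := Sb; have [[l2t _ _] wt] := St.
split.
- exact: fstate_h.
- apply: fstate_e => //; first exact: L2_per.
  by move=> x; rewrite /fluct /= (ev x).
- exact: fstate_s.
- move=> p k; have [k0|k0] := eqVneq k.2 0; first exact: (@fstate_d _ (fluct v0) false ib wb).
  by rewrite /dstate !fstate_s// !mulr0 addr0.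
- exact: fstate_z.
- by move=> [[s i] p]; apply: fstate_0; case: s; exact: spaceS_0.
Qed.

Lemma data_summ : [/\ summ (fun k => wgt tau0 r k * fourier_sq (lift3 (P0 v0)) k), summ (fun k => wgt tau0 r k * fourier_sq (fluct v0) k) &
  M = sm (fun k => wgt tau0 r k * fourier_sq (lift3 (P0 v0)) k) + sm (fun k => wgt tau0 r k * fourier_sq (fluct v0) k)].
Proof.
case: adm => _ [_ [_ hb']] [_ [_ ht']].
have hb := proj1 (anorm_fin tau0 r (lift3 (P0 v0))) hb'; have ht := proj1 (anorm_fin tau0 r (fluct v0)) ht'.
by split; [exact hb|exact ht|rewrite /M /data_size (anorm_fine_sqr hb) (anorm_fine_sqr ht)].
Qed.

Lemma M_ge0 : 0 <= M.
Proof. by rewrite addr_ge0// sqr_ge0. Qed.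

Lemma dmaj_maj : maj r dmaj (Num.sqrt M).
Proof.
have [sb st0 ME] := data_summ.
have g0 k : 0 <= fourier_sq (lift3 (P0 v0)) k + fourier_sq (fluct v0) k by rewrite addr_ge0// fsq_ge0.
have le k : (freq k `^ r * dmaj k) ^+ 2 <= wgt tau0 r k * fourier_sq (lift3 (P0 v0)) k + wgt tau0 r k * fourier_sq (fluct v0) k.
  rewrite /dmaj !exprMn sqr_sqrtr// powR_sqr ?freq_ge0// -mulrDr mulrA; apply: ler_wpM2r => //.
  rewrite -expRM_natl /wgt (_ : 2 * tau0 * freq k = 2 * (tau0 * freq k)); last by rewrite mulrA.
  by rewrite lerDr.
have ss : summ (fun k => wgt tau0 r k * fourier_sq (lift3 (P0 v0)) k + wgt tau0 r k * fourier_sq (fluct v0) k) by exact (summD sb st0).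
have s1 : summ (fun k => (freq k `^ r * dmaj k) ^+ 2) by apply: summ_le ss => k; rewrite ger0_norm ?sqr_ge0.
split=> //; first by move=> k; rewrite mulr_ge0 ?expR_ge0 ?sqrtr_ge0.
rewrite sqr_sqrtr ?M_ge0// ME -smD//; exact: le_sm.
Qed.

Lemma dstate_le i k : `|dstate i k| <= expR (- (tau0 * freq k)) * dmaj k.
Proof.
rewrite /dmaj mulrA -expRD addNr expR0 mul1r -[leLHS]ger0_norm//.
rewrite -sqrtr_sqr; apply: ler_wsqrtr; rewrite real_normK ?num_real//.
rewrite fstate_sum (bigD1 i)//= lerDl; apply: sumr_ge0 => j _; exact: sqr_ge0.
Qed.

End Data.
End FourierState.

(** * Vector fields synthesised from coefficients *)

Section Fields.
Context {R : realType}.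
Local Notation C := (R[i]).
Local Notation Re := (@complex.Re R).
Local Notation Im := (@complex.Im R).
Local Notation K := (int * int * int)%type.
Local Notation leb2 := (@leb2 R).
Local Notation leb3 := (@leb3 R).
Local Notation freq := (@freq R).
Local Notation st := (Ix -> K -> R).
Implicit Types (k : K) (n b t : bool -> K -> C) (u v : st) (U : K -> R).

Lemma cmpt_vser i n : cmpt i (vser n) = ser (n i).
Proof. by case: i. Qed.

Lemma vser_cts n : (forall i, csumm (n i)) -> continuous (vser n).
Proof.
move=> sn x; apply: (@cvg_pair _ _ _ _ (nbhs (ser (n false) x)) (nbhs (ser (n true) x))); first exact: (ser_cts (sn false)).
exact: (ser_cts (sn true)).
Qed.

Lemma vser_per n : periodic3 (vser n).
Proof. by move=> x; have [h1 h2 h3] := ser_per (n false) x; have [g1 g2 g3] := ser_per (n true) x; rewrite /vser h1 h2 h3 g1 g2 g3. Qed.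

Lemma vser2_per n : periodic2 (fun y => vser n (y, 0)).
Proof. by move=> y; have [h1 h2 _] := vser_per n (y, 0). Qed.

Lemma vser2_cts n : (forall i, csumm (n i)) -> continuous (fun y => vser n (y, 0)).
Proof.
move=> sn y; apply: (@continuous_comp _ _ _ (fun y => (y, 0)) (vser n)); first exact: pair1_cts.
exact: vser_cts.
Qed.

Lemma vser_even n : (forall i k, n i (zr k) = n i k) -> even_z (vser n).
Proof.
move=> en x; have h i : ser (n i) (x.1, - x.2) = ser (n i) x.
  rewrite /ser; have [q _] := sm_reindex (fun k => Re (n i k * ek k (x.1, - x.2))) bijzr.
  rewrite -q; apply: eq_sm => k /=; rewrite en; congr (Re (_ * cis _)).
  by rewrite /Defs.phase /= mulrNz; ring.
by rewrite /vser !h.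
Qed.

Lemma lift_vser n : (forall i k, k.2 != 0 -> n i k = 0) -> lift3 (fun y => vser n (y, 0)) = vser n.
Proof.
move=> n0; apply/funext => -[y z]; rewrite /lift3 /vser /=.
by rewrite -(@ser_z0 _ (n false) y z (n0 false)) -(@ser_z0 _ (n true) y z (n0 true)).
Qed.

Lemma fourier_vser n i : (forall i, csumm (n i)) -> (forall i, herm (n i)) -> fourier (cmpt i (vser n)) = n i.
Proof. by move=> sn hn; rewrite cmpt_vser fourier_ser. Qed.

Lemma vser_L2 n : (forall i, csumm (n i)) -> L2 (vser n).
Proof.
move=> sn; have h i : L2scalar (ser (n i)) by apply: cts_L2scalar; [exact: ser_cts|exact: ser_per].
by split; [exact (h false)|exact (h true)].
Qed.

Lemma fsq_vser n k : (forall i, csumm (n i)) -> (forall i, herm (n i)) ->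
  fourier_sq (vser n) k = \sum_(i : bool) (Re (n i k) ^+ 2 + Im (n i k) ^+ 2).
Proof.
move=> sn hn; have h i := fourier_vser i sn hn.
have h1 := h true; have h0 := h false; rewrite /cmpt in h1 h0.
rewrite /fourier_sq h1 h0 !normc_sqr big_bool; exact: addrC.
Qed.

Lemma vser_mean n : (forall i, csumm (n i)) -> (forall i, herm (n i)) -> (forall i, n i 0 = 0) -> L2dot (vser n).
Proof.
move=> sn hn n0; have h i : \int[leb3]_(x in cube) ser (n i) x = 0.
  have := congr1 Re (congr1 (fun f => f 0) (fourier_ser (sn i) (hn i))).
  rewrite n0 /= => q; rewrite -[RHS]q; apply: eq_Rintegral => x _; by rewrite phase0 cos0 mulr1.
by split; [exact: vser_L2|exact: (h false)|exact: (h true)].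
Qed.

Lemma P0_lift (g : R * R -> R * R) : P0 (lift3 g) = g.
Proof. by apply/funext => y; rewrite /P0 /lift3 /= !int01_cst; case: (g y). Qed.

Lemma spaceS_bar n : (forall i, rd (n i)) -> (forall i, herm (n i)) -> (forall i k, k.2 != 0 -> n i k = 0) ->
  (forall i, n i 0 = 0) -> (forall k, cdiv n k = 0) -> spaceS (vser n).
Proof.
move=> rn hn n0 n00 dn; have sn i := rd_summ (rn i); split; first exact: vser_mean.
rewrite -(lift_vser n0) P0_lift; apply: weak_div_ser.
- exact: vser2_per.
- exact: (classC_ser 1 0 (rn false)).
- exact: (classC_ser 1 0 (rn true)).
move=> y; rewrite /div.
have e1 : dx1 (fun y => ser (n false) (y, 0)) y = ser (D false (n false)) (y, 0) by rewrite (dx1_ser 0 (rn false)).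
have e2 : dx2 (fun y => ser (n true) (y, 0)) y = ser (D true (n true)) (y, 0) by rewrite (dx2_ser 0 (rn true)).
rewrite [X in X + _]e1 [X in _ + X]e2 -(serD _ (rd_summ (rdDx false (rn false))) (rd_summ (rdDx true (rn true)))).
by rewrite -[RHS](ser0 (y, 0)); exact: eq_ser.
Qed.

Lemma spaceS_til n : (forall i, rd (n i)) -> (forall i, herm (n i)) -> (forall i k, k.2 = 0 -> n i k = 0) -> spaceS (vser n).
Proof.
move=> rn hn n0; have sn i := rd_summ (rn i); split; first by apply: vser_mean => // i; exact: n0.
rewrite P0_ser//.
have -> : (fun y => vser (fun b0 : bool => Zz (n b0)) (y, 0)) = (fun=> 0).
  apply/funext => y; have h i : ser (Zz (n i)) (y, 0) = 0.
    by rewrite -[RHS](ser0 (y, 0)); apply: eq_ser => k; rewrite /Zz; case: eqP => // k0; rewrite n0.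
  by rewrite /vser !h.
move=> psi _ _; rewrite -[RHS](mul0r (fine (leb2 square))) -Rintegral_cst; last exact: msquare.
by apply: eq_Rintegral => y _; rewrite /= !mul0r addr0.
Qed.

Lemma serZ (a : R) (c : K -> C) x : csumm c -> ser (fun k => Complex a 0 * c k) x = a * ser c x.
Proof.
move=> sc; rewrite /ser -smZ; last exact: (csumm_Re (csumm_ek x sc)).
by apply: eq_sm => k; rewrite ?(cReM,cImM) /=; ring.
Qed.

Lemma rd_zc s i u (U : K -> R) : (forall j k, `|u j k| <= U k) -> (forall q : nat, summ (fun k => pw q k * U k)) -> rd (zc s i u).
Proof.
move=> uU sU; apply: (rd_le (U := fun k => 2 * U k)).
  by move=> k; apply: zc_le => //; exact: le_trans (normr_ge0 _) (uU (s, i, false) k).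
by move=> q; have := summZ 2 (sU q); under eq_fun do rewrite mulrCA.
Qed.

Lemma zc_sq s i u k : u (s, i, false) 0 = 0 -> u (s, i, true) 0 = 0 -> Re (zc s i u k) ^+ 2 + Im (zc s i u k) ^+ 2 = u (s, i, false) k ^+ 2 + u (s, i, true) k ^+ 2.
Proof. by move=> h1 h2; rewrite /zc; case: eqP => [->|] //=; rewrite h1 h2. Qed.

Lemma fsq_zc s u k (sz : forall i, csumm (fun k => zc s i u k)) : (forall i, herm (zc s i u)) -> (forall j, u j 0 = 0) ->
  fourier_sq (vser (fun i => zc s i u)) k = \sum_(i : bool) \sum_(p : bool) u (s, i, p) k ^+ 2.
Proof.
move=> hz u0; rewrite fsq_vser//; apply: eq_bigr => i _; rewrite big_bool zc_sq// addrC//.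
Qed.

(* Right-hand side of the coefficient system in the original, non-rotating variables; [NR] is its counterpart in the rotating frame, where the Coriolis term disappears. *)
Definition GG (Om : R) v : st := fun j k => N0 v j k + JJ (- Om) v j k.

Lemma zc_GGb Om v i k : zc false i (GG Om v) k = Nb (zb v) (zt v) i k.
Proof.
rewrite /zc /GG /JJ /= !addr0 /N0 /part /=; case: eqP => [->|_]; first by rewrite /Nb eqxx.
by case: (Nb _ _ _ _).
Qed.

Lemma zc_GGt Om v i k : zc true i (GG Om v) k = Nt (zb v) (zt v) i k + Complex (if i then - Om else Om) 0 * zt v (~~ i) k.
Proof.
rewrite /zt /zc /GG /JJ /= /N0 /part /=; case: eqP => [->|_]; first by rewrite /Nt eqxx mulr0 addr0.
by apply: C_eq; rewrite ?(cReD,cImD,cReM,cImM) /=; case: i => /=; ring.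
Qed.

Lemma field_bar_eq Om v : pgood (zb v) (zt v) ->
  barotropic_eq (fun y => vser (zb (GG Om v)) (y, 0)) (vbP (zb v)) (vtP (zt v)).
Proof.
move=> pg y'; have P := phys_bar pg y'; rewrite -[LHS]addrA P.
have -> : vser (zb (GG Om v)) (y', 0) = vser (Nb (zb v) (zt v)) (y', 0) by apply: eq_vser => i k; exact: zc_GGb.
exact: subrr.
Qed.

Lemma til_rearr2 (V : zmodType) (v w a b d e f : V) : v - w + a + b + d - e - f + w = v + (a + b + d - e - f).
Proof.
rewrite !addrA; have h (x y : V) : x - w + y = x + y - w by rewrite addrAC.
by rewrite !h addrK.
Qed.

Lemma field_til_eq Om v : pgood (zb v) (zt v) -> (forall i, csumm (Nt (zb v) (zt v) i)) ->
  baroclinic_eq Om (fun x => vser (zt (GG Om v)) x) (vbP (zb v)) (vtP (zt v)).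
Proof.
move=> pg sN x; have P := phys_til pg x.
set A := adv3 (vtP (zt v)) (vtP (zt v)) x in P *.
have e : vser (zt (GG Om v)) x = vser (Nt (zb v) (zt v)) x - Om *: perp (vtP (zt v) x).
  have st' i := rd_summ (pg_rt pg i).
  have h i : ser (zt (GG Om v) i) x = ser (Nt (zb v) (zt v) i) x + (if i then - Om else Om) * ser (zt v (~~ i)) x.
    rewrite -(serZ _ x (st' (~~ i))) -(serD _ (sN i) (csumZ _ (st' (~~ i)))).
    by apply: eq_ser => k; exact: zc_GGt.
  rewrite /vser !h /perp /vtP /vser /=.
  transitivity (ser (Nt (zb v) (zt v) false) x - Om * - ser (zt v true) x, ser (Nt (zb v) (zt v) true) x - Om * ser (zt v false) x); last by [].
  by congr pair; ring.
rewrite e; move: P; set B := adv3 (vtP (zt v)) (lift3 _) x; set D' := adv3 (lift3 _) _ x; set E := P0 _ x.1; set F := _ *: dz _ _.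
set V := vser (Nt _ _) x; set W := Om *: _ => P.
rewrite til_rearr2 P; exact: subrr.
Qed.

End Fields.

(** * Time regularity of the synthesised fields *)

Section Track.
Context {R : realType}.
Local Notation K := (int * int * int)%type.
Local Notation freq := (@freq R).
Local Notation st := (Ix -> K -> R).
Local Notation q1 := (2 * @kB R * (2 * @kB R)) (only parsing).
Variables (Om s0 : R) (W : K -> R) (v : R -> st).
Hypotheses (s00 : 0 < s0) (sW : smallw W).
Hypothesis bv : forall t, bdd (v t) (fun k => expR (- (s0 * freq k)) * W k).
Hypothesis cv : forall j k, continuous (fun t => v t j k).

Let E : K -> R := fun k => expR (- (s0 * freq k)) * W k.

Lemma track_sE : smallw E.
Proof.
have [W0 sw] := sW; split; first by move=> k; rewrite mulr_ge0 ?expR_ge0.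
apply: summ_le sw => k; rewrite ger0_norm ?mulr_ge0 ?freq_ge0 ?expR_ge0//.
apply: ler_wpM2l; first exact: freq_ge0.
by rewrite ler_piMl// -[leRHS]expR0 ler_expR oppr_le0 mulr_ge0 ?freq_ge0// ltW.
Qed.

Lemma track_rd t s i : rd (zc s i (v t)).
Proof.
apply: (rd_zc s i (@bv t)) => q; apply: summ_pw_exp => //; first by case: sW.
exact: smallw_summ.
Qed.

(** A time-independent majorant of the right-hand side. Dependence on [Om] is harmless: it only
    justifies exchanging sums with time integrals and enters no bound of the theorem. *)
Definition gmaj k : R := 24 * q1 * (Q E E k + Q E E k) + `|Om| * E k.

Lemma gmaj_summ : summ gmaj.
Proof.
have sE := track_sE; have sq := summ_Q sE sE.
by apply: summD; [apply: summZ; exact: summD|apply: summZ; exact: smallw_summ].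
Qed.

Lemma gmaj_le t j k : `|GG Om (v t) j k| <= gmaj k.
Proof.
have sE := track_sE; rewrite /GG; apply: (le_trans (ler_normD _ _)); apply: lerD.
  have h := quad_lip (@quad_N0 R) t sE sE sE (@bv t) _ _ j k; have := h (fun _ _ => 0); rewrite (quad_0 (@quad_N0 R) t) subr0; apply.
    by move=> i' k'; rewrite normr0; case: sE.
  by move=> i' k'; rewrite /sdiff subr0; exact: bv.
rewrite /JJ; case: j => [[[] i] p] /=; last by rewrite normr0 mulr_ge0//; case: sE.
by case: i; rewrite ?opprK ?mulNr ?normrN normrM; apply: ler_wpM2l => //; exact: bv.
Qed.

Lemma GG_cts j k : continuous (fun t => GG Om (v t) j k).
Proof.
move=> t; apply: cvgD; first exact: (quad_cts (@quad_N0 R) track_sE bv cv).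
case: j => [[[] i] p]; rewrite /JJ /=; last exact: cvg_cst.
by case: i; apply: cvgMr; exact: cv.
Qed.

Lemma part_zc_cts (w : R -> st) s i p k : (forall j k, continuous (fun t => w t j k)) -> continuous (fun t => part p (zc s i (w t) k)).
Proof.
move=> cw; rewrite /zc; case: (k == 0); first by move=> t; exact: cvg_cst.
by rewrite /part; case: p => /=; exact: cw.
Qed.

Lemma zcG_le t s i k : nc (zc s i (GG Om (v t)) k) <= 2 * gmaj k.
Proof. apply: zc_le => [j l|]; first exact: gmaj_le.
exact: le_trans (normr_ge0 _) (gmaj_le t (s, i, false) k). Qed.

Lemma summ2_gmaj : summ (fun k => 2 * gmaj k).
Proof. by apply: summZ; exact: gmaj_summ. Qed.

Lemma serG_cts s i x : continuous (fun t => ser (zc s i (GG Om (v t))) x).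
Proof.
apply: (@ser_time_cts _ _ (fun k => 2 * gmaj k)); [exact: summ2_gmaj|by move=> t k; exact: zcG_le|].
by move=> p k; apply: part_zc_cts; exact: GG_cts.
Qed.

Lemma part_zc_int (a : st) t s i p k : (forall j k, v t j k = a j k + ig (fun s => GG Om (v s) j k) t) ->
  part p (zc s i (v t) k) = part p (zc s i a k) + ig (fun s' => part p (zc s i (GG Om (v s')) k)) t.
Proof.
move=> h; rewrite /zc; case: (k == 0).
  by rewrite (_ : ig _ _ = 0) ?addr0// /ig /part /=; case: p; rewrite Rintegral_cst//= mul0r.
by rewrite /part; case: p => /=; exact: h.
Qed.

Lemma serG_int (a : st) t s i x : 0 <= t -> csumm (zc s i a) -> (forall j k, v t j k = a j k + ig (fun s => GG Om (v s) j k) t) ->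
  ser (zc s i (v t)) x = ser (zc s i a) x + ig (fun s' => ser (zc s i (GG Om (v s'))) x) t.
Proof.
move=> t0 sa h; apply: (@ser_time _ _ _ (fun s' => zc s i (GG Om (v s'))) (fun k => 2 * gmaj k)) => //.
- exact: summ2_gmaj.
- by move=> s' k; exact: zcG_le.
- by move=> p k; apply: part_zc_cts; exact: GG_cts.
- by move=> p k; exact: part_zc_int.
Qed.

Lemma serG_dt (a : st) T s i x : 0 <= T -> csumm (zc s i a) -> (forall t, 0 <= t <= T -> forall j k, v t j k = a j k + ig (fun s => GG Om (v s) j k) t) ->
  has_dt T (fun t => ser (zc s i (v t)) x) (fun t => ser (zc s i (GG Om (v t))) x).
Proof.
move=> T0 sa h; split; first by apply: cts_integrable; exact: serG_cts.
move=> t; rewrite in_itv /= => tT; have /andP[t0 _] := tT.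
have t00 : 0 <= (0 : R) <= T by rewrite lexx.
by rewrite (serG_int x t0 sa (h t tT)) (serG_int x (lexx 0) sa (h 0 t00)) ig0 addr0.
Qed.

Lemma track_csummN t i : csumm (Nt (zb (v t)) (zt (v t)) i).
Proof.
have h : zt (N0 (v t)) i = Nt (zb (v t)) (zt (v t)) i.
  apply/funext => k; rewrite /zt /zc /N0 /part /=; case: eqP => [->|_]; first by rewrite /Nt eqxx.
  by case: (Nt _ _ _ _).
have sE := track_sE; rewrite -h.
apply: (csumm_le (M := fun k => 2 * (24 * q1 * (Q E E k + Q E E k)))); last first.
  have sq := summ_Q sE sE; exact (summZ 2 (summZ (24 * q1) (summD sq sq))).
have b0 j k : `|N0 (v t) j k| <= 24 * q1 * (Q E E k + Q E E k).
  have hq := quad_lip (@quad_N0 R) t sE sE sE (@bv t) _ _ j k; have := hq (fun _ _ => 0); rewrite (quad_0 (@quad_N0 R) t) subr0; apply.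
    by move=> i' k'; rewrite normr0; case: sE.
  by move=> i' k'; rewrite /sdiff subr0; exact: bv.
move=> k; apply: (@zc_le _ true i _ (fun k => 24 * q1 * (Q E E k + Q E E k))) => [j l|]; first exact: b0.
exact: le_trans (normr_ge0 _) (b0 (true, i, false) k).
Qed.

End Track.

(** * Existence *)

Section NormInTime.
Context {R : realType}.
Local Notation K := (int * int * int)%type.
Local Notation leb := (@lebesgue_measure R).
Local Notation freq := (@freq R).
Implicit Types (phi : R -> R * R * R -> R * R) (tau : R -> R) (A : K -> R) (f : R -> \bar R) (T B : R).

Lemma leb_setT : (0 < leb [set: R])%E.
Proof.
apply: (@lt_le_trans _ _ (leb `[0%R, 1%R]%classic)); first by rewrite lebesgue_measure_itv/= lte_fin ltr01 oppr0 adde0 lte_fin.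
by apply: le_measure => //; rewrite inE; [exact: measurable_itv|exact: measurableT].
Qed.

Lemma Loo_lt T B f : (forall t, t \in `]0, T[ -> (0 <= f t <= B%:E)%E) ->
  ('N[leb]_(+oo%E) [(f \_ `]0%R, T[%classic)] < +oo)%E.
Proof.
move=> h; rewrite unlock /= leb_setT; apply: (@le_lt_trans _ _ (Num.max 0 B)%:E); last exact: ltry.
apply/ess_supP; apply/aeW => t; rewrite /= patchE; case: ifPn => [|_]; last by rewrite abse0 lee_fin le_max lexx.
by rewrite inE => tT; have /andP[f0 fB] := h t tT; rewrite gee0_abs//; apply: (le_trans fB); rewrite lee_fin le_max lexx orbT.
Qed.

Lemma Loo_ae T f : ('N[leb]_(+oo%E) [(f \_ `]0%R, T[%classic)] < +oo)%E ->
  exists2 B : R, 0 <= B & {ae leb, forall t, t \in `]0, T[ -> (`|f t| <= B%:E)%E}.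
Proof.
rewrite unlock /= leb_setT; set e := ess_sup _ _ => eoo.
exists (fine (maxe 0 e)%E); first by rewrite fine_ge0// le_max lexx.
have := ess_sup_ge leb (abse \o (f \_ `]0%R, T[%classic)); rewrite -/e.
apply: filterS => t /=; rewrite patchE => h tT; have {}h : (`|f t| <= e)%E by move: h; rewrite ifT// inE.
rewrite fineK; first by apply: (le_trans h); rewrite le_max lexx orbT.
by rewrite ge0_fin_numE ?le_max ?lexx// gt_max eoo ltry.
Qed.

Lemma L2_lt T B f : (forall t, t \in `]0, T[ -> (0 <= f t)%E) ->
  (\int[leb]_(t in `]0%R, T[) (f t ^+ 2) <= B%:E)%E -> ('N[leb]_(2%:E) [(f \_ `]0%R, T[%classic)] < +oo)%E.
Proof.
move=> f0 h; rewrite unlock /=; apply: poweR_lty; apply: le_lt_trans (ltry B); apply: le_trans h.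
rewrite [leRHS]integral_mkcond le_eqVlt; apply/orP; left; apply/eqP; apply: eq_integral => t _.
rewrite !patchE; case: ifPn => [|_]; last by rewrite abse0 poweR0r// eqe pnatr_eq0.
rewrite inE => tT; have := f0 t tT; case: (f t) => [x| |]//=.
  by rewrite lee_fin => x0; rewrite ger0_norm// powR_mulrn.
by move=> _; rewrite ifF ?mulyy// pnatr_eq0.
Qed.

Definition nsum tau q phi k t : R := wgt (tau t) q k * fourier_sq (phi t) k.

Lemma nsum_ge0 tau q phi k t : 0 <= nsum tau q phi k t.
Proof. by rewrite mulr_ge0 ?fsq_ge0// (le_trans ler01)// wgt_ge1. Qed.

Lemma anorm_time_meas T tau q phi : (forall k, measurable_fun `]0, T[ (nsum tau q phi k)) ->
  (forall t, t \in `]0, T[ -> summ (nsum tau q phi ^~ t)) ->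
  measurable_fun `]0, T[ (fun t => anorm (tau t) q (phi t)).
Proof.
move=> hm hs.
have mD : measurable (`]0%R, T[%classic : set R) by exact: measurable_itv.
apply: (eq_measurable_fun (fun t => (Num.sqrt (sm (nsum tau q phi ^~ t)))%:E)).
  by move=> t; rewrite inE => tT; rewrite (anormE (hs t tT)).
apply/measurable_EFinP; apply: (@measurableT_comp _ _ _ _ _ _ (@Num.sqrt R)).
  by apply: continuous_measurable_fun; exact: sqrt_continuous.
exact: (sm_measurable mD hm hs).
Qed.

Lemma anorm_time_oo T tau q phi A : summ A -> (forall k t, t \in `]0, T[ -> nsum tau q phi k t <= A k) ->
  ('N[leb]_(+oo%E) [((fun t => anorm (tau t) q (phi t)) \_ `]0%R, T[%classic)] < +oo)%E.
Proof.
move=> sA hA; apply: (@Loo_lt T (Num.sqrt (sm A))) => t tT; rewrite anorm_ge0/=.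
have ss : summ (nsum tau q phi ^~ t) by apply: summ_le sA => k; rewrite ger0_norm ?nsum_ge0//; exact: hA.
by rewrite (anormE ss) lee_fin ler_wsqrtr//; apply: le_sm => // k; exact: hA.
Qed.

Lemma anorm_time_2 T tau q phi A : (forall k, measurable_fun `]0, T[ (nsum tau q phi k)) ->
  (forall t, t \in `]0, T[ -> summ (nsum tau q phi ^~ t)) -> summ A -> (forall k, 0 <= A k) ->
  (forall k, (\int[leb]_(t in `]0%R, T[) (nsum tau q phi k t)%:E <= (A k)%:E)%E) ->
  ('N[leb]_(2%:E) [((fun t => anorm (tau t) q (phi t)) \_ `]0%R, T[%classic)] < +oo)%E.
Proof.
move=> hm hs sA A0 hA; apply: (@L2_lt T (sm A)) => [t _|]; first exact: anorm_ge0.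
have mD : measurable (`]0%R, T[%classic : set R) by exact: measurable_itv.
have -> : (\int[leb]_(t in `]0%R, T[) (anorm (tau t) q (phi t) ^+ 2) = \int[leb]_(t in `]0%R, T[) (sm (nsum tau q phi ^~ t))%:E)%E; last first.
  by apply: le_int_sm => // k t _; exact: nsum_ge0.
apply: eq_integral => t; rewrite inE => tT; rewrite (anormE (hs t tT)) -EFin_expe sqr_sqrtr//.
by apply: sm_ge0 => k; exact: nsum_ge0.
Qed.

Lemma Dana_summ (tau0 q : R) (w : R * R * R -> R * R) : 0 <= tau0 -> L2 w -> summ (fun k => wgt tau0 q k * fourier_sq w k) -> Dana tau0 q w.
Proof.
move=> t0 Lw hs; split; last exact (proj2 (anorm_fin tau0 q w) hs).
split; first exact Lw.
apply: (proj2 (anorm_fin 0 q w)); apply: summ_le hs => k.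
rewrite ger0_norm ?mulr_ge0 ?fsq_ge0 ?(le_trans ler01 (wgt_ge1 _ _ _))//.
apply: ler_wpM2r; first exact: fsq_ge0.
rewrite /wgt lerD2l; apply: ler_wpM2l; first exact: powR_ge0.
by rewrite ler_expR mulr0 mul0r !mulr_ge0// freq_ge0.
Qed.

(** Bounded uniformly in the frequency w: an excess decay rate [gam] buys one power of |k| in the
    square of the norm, that is half a derivative in L^2 in time. *)
Lemma int_exp_gain T gam w : 0 < gam -> 0 < w ->
  (\int[leb]_(t in `]0%R, T[) (w * expR (- (2 * gam * t * w)))%:E <= ((2 * gam)^-1)%:E)%E.
Proof.
move=> g0 w0; have [T0|T0] := leP T 0.
  by rewrite set_itv_ge ?integral_set0 ?lee_fin ?invr_ge0 ?mulr_ge0 ?(ltW g0)// bnd_simp -leNgt.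
have cg : continuous (fun t : R => w * expR (0 + (- (2 * gam * w)) * t)) by move=> t; apply: cvgMr; exact: exp_aff_cts.
apply: (@le_trans _ _ (\int[leb]_(t in `[0%R, T]) (w * expR (0 + (- (2 * gam * w)) * t))%:E)%E).
  have -> : (\int[leb]_(t in `]0%R, T[) (w * expR (- (2 * gam * t * w)))%:E = \int[leb]_(t in `]0%R, T[) (w * expR (0 + (- (2 * gam * w)) * t))%:E)%E.
    by apply: eq_integral => t _; congr (EFin (_ * expR _)); ring.
  apply: ge0_subset_integral; [exact: measurable_itv|exact: measurable_itv| | |].
  - by apply/measurable_EFinP; apply: cts_measurable.
  - by move=> t _; rewrite lee_fin mulr_ge0 ?expR_ge0// ltW.
  - by apply: subset_itvW; rewrite bnd_simp.
have fi : leb.-integrable `[0, T] (EFin \o (fun t => w * expR (0 + (- (2 * gam * w)) * t))) by exact: cts_integrable.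
have mT : measurable (`[0%R, T]%classic : set (measurableTypeR R)) by exact: measurable_itv.
have fin := integrable_fin_num mT fi.
have gw : 2 * gam * w != 0 by rewrite gt_eqF// !mulr_gt0.
apply: (@le_trans _ _ (ig (fun t => w * expR (0 + (- (2 * gam * w)) * t)) T)%:E).
  by rewrite /ig /Rintegral fineK.
rewrite lee_fin.
rewrite igZ ?ig_exp ?oppr_eq0 ?(ltW T0)//; last by exact: exp_aff_cts.
rewrite expR0; have e0 := expR_ge0 (0 + - (2 * gam * w) * T); move: (expR _) e0 => e e0.
have gn : gam != 0 by rewrite gt_eqF.
have wn : w != 0 by rewrite gt_eqF.
have -> : w * ((e - 1) / - (2 * gam * w)) = (1 - e) * (2 * gam)^-1 by field; rewrite gn wn.
by rewrite ler_piMl ?invr_ge0 ?mulr_ge0 ?(ltW g0)// gerBl.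
Qed.

End NormInTime.

(** * Attaining the initial data almost everywhere *)

Section InitialData.
Context {R : realType}.

Lemma le_sum4 (a b c d f : R) : b <= 2 ^+ 2 * a -> c <= 2 ^+ 2 * a -> d <= 2 ^+ 2 * a -> f <= 2 ^+ 2 * a -> f + d + (c + b) <= 16 * a.
Proof. lra. Qed.

Local Notation leb2 := (@leb2 R).
Local Notation leb3 := (@leb3 R).

(** The exceptional set on the three-dimensional side need not be a cylinder, so the statement is
    passed down through the vanishing integral of |f - g|. *)
Lemma ae_unlift (f g : R * R -> R) : leb3.-integrable cube (EFin \o lift3 f) -> leb3.-integrable cube (EFin \o lift3 g) ->
  {ae leb3, forall x, cube x -> lift3 f x = lift3 g x} -> {ae leb2, forall y, square y -> f y = g y}.
Proof.
move=> fi gi fg; pose h y := `|f y - g y|.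
have di : leb3.-integrable cube (EFin \o lift3 (fun y => f y - g y)).
  rewrite (_ : EFin \o _ = (EFin \o lift3 f) \- (EFin \o lift3 g))%E; last by apply/funext.
  by apply: integrableB; [exact: mcube|exact: fi|exact: gi].
have hi : leb3.-integrable cube (EFin \o lift3 h).
  rewrite (_ : EFin \o _ = abse \o (EFin \o lift3 (fun y => f y - g y))); last by apply/funext.
  by apply: integrable_abse; exact: di.
have [h2 E] := lift_int hi.
have z : \int[leb2]_(y in square) h y = 0.
  rewrite -E -[RHS](mul0r (fine (leb3 cube))) -Rintegral_cst; last exact: mcube.
  congr fine; apply: ae_eq_integral; [exact: mcube|exact: measurable_int hi|exact: measurable_cst|].
  by apply: (ae1 fg) => x hx Cx /=; congr EFin; rewrite /h /lift3; have := hx Cx; rewrite /lift3 => ->; rewrite subrr normr0.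
have q : {ae leb2, forall y, square y -> h y = 0}.
  by apply: ge0_int0_ae; [exact: msquare|exact: h2|move=> y _; exact: normr_ge0|exact: z].
apply: (ae1 q) => y hy Sy; apply/eqP; rewrite -subr_eq0 -normr_eq0; apply/eqP; exact: hy.
Qed.

Lemma zc_fstate phib phit s i : (\int[leb3]_(x in cube) cmpt i (if s then phit else phib) x) = 0 ->
  zc s i (fstate phib phit) = fourier (cmpt i (if s then phit else phib)).
Proof.
move=> h0; apply/funext => k; rewrite /zc; case: eqP => [->|_]; last by apply: C_eq.
have h p := @fstate_0 _ phib phit s i p h0; have h1 := h true; have h2 := h false.
by rewrite /fstate /part /= in h1 h2; apply: C_eq.
Qed.

End InitialData.

(** * The constructed solution *)

Section Flow.
Context {R : realType}.
Local Notation C := (R[i]).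
Local Notation K := (int * int * int)%type.
Local Notation leb := (@lebesgue_measure R).
Local Notation leb2 := (@leb2 R).
Local Notation leb3 := (@leb3 R).
Local Notation freq := (@freq R).
Local Notation st := (Ix -> K -> R).
Local Notation cQ := (8 * (24 * (2 * @kB R * (2 * @kB R)))).
Variables (r Om tau0 T lam sig : R) (v0 : R * R * R -> R * R).
Hypotheses (hr : 5 / 2 < r) (t00 : 0 < tau0) (adm : admissible r tau0 v0) (T0 : 0 < T) (lam0 : 0 < lam).
Let M := data_size r tau0 v0.
Hypotheses (small : 8 * cQ * kap r * Num.sqrt M <= lam) (lamT : lam * T < tau0) (ls : lam < sig) (sigT : sig * T <= tau0).

Let A := dmaj tau0 v0.
Let S := S_lim cQ lam A.
Let s0 := tau0 - lam * T.

Definition flow t : st := u_lim (NR Om) T (dstate v0) t.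
(** The coefficients in the original frame; [flow] lives in the rotating one. *)
Definition vst t : st := rota (- Om * cl T t) (flow t).

Let c0 : 0 <= cQ. Proof. by rewrite mulr_ge0// mulr_ge0// q1_ge0. Qed.
Let qN : quad (NR Om) cQ. Proof. exact: quad_NR. Qed.
Let T0' : 0 <= T. Proof. exact: ltW. Qed.
Let tauT : lam * T <= tau0. Proof. exact: ltW. Qed.
Let al0 : 0 <= Num.sqrt M. Proof. exact: sqrtr_ge0. Qed.
Let mA : maj r A (Num.sqrt M). Proof. exact: dmaj_maj. Qed.
Let bA i k : `|dstate v0 i k| <= expR (- (tau0 * freq k)) * A k. Proof. exact: dstate_le. Qed.
Let s00 : 0 < s0. Proof. by rewrite subr_gt0. Qed.

Lemma flow_S : maj r S (2 * Num.sqrt M).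
Proof. exact (S_lim_maj hr c0 lam0 al0 mA small). Qed.

Lemma flow_sS : smallw S.
Proof. by apply: (maj_small hr _ flow_S); rewrite mulr_ge0. Qed.

Lemma flow_bdd t : bdd (flow t) (ub tau0 lam T t S).
Proof. exact (u_lim_bdd hr c0 qN T0' lam0 tauT al0 mA bA small t). Qed.

Lemma flow_cts i k : continuous (fun t => flow t i k).
Proof. exact: (u_lim_cts hr c0 qN T0' lam0 tauT al0 mA bA small). Qed.

Lemma flow_eq t i k : flow t i k = dstate v0 i k + ig (fun s => NR Om s (flow s) i k) (cl T t).
Proof. exact (u_lim_eq hr c0 qN T0' lam0 tauT al0 mA bA small t i k). Qed.

(** Rotations and [N0] preserve [good], so its defining linear relations hold for all iterates and
    for their limit. *)
Lemma flow_good t : good (flow t).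
Proof.
apply: good_linP; apply: (u_lim_inv hr c0 qN T0' lam0 tauT al0 mA bA small).
- move=> t' u U _ _ hu; have gu : good u by exact: good_linP.
  by move=> l; apply; rewrite /NR; apply: good_rota; apply: good_N0; exact: good_rota.
- by move=> l; apply; exact: (dstate_good adm).
Qed.

Lemma vst_good t : good (vst t).
Proof. by apply: good_rota; exact: flow_good. Qed.

Lemma vst_ub t j k : `|vst t j k| <= 2 * ub tau0 lam T t S k.
Proof. by apply: rota_le => i; exact: flow_bdd. Qed.

(** The radius left at the final time is a decay rate valid at all times, which makes the
    coefficients rapidly decreasing uniformly on [0, T]. *)
Lemma flow_bdd0 t : bdd (flow t) (fun k => expR (- (s0 * freq k)) * S k).
Proof.
move=> i k; apply: (le_trans (flow_bdd t i k)); rewrite /ub; apply: ler_wpM2r; first by case: flow_sS.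
rewrite ler_expR lerN2; apply: ler_wpM2r; first exact: freq_ge0.
by rewrite lerD2l lerN2; apply: ler_wpM2l; [exact: ltW|case/andP: (cl_itv t T0')].
Qed.

Lemma vst_bdd t : bdd (vst t) (fun k => expR (- (s0 * freq k)) * (2 * S k)).
Proof. by move=> j k; rewrite mulrCA; apply: rota_le => i; exact: flow_bdd0. Qed.

Let sS2 : smallw (fun k => 2 * S k). Proof. exact: smallw2 flow_sS. Qed.

Lemma vst_cts j k : continuous (fun t => vst t j k).
Proof.
apply: (@rota_cts _ (fun t => - Om * cl T t) flow); last exact: flow_cts.
by move=> t; apply: cvgMr; exact: cl_cts.
Qed.

Lemma vst_int t : 0 <= t <= T -> forall j k, vst t j k = dstate v0 j k + ig (fun s => GG Om (vst s) j k) t.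
Proof.
move=> tT j k.
have cg j' k' : continuous (fun s => NR Om s (flow s) j' k') by exact: (quad_cts qN (track_sE s00 flow_sS) flow_bdd0 flow_cts).
have h := @rota_int _ (- Om) T flow (fun s => NR Om s (flow s)) (dstate v0) T0' cg flow_eq t tT j k.
rewrite /vst cl_id// h; congr (_ + _); apply: eq_ig => s /andP[s1 s2].
have /andP[_ t2] := tT.
have E : cl T s = s by rewrite cl_id// s1 (le_trans s2).
rewrite /vst E /GG /NR; congr (_ + _).
have -> : - (Om * s) = - Om * s by rewrite mulNr.
by have := rotaK (- Om * s) (N0 (rota (- Om * s) (flow s))); rewrite mulNr opprK => ->.
Qed.

Lemma vst_0 : vst 0 = dstate v0.
Proof.
apply/funext => j; apply/funext => k; rewrite vst_int ?lexx//; by rewrite ig0 addr0.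
Qed.

Lemma vst_rd t s i : rd (zc s i (vst t)).
Proof. exact: (track_rd s00 sS2 vst_bdd). Qed.

Lemma vst_pgood t : pgood (zb (vst t)) (zt (vst t)).
Proof. by apply: good_pgood; [exact: vst_good|move=> s i; exact: vst_rd]. Qed.

Definition fld (s : bool) t : R * R * R -> R * R := vser (fun i => zc s i (vst t)).
Definition flow_b t : R * R -> R * R := vbP (zb (vst t)).
Definition flow_t t : R * R * R -> R * R := vtP (zt (vst t)).

Lemma lift_flow_b t : lift3 (flow_b t) = fld false t.
Proof. by apply: lift_vser; exact: (pg_sb (vst_pgood t)). Qed.

Let sz t s i : csumm (zc s i (vst t)) := rd_summ (vst_rd t s i).
Let hz t s i : herm (zc s i (vst t)) := good_zc_herm s i (vst_good t).

Lemma fld_sq s t k : fourier_sq (fld s t) k = \sum_(i : bool) \sum_(p : bool) vst t (s, i, p) k ^+ 2.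
Proof. by apply: fsq_zc => [i|i|j]; [exact: sz|exact: hz|exact: (gd_0 (vst_good t))]. Qed.

(** The solution decays with radius tau0 - lam t while the norm asks for the smaller tau0 - sig t;
    the surplus is the exponential on the right. In 32, a factor 2 absorbs the inhomogeneous weight
    for k != 0 and 16 adds four components, each bounded by 2 before squaring. *)
Lemma fld_nsum q s k t : 0 <= q -> 0 <= t <= T ->
  nsum (fun t => tau0 - sig * t) q (fld s) k t <= 32 * (freq k `^ q * S k) ^+ 2 * expR (- (2 * (sig - lam) * t * freq k)).
Proof.
move=> q0 tT; rewrite /nsum fld_sq; have [t1 t2] := andP tT; have [S0 _] := flow_sS.
have [->|k0] := eqVneq k 0.
  have -> : \sum_(i : bool) \sum_(p : bool) vst t (s, i, p) 0 ^+ 2 = 0.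
    by apply: big1 => i _; apply: big1 => p _; rewrite (gd_0 (vst_good t)) expr0n.
  by rewrite mulr0; apply: mulr_ge0; [apply: mulr_ge0; [|exact: sqr_ge0]|exact: expR_ge0].
set e := expR (- ((tau0 - lam * t) * freq k)).
have h i p : vst t (s, i, p) k ^+ 2 <= (2 * (e * S k)) ^+ 2.
  rewrite -real_normK ?num_real// ler_pXn2r ?nnegrE ?mulr_ge0 ?expR_ge0//.
  by have := vst_ub t (s, i, p) k; rewrite /ub cl_id.
apply: (@le_trans _ _ (2 * (freq k `^ (2 * q) * expR (2 * (tau0 - sig * t) * freq k)) * (16 * (e * S k) ^+ 2))).
  apply: ler_pM.
  - by rewrite (le_trans ler01)// wgt_ge1.
  - by apply: sumr_ge0 => i _; apply: sumr_ge0 => p _; exact: sqr_ge0.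
  - rewrite /wgt; have two (x : R) : 1 <= x -> 1 + x <= 2 * x by move=> h1; rewrite [2 * x]mulr_natl mulr2n lerD2r.
    apply: two; rewrite -[leLHS]mulr1; apply: ler_pM => //.
      by rewrite -[leLHS](powRr0 (freq k)); apply: ler_powR; [exact: freq_ge1|exact: mulr_ge0].
    rewrite -expR0 ler_expR !mulr_ge0 ?freq_ge0// subr_ge0 (le_trans _ sigT)//.
    by apply: ler_wpM2l => //; apply: le_trans (ltW ls); exact: ltW.
  rewrite !big_bool /=; have := h true true; have := h true false; have := h false true; have := h false false.
  rewrite [(2 * _) ^+ 2]exprMn; exact: le_sum4.
rewrite le_eqVlt; apply/orP; left; apply/eqP.
rewrite !exprMn powR_sqr ?freq_ge0//.
have -> : expR (2 * (tau0 - sig * t) * freq k) = expR (- (2 * (sig - lam) * t * freq k)) * expR (2 * ((tau0 - lam * t) * freq k)).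
  by rewrite -expRD; congr expR; ring.
have E : expR (2 * ((tau0 - lam * t) * freq k)) * e ^+ 2 = 1.
  by rewrite -expRM_natl -expRD -[RHS]expR0; congr expR; ring.
transitivity (32 * (freq k `^ (2 * q) * S k ^+ 2) * expR (- (2 * (sig - lam) * t * freq k)) * (expR (2 * ((tau0 - lam * t) * freq k)) * e ^+ 2)); first by ring.
by rewrite E mulr1.
Qed.

Lemma fld_nsum_cts q s k : continuous (nsum (fun t => tau0 - sig * t) q (fld s) k).
Proof.
have -> : nsum (fun t => tau0 - sig * t) q (fld s) k = (fun t => wgt (tau0 - sig * t) q k * \sum_(i : bool) \sum_(p : bool) vst t (s, i, p) k ^+ 2).
  by apply/funext => t; rewrite /nsum fld_sq.
have cw : continuous (fun t => wgt (tau0 - sig * t) q k).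
  have -> : (fun t => wgt (tau0 - sig * t) q k) = (fun t => 1 + freq k `^ (2 * q) * expR (2 * tau0 * freq k + - (2 * sig * freq k) * t)).
    by apply/funext => t; rewrite /wgt; congr (_ + _ * expR _); ring.
  by move=> t; apply: cvgD; [exact: cvg_cst|apply: cvgMr; exact: exp_aff_cts].
move=> t; apply: cvgM; first exact: cw.
have sqc i p : continuous (fun t => vst t (s, i, p) k ^+ 2) by under eq_fun do rewrite expr2; move=> t'; apply: cvgM; exact: vst_cts.
rewrite !big_bool /=; under eq_fun do rewrite !big_bool /=.
by apply: cvgD; apply: cvgD; exact: sqc.
Qed.

Lemma fld_nsum_r s k t : 0 <= t <= T -> nsum (fun t => tau0 - sig * t) r (fld s) k t <= 32 * (freq k `^ r * S k) ^+ 2.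
Proof.
move=> tT; have r0 : 0 <= r by have := hr; lra.
apply: (le_trans (fld_nsum s k r0 tT)); apply: ler_piMr; first by apply: mulr_ge0 => //; exact: sqr_ge0.
rewrite -[leRHS]expR0 ler_expR oppr_le0.
by have /andP[t1 _] := tT; rewrite !mulr_ge0 ?freq_ge0// subr_ge0 ltW.
Qed.

Lemma fld_summ_r s t : 0 <= t <= T -> summ (nsum (fun t => tau0 - sig * t) r (fld s) ^~ t).
Proof.
move=> tT; have [_ sS _] := flow_S.
by apply: summ_le (summZ 32 sS) => k; rewrite ger0_norm ?nsum_ge0//; exact: fld_nsum_r.
Qed.

Lemma fld_nsum_half s k t : 0 <= t <= T ->
  nsum (fun t => tau0 - sig * t) (r + 2^-1) (fld s) k t <= 32 * (freq k `^ r * S k) ^+ 2 * (freq k * expR (- (2 * (sig - lam) * t * freq k))).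
Proof.
move=> tT; have r0 : 0 <= r + 2^-1 by have := hr; lra.
apply: (le_trans (fld_nsum s k r0 tT)); rewrite le_eqVlt; apply/orP; left; apply/eqP.
rewrite !exprMn !powR_sqr ?freq_ge0//.
have [->|k0] := eqVneq k 0.
  have -> : freq (0 : K) = 0 by rewrite /Defs.freq /= !expr0n /= !addr0 sqrtr0.
  by rewrite !mul0r mulr0 powR0 ?mul0r ?mulr0 ?mul0r// gt_eqF// mulr_gt0//; have := hr; lra.
rewrite (_ : 2 * (r + 2^-1) = 2 * r + 1); last by field.
rewrite powRD; last by rewrite (gt_eqF (lt_le_trans ltr01 (freq_ge1 k0))) implybT.
by rewrite powRr1 ?freq_ge0//; ring.
Qed.

(** At a positive time the surplus decay absorbs the extra power of |k|, since x e^(-g x) <= 1/g;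
    the bound degenerates as t tends to 0. *)
Lemma fld_summ_half s t : 0 < t <= T -> summ (nsum (fun t => tau0 - sig * t) (r + 2^-1) (fld s) ^~ t).
Proof.
move=> /andP[t1 t2]; have tT : 0 <= t <= T by rewrite (ltW t1).
have [_ sS _] := flow_S; have g0 : 0 < 2 * (sig - lam) * t by rewrite !mulr_gt0// subr_gt0.
apply: summ_le (summZ (2 * (sig - lam) * t)^-1 (summZ 32 sS)) => k; rewrite ger0_norm ?nsum_ge0//.
apply: (le_trans (fld_nsum_half s k tT)); rewrite mulrC; apply: ler_wpM2r; first by rewrite mulr_ge0// sqr_ge0.
rewrite expRN ler_pdivrMr ?expR_gt0// -[leLHS](mulKf (lt0r_neq0 g0)); apply: ler_wpM2l; first by rewrite invr_ge0 ltW.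
by apply: le_trans (expR_ge1Dx _); rewrite lerDr.
Qed.

Lemma fld_L2 s t : L2 (fld s t).
Proof. by apply: vser_L2 => i; exact: sz. Qed.

Let sigt t : 0 <= t <= T -> 0 <= tau0 - sig * t.
Proof.
move=> /andP[_ tT]; rewrite subr_ge0; apply: le_trans sigT; apply: ler_wpM2l => //.
by apply: le_trans (ltW ls); exact: ltW.
Qed.

Lemma fld_S s t : spaceS (fld s t).
Proof.
have pg := vst_pgood t; case: s.
  apply: (@spaceS_til _ (zt (vst t))); [exact (pg_rt pg)|exact (pg_ht pg)|].
  by move=> i k k0; rewrite /zt /zc !(gd_z (vst_good t))// -[Complex 0 0]/(0 : C) if_same.
apply: (@spaceS_bar _ (zb (vst t))); [exact (pg_rb pg)|exact (pg_hb pg)|exact (pg_sb pg)| |exact (pg_db pg)].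
by move=> i; rewrite /zb /zc eqxx.
Qed.

Lemma in_oo t : t \in `]0, T[ -> 0 <= t <= T.
Proof. by rewrite in_itv /= => /andP[h1 h2]; rewrite !ltW. Qed.

Lemma fld_Loo s : Lp_in +oo%E T (fun t => spaceS `&` Dana (tau0 - sig * t) r) (fun t => anorm (tau0 - sig * t) r) (fld s).
Proof.
have mD : measurable (`]0%R, T[%classic : set R) by exact: measurable_itv.
split.
- apply/aeW => t /in_oo tT; split; first exact: fld_S.
  by apply: Dana_summ; [exact: sigt|exact: fld_L2|exact: (fld_summ_r s tT)].
- apply: (@anorm_time_meas _ T (fun t => tau0 - sig * t)) => [k|t /in_oo]; last exact: fld_summ_r.
  by apply: cts_measurable => //; exact: fld_nsum_cts.
have [_ sS _] := flow_S.
by apply: (anorm_time_oo (tau := fun t => tau0 - sig * t) (summZ 32 sS)) => k t /in_oo tT; exact: fld_nsum_r.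
Qed.

Lemma fld_L2in s : Lp_in 2%:E T (fun t => Dana (tau0 - sig * t) (r + 2^-1)) (fun t => anorm (tau0 - sig * t) (r + 2^-1)) (fld s).
Proof.
have mD : measurable (`]0%R, T[%classic : set R) by exact: measurable_itv.
have hs t : t \in `]0, T[ -> summ (nsum (fun t => tau0 - sig * t) (r + 2^-1) (fld s) ^~ t).
  by rewrite in_itv /= => /andP[t1 t2]; apply: fld_summ_half; rewrite t1 ltW.
have hm k : measurable_fun `]0, T[ (nsum (fun t => tau0 - sig * t) (r + 2^-1) (fld s) k).
  by apply: cts_measurable => //; exact: fld_nsum_cts.
split.
- apply/aeW => t tT; apply: Dana_summ; [exact: (sigt (in_oo tT))|exact: fld_L2|exact: (hs t tT)].
- exact: (@anorm_time_meas _ T (fun t => tau0 - sig * t)).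
have [S0 sS _] := flow_S; have g0 : 0 < sig - lam by rewrite subr_gt0.
apply: (@anorm_time_2 _ T (fun t => tau0 - sig * t) _ _ (fun k => 32 * (freq k `^ r * S k) ^+ 2 * (2 * (sig - lam))^-1) hm hs).
- by under eq_fun do rewrite mulrC; exact: summZ (summZ 32 sS).
- by move=> k; apply: mulr_ge0; [apply: mulr_ge0 => //; exact: sqr_ge0|rewrite invr_ge0 mulr_ge0// ltW].
move=> k; set a := 32 * _; have a0 : 0 <= a by rewrite mulr_ge0// sqr_ge0.
have [k0|k0] := eqVneq k 0.
  have az : a = 0.
    rewrite /a k0; have -> : freq (0 : K) = 0 by rewrite /Defs.freq /= !expr0n /= !addr0 sqrtr0.
    by rewrite powR0 ?mul0r ?expr0n ?mulr0//; have := hr; lra.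
  rewrite az mul0r integral0_eq// => t /in_oo tT; congr EFin; apply/eqP; rewrite eq_le nsum_ge0 andbT.
  by have := fld_nsum_half s k tT; rewrite -/a az mul0r.
have w0 : 0 < freq k := lt_le_trans ltr01 (freq_ge1 k0).
apply: (@le_trans _ _ (\int[leb]_(t in `]0%R, T[) (a%:E * (freq k * expR (- (2 * (sig - lam) * t * freq k)))%:E))%E).
  apply: ge0_le_integral => //.
  - by move=> t _; rewrite lee_fin nsum_ge0.
  - by apply/measurable_EFinP; exact: hm.
  - apply/measurable_EFinP; apply: cts_measurable => //.
    have -> : (fun t => a * (freq k * expR (- (2 * (sig - lam) * t * freq k)))) = (fun t => a * (freq k * expR (0 + - (2 * (sig - lam) * freq k) * t))).
      by apply/funext => t; congr (_ * (_ * expR _)); ring.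
    by move=> t; do 2 apply: cvgMr; exact: exp_aff_cts.
  - by move=> t /in_oo tT; rewrite -EFinM lee_fin; exact: fld_nsum_half.
rewrite ge0_integralZl_EFin//; first by rewrite [leRHS]EFinM; exact: (lee_wpmul2l _ (int_exp_gain T g0 w0)).
  by move=> t _; rewrite lee_fin mulr_ge0 ?expR_ge0// freq_ge0.
apply/measurable_EFinP; apply: cts_measurable => //.
have -> : (fun t => freq k * expR (- (2 * (sig - lam) * t * freq k))) = (fun t => freq k * expR (0 + - (2 * (sig - lam) * freq k) * t)).
  by apply/funext => t; congr (_ * expR _); ring.
by move=> t; apply: cvgMr; exact: exp_aff_cts.
Qed.

Lemma fld0_init s i : {ae leb3, forall x, cube x -> cmpt i (fld s 0) x = cmpt i (if s then fluct v0 else lift3 (P0 v0)) x}.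
Proof.
have [ib it] := data_intg adm; have [_ [Sb _] [St _]] := adm.
have m0 : \int[leb3]_(x in cube) cmpt i (if s then fluct v0 else lift3 (P0 v0)) x = 0 by case: s; exact: spaceS_0.
have ii : leb3.-integrable cube (EFin \o cmpt i (if s then fluct v0 else lift3 (P0 v0))) by case: s {m0}; [exact: it|exact: ib].
have E := zc_fstate m0.
rewrite /fld cmpt_vser vst_0 /dstate E; apply: ae_ser_fourier ii _.
by rewrite -E -/(dstate v0) -vst_0; exact: sz.
Qed.

Lemma cmpt_int s i t : leb3.-integrable cube (EFin \o cmpt i (fld s t)).
Proof. exact: (L2_intg (fld_L2 s t)). Qed.

Theorem flow_solution : solution r Om T (fun t => tau0 - sig * t) (P0 v0) (fluct v0) flow_b flow_t.
Proof.
have [ib it] := data_intg adm.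
split.
- by move=> t _; split; [exact: vser2_per|apply: vser2_cts => i; exact: sz].
- move=> t _; split; [exact: vser_per|apply: vser_cts => i; exact: sz|apply: vser_even; exact: (pg_ev (vst_pgood t))].
- have -> : (fun t => lift3 (flow_b t)) = fld false by apply/funext => t; exact: lift_flow_b.
  by split; [exact: (fld_Loo false)|exact: (fld_Loo true)].
- have -> : (fun t => lift3 (flow_b t)) = fld false by apply/funext => t; exact: lift_flow_b.
  by split; [exact: (fld_L2in false)|exact: (fld_L2in true)].
- have sd s i : csumm (zc s i (dstate v0)) by rewrite -vst_0; exact: sz.
  (* The time derivatives are the series of the right-hand side [GG], defined at every time; the
     equations then hold at all times and not only almost everywhere. *)
  have D s i x := serG_dt s00 sS2 vst_bdd vst_cts x T0' (sd s i) vst_int.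
  exists (fun t y => vser (zb (GG Om (vst t))) (y, 0)), (fun t x => vser (zt (GG Om (vst t))) x); split.
  + by move=> y; split; [exact (D false false (y, 0))|exact (D false true (y, 0))].
  + by move=> x; split; [exact (D true false x)|exact (D true true x)].
  apply/aeW => t _; split; first by apply: field_bar_eq; exact: vst_pgood.
  apply: field_til_eq; first exact: vst_pgood.
  move=> i; exact (track_csummN s00 sS2 vst_bdd t i).
split.
  have h i : {ae leb2, forall y, square y -> (if i then (flow_b 0 y).2 else (flow_b 0 y).1) = (if i then (P0 v0 y).2 else (P0 v0 y).1)}.
    have e1 : lift3 (fun y => if i then (flow_b 0 y).2 else (flow_b 0 y).1) = cmpt i (fld false 0) by rewrite -lift_flow_b; case: (i).
    have e2 : lift3 (fun y => if i then (P0 v0 y).2 else (P0 v0 y).1) = cmpt i (lift3 (P0 v0)) by case: (i).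
    apply: ae_unlift; rewrite ?e1 ?e2; [exact: cmpt_int|exact: ib|exact: (fld0_init false i)].
  apply: (ae2 (h false) (h true)) => y h1 h2 Sy; have {}h1 := h1 Sy; have {}h2 := h2 Sy.
  by move: h1 h2; case: (flow_b 0 y) => a b; case: (P0 v0 y) => c d /= -> ->.
apply: (ae2 (fld0_init true false) (fld0_init true true)) => x h1 h2 Sx; have {}h1 := h1 Sx; have {}h2 := h2 Sx.
rewrite [RHS]surjective_pairing; congr pair; [exact h1|exact h2].
Qed.

End Flow.

(** * Uniqueness *)

Section Apriori.
Context {R : realType}.
Local Notation C := (R[i]).
Local Notation K := (int * int * int)%type.
Local Notation leb2 := (@leb2 R).
Local Notation leb3 := (@leb3 R).
Local Notation freq := (@freq R).
Local Notation st := (Ix -> K -> R).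
Implicit Types (k : K).

Lemma anorm_coef tau q (phi : R * R * R -> R * R) (B : R) k : (anorm tau q phi <= B%:E)%E ->
  freq k `^ (2 * q) * expR (2 * tau * freq k) * fourier_sq phi k <= B ^+ 2.
Proof.
move=> h; have hs : summ (fun k => wgt tau q k * fourier_sq phi k) by apply: (proj1 (anorm_fin tau q phi)); apply: le_lt_trans h (ltry _).
have g0 l : 0 <= wgt tau q l * fourier_sq phi l by rewrite mulr_ge0 ?fsq_ge0// (le_trans ler01)// wgt_ge1.
move: h; rewrite (anormE hs) lee_fin => h.
have B0 : 0 <= B := le_trans (sqrtr_ge0 _) h.
apply: (@le_trans _ _ (wgt tau q k * fourier_sq phi k)).
  by apply: ler_wpM2r; [exact: fsq_ge0|rewrite /wgt lerDr].
apply: (le_trans (le_sm1 k g0 hs)).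
by rewrite -[leLHS]sqr_sqrtr ?sm_ge0// ler_pXn2r ?nnegrE ?sqrtr_ge0.
Qed.

(** A norm bound at one time controls each coefficient by |k|^(-r) e^(-s1 |k|), but the
    square-summable profile depends on the time. To get one majorant for all times, half of the
    exponential is traded for further powers of |k|, which make the pointwise bound itself square
    summable with weight |k|^r. *)
Lemma apriori (r s1 B : R) : 5 / 2 < r -> 0 < s1 -> 0 <= B ->
  exists W : K -> R, exists w : R, [/\ 0 <= w, maj r W w, W 0 = 0 &
    forall (tau : R) (phib phit : R * R * R -> R * R), s1 <= tau -> (anorm tau r phib <= B%:E)%E -> (anorm tau r phit <= B%:E)%E ->
    (forall j, fstate phib phit j 0 = 0) -> forall j k, `|fstate phib phit j k| <= expR (- (s1 / 2 * freq k)) * W k].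
Proof.
move=> hr s10 B0; have r0 : 0 <= r by lra.
have s12 : 0 < s1 / 2 by rewrite divr_gt0.
pose n := (Num.bound (2 * r - 1)).
have hn : 2 * r - 1 <= n%:R.
  have h0 : 0 <= 2 * r - 1 by lra.
  by have := archi_boundP h0; rewrite -/n => /ltW.
have [Ce Ce0 hCe] := pw_exp_bound n s12.
pose g k : R := if k == 0 then 0 else freq k `^ (1 - r).
pose b := 2 * B * Ce; have b0 : 0 <= b by rewrite !mulr_ge0.
(* The exponent is chosen so that |k|^r W is b |k|^(1-r), square summable for r > 5/2. The factor 2
   B in [b] bounds the two fields together. *)
pose W k : R := b * (if k == 0 then 0 else freq k `^ (1 - 2 * r)).
have gW k : freq k `^ r * W k = b * g k.
  rewrite /W /g; have [->|k0] := eqVneq k 0; first by rewrite !mulr0.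
  rewrite mulrCA -powRD; last by rewrite (gt_eqF (lt_le_trans ltr01 (freq_ge1 k0))) implybT.
  by congr (_ * _ `^ _); ring.
have sg : summ (fun k => g k ^+ 2).
  have h3 : 3 < 2 * r - 2 by lra.
  apply: summ_le (summ_freq h3) => k; rewrite /g; case: eqP => [_|_]; first by rewrite expr0n normr0.
  rewrite ger0_norm ?sqr_ge0// powR_sqr ?freq_ge0// le_eqVlt; apply/orP; left; apply/eqP; congr (_ `^ _); ring.
have W0 k : 0 <= W k by rewrite mulr_ge0//; case: ifP => // _; exact: powR_ge0.
exists W, (b * Num.sqrt (sm (fun k => g k ^+ 2))); split.
- by rewrite mulr_ge0// sqrtr_ge0.
- have E : (fun k => (freq k `^ r * W k) ^+ 2) = (fun k => b ^+ 2 * g k ^+ 2) by apply/funext => k; rewrite gW exprMn.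
  split=> //; first by rewrite E; exact: summZ.
  rewrite E smZ// [leRHS]exprMn [X in _ <= _ * X]sqr_sqrtr//.
  by apply: sm_ge0 => k; exact: sqr_ge0.
- by rewrite /W eqxx mulr0.
move=> tau phib phit st hb ht z j k.
have [->|k0] := eqVneq k 0; first by rewrite z /W eqxx !mulr0 normr0.
have w1 := freq_ge1 k0 : 1 <= freq k; have w0 : 0 < freq k := lt_le_trans ltr01 w1.
have h : freq k `^ (2 * r) * expR (2 * tau * freq k) * (fstate phib phit j k ^+ 2) <= (2 * B) ^+ 2.
  apply: (@le_trans _ _ (freq k `^ (2 * r) * expR (2 * tau * freq k) * (fourier_sq phib k + fourier_sq phit k))).
    apply: ler_wpM2l; first by rewrite mulr_ge0 ?powR_ge0 ?expR_ge0.
    by rewrite fstate_sum (bigD1 j)//= lerDl; apply: sumr_ge0 => i _; exact: sqr_ge0.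
  rewrite mulrDr; apply: (le_trans (lerD (anorm_coef k hb) (anorm_coef k ht))).
  by rewrite exprMn; move: (B ^+ 2) (sqr_ge0 B) => a a0; rewrite -[2 ^+ 2]/(2 * 2); lra.
have {}h : freq k `^ r * expR (tau * freq k) * `|fstate phib phit j k| <= 2 * B.
  rewrite -(ler_pXn2r (n := 2))// ?nnegrE ?mulr_ge0 ?powR_ge0 ?expR_ge0//.
  rewrite !exprMn powR_sqr ?(ltW w0)// -expRM_natl real_normK ?num_real//.
  rewrite (_ : 2 * (tau * freq k) = 2 * tau * freq k); last by rewrite mulrA.
  by move: h; rewrite [(2 * B) ^+ 2]exprMn.
have q1 : 0 < freq k `^ r by rewrite powR_gt0.
have q2 := expR_gt0 (tau * freq k).
apply: (@le_trans _ _ (2 * B * (expR (- (tau * freq k)) * freq k `^ (- r)))).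
  rewrite powRN expRN -invfM ler_pdivlMr ?mulr_gt0//; apply: le_trans h; rewrite le_eqVlt; apply/orP; left; apply/eqP; ring.
rewrite /W (negbTE k0) /b.
have -> : expR (- (s1 / 2 * freq k)) * (2 * B * Ce * freq k `^ (1 - 2 * r)) = 2 * B * (expR (- (s1 / 2 * freq k)) * (Ce * freq k `^ (1 - 2 * r))) by ring.
apply: ler_wpM2l; first by rewrite mulr_ge0.
have le1 : expR (- (tau * freq k)) <= expR (- (s1 / 2 * freq k)) * expR (- (s1 / 2 * freq k)).
  rewrite -expRD ler_expR (_ : - (s1 / 2 * freq k) + - (s1 / 2 * freq k) = - (s1 * freq k)); last by field.
  by rewrite lerN2; apply: ler_wpM2r => //; exact: ltW.
apply: (le_trans (ler_wpM2r (powR_ge0 _ _) le1)); rewrite -[leLHS]mulrA; apply: ler_wpM2l; first exact: expR_ge0.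
have -> : freq k `^ (- r) = freq k `^ (r - 1) * freq k `^ (1 - 2 * r).
  by rewrite -powRD; [congr (_ `^ _); ring|rewrite (gt_eqF w0) implybT].
rewrite mulrA; apply: ler_wpM2r; first exact: powR_ge0.
apply: le_trans (hCe _ (ltW w0)); rewrite mulrC; apply: ler_wpM2r; first exact: expR_ge0.
apply: (@le_trans _ _ (freq k `^ n%:R)); first by apply: ler_powR => //; lra.
by rewrite powR_mulrn ?(ltW w0)//; apply: lerXn2r; rewrite ?nnegrE ?addr_ge0 ?(ltW w0)// lerDr.
Qed.

Lemma zc_fourier (phib phit : R * R * R -> R * R) (s i : bool) : (forall p, fstate phib phit (s, i, p) 0 = 0) ->
  zc s i (fstate phib phit) = fourier (cmpt i (if s then phit else phib)).
Proof.
move=> h; apply/funext => k; rewrite /zc; case: eqP => [->|_]; last by apply: C_eq.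
have h1 := h true; have h2 := h false.
by rewrite /fstate /part /= in h1 h2; apply: C_eq.
Qed.

Section OneTime.
Variables (vb : R * R -> R * R) (vt : R * R * R -> R * R).
Hypotheses (pb : periodic2 vb) (cb : continuous vb) (pt : periodic3 vt) (ct : continuous vt) (et : even_z vt).
Let c := fstate (lift3 vb) vt.
Hypothesis c0 : forall j, c j 0 = 0.

Lemma field_cmpt s i : continuous (cmpt i (if s then vt else lift3 vb)) /\ periodic3 (cmpt i (if s then vt else lift3 vb)).
Proof.
have cl : continuous (lift3 vb) by move=> x; apply: (@continuous_comp _ _ _ fst vb); [exact: cvg_fst|exact: cb].
have pl : periodic3 (lift3 vb) by move=> x; have [h1 h2] := pb x.1; split; rewrite /lift3 /= ?h1 ?h2.
have cf : continuous (if s then vt else lift3 vb) by case: (s).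
have pf : periodic3 (if s then vt else lift3 vb) by case: (s).
split; last by move=> x; have [h1 h2 h3] := pf x; rewrite /cmpt; case: (i); rewrite /= h1 h2 h3.
rewrite /cmpt; case: (i) => x; apply: (@continuous_comp _ _ _ (if s then vt else lift3 vb)); first exact: cf.
- exact: cvg_snd.
- exact: cf.
- exact: cvg_fst.
Qed.

Lemma field_intg s : intg (if s then vt else lift3 vb).
Proof. by move=> i; apply: cts3_int; exact (proj1 (field_cmpt s i)). Qed.

Lemma state_herm s i : herm (zc s i c).
Proof. by rewrite /c zc_fourier//; apply: fourier_herm; exact: field_intg. Qed.

Lemma state_ser (s : bool) i : csumm (zc s i c) -> ser (zc s i c) = cmpt i (if s then vt else lift3 vb).
Proof. by have [h1 h2] := field_cmpt s i; rewrite /c zc_fourier// => h; exact: ser_fourier. Qed.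

Lemma state_vbP : (forall s i, csumm (zc s i c)) -> vb = vbP (zb c).
Proof.
move=> sc; apply/funext => y; rewrite /vbP /vser /zb !(@state_ser false)//=.
by rewrite [LHS]surjective_pairing.
Qed.

Lemma state_vtP : (forall s i, csumm (zc s i c)) -> vt = vtP (zt c).
Proof. by move=> sc; apply/funext => x; rewrite /vtP /vser /zt !(@state_ser true)//=; case: (vt x). Qed.

Lemma state_pgood : (forall s i, rd (zc s i c)) -> weak_div_free (P0 (lift3 vb)) -> weak_div_free (P0 vt) -> pgood (zb c) (zt c).
Proof.
move=> rc wb wt; split.
- exact: rc.
- exact: rc.
- exact: state_herm.
- exact: state_herm.
- move=> i k; rewrite /zt /zc; have -> : (zr k == 0) = (k == 0) by case: k => k1 k2; rewrite /zr !xpair_eqE oppr_eq0.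
  by rewrite /c !fstate_e//; [exact: (field_intg true)|move=> j; exact (proj2 (field_cmpt true j))|exact: (field_intg true)|move=> j; exact (proj2 (field_cmpt true j))].
- move=> i k k0; rewrite /zb /zc /c !fstate_s//; [|exact: (field_intg false)|exact: (field_intg false)].
  by rewrite -[Complex 0 0]/(0 : C) if_same.
- move=> k; rewrite /zb /c; have [k0|k0] := eqVneq k.2 0.
    rewrite (_ : (fun i => zc false i _) = (fun i => fourier (cmpt i (lift3 vb)))); last by apply/funext => i; exact: (@zc_fourier _ _ false).
    exact: (weak_div_coef (field_intg false false) (field_intg false true) wb k0).
  rewrite /cdiv /D /zc !fstate_s//; [|exact: (field_intg false)..].
  by rewrite -[Complex 0 0]/(0 : C) if_same !mulr0 addr0.
- move=> k k0; rewrite /zt /c.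
  rewrite (_ : (fun i => zc true i _) = (fun i => fourier (cmpt i vt))); last by apply/funext => i; exact: (@zc_fourier _ _ true).
  exact: (weak_div_coef (field_intg true false) (field_intg true true) wt k0).
Qed.

End OneTime.
End Apriori.

(** * From almost every time to every time *)

Section AETime.
Context {R : realType}.
Local Notation leb := (@lebesgue_measure R).
Implicit Types (P : R -> Prop) (T : R) (u g h : R -> R).

Lemma ae_neq (a : R) : {ae leb, forall t : R, t != a}.
Proof.
exists [set a]; split; [exact: measurable_set1|exact: lebesgue_measure_set1|].
by move=> t /= /negP; rewrite negbK => /eqP.
Qed.

Lemma ae_oo_cc T P : {ae leb, forall t, t \in `]0, T[ -> P t} -> {ae leb, forall t, t \in `[0, T] -> P t}.
Proof.
move=> h; have hh : {ae leb, forall t : R, t != 0 /\ t != T} by apply: (ae2 (ae_neq 0) (ae_neq T)) => t h1 h2; split.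
apply: (ae2 h hh) => t ht [t0 tT]; rewrite in_itv /= => /andP[h0 hT]; apply: ht.
by rewrite in_itv /= !lt_neqAle eq_sym t0 h0 tT hT.
Qed.

Lemma ae_dense T P : 0 < T -> {ae leb, forall t, t \in `]0, T[ -> P t} ->
  forall t e, t \in `[0, T] -> 0 < e -> exists t', [/\ t' \in `]0, T[, `|t - t'| < e & P t'].
Proof.
move=> T0 [N [mN N0 NP]] t e; rewrite in_itv /= => /andP[t0 tT] e0.
apply: contrapT => H.
pose a := Num.max 0 (t - e); pose b := Num.min T (t + e).
have ab : a < b by rewrite /a /b lt_min !gt_max T0/=; apply/and3P; split; lra.
have sub : `]a, b[ `<=` N.
  move=> s /=; rewrite in_itv /= /a /b gt_max lt_min => /andP[/andP[s0 s1] /andP[sT s2]].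
  apply: NP => /= h; apply: H; exists s; have hs : s \in `]0, T[ by rewrite in_itv /= s0.
  by split=> //; [rewrite ltr_norml; apply/andP; split; lra|exact: h].
have : (leb `]a, b[ <= leb N)%E by apply: le_measure => //; rewrite inE; [exact: measurable_itv|exact: mN].
by rewrite N0 lebesgue_measure_itv/= lte_fin ab -EFinB lee_fin leNgt subr_gt0 ab.
Qed.

Lemma has_dt_sub T u g t t' : has_dt T u g -> 0 <= t' -> t' <= t -> t <= T ->
  leb.-integrable `]t', t] (EFin \o g) /\ u t - u t' = \int[leb]_(s in `]t', t]) g s.
Proof.
move=> [gi ug] t0 tt tT.
have ot : t \in `[0, T] by rewrite in_itv /= (le_trans t0).
have ot' : t' \in `[0, T] by rewrite in_itv /= t0 (le_trans tt).
have mD (i : interval R) : measurable ([set` i] : set (measurableTypeR R)) by exact: measurable_itv.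
have i1 : leb.-integrable `[0, t] (EFin \o g).
  by apply: (integrableS _ _ _ gi); [exact: mD|exact: mD|apply: subset_itvl; rewrite bnd_simp].
split; first by apply: (integrableS _ _ _ i1); [exact: mD|exact: mD|apply: subset_itv; rewrite bnd_simp].
rewrite (ug _ ot) (ug _ ot') opprD addrACA subrr add0r.
by apply: (Rintegral_itvB i1); rewrite bnd_simp.
Qed.

(** An essential bound on the derivative of an absolutely continuous function is a Lipschitz
    constant valid at all times. *)
Lemma has_dt_lip T u g (B : R) : 0 <= B -> has_dt T u g -> {ae leb, forall t, t \in `]0, T[ -> `|g t| <= B} ->
  forall t t', t \in `[0, T] -> t' \in `[0, T] -> `|u t - u t'| <= B * `|t - t'|.
Proof.
move=> B0 du gB.
have main t t' : 0 <= t' -> t' <= t -> t <= T -> `|u t - u t'| <= B * (t - t').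
  move=> t0 tt tT; have [gi ->] := has_dt_sub du t0 tt tT.
  have mD : measurable (`]t', t]%classic : set (measurableTypeR R)) by exact: measurable_itv.
  have fin : leb `]t', t] = (t - t')%:E.
    rewrite lebesgue_measure_itv/= lte_fin; case: (ltrP t' t) tt => [_ _|h1 h2]; rewrite -?EFinB//; have -> : t = t' by apply/eqP; rewrite eq_le h1 h2.
    by rewrite subrr.
  apply: (le_trans (le_normr_Rintegral _ gi)) => //.
  rewrite -lee_fin /Rintegral fineK; last by apply: integrable_fin_num => //; exact: (integrable_abse gi).
  apply: (@le_trans _ _ (\int[leb]_(s in `]t', t]) (cst B%:E s))%E).
    apply: ae_ge0_le_integral => //.
    - by apply/measurable_EFinP; apply: measurableT_comp => //; apply/measurable_EFinP; exact: measurable_int gi.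
    have q := ae_oo_cc gB; apply: (ae1 q) => s hs; rewrite /= in_itv /= => /andP[s1 s2]; rewrite lee_fin; apply: hs.
    by rewrite in_itv /= (le_trans s2 tT) (le_trans t0)// ltW.
  have -> : (\int[leb]_(s in `]t', t]) cst B%:E s = B%:E * leb `]t', t])%E by exact: integral_cst.
  by rewrite fin -EFinM.
move=> t t'; rewrite !in_itv /= => /andP[t0 tT] /andP[t0' tT'].
have [tt|/ltW tt] := leP t' t; first by rewrite [X in _ * X]ger0_norm ?subr_ge0//; exact: main.
by rewrite distrC [X in _ * X]ler0_norm ?subr_le0// opprB; exact: main.
Qed.

Lemma has_dt_ig T u g h : 0 <= T -> has_dt T u g -> continuous h -> {ae leb, forall t, t \in `]0, T[ -> g t = h t} ->
  forall t, 0 <= t <= T -> u t = u 0 + ig h t.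
Proof.
move=> T0 [gi ug] ch gh t /andP[t0 tT]; rewrite ug ?in_itv/= ?t0//; congr (_ + _).
have mD : measurable (`[0, t]%classic : set (measurableTypeR R)) by exact: measurable_itv.
have mT : measurable (`[0, T]%classic : set (measurableTypeR R)) by exact: measurable_itv.
have i1 : leb.-integrable `[0, t] (EFin \o g).
  by apply: (integrableS mT mD _ gi); apply: subset_itvl; rewrite bnd_simp.
congr fine; apply: ae_eq_integral => //; first exact: measurable_int i1.
  by apply/measurable_EFinP; exact: cts_measurable.
have q := ae_oo_cc gh; apply: (ae1 q) => s hs; rewrite /= in_itv /= => /andP[s1 s2]; congr EFin; apply: hs.
by rewrite in_itv /= s1 (le_trans s2).
Qed.

(** A set of times of full measure is dense, and a Lipschitz function carries the bound to the
    remaining times, endpoints included. *)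
Lemma le_Lip_ext (B : R) (f : R -> R) (T : R) (P : R -> Prop) (M : R) : 0 < T -> 0 <= B ->
  {ae leb, forall t, t \in `]0, T[ -> P t} -> (forall t, t \in `]0, T[ -> P t -> f t <= M) ->
  (forall t t', t \in `[0, T] -> t' \in `[0, T] -> `|f t - f t'| <= B * `|t - t'|) ->
  forall t, t \in `[0, T] -> f t <= M.
Proof.
move=> T0 B0 aP fM lf t tT; apply/ler_addgt0Pr => e e0.
have B1 : 0 < B + 1 by lra.
have d0 : 0 < e / (B + 1) by rewrite divr_gt0.
have [t' [t1 t2 t3]] := ae_dense T0 aP tT d0.
have t1' : t' \in `[0, T] by move: t1; rewrite !in_itv /= => /andP[h1 h2]; rewrite !ltW.
have := lf t t' tT t1'; have h1 := fM _ t1 t3.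
have h2 : B * `|t - t'| <= e.
  apply: (@le_trans _ _ ((B + 1) * (e / (B + 1)))); last by rewrite mulrC divfK// gt_eqF.
  by apply: ler_pM => //; [lra|exact: ltW].
by move=> h3; have := ler_norm (f t - f t'); lra.
Qed.

End AETime.

Section HermInt.
Context {R : realType}.
Local Notation C := (R[i]).
Local Notation K := (int * int * int)%type.

Lemma herm_int (c0 : K -> C) (g : R -> K -> C) t : herm c0 -> (forall s, herm (g s)) ->
  (forall q l, continuous (fun s => part q (g s l))) ->
  herm (fun l => Complex (part false (c0 l) + ig (fun s => part false (g s l)) t) (part true (c0 l) + ig (fun s => part true (g s l)) t)).
Proof.
move=> h0 hg cg l; apply: C_eq; rewrite ?(cReJ,cImJ) /= h0 ?(cReJ,cImJ).
  by rewrite (@eq_ig _ _ (fun s => complex.Re (g s l)))// => s _; rewrite hg cReJ.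
have cn := cg true l; rewrite /part in cn.
rewrite (@eq_ig _ _ (fun s => -1 * complex.Im (g s l))); last by move=> s _; rewrite hg cImJ mulN1r.
by rewrite igZ// mulN1r opprD.
Qed.

End HermInt.

(** * Coefficients of an arbitrary solution *)

Section Solution.
Context {R : realType}.
Local Notation K := (int * int * int)%type.
Local Notation leb := (@lebesgue_measure R).
Local Notation leb3 := (@leb3 R).
Local Notation freq := (@freq R).
Local Notation st := (Ix -> K -> R).
Variables (Om T s0 : R) (W : K -> R).
Variables (vb dvb : R -> R * R -> R * R) (vt dvt : R -> R * R * R -> R * R).
Hypotheses (T0 : 0 < T) (s00 : 0 < s0) (sW : smallw W) (W00 : W 0 = 0).

Definition traj t : st := fstate (lift3 (vb t)) (vt t).
Local Notation c := traj.
Let fl (s : bool) t := if s then vt t else lift3 (vb t).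
Let df (s : bool) t := if s then dvt t else lift3 (dvb t).

(** What the definition of a solution and the a priori bound provide at almost every time. *)
Definition regular_time t : Prop := [/\ bdd (c t) (fun k => expR (- (s0 * freq k)) * W k),
  weak_div_free (P0 (lift3 (vb t))), weak_div_free (P0 (vt t)),
  barotropic_eq (dvb t) (vb t) (vt t) & baroclinic_eq Om (dvt t) (vb t) (vt t)].

Hypothesis Hb : forall t, t \in `[0, T] -> periodic2 (vb t) /\ continuous (vb t).
Hypothesis Ht : forall t, t \in `[0, T] -> [/\ periodic3 (vt t), continuous (vt t) & even_z (vt t)].
Hypothesis Hdb : forall y, has_dt2 T (vb ^~ y) (dvb ^~ y).
Hypothesis Hdt : forall x, has_dt2 T (vt ^~ x) (dvt ^~ x).
Hypothesis Hae : {ae leb, forall t, t \in `]0, T[ -> regular_time t}.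

Let in_cc t : t \in `]0, T[ -> t \in `[0, T].
Proof. by rewrite !in_itv /= => /andP[h1 h2]; rewrite !ltW. Qed.

Let E k := expR (- (s0 * freq k)) * W k.

Lemma bdd_0 (u : st) : bdd u E -> forall j, u j 0 = 0.
Proof. by move=> h j; apply/eqP; rewrite -normr_le0; have := h j 0; rewrite /E W00 mulr0. Qed.

Lemma fl_dt s i x : has_dt T (fun t => cmpt i (fl s t) x) (fun t => cmpt i (df s t) x).
Proof.
rewrite /fl /df; case: s; first by have [h1 h2] := Hdt x; case: i.
by have [h1 h2] := Hdb x.1; case: i.
Qed.

Lemma fl_cts s i t : t \in `[0, T] -> continuous (cmpt i (fl s t)).
Proof. by move=> tT; have [pb cb] := Hb tT; have [pt ct _] := Ht tT; have [h _] := field_cmpt pb cb pt ct s i. Qed.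

Lemma bdd_csumm (u : st) s i : bdd u E -> csumm (zc s i u).
Proof. by move=> bu; exact: rd_summ (@track_rd _ s0 W (fun=> u) s00 sW (fun=> bu) 0 s i). Qed.

(** At a regular time the fields are the sums of their Fourier series, so both the given derivative
    and the series of [GG] solve the same equation, in which the time derivative is an isolated
    summand. *)
Lemma regular_dt t : t \in `[0, T] -> regular_time t -> forall s i x, cmpt i (df s t) x = ser (zc s i (GG Om (c t))) x.
Proof.
move=> tT [bc wb wt eb et] s i x; have [pb cb] := Hb tT; have [pt ct ev] := Ht tT.
have c0 := bdd_0 bc; have rc s' i' : rd (zc s' i' (c t)) := @track_rd _ s0 W (fun=> c t) s00 sW (fun=> bc) 0 s' i'.
have sc s' i' := rd_summ (rc s' i').
have pg := state_pgood pb cb pt ct ev c0 rc wb wt.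
have Eb := state_vbP pb cb pt ct c0 sc; have Et := state_vtP pb cb pt ct c0 sc.
have hb y : dvb t y = vser (zb (GG Om (c t))) (y, 0).
  have := field_bar_eq Om pg y; rewrite -[fstate _ _]/(c t) -Eb -Et => h.
  by have := etrans (eb y) (esym h); move=> /addIr/addIr.
have ht x' : dvt t x' = vser (zt (GG Om (c t))) x'.
  have sN i' : csumm (Nt (zb (c t)) (zt (c t)) i') := @track_csummN _ s0 W (fun=> c t) s00 sW (fun=> bc) 0 i'.
  have := field_til_eq Om pg sN x'; rewrite -[fstate _ _]/(c t) -Eb -Et => h.
  by have := etrans (et x') (esym h); move=> /addIr/addIr/addIr/addIr/addIr/addIr.
rewrite /df; case: s; first by rewrite /cmpt; case: i; rewrite /= ht.
rewrite /cmpt /lift3; have s0' k : k.2 != 0 -> zc false i (GG Om (c t)) k = 0.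
  by move=> k0; rewrite (zc_GGb Om (c t) i k) /Nb k0 orbT.
case: x => y z; rewrite [RHS](ser_z0 y z s0').
by case: i {s0'}; rewrite /= hb.
Qed.

Let Bg := sm (fun k => 2 * gmaj Om s0 W k).
Let Bg0 : 0 <= Bg.
Proof.
apply: sm_ge0 => k; rewrite mulr_ge0//; have [W0 _] := sW.
have h := @gmaj_le _ Om s0 W (fun=> (fun _ _ => 0)) s00 sW.
apply: le_trans (normr_ge0 _) (h _ 0 (true, true, true) k) => t j l.
by rewrite normr0 mulr_ge0 ?expR_ge0.
Qed.

Lemma fl_lip s i x t t' : t \in `[0, T] -> t' \in `[0, T] -> `|cmpt i (fl s t) x - cmpt i (fl s t') x| <= Bg * `|t - t'|.
Proof.
apply: (has_dt_lip Bg0 (fl_dt s i x)); apply: (ae1 Hae) => t2 hr tT; have rt := hr tT.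
rewrite (regular_dt (in_cc tT) rt); have [bc _ _ _ _] := rt.
apply: ser_bound; last exact: summ2_gmaj.
by move=> k; exact: (@zcG_le _ Om s0 W (fun=> c t2) s00 sW (fun=> bc) 0 s i k).
Qed.

Lemma fourier_lip (f g : R * R * R -> R) (A : R) p k : continuous f -> continuous g -> 0 <= A -> (forall x, `|f x - g x| <= A) ->
  `|part p (fourier f k) - part p (fourier g k)| <= A.
Proof.
move=> cf cg A0 fg; have fi := cts3_int cf; have gi := cts3_int cg.
have h b : `|\int[leb3]_(x in cube) (f x * wv b k x) - \int[leb3]_(x in cube) (g x * wv b k x)| <= A.
  have fw := wv_integrable b k fi; have gw := wv_integrable b k gi.
  rewrite -RintegralB; [|exact: mcube|exact: fw|exact: gw].
  have di : leb3.-integrable cube (EFin \o (fun x => f x * wv b k x - g x * wv b k x)).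
    rewrite (_ : EFin \o _ = (EFin \o (fun x => (f x * wv b k x)%R)) \- (EFin \o (fun x => (g x * wv b k x)%R)))%E; last by apply/funext.
    by apply: integrableB; [exact: mcube|exact: fw|exact: gw].
  have ci : leb3.-integrable cube (EFin \o (fun=> A)) by apply: cts3_int => x; exact: cvg_cst.
  have di' : leb3.-integrable cube (EFin \o (fun x => `|f x * wv b k x - g x * wv b k x|)).
    rewrite (_ : EFin \o _ = abse \o (EFin \o (fun x => f x * wv b k x - g x * wv b k x))); last by apply/funext.
    by apply: integrable_abse; exact: di.
  have l1 : `|\int[leb3]_(x in cube) (f x * wv b k x - g x * wv b k x)| <= \int[leb3]_(x in cube) `|f x * wv b k x - g x * wv b k x|.
    by apply: le_normr_Rintegral; [exact: mcube|exact: di].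
  apply: (le_trans l1).
  apply: (@le_trans _ _ (\int[leb3]_(x in cube) A)).
    apply: le_Rintegral; [exact: mcube|exact: di'|exact: ci|move=> x _].
    rewrite -mulrBl normrM -[leRHS]mulr1; apply: ler_pM => //; exact: wv_le1.
  rewrite Rintegral_cst; last exact: mcube.
  have e1 : fine (leb3 cube) = 1 by have -> : leb3 cube = 1%E := @leb3_cube R.
  by rewrite [fine _]e1 mulr1.
have e (a b : R) : `|- a - - b| = `|a - b| by rewrite -opprD normrN.
by rewrite !fourier_wv /part; case: p => /=; [rewrite e; exact (h false)|exact (h true)].
Qed.

(** The fields are Lipschitz in time uniformly in x, and a Fourier coefficient on a cube of volume 1
    is bounded by the supremum. With this the decay extends to every time in [traj_bdd]. *)
Lemma traj_lip t t' j k : t \in `[0, T] -> t' \in `[0, T] -> `|c t j k - c t' j k| <= Bg * `|t - t'|.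
Proof.
move=> tT tT'; case: j => [[s i] p]; apply: (@fourier_lip (cmpt i (fl s t)) (cmpt i (fl s t'))); [exact: fl_cts|exact: fl_cts|exact: mulr_ge0|].
by move=> x; exact: fl_lip.
Qed.

Lemma traj_bdd t : t \in `[0, T] -> bdd (c t) E.
Proof.
move=> tT j k; apply: (@le_Lip_ext _ Bg (fun t => `|c t j k|) T regular_time) => //.
  by move=> t' _ [bc _ _ _ _]; exact: bc.
move=> t1 t2 h1 h2; apply: (le_trans (ler_dist_dist _ _)); exact: traj_lip.
Qed.

Definition ctraj t : st := c (cl T t).

Let clT t : cl T t \in `[0, T].
Proof. by rewrite in_itv; exact: cl_itv (ltW T0). Qed.

Lemma ctraj_bdd t : bdd (ctraj t) E.
Proof. by apply: traj_bdd; exact: clT. Qed.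

Lemma ctraj_cts j k : continuous (fun t => ctraj t j k).
Proof.
move=> t; apply/cvgrPdist_le => e e0.
have B1 : 0 < Bg + 1 by have := Bg0; lra.
have d0 : 0 < e / (Bg + 1) by rewrite divr_gt0.
have /cvgrPdist_le/(_ _ d0) := @cl_cts R T t.
apply: filterS => t' h; apply: (le_trans (traj_lip j k (clT t) (clT t'))).
apply: (@le_trans _ _ ((Bg + 1) * (e / (Bg + 1)))); last by rewrite mulrC divfK// gt_eqF.
by apply: ler_pM => //; lra.
Qed.

Lemma traj_fields t : t \in `[0, T] -> vb t = vbP (zb (c t)) /\ vt t = vtP (zt (c t)).
Proof.
move=> tT; have [pb cb] := Hb tT; have [pt ct ev] := Ht tT; have bc := traj_bdd tT.
have sc s i := bdd_csumm s i bc; have c0 := bdd_0 bc.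
by split; [exact: (state_vbP pb cb pt ct c0 sc)|exact: (state_vtP pb cb pt ct c0 sc)].
Qed.

Lemma GG_herm (u : st) : (forall s i, herm (zc s i u)) -> forall s i, herm (zc s i (GG Om u)).
Proof.
move=> hz; have [hb ht] := N_herm hz; case=> i k; last by rewrite !zc_GGb hb.
have hz' : zt u (~~ i) (- k) = conjc (zt u (~~ i) k) := hz true (~~ i) k.
rewrite !zc_GGt ht hz'; apply: C_eq; rewrite ?(cReD,cImD,cReM,cImM,cReJ,cImJ) /= ?(cReD,cImD,cReM,cImM,cReJ,cImJ) /=; ring.
Qed.

Lemma GG_0 (u : st) j : (forall j, u j 0 = 0) -> GG Om u j 0 = 0.
Proof.
move=> u0; rewrite /GG (quad_k0 (@quad_N0 R) 0) add0r /JJ; case: j => [[[] i] p] //=.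
by case: i; rewrite u0 mulr0.
Qed.

Lemma ctraj_GG_cts j k : continuous (fun t => GG Om (ctraj t) j k).
Proof. exact: (GG_cts s00 sW ctraj_bdd ctraj_cts). Qed.

Lemma traj_herm t s i : t \in `[0, T] -> herm (zc s i (c t)).
Proof.
move=> tT; have [pb cb] := Hb tT; have [pt ct ev] := Ht tT.
by apply: (state_herm pb cb pt ct); exact: (bdd_0 (traj_bdd tT)).
Qed.

Lemma traj_ser t s i : t \in `[0, T] -> ser (zc s i (c t)) = cmpt i (fl s t).
Proof.
move=> tT; have [pb cb] := Hb tT; have [pt ct ev] := Ht tT.
by apply: (state_ser pb cb pt ct (bdd_0 (traj_bdd tT))); exact: bdd_csumm (traj_bdd tT).
Qed.

(** The given derivative is integrable in time for each x separately, with no joint measurability in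
    (t, x), so the Fourier integral is not exchanged with it. The equation is integrated in time at
    fixed x, both sides are recognised as Hermitian series, and coefficients are compared
    afterwards. *)
Lemma traj_int t : 0 <= t <= T -> forall j k, c t j k = c 0 j k + ig (fun s => GG Om (ctraj s) j k) t.
Proof.
move=> tT [[s i] p] k; have [t0 _] := andP tT.
have T00 : (0 : R) \in `[0, T] by rewrite in_itv /= lexx ltW.
have tT' : t \in `[0, T] by rewrite in_itv.
have [->|k0] := eqVneq k 0.
  rewrite !(bdd_0 (traj_bdd _))// add0r; under eq_fun do rewrite (GG_0 _ (bdd_0 (ctraj_bdd _))).
  by rewrite /ig Rintegral_cst ?mul0r//; exact: measurable_itv.
pose g s' := zc s i (GG Om (ctraj s')).
have cg q l : continuous (fun s' => part q (g s' l)) by apply: part_zc_cts; exact: ctraj_GG_cts.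
have gU s' l : nc (g s' l) <= 2 * gmaj Om s0 W l := zcG_le Om s00 sW ctraj_bdd s' s i l.
have sU := summ2_gmaj Om s00 sW.
(* The candidate: coefficientwise time integrals, shown below to be summable and Hermitian so that
   its series determines it. *)
pose c' l := Complex (part false (zc s i (c 0) l) + ig (fun s' => part false (g s' l)) t)
  (part true (zc s i (c 0) l) + ig (fun s' => part true (g s' l)) t).
have sc0 : csumm (zc s i (c 0)) := bdd_csumm s i (traj_bdd T00).
have sc' : csumm c'.
  pose o := ig (fun=> 1) t.
  have ib q l : `|ig (fun s' => part q (g s' l)) t| <= o * (2 * gmaj Om s0 W l).
    have cc (a : R) : continuous (fun _ : R => a) by move=> ?; exact: cvg_cst.
    rewrite mulrC -(igZ _ _ (cc 1)); apply: (le_ig (cg q l)) => [|s' _]; first exact: cc.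
    rewrite mulr1; apply: le_trans (gU s' l); rewrite /nc /part.
    by case: (q); rewrite ?lerDl ?lerDr.
  apply: (csumm_le (M := fun l => nc (zc s i (c 0) l) + (o * (2 * gmaj Om s0 W l) + o * (2 * gmaj Om s0 W l)))).
    move=> l; rewrite /nc /c' /=; have h1 := ib false l; have h2 := ib true l.
    apply: (le_trans (lerD (ler_normD _ _) (ler_normD _ _))); rewrite [leLHS]addrACA.
    by apply: lerD => //; apply: lerD.
  have so := summZ o sU; exact (summD sc0 (summD so so)).
have hg s' : herm (g s') by apply: GG_herm => s2 i2; apply: traj_herm.
have hc' : herm c' := herm_int t (traj_herm s i T00) hg cg.
have E1 : ser (zc s i (c t)) = ser c'.
  apply/funext => x; rewrite (traj_ser s i tT').
  have ch : continuous (fun s' => ser (g s') x) := ser_time_cts sU gU cg.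
  rewrite (has_dt_ig (ltW T0) (fl_dt s i x) ch _ tT).
    rewrite -(traj_ser s i T00); symmetry.
    by apply: (@ser_time _ _ _ g (fun l => 2 * gmaj Om s0 W l)) => // q l; rewrite /c' /part; case: q.
  apply: (ae1 Hae) => t2 hr ht2; have rt := hr ht2.
  rewrite (regular_dt (in_cc ht2) rt) /g /ctraj cl_id//.
  by move: ht2; rewrite in_itv /= => /andP[h1 h2]; rewrite !ltW.
have E2 : zc s i (c t) = c'.
  by rewrite -(fourier_ser (bdd_csumm s i (traj_bdd tT')) (traj_herm s i tT')) E1 fourier_ser.
have := congr1 (fun f => part p (f k)) E2; rewrite /c' /g /zc (negbTE k0).
by rewrite /part; case: (p) => /=.
Qed.

Lemma ctraj_clK t : ctraj (cl T t) = ctraj t.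
Proof. by rewrite /ctraj clK// ltW. Qed.

Lemma ctraj_int t j k : ctraj t j k = c 0 j k + ig (fun s => GG Om (ctraj s) j k) (cl T t).
Proof. by rewrite /ctraj traj_int//; exact: cl_itv (ltW T0). Qed.

(** The trajectory seen in the rotating frame, where it satisfies the same integral equation as
    [flow]. *)
Definition rtraj t : st := rota (Om * cl T t) (ctraj t).

Lemma rtraj_eq t j k : rtraj t j k = c 0 j k + ig (fun s => NR Om s (rtraj s) j k) (cl T t).
Proof.
have h := rota_int Om (ltW T0) ctraj_GG_cts ctraj_int (cl_itv t (ltW T0)) j k.
rewrite /rtraj -[ctraj t]ctraj_clK h; congr (_ + _); apply: eq_ig => s /andP[s1 s2].
have /andP[_ t2] := cl_itv t (ltW T0).
have e : cl T s = s by rewrite cl_id// s1 (le_trans s2).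
rewrite /NR e.
have -> : rota (- (Om * s)) (rota (Om * s) (ctraj s)) = ctraj s.
  by have := rotaK (- (Om * s)) (ctraj s); rewrite opprK.
rewrite /GG -/(JJ (- Om) (ctraj s)); set v := ctraj s.
case: (j) => [[[] i] p]; rewrite /rota /JJ /=; last by rewrite !addr0.
by move: (sin _) (cos _) (N0 v (true, false, p) k) (N0 v (true, true, p) k) (v (true, false, p) k) (v (true, true, p) k) => a b d e1 f h1; case: i => /=; ring.
Qed.

Lemma rtraj_bdd t : bdd (rtraj t) (fun k => expR (- (s0 * freq k)) * (2 * W k)).
Proof. by move=> j k; rewrite mulrCA; apply: rota_le => i; exact: ctraj_bdd. Qed.

Lemma rtraj_cts j k : continuous (fun t => rtraj t j k).
Proof.
apply: (@rota_cts _ (fun t => Om * cl T t) ctraj); last exact: ctraj_cts.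
by move=> t; apply: cvgMr; exact: cl_cts.
Qed.

Lemma ctraj_rtraj t : ctraj t = rota (- Om * cl T t) (rtraj t).
Proof. by rewrite /rtraj; have := rotaK (- Om * cl T t) (ctraj t); rewrite mulNr opprK => ->. Qed.

End Solution.

(** * Uniqueness of solutions in the analytic class *)

Section Uniqueness.
Context {R : realType}.
Local Notation K := (int * int * int)%type.
Local Notation leb := (@lebesgue_measure R).
Local Notation leb2 := (@leb2 R).
Local Notation leb3 := (@leb3 R).
Local Notation freq := (@freq R).
Local Notation cQ := (8 * (24 * (2 * @kB R * (2 * @kB R)))).

Variables (r Om tau0 T lam sig : R) (v0 : R * R * R -> R * R).
Hypotheses (hr : 5 / 2 < r) (adm : admissible r tau0 v0) (T0 : 0 < T) (lam0 : 0 < lam).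
Let M := data_size r tau0 v0.
Hypotheses (small : 8 * cQ * kap r * Num.sqrt M <= lam) (lamT : lam * T < tau0) (ls : lam < sig) (sigT : sig * T < tau0).

Section AnySolution.
Variables (vb : R -> R * R -> R * R) (vt : R -> R * R * R -> R * R).
Hypothesis sol : solution r Om T (fun t => tau0 - sig * t) (P0 v0) (fluct v0) vb vt.

(** The data are attained only almost everywhere, which does not affect Fourier coefficients. *)
Lemma traj_init : traj vb vt 0 = dstate v0.
Proof.
have T00 : (0 : R) \in `[0, T] by rewrite in_itv /= lexx ltW.
have [pb cb] := sol_bar sol T00; have [pt ct ev] := sol_fluct sol T00.
have [ib it] := data_intg adm; have [hb ht] := sol_init sol.
have E s i : fourier (cmpt i (if s then vt 0 else lift3 (vb 0))) = fourier (cmpt i (if s then fluct v0 else lift3 (P0 v0))).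
  apply: ae_fourier; first by apply: cts3_int; have [h _] := field_cmpt pb cb pt ct s i.
    by case: s; [exact: it|exact: ib].
  case: s.
    by apply: (ae1 ht) => x h Cx; rewrite /cmpt; case: (i); rewrite /= h.
  apply: (ae1 (ae_lift hb)) => x h [Sx _]; rewrite /cmpt /lift3; by case: (i); rewrite /= h.
apply/funext => -[[s i] p]; apply/funext => k; rewrite /traj /dstate /fstate /=.
by rewrite E.
Qed.

Lemma sol_rtraj : exists (W : K -> R) (w s0 : R), [/\ 0 <= w, maj r W w & 0 < s0] /\
  [/\ forall t, bdd (rtraj Om T vb vt t) (fun k => expR (- (s0 * freq k)) * (2 * W k)),
    forall j k, continuous (fun t => rtraj Om T vb vt t j k),
    forall t j k, rtraj Om T vb vt t j k = dstate v0 j k + ig (fun s => NR Om s (rtraj Om T vb vt s) j k) (cl T t) &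
    forall t, t \in `[0, T] -> vb t = vbP (zb (traj vb vt t)) /\ vt t = vtP (zt (traj vb vt t))].
Proof.
have [[aeb _ ib] [aet _ it]] := sol_Linfty sol.
have [Bb Bb0 hBb] := Loo_ae ib; have [Bt Bt0 hBt] := Loo_ae it.
(* The stated radius is bounded below on [0, T] by this positive number; it feeds the a priori decay
   rate. *)
have s10 : 0 < tau0 - sig * T by rewrite subr_gt0.
have [W [w [w0 mW W00 hW]]] := apriori hr s10 (addr_ge0 Bb0 Bt0).
have s00 : 0 < (tau0 - sig * T) / 2 by rewrite divr_gt0.
have sW := maj_small hr w0 mW.
have [dvb [dvt [Hdb Hdt Heq]]] := sol_eq sol.
have Hae : {ae leb, forall t, t \in `]0, T[ -> regular_time Om ((tau0 - sig * T) / 2) W vb dvb vt dvt t}.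
  have q1 : {ae leb, forall t, t \in `]0, T[ -> (`|anorm (tau0 - sig * t) r (lift3 (vb t))| <= Bb%:E)%E /\ (`|anorm (tau0 - sig * t) r (vt t)| <= Bt%:E)%E}.
    by apply: (ae2 hBb hBt) => t h1 h2 tT; split; [exact: h1|exact: h2].
  have q2 : {ae leb, forall t, t \in `]0, T[ -> spaceS (lift3 (vb t)) /\ spaceS (vt t)}.
    by apply: (ae2 aeb aet) => t h1 h2 tT; have [h1' _] := h1 tT; have [h2' _] := h2 tT.
  have q3 : {ae leb, forall t, t \in `]0, T[ -> [/\ (`|anorm (tau0 - sig * t) r (lift3 (vb t))| <= Bb%:E)%E, (`|anorm (tau0 - sig * t) r (vt t)| <= Bt%:E)%E,
    spaceS (lift3 (vb t)) & spaceS (vt t)]}.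
    by apply: (ae2 q1 q2) => t h1 h2 tT; have [nb nt] := h1 tT; have [Sb St] := h2 tT.
  apply: (ae2 q3 Heq) => t h1 h2 tT; have [nb nt Sb St] := h1 tT; have [e1 e2] := h2 tT.
  have z j : traj vb vt t j 0 = 0 by case: j => [[s i] p]; apply: fstate_0; case: s; exact: spaceS_0.
  split; [|exact: (proj2 Sb)|exact: (proj2 St)|exact: e1|exact: e2].
  apply: (hW (tau0 - sig * t)) => //.
  - have [_ t2] : 0 < t /\ t < T by move: tT; rewrite in_itv => /andP[].
    rewrite lerD2l lerN2; apply: ler_wpM2l; last exact: ltW.
    by apply: le_trans (ltW lam0) (ltW ls).
  - move: nb; rewrite gee0_abs ?anorm_ge0// => h; apply: (le_trans h); by rewrite lee_fin lerDl.
  - move: nt; rewrite gee0_abs ?anorm_ge0// => h; apply: (le_trans h); by rewrite lee_fin lerDr.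
exists W, w, ((tau0 - sig * T) / 2); split=> //; split.
- exact: (rtraj_bdd T0 s00 sW W00 (sol_bar sol) (sol_fluct sol) Hdb Hdt Hae).
- exact: (rtraj_cts T0 s00 sW W00 (sol_bar sol) (sol_fluct sol) Hdb Hdt Hae).
- by move=> t j k; rewrite -traj_init; exact: (rtraj_eq T0 s00 sW W00 (sol_bar sol) (sol_fluct sol) Hdb Hdt Hae).
- exact: (traj_fields T0 s00 sW W00 (sol_bar sol) (sol_fluct sol) Hdb Hdt Hae).
Qed.

(** In the rotating frame any solution and the constructed one solve the same integral equation with
    the same datum. A common decay rate (the minimum) and a common majorant (the sum) bring them
    under [quad_unique]; undoing the rotation and summing the series recovers the fields. *)
Theorem solution_flow t : t \in `[0, T] -> vb t = flow_b Om T v0 t /\ vt t = flow_t Om T v0 t.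
Proof.
move=> tT; have [W [w [s0 [[w0 mW s00] [bu cu eu ft]]]]] := sol_rtraj.
have sl0 : 0 < tau0 - lam * T by rewrite subr_gt0.
pose s2 := Num.min s0 (tau0 - lam * T); have s20 : 0 < s2 by rewrite lt_min s00.
have mS := flow_S hr adm lam0 small; have sM : 0 <= 2 * Num.sqrt M by rewrite mulr_ge0 ?sqrtr_ge0.
have mW2 : maj r (fun k => W k + W k) (w + w) := majD w0 w0 mW mW.
have w20 : 0 <= w + w by rewrite addr_ge0.
have mX := majD w20 sM mW2 mS.
have c0 : 0 <= cQ by rewrite mulr_ge0// mulr_ge0// q1_ge0.
set X := (fun k => _) in mX.
have le (s' : R) (Y : K -> R) k : s2 <= s' -> 0 <= Y k -> Y k <= X k -> expR (- (s' * freq k)) * Y k <= expR (- (s2 * freq k)) * X k.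
  move=> ss Y0 YX; apply: ler_pM => //; by rewrite ler_expR lerN2; apply: ler_wpM2r => //; exact: freq_ge0.
have [W0 _ _] := mW; have [S0 _ _] := mS.
have E : forall t, rtraj Om T vb vt t = flow Om T v0 t.
  have XX0 : 0 <= w + w + 2 * Num.sqrt M by rewrite addr_ge0.
  apply: (quad_unique hr c0 (quad_NR Om) (ltW T0) s20 XX0 mX cu _ _ _ eu).
  - exact: (flow_cts hr adm T0 lam0 small lamT).
  - move=> t' i k; apply: (le_trans (bu t' i k)); apply: (le s0 (fun k => 2 * W k)); first by rewrite ge_min lexx.
      by rewrite mulr_ge0.
    by rewrite /X mulr_natl mulr2n lerDl.
  - move=> t' i k; apply: (le_trans (flow_bdd0 Om hr adm T0 lam0 small lamT t' i k)); apply: le; [by rewrite ge_min lexx orbT|exact: S0|].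
    by rewrite /X lerDr addr_ge0.
  - exact: (flow_eq Om hr adm T0 lam0 small lamT).
have [-> ->] := ft t tT.
have -> : traj vb vt t = vst Om T v0 t.
  have tc : cl T t = t by rewrite cl_id//; move: tT; rewrite in_itv.
  by have := ctraj_rtraj Om T vb vt t; rewrite E /ctraj {1}tc.
by [].
Qed.

End AnySolution.

End Uniqueness.

(** * Continuous dependence *)

Section Dependence.
Context {R : realType}.
Local Notation K := (int * int * int)%type.
Local Notation leb3 := (@leb3 R).
Local Notation freq := (@freq R).
Local Notation st := (Ix -> K -> R).
Local Notation cQ := (8 * (24 * (2 * @kB R * (2 * @kB R)))).

Lemma fstateB (pb1 pt1 pb2 pt2 : R * R * R -> R * R) j k : intg pb1 -> intg pt1 -> intg pb2 -> intg pt2 ->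
  fstate (pb1 \- pb2) (pt1 \- pt2) j k = fstate pb1 pt1 j k - fstate pb2 pt2 j k.
Proof.
move=> b1 t1 b2 t2; case: j => [[s i] p]; rewrite /fstate /=.
have -> : cmpt i (if s then pt1 \- pt2 else pb1 \- pb2) = cmpt i (if s then pt1 else pb1) \- cmpt i (if s then pt2 else pb2).
  by case: s; case: i.
have i1 : leb3.-integrable cube (EFin \o cmpt i (if s then pt1 else pb1)) by case: (s); [exact: t1|exact: b1].
have i2 : leb3.-integrable cube (EFin \o cmpt i (if s then pt2 else pb2)) by case: (s); [exact: t2|exact: b2].
rewrite (fourierB k i1 i2) /part; case: p; rewrite ?(cReD,cImD,cReN,cImN) //.
Qed.

Lemma anorm_pair tau q (pb1 pt1 pb2 pt2 : R * R * R -> R * R) : intg pb1 -> intg pt1 -> intg pb2 -> intg pt2 ->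
  (anorm tau q (pb1 \- pb2)%R ^+ 2 + anorm tau q (pt1 \- pt2)%R ^+ 2 =
   \esum_(k in [set: K]) (wgt tau q k * \sum_j (fstate pb1 pt1 j k - fstate pb2 pt2 j k) ^+ 2)%:E)%E.
Proof.
move=> b1 t1 b2 t2; rewrite !anorm_sqr -esumD; last 2 first.
- by move=> k _; rewrite lee_fin mulr_ge0 ?fsq_ge0// (le_trans ler01)// wgt_ge1.
- by move=> k _; rewrite lee_fin mulr_ge0 ?fsq_ge0// (le_trans ler01)// wgt_ge1.
apply: eq_esum => k _; rewrite -EFinD -mulrDr fstate_sum; congr (_ * _)%:E.
by apply: eq_bigr => j _; rewrite fstateB.
Qed.

Lemma anorm_pair_le (tau tau' q : R) (f1 f2 g1 g2 : R * R -> R * R) (h1 h2 l1 l2 : R * R * R -> R * R) (u1 u2 d1 d2 : st) :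
  intg (lift3 f1) /\ intg h1 -> intg (lift3 f2) /\ intg h2 -> intg (lift3 g1) /\ intg l1 -> intg (lift3 g2) /\ intg l2 ->
  fstate (lift3 f1) h1 = u1 -> fstate (lift3 f2) h2 = u2 -> fstate (lift3 g1) l1 = d1 -> fstate (lift3 g2) l2 = d2 ->
  (\esum_(k in [set: K]) (wgt tau q k * \sum_j (u1 j k - u2 j k) ^+ 2)%:E
   <= \esum_(k in [set: K]) (wgt tau' q k * \sum_j (d1 j k - d2 j k) ^+ 2)%:E)%E ->
  (anorm tau q (lift3 (f1 \- f2)%R) ^+ 2 + anorm tau q (h1 \- h2)%R ^+ 2
   <= anorm tau' q (lift3 (g1 \- g2)%R) ^+ 2 + anorm tau' q (l1 \- l2)%R ^+ 2)%E.
Proof.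
move=> [a1 a2] [b1 b2] [e1 e2] [i1 i2] <- <- <- <-.
by rewrite -(anorm_pair tau q a1 a2 b1 b2) -(anorm_pair tau' q e1 e2 i1 i2).
Qed.

Lemma sum_rota th (u v : st) k : \sum_j (rota th u j k - rota th v j k) ^+ 2 = \sum_j (u j k - v j k) ^+ 2.
Proof.
rewrite !sum_Ix !big_bool /= /rota /=; have h := cos2Dsin2 th.
move: (cos th) (sin th) h => a b h.
move: (u (true, true, true) k) (v (true, true, true) k) (u (true, true, false) k) (v (true, true, false) k)
  (u (true, false, true) k) (v (true, false, true) k) (u (true, false, false) k) (v (true, false, false) k).
move=> x1 y1 x2 y2 x3 y3 x4 y4.
have e x y z t : (b * x + a * y - (b * z + a * t)) ^+ 2 + (a * x - b * y - (a * z - b * t)) ^+ 2 = (x - z) ^+ 2 + (y - t) ^+ 2.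
  by transitivity ((a ^+ 2 + b ^+ 2) * ((x - z) ^+ 2 + (y - t) ^+ 2)); [ring|rewrite h mul1r].
have e1 := e x3 x1 y3 y1; have e2 := e x4 x2 y4 y2.
move: e1 e2.
move: ((b * x3 + a * x1 - (b * y3 + a * y1)) ^+ 2) ((a * x3 - b * x1 - (a * y3 - b * y1)) ^+ 2) ((b * x4 + a * x2 - (b * y4 + a * y2)) ^+ 2) ((a * x4 - b * x2 - (a * y4 - b * y2)) ^+ 2).
move=> A B D E e1 e2; lra.
Qed.

Section OneFlow.
Variables (r Om tau0 T lam sig : R) (v0 : R * R * R -> R * R).
Hypotheses (hr : 5 / 2 < r) (adm : admissible r tau0 v0) (T0 : 0 < T) (lam0 : 0 < lam).
Let M := data_size r tau0 v0.
Hypotheses (small : 8 * cQ * kap r * Num.sqrt M <= lam) (lamT : lam * T < tau0).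

Lemma flow_intg t : intg (lift3 (flow_b Om T v0 t)) /\ intg (flow_t Om T v0 t).
Proof.
rewrite (lift_flow_b Om hr adm T0 lam0 small lamT).
by split; apply: L2_intg; [exact: (fld_L2 Om hr adm T0 lam0 small lamT false)|exact: (fld_L2 Om hr adm T0 lam0 small lamT true)].
Qed.

Lemma fstate_flow t : fstate (lift3 (flow_b Om T v0 t)) (flow_t Om T v0 t) = vst Om T v0 t.
Proof.
rewrite (lift_flow_b Om hr adm T0 lam0 small lamT); apply/funext => -[[s i] p]; apply/funext => k.
have g := vst_good Om hr adm T0 lam0 small lamT t.
rewrite /fstate /=; have -> : (if s then flow_t Om T v0 t else fld Om T v0 false t) = vser (fun i => zc s i (vst Om T v0 t)) by case: (s).
rewrite fourier_vser; last 2 first.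
- by move=> i'; exact: rd_summ (vst_rd Om hr adm T0 lam0 small lamT t s i').
- by move=> i'; exact: good_zc_herm.
by rewrite /zc; case: eqP => [->|_]; rewrite /part; case: p; rewrite //= (gd_0 g).
Qed.

End OneFlow.

Lemma le_maxL (a b : R) : a <= Num.max a b. Proof. by rewrite le_max lexx. Qed.
Lemma le_maxR (a b : R) : b <= Num.max a b. Proof. by rewrite le_max lexx orbT. Qed.
Lemma ge_minL (a b : R) : Num.min a b <= a. Proof. by rewrite ge_min lexx. Qed.
Lemma ge_minR (a b : R) : Num.min a b <= b. Proof. by rewrite ge_min lexx orbT. Qed.
Lemma min_gt0 (a b : R) : 0 < a -> 0 < b -> 0 < Num.min a b. Proof. by move=> a0 b0; rewrite lt_min a0. Qed.

(** * Choice of the constant and comparison of rates and lifespans *)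

Section Constants.
Variable r : R.

(** The product of the quadratic constant and the convolution constant; the summand 1 keeps it
    positive in any case. *)
Definition kq : R := cQ * kap r + 1.
(** It gives the rate sigr m = 64 kq (1 + m), above the existence rate lamr m = 8 kq (1 + m) and
    above the 32 cQ kap (1 + m) that suffices for the energy estimate of two solutions with eight
    real unknowns. *)
Definition Cr : R := 32 * kq.
Definition lamr (m : R) : R := 8 * kq * (1 + m).
Definition sigr (m : R) : R := 2 * Cr * (1 + m).

Lemma cQ_ge0 : 0 <= cQ.
Proof. by rewrite mulr_ge0// mulr_ge0// q1_ge0. Qed.

Lemma kq_ge1 : 1 <= kq.
Proof. by rewrite lerDr mulr_ge0 ?cQ_ge0 ?kap_ge0. Qed.

Lemma Cr_gt0 : 0 < Cr.
Proof. by rewrite mulr_gt0// (lt_le_trans ltr01 kq_ge1). Qed.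

Lemma lamr_gt0 m : 0 <= m -> 0 < lamr m.
Proof. by move=> m0; rewrite !mulr_gt0 ?(lt_le_trans ltr01 kq_ge1)// ltr_wpDr. Qed.

Lemma lamr_sigr m : 0 <= m -> lamr m < sigr m.
Proof.
move=> m0; rewrite /lamr /sigr /Cr; have h := kq_ge1; have p : 0 < kq * (1 + m) by rewrite mulr_gt0 ?(lt_le_trans ltr01 h)// ltr_wpDr.
by rewrite -!mulrA; move: p; move: (kq * (1 + m)) => x x0; lra.
Qed.

(** The Picard scheme asks for a rate proportional to the norm of the data, the square root of M;
    this bound converts it to the 1 + M of the theorem. *)
Lemma sqrt_le1D (m : R) : 0 <= m -> 2 * Num.sqrt m <= 1 + m.
Proof.
move=> m0; have := sqr_ge0 (Num.sqrt m - 1); rewrite sqrrB sqr_sqrtr// expr1n mulr1.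
by rewrite -mulr_natl; lra.
Qed.

Lemma lamr_small m : 0 <= m -> 8 * cQ * kap r * Num.sqrt m <= lamr m.
Proof.
move=> m0; have h := sqrt_le1D m0; have h1 := sqrtr_ge0 m; have q0 := mulr_ge0 cQ_ge0 (kap_ge0 r).
rewrite /lamr /kq; move: (Num.sqrt m) h h1 => x h h1.
rewrite -[8 * cQ * kap r]mulrA; move: (cQ * kap r) q0 => a a0.
rewrite -[leLHS]mulrA -[leRHS]mulrA; apply: ler_wpM2l => //.
by apply: ler_pM => //; [rewrite lerDl|lra].
Qed.

Lemma sigr_large m1 m2 m : 0 <= m1 -> 0 <= m2 -> m1 <= m -> m2 <= m ->
  2 * #|Ix|%:R * cQ * kap r * (2 * Num.sqrt m1 + 2 * Num.sqrt m2) <= sigr m.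
Proof.
move=> m10 m20 h1 h2; have -> : #|Ix| = 8%N by rewrite !card_prod card_bool.
have q1 := sqrt_le1D m10; have q2 := sqrt_le1D m20; have p1 := sqrtr_ge0 m1; have p2 := sqrtr_ge0 m2.
have q0 := mulr_ge0 cQ_ge0 (kap_ge0 r).
rewrite /sigr /Cr /kq -[2 * 8%:R * cQ * kap r]mulrA; move: (cQ * kap r) q0 => a a0.
move: (Num.sqrt m1) (Num.sqrt m2) q1 q2 p1 p2 => x y q1 q2 p1 p2.
have -> : 2 * 8%:R * a * (2 * x + 2 * y) = a * (16 * (2 * x + 2 * y)) by ring.
have -> : 2 * (32 * (a + 1)) * (1 + m) = (a + 1) * (64 * (1 + m)) by ring.
by apply: ler_pM => //; [lra|rewrite lerDl|lra].
Qed.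

Lemma sigr_gt0 m : 0 <= m -> 0 < sigr m.
Proof. by move=> m0; apply: lt_trans (lamr_sigr m0); exact: lamr_gt0. Qed.

Lemma lifespan_gt0 (tau m : R) : 0 < tau -> 0 <= m -> 0 < lifespan Cr tau m.
Proof. by move=> t0 m0; rewrite divr_gt0// addr_gt0//; exact: sigr_gt0. Qed.

(** Strict because the denominator of the lifespan is 1 + sigr m: the radius tau / (1 + sigr m) is
    left at the final time. *)
Lemma sigr_lifespan (tau m : R) : 0 < tau -> 0 <= m -> sigr m * lifespan Cr tau m < tau.
Proof.
move=> t0 m0; rewrite /lifespan -/(sigr m); have s0 := sigr_gt0 m0.
by rewrite mulrA ltr_pdivrMr ?addr_gt0// mulrC ltr_pM2l// ltrDr.
Qed.

Lemma lamr_lifespan (tau m : R) : 0 < tau -> 0 <= m -> lamr m * lifespan Cr tau m < tau.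
Proof.
move=> t0 m0; apply: le_lt_trans (sigr_lifespan t0 m0); apply: ler_wpM2r; first exact: ltW (lifespan_gt0 t0 m0).
exact: ltW (lamr_sigr m0).
Qed.

Lemma analytic_radiusE (tau m : R) : analytic_radius Cr tau m = (fun t => tau - sigr m * t).
Proof. by apply/funext => t; rewrite /analytic_radius /sigr; congr (_ - _); ring. Qed.

Lemma sigr_mono m1 m2 : m1 <= m2 -> sigr m1 <= sigr m2.
Proof. by move=> h; rewrite ler_wpM2l ?lerD2l// mulr_ge0// ltW// Cr_gt0. Qed.

Lemma lifespan_mono (tau1 tau2 m1 m2 : R) : 0 < tau1 -> tau1 <= tau2 -> 0 <= m2 -> m2 <= m1 ->
  lifespan Cr tau1 m1 <= lifespan Cr tau2 m2.
Proof.
move=> t1 t12 m0 m12; rewrite /lifespan -/(sigr m1) -/(sigr m2).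
have s2 := sigr_gt0 m0; have s12 := sigr_mono m12.
have s1 : 0 < sigr m1 := lt_le_trans s2 s12.
apply: ler_pM => //; [exact: ltW|by rewrite invr_ge0 addr_ge0// ltW|].
by rewrite lef_pV2 ?posrE ?addr_gt0// lerD2l.
Qed.

End Constants.

(** Two flows built with different radii, rates and lifespans are put under the common weight of the
    energy estimate: a smaller initial radius and a faster decrease only weaken the decay, taui -
    lami t >= tau0 - mu t. *)
Lemma flow_short (r Om taui Ti lami T mu tau0 : R) (v0 : R * R * R -> R * R) : 5 / 2 < r -> admissible r taui v0 -> 0 < Ti -> 0 < lami ->
  8 * cQ * kap r * Num.sqrt (data_size r taui v0) <= lami -> lami * Ti < taui -> 0 < T -> T <= Ti -> tau0 <= taui -> lami <= mu ->
  let u t := flow Om Ti v0 (cl T t) in exists U,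
  [/\ maj r U (2 * Num.sqrt (data_size r taui v0)), forall j k, continuous (fun t => u t j k), forall t, bdd (u t) (ub tau0 mu T t U) &
   forall t j k, u t j k = dstate v0 j k + ig (fun s => NR Om s (u s) j k) (cl T t)].
Proof.
move=> hr adm Ti0 l0 sm lT T0 TT tt lm u.
have cc t : cl Ti (cl T t) = cl T t.
  by rewrite cl_id//; have /andP[-> h] := cl_itv t (ltW T0); exact: le_trans TT.
have mS := flow_S hr adm l0 sm; exists (S_lim cQ lami (dmaj taui v0)); split=> //.
- move=> j k t; apply: (@continuous_comp _ _ _ (cl T) (fun t => flow Om Ti v0 t j k)); first exact: cl_cts.
  exact: (flow_cts hr adm Ti0 l0 sm lT).
- move=> t j k; apply: (le_trans (flow_bdd Om hr adm Ti0 l0 sm lT (cl T t) j k)).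
  rewrite /ub cc; have [S0 _ _] := mS; apply: ler_wpM2r => //; rewrite ler_expR lerN2.
  apply: ler_wpM2r; first exact: freq_ge0.
  by apply: lerB => //; have /andP[h _] := cl_itv t (ltW T0); apply: ler_wpM2r.
move=> t j k.
have E s : 0 <= s <= cl T t -> NR Om s (flow Om Ti v0 s) j k = NR Om s (u s) j k.
  move=> /andP[s1 s2]; have e : cl T s = s by rewrite cl_id// s1 (le_trans s2)//; case/andP: (cl_itv t (ltW T0)).
  by rewrite /u e.
have h := flow_eq Om hr adm Ti0 l0 sm lT (cl T t) j k; rewrite cc in h.
exact (etrans h (congr1 (fun x => dstate v0 j k + x) (eq_ig E))).
Qed.

Lemma flow_energy (r Om tau1 tau2 T1 T2 lam1 lam2 tau0 T mu : R) (v01 v02 : R * R * R -> R * R) :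
  5 / 2 < r -> admissible r tau1 v01 -> admissible r tau2 v02 -> 0 < T1 -> 0 < T2 -> 0 < lam1 -> 0 < lam2 ->
  8 * cQ * kap r * Num.sqrt (data_size r tau1 v01) <= lam1 -> 8 * cQ * kap r * Num.sqrt (data_size r tau2 v02) <= lam2 ->
  lam1 * T1 < tau1 -> lam2 * T2 < tau2 -> 0 < T -> T <= T1 -> T <= T2 -> tau0 <= tau1 -> tau0 <= tau2 -> lam1 <= mu -> lam2 <= mu ->
  mu * T <= tau0 ->
  2 * #|Ix|%:R * cQ * kap r * (2 * Num.sqrt (data_size r tau1 v01) + 2 * Num.sqrt (data_size r tau2 v02)) <= mu ->
  forall t, 0 <= t <= T ->
  (\esum_(k in [set: K]) (wgt (tau0 - mu * t) (r - 2^-1) k * \sum_j (vst Om T1 v01 t j k - vst Om T2 v02 t j k) ^+ 2)%:E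
   <= \esum_(k in [set: K]) (wgt tau0 (r - 2^-1) k * \sum_j (dstate v01 j k - dstate v02 j k) ^+ 2)%:E)%E.
Proof.
move=> hr adm1 adm2 T10 T20 l1 l2 s1 s2 lT1 lT2 T0 TT1 TT2 tt1 tt2 lm1 lm2 muT big t tT.
have mu0 : 0 < mu := lt_le_trans l1 lm1.
have [U1 [mU1 c1 b1 e1]] := flow_short Om hr adm1 T10 l1 s1 lT1 T0 TT1 tt1 lm1.
have [U2 [mU2 c2 b2 e2]] := flow_short Om hr adm2 T20 l2 s2 lT2 T0 TT2 tt2 lm2.
have a1 : 0 <= 2 * Num.sqrt (data_size r tau1 v01) by rewrite mulr_ge0 ?sqrtr_ge0.
have a2 : 0 <= 2 * Num.sqrt (data_size r tau2 v02) by rewrite mulr_ge0 ?sqrtr_ge0.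
have d0 j : dstate v01 j 0 = dstate v02 j 0 by rewrite (gd_0 (dstate_good adm1)) (gd_0 (dstate_good adm2)).
have En := energy hr cQ_ge0 (quad_NR Om) (ltW T0) mu0 muT a1 a2 mU1 mU2 c1 c2 b1 b2 e1 e2 d0 big tT.
have [h0 hT] := andP tT.
have ct : cl T t = t := cl_id tT.
have ct1 : cl T1 t = t by apply: cl_id; rewrite h0; exact: le_trans hT TT1.
have ct2 : cl T2 t = t by apply: cl_id; rewrite h0; exact: le_trans hT TT2.
have V1 : vst Om T1 v01 t = rota (- Om * t) (flow Om T1 v01 (cl T t)) by rewrite ct -{2}ct1.
have V2 : vst Om T2 v02 t = rota (- Om * t) (flow Om T2 v02 (cl T t)) by rewrite ct -{2}ct2.
have z : cl T 0 = 0 by apply: cl_id; rewrite lexx ltW.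
have D1 j k : flow Om T1 v01 (cl T 0) j k = dstate v01 j k.
  by have h := e1 0 j k; rewrite z ig0 addr0 in h; rewrite z; exact h.
have D2 j k : flow Om T2 v02 (cl T 0) j k = dstate v02 j k.
  by have h := e2 0 j k; rewrite z ig0 addr0 in h; rewrite z; exact h.
have EL k : \sum_j (vst Om T1 v01 t j k - vst Om T2 v02 t j k) ^+ 2 = \sum_j (flow Om T1 v01 (cl T t) j k - flow Om T2 v02 (cl T t) j k) ^+ 2.
  by rewrite V1 V2; exact: sum_rota.
have ER k : \sum_j (dstate v01 j k - dstate v02 j k) ^+ 2 = \sum_j (flow Om T1 v01 (cl T 0) j k - flow Om T2 v02 (cl T 0) j k) ^+ 2.
  by apply: eq_bigr => j _; rewrite D1 D2.
have t0E : tau0 - mu * 0 = tau0 by rewrite mulr0 subr0.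
rewrite -[in X in (_ <= X)%E]t0E.
have SL : (\esum_(k in [set: K]) (wgt (tau0 - mu * t) (r - 2^-1) k * \sum_j (vst Om T1 v01 t j k - vst Om T2 v02 t j k) ^+ 2)%:E =
  \esum_(k in [set: K]) (wgt (tau0 - mu * t) (r - 2^-1) k * \sum_j (flow Om T1 v01 (cl T t) j k - flow Om T2 v02 (cl T t) j k) ^+ 2)%:E)%E.
  by apply: eq_esum => k _; rewrite EL.
have SR : (\esum_(k in [set: K]) (wgt (tau0 - mu * 0) (r - 2^-1) k * \sum_j (dstate v01 j k - dstate v02 j k) ^+ 2)%:E =
  \esum_(k in [set: K]) (wgt (tau0 - mu * 0) (r - 2^-1) k * \sum_j (flow Om T1 v01 (cl T 0) j k - flow Om T2 v02 (cl T 0) j k) ^+ 2)%:E)%E.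
  by apply: eq_esum => k _; rewrite ER.
rewrite SL SR; exact En.
Qed.


End Dependence.

Theorem theorem3p1 (R : realType) (r : R) (hr : 5 / 2 < r) :
  exists C : R, 0 < C /\
  (forall (tau0 Omega : R) (v0 : R * R * R -> R * R),
     0 < tau0 -> admissible r tau0 v0 ->
     let M := data_size r tau0 v0 in
     let T := lifespan C tau0 M in
     let tau := analytic_radius C tau0 M in
     0 < T /\
     exists (vb : R -> R * R -> R * R) (vt : R -> R * R * R -> R * R),
       solution r Omega T tau (P0 v0) (fluct v0) vb vt /\
       forall (vb' : R -> R * R -> R * R) (vt' : R -> R * R * R -> R * R),
         solution r Omega T tau (P0 v0) (fluct v0) vb' vt' ->
         forall t : R, t \in `[0, T] -> vb' t = vb t /\ vt' t = vt t) /\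
  (forall (Omega tau10 tau20 : R) (v01 v02 : R * R * R -> R * R)
     (vb1 vb2 : R -> R * R -> R * R) (vt1 vt2 : R -> R * R * R -> R * R),
     0 < tau10 -> 0 < tau20 ->
     admissible r tau10 v01 -> admissible r tau20 v02 ->
     let M1 := data_size r tau10 v01 in
     let M2 := data_size r tau20 v02 in
     solution r Omega (lifespan C tau10 M1) (analytic_radius C tau10 M1)
       (P0 v01) (fluct v01) vb1 vt1 ->
     solution r Omega (lifespan C tau20 M2) (analytic_radius C tau20 M2)
       (P0 v02) (fluct v02) vb2 vt2 ->
     let tau0 := Num.min tau10 tau20 in
     let M := Num.max M1 M2 in
     let tau := analytic_radius C tau0 M in
     forall t : R, t \in `[0, lifespan C tau0 M] ->
       (anorm (tau t) (r - 2^-1)%R (lift3 (vb1 t \- vb2 t)%R) ^+ 2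
        + anorm (tau t) (r - 2^-1)%R (vt1 t \- vt2 t)%R ^+ 2
        <= anorm tau0 (r - 2^-1)%R (lift3 (P0 v01 \- P0 v02)%R) ^+ 2
           + anorm tau0 (r - 2^-1)%R (fluct v01 \- fluct v02)%R ^+ 2)%E).
Proof.
exists (Cr r); split; first exact: Cr_gt0; split.
(* Existence runs at rate [lamr] while the announced radius decreases at the faster rate [sigr]. *)
- move=> tau0 Om v0 t0 adm M T tau; have M0 : 0 <= M := M_ge0 r tau0 v0.
  have T0 : 0 < T := lifespan_gt0 r t0 M0; split=> //.
  have l0 := lamr_gt0 r M0; have sm := lamr_small r M0; have lT := lamr_lifespan r t0 M0.
  have ls := lamr_sigr r M0; have sT := sigr_lifespan r t0 M0.
  rewrite /tau analytic_radiusE; exists (flow_b Om T v0), (flow_t Om T v0); split.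
    exact: (flow_solution Om hr adm T0 l0 sm lT ls (ltW sT)).
  by move=> vb vt sol t tT; exact: (solution_flow hr adm T0 l0 sm lT ls sT sol tT).
move=> Om tau10 tau20 v01 v02 vb1 vb2 vt1 vt2 t10 t20 adm1 adm2 M1 M2 sol1 sol2 tau0 M tau t tT.
have M10 : 0 <= M1 := M_ge0 r tau10 v01.
have M20 : 0 <= M2 := M_ge0 r tau20 v02.
rewrite analytic_radiusE in sol1; rewrite analytic_radiusE in sol2.
have m1 : M1 <= M := le_maxL M1 M2.
have m2 : M2 <= M := le_maxR M1 M2.
have t01 : tau0 <= tau10 := ge_minL tau10 tau20.
have t02 : tau0 <= tau20 := ge_minR tau10 tau20.
have t00 : 0 < tau0 := min_gt0 t10 t20.
have M0 : 0 <= M := le_trans M10 m1.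
have tT1 : t \in `[0, lifespan (Cr r) tau10 M1].
  by move: tT; rewrite !in_itv /= => /andP[-> h]; exact: (le_trans h (lifespan_mono r t00 t01 M10 m1)).
have tT2 : t \in `[0, lifespan (Cr r) tau20 M2].
  by move: tT; rewrite !in_itv /= => /andP[-> h]; exact: (le_trans h (lifespan_mono r t00 t02 M20 m2)).
have T10 := lifespan_gt0 r t10 M10; have T20 := lifespan_gt0 r t20 M20.
(* By uniqueness the two given solutions are the constructed flows, for which the integral equations
   and majorants needed by the energy estimate are available. *)
have [-> ->] := solution_flow hr adm1 T10 (lamr_gt0 r M10) (lamr_small r M10) (lamr_lifespan r t10 M10) (lamr_sigr r M10) (sigr_lifespan r t10 M10) sol1 tT1.
have [-> ->] := solution_flow hr adm2 T20 (lamr_gt0 r M20) (lamr_small r M20) (lamr_lifespan r t20 M20) (lamr_sigr r M20) (sigr_lifespan r t20 M20) sol2 tT2.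
have I1 := flow_intg Om hr adm1 T10 (lamr_gt0 r M10) (lamr_small r M10) (lamr_lifespan r t10 M10) t.
have I2 := flow_intg Om hr adm2 T20 (lamr_gt0 r M20) (lamr_small r M20) (lamr_lifespan r t20 M20) t.
have F1 := fstate_flow Om hr adm1 T10 (lamr_gt0 r M10) (lamr_small r M10) (lamr_lifespan r t10 M10) t.
have F2 := fstate_flow Om hr adm2 T20 (lamr_gt0 r M20) (lamr_small r M20) (lamr_lifespan r t20 M20) t.
have tT' : 0 <= t <= lifespan (Cr r) tau0 M by move: tT; rewrite in_itv.
have T00 := lifespan_gt0 r t00 M0.
have lm1 : lamr r M1 <= sigr r M := le_trans (ltW (lamr_sigr r M10)) (sigr_mono r m1).
have lm2 : lamr r M2 <= sigr r M := le_trans (ltW (lamr_sigr r M20)) (sigr_mono r m2).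
(* The common rate is [sigr] at the larger data size M: it exceeds both existence rates and meets
   the absorption condition for the two majorants together. *)
have F := flow_energy Om hr adm1 adm2 T10 T20 (lamr_gt0 r M10) (lamr_gt0 r M20) (lamr_small r M10) (lamr_small r M20)
  (lamr_lifespan r t10 M10) (lamr_lifespan r t20 M20) T00 (lifespan_mono r t00 t01 M10 m1) (lifespan_mono r t00 t02 M20 m2)
  t01 t02 lm1 lm2 (ltW (sigr_lifespan r t00 M0)) (sigr_large r M10 M20 m1 m2) tT'.
rewrite /tau analytic_radiusE.
exact (anorm_pair_le I1 I2 (data_intg adm1) (data_intg adm2) F1 F2 erefl erefl F).
Qed.
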